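(* Let $X$ be one of the compact connected symmetric spaces of rank one $\mathbb R\mathbb S^n$ ($n\ge1$), $\mathbb R\mathbb P^n$, $\mathbb C\mathbb P^n$, $\mathbb H\mathbb P^n$ ($n\ge2$) or $\mathbb O\mathbb P^2$, with the distance $d$ and the invariant probability measure described below, and let $L\in(0,\frac\pi2)$. Let $A(N,L)$ be the adjacency matrix of the random geometric graph with $N$ independent uniform vertices on $X$ and edges between distinct vertices at distance $\le L$. In the Giné--Koltchinskii sense (padding both spectra with zeros, listing nonnegative values decreasingly and negative values increasingly, the $\ell^2$ distance between the ordered sequences tends to $0$ almost surely), the limit of $\mathrm{Spec}(A(N,L)/N)$ consists of one eigenvalue $c_k$ for each integer $k\ge0$, with multiplicity $d_{k\omega_0}$, where: - $\mathbb R\mathbb S^n$: $d_{k\omega_0}=\frac{2k+n-1}{k+n-1}\binom{k+n-1}{n-1}$, $c_0=\frac{\int_0^L\sin^{n-1}\theta\,d\theta}{\int_0^\pi\sin^{n-1}\theta\,d\theta}$, $c_{k\ge1}=\frac{(\sin L)^n}{n\int_0^\pi\sin^{n-1}\theta\,d\theta}P^{n+2,k-1}(\cos L)$; - $\mathbb R\mathbb P^n$: $d_{k\omega_0}=\frac{4k+n-1}{2k+n-1}\binom{2k+n-1}{n-1}$, $c_0=\frac{\int_0^L\sin^{n-1}\theta\,d\theta}{\int_0^{\pi/2}\sin^{n-1}\theta\,d\theta}$, $c_{k\ge1}=\frac{\Gamma(\frac{n+1}2)}{\Gamma(\frac12)\Gamma(\frac{n+2}2)}\cos L\,(\sin L)^nJ^{(\frac32,\frac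 n2+1),k-1}(\cos^2L)$; - $\mathbb C\mathbb P^n$: $d_{k\omega_0}=\frac{2k+n}{n}\binom{k+n-1}{n-1}^2$, $c_0=(\sin L)^{2n}$, $c_{k\ge1}=(\cos L)^2(\sin L)^{2n}J^{(2,n+1),k-1}(\cos^2L)$; - $\mathbb H\mathbb P^n$: $d_{k\omega_0}=\frac{2k+2n+1}{(2n+1)(k+1)}\binom{k+2n}{2n}\binom{k+2n-1}{2n-1}$, $c_0=(\sin L)^{4n}(1+2n\cos^2L)$, $c_{k\ge1}=(2n+1)(\cos L)^4(\sin L)^{4n}J^{(3,2n+1),k-1}(\cos^2L)$; - $\mathbb O\mathbb P^2$: $d_{k\omega_0}=\frac{2k+11}{385}\binom{k+7}{4}\binom{k+10}{10}$, $c_0=(\sin L)^{16}(1+8\cos^2L+36\cos^4L+120\cos^6L)$, $c_{k\ge1}=165(\cos L)^8(\sin L)^{16}J^{(5,9),k-1}(\cos^2L)$.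
   Context: Coordinates: $\mathbb R\mathbb S^n=\{(x_1,\dots,x_{n+1})\in\mathbb R^{n+1}:\sum x_i^2=1\}$ with base point $b=(0,\dots,0,1)$ and $d(x,b)=\arccos(x_{n+1})$; for the projective spaces $\mathbb K\mathbb P^n$ ($\mathbb K=\mathbb R,\mathbb C,\mathbb H$, and $\mathbb O\mathbb P^2$ with homogeneous octonionic coordinates $[\theta_1:\theta_2:\theta_3]$ in an associative chart), base point $b=[0:\dots:0:1]$ and $d(x,b)=\arccos\big(|x_{n+1}|/\sqrt{|x_1|^2+\dots+|x_{n+1}|^2}\big)$; the distance between arbitrary points is obtained by invariance under the isometry group $G$ ($\mathrm{SO}(n+1)$, $\mathrm{SO}(n+1)$, $\mathrm{SU}(n+1)$, $\mathrm{USp}(n+1)$, $\mathrm F_4$ respectively), which acts transitively. Vertices are distributed according to the unique $G$-invariant probability measure on $X$. Legendre polynomials: $P^{n,k}(x)=\frac{(-1)^k\Gamma(\frac n2)}{2^k\Gamma(\frac n2+k)}\frac{1}{(1-x^2)^{\frac n2-1}}\frac{d^k}{dx^k}(1-x^2)^{\frac n2+k-1}$. Jacobi polynomials: $J^{(a,b),k}(s)=\frac{(-1)^k\Gamma(b)}{\Gamma(b+k)}\frac{1}{s^{a-1}(1-s)^{b-1}}\frac{d^k}{ds^k}\big(s^{a+k-1}(1-s)^{b+k-1}\big)$.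
   Formalization: The multiplicity of c_0 is set to 1; for the circle (sphere with n=1) the printed formula for d at k=0 is the undefined 0/0, and in every other case it already gives 1. *)

(* Defs.v *)
From mathcomp Require Import all_boot all_order all_algebra all_fingroup.
From mathcomp Require Import all_classical all_reals all_analysis.
Unset Printing Implicit Defensive.
Import Order.TTheory GRing.Theory Num.Theory.
Local Open Scope classical_set_scope.
Local Open Scope ring_scope.

Section RGGDefs.
Context {R : realType}.

Definition Gamma (x : R) : R :=
  Rintegral lebesgue_measure `]0, +oo[%classic
    (fun t : R => powR t (x - 1) * expR (- t)).

(* Legendre polynomial P^{m,k}(x) (Rodrigues formula of the context). *)
Definition legendreP (m k : nat) (x : R) : R :=
  (-1) ^+ k * Gamma (m%:R / 2) / (2 ^+ k * Gamma (m%:R / 2 + k%:R))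
  * (powR (1 - x ^+ 2) (m%:R / 2 - 1))^-1
  * derive1n k (fun y : R => powR (1 - y ^+ 2) (m%:R / 2 + k%:R - 1)) x.

(* Jacobi polynomial J^{(a,b),k}(s) (Rodrigues formula of the context). *)
Definition jacobiJ (a b : R) (k : nat) (s : R) : R :=
  (-1) ^+ k * Gamma b / Gamma (b + k%:R)
  * (powR s (a - 1) * powR (1 - s) (b - 1))^-1
  * derive1n k (fun u : R => powR u (a + k%:R - 1) * powR (1 - u) (b + k%:R - 1)) s.

Definition sin_int (n : nat) (a : R) : R :=
  Rintegral lebesgue_measure `[0, a]%classic (fun t : R => sin t ^+ n.-1).

Definition iid_with_law {dO dT} {Om : measurableType dO} {T : measurableType dT}
  (P : probability Om R) (V : nat -> Om -> T) (mu : probability T R) : Prop :=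
  [/\ (forall i, measurable_fun setT (V i)),
      (forall i (A : set T), measurable A -> P (V i @^-1` A) = mu A) &
      (forall (s : seq nat) (A : nat -> set T), uniq s ->
          (forall i, measurable (A i)) ->
          fine (P (\bigcap_(i in [set` s]) (V i @^-1` A i))) =
          \prod_(i <- s) fine (P (V i @^-1` A i)))].

Definition invariant_under {dT} {T : measurableType dT}
  (G : set (T -> T)) (mu : probability T R) : Prop :=
  forall g, G g -> forall A : set T, measurable A -> mu (g @^-1` A) = mu A.

Definition rgg_adj {T Om : Type} (dist : T -> T -> R) (L : R)
  (V : nat -> Om -> T) (N : nat) (w : Om) : 'M[R]_N :=
  \matrix_(i < N, j < N)
    (if (i != j) && (dist (V i w) (V j w) <= L) then 1 else 0).

(* A multiset is given by values v k with multiplicities m k (k : nat); *)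
(* entries with m k = 0 are ignored (zero padding is implicit).         *)

Definition count_gt_le (v m : nat -> R) (t : R) (i : nat) : Prop :=
  exists s : seq nat, [/\ uniq s,
    (forall k, 0 < m k -> t < v k -> k \in s) &
    \sum_(k <- s | t < v k) m k <= i%:R].

(* i-th (from 0) element of the nonnegative part listed decreasingly,
   padded with zeros *)
Definition pos_ord (v m : nat -> R) (i : nat) : R :=
  inf [set t | 0 <= t /\ count_gt_le v m t i].

Definition neg_ord (v m : nat -> R) (i : nat) : R :=
  - pos_ord (fun k => - v k) m i.

Definition delta2_sq (v m w p : nat -> R) : \bar R :=
  (\sum_(i <oo) (((pos_ord v m i - pos_ord w p i) ^+ 2)%:E) +
   \sum_(i <oo) (((neg_ord v m i - neg_ord w p i) ^+ 2)%:E))%E.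

Definition is_spectrum {N : nat} (A : 'M[R]_N) (s : seq R) : Prop :=
  char_poly A = \prod_(x <- s) ('X - x%:P).

Definition GK_spectral_limit {dT} {T : measurableType dT} (X : set T)
  (dist : T -> T -> R) (G : set (T -> T)) (L : R) (c d : nat -> R) : Prop :=
  forall (dO : measure_display) (Om : measurableType dO)
         (P : probability Om R) (mu : probability T R) (V : nat -> Om -> T),
    mu X = 1%E -> invariant_under G mu -> iid_with_law P V mu ->
    {ae P, forall w, forall s : nat -> seq R,
       (forall N, is_spectrum ((N%:R)^-1 *: rgg_adj dist L V N w) (s N)) ->
       (fun N => delta2_sq (fun j => nth 0 (s N) j) (fun j => (j < size (s N))%:R)
                           c d) @ \oo --> 0%E}.

Definition sph_pts (n : nat) : set ((n.+1).-tuple R) :=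
  [set x | \sum_(i < n.+1) tnth x i ^+ 2 = 1].

Definition sph_dist (n : nat) (x y : (n.+1).-tuple R) : R :=
  acos (\sum_(i < n.+1) tnth x i * tnth y i).

Definition SO_sph (n : nat) : set ((n.+1).-tuple R -> (n.+1).-tuple R) :=
  [set f | exists g : 'M[R]_n.+1, [/\ g *m g^T = 1%:M, \det g = 1 &
     f = fun x => [tuple \sum_(l < n.+1) g i l * tnth x l | i < n.+1]]].

(* Cayley--Dickson algebras: level j has real dimension 2^j             *)
(* (j = 0,1,2,3 : R, C, H, O), elements are lists of 2^j reals,         *)
(* (a,b)(c,d) = (ac - conj(d) b, d a + b conj(c)), conj(a,b) = (conj a, -b). *)

Definition cdadd (x y : seq R) : seq R := map (fun p => p.1 + p.2) (zip x y).
Definition cdscale (a : R) (x : seq R) : seq R := map (fun u => a * u) x.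

Fixpoint cdconj (j : nat) (x : seq R) : seq R :=
  match j with
  | 0 => x
  | j'.+1 => cdconj j' (take (2 ^ j')%N x) ++ map (fun u => - u) (drop (2 ^ j')%N x)
  end.

Fixpoint cdmul (j : nat) (x y : seq R) : seq R :=
  match j with
  | 0 => [:: head 0 x * head 0 y]
  | j'.+1 =>
    let h := (2 ^ j')%N in
    let a := take h x in let b := drop h x in
    let c := take h y in let d := drop h y in
    cdadd (cdmul j' a c) (cdscale (-1) (cdmul j' (cdconj j' d) b)) ++
    cdadd (cdmul j' d a) (cdmul j' b (cdconj j' c))
  end.

Definition cdzero (j : nat) : seq R := nseq (2 ^ j)%N 0.
Definition cdone (j : nat) : seq R := 1 :: nseq (2 ^ j)%N.-1 0.

(* Projective spaces KP^n as trace-one Hermitian idempotent             *)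
(* (n+1)x(n+1) matrices over the level-j Cayley--Dickson algebra         *)

Definition KMat (n : nat) := 'I_n.+1 -> 'I_n.+1 -> seq R.

(* ambient measurable space: real coordinates of (n+1)x(n+1) K-matrices *)
Definition proj_amb (j n : nat) := (n.+1).-tuple ((n.+1).-tuple ((2 ^ j)%N.-tuple R)).

Definition kdec {j n : nat} (x : proj_amb j n) : KMat n :=
  fun i l => val (tnth (tnth x i) l).
Definition kenc {j n : nat} (M : KMat n) : proj_amb j n :=
  [tuple [tuple [tuple nth 0 (M i l) c | c < (2 ^ j)%N] | l < n.+1] | i < n.+1].

Definition kmxmul (j : nat) {n : nat} (M N : KMat n) : KMat n :=
  fun i l => foldr cdadd (cdzero j) [seq cdmul j (M i k) (N k l) | k <- enum 'I_n.+1].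
Definition kmxstar (j : nat) {n : nat} (M : KMat n) : KMat n :=
  fun i l => cdconj j (M l i).
Definition kmxid (j n : nat) : KMat n :=
  fun i l => if i == l then cdone j else cdzero j.
Definition kmxlin {n : nat} (a : R) (M N : KMat n) : KMat n :=
  fun i l => cdadd (cdscale a (M i l)) (N i l).
Definition kjordan (j : nat) {n : nat} (M N : KMat n) : KMat n :=
  fun i l => cdscale (1 / 2) (cdadd (kmxmul j M N i l) (kmxmul j N M i l)).
Definition kretr {n : nat} (M : KMat n) : R := \sum_(i < n.+1) head 0 (M i i).

Definition ksized (j : nat) {n : nat} (M : KMat n) : Prop :=
  forall i l, size (M i l) = (2 ^ j)%N.
Definition kherm (j : nat) {n : nat} (M : KMat n) : Prop :=
  ksized j M /\ forall i l, M l i = cdconj j (M i l).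

Definition proj_pts (j n : nat) : set (proj_amb j n) :=
  [set x | [/\ kherm j (kdec x), kmxmul j (kdec x) (kdec x) = kdec x &
              kretr (kdec x) = 1]].

(* d(P,Q) = arccos sqrt(Re tr(PQ)); for Q = base point [0:...:0:1] this is
   arccos(|x_{n+1}|/|x|) *)
Definition proj_dist (j n : nat) (x y : proj_amb j n) : R :=
  acos (Num.sqrt (kretr (kmxmul j (kdec x) (kdec y)))).

Definition kact (j n : nat) (g : KMat n) (x : proj_amb j n) : proj_amb j n :=
  kenc (kmxmul j (kmxmul j g (kdec x)) (kmxstar j g)).

Definition kunitary (j : nat) {n : nat} (g : KMat n) : Prop :=
  [/\ ksized j g, kmxmul j g (kmxstar j g) = @kmxid j n &
      kmxmul j (kmxstar j g) g = @kmxid j n].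

(* Leibniz determinant (used for the commutative levels j = 0, 1) *)
Definition kdet (j : nat) {n : nat} (g : KMat n) : seq R :=
  foldr cdadd (cdzero j)
    [seq cdscale ((-1) ^+ odd_perm s) (foldr (cdmul j) (cdone j) [seq g i (s i) | i <- enum 'I_n.+1])
    | s : {perm 'I_n.+1} <- enum {perm 'I_n.+1}].

Definition SO_proj (n : nat) : set (proj_amb 0 n -> proj_amb 0 n) :=
  [set f | exists g : 'M[R]_n.+1, [/\ g *m g^T = 1%:M, \det g = 1 &
     f = @kact 0 n (fun i l => [:: g i l])]].

Definition SU_proj (n : nat) : set (proj_amb 1 n -> proj_amb 1 n) :=
  [set f | exists g : KMat n, [/\ kunitary 1 g, kdet 1 g = cdone 1 & f = @kact 1 n g]].

Definition USp_proj (n : nat) : set (proj_amb 2 n -> proj_amb 2 n) :=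
  [set f | exists g : KMat n, kunitary 2 g /\ f = @kact 2 n g].

(* F4 = automorphism group of the exceptional Jordan algebra Herm_3(O) *)
Definition albert_aut (phi : KMat 2 -> KMat 2) : Prop :=
  [/\ (forall P, kherm 3 P -> kherm 3 (phi P)),
      (forall a P Q, kherm 3 P -> kherm 3 Q -> phi (kmxlin a P Q) = kmxlin a (phi P) (phi Q)),
      (forall P Q, kherm 3 P -> kherm 3 Q -> phi (kjordan 3 P Q) = kjordan 3 (phi P) (phi Q)) &
      (forall Q, kherm 3 Q -> exists P, kherm 3 P /\ phi P = Q)].

Definition F4_proj : set (proj_amb 3 2 -> proj_amb 3 2) :=
  [set f | exists phi, albert_aut phi /\ f = fun x => kenc (phi (kdec x))].

Definition binR (a b : nat) : R := ('C(a, b))%:R.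

Definition mult_RS (n k : nat) : R :=
  if k == 0%N then 1 else
  (2 * k%:R + n%:R - 1) / (k%:R + n%:R - 1) * binR (k + n - 1) (n - 1).
Definition eig_RS (L : R) (n k : nat) : R :=
  if k == 0%N then sin_int n L / sin_int n pi else
  sin L ^+ n / (n%:R * sin_int n pi) * legendreP (n + 2) k.-1 (cos L).

Definition mult_RP (n k : nat) : R :=
  if k == 0%N then 1 else
  (4 * k%:R + n%:R - 1) / (2 * k%:R + n%:R - 1) * binR (2 * k + n - 1) (n - 1).
Definition eig_RP (L : R) (n k : nat) : R :=
  if k == 0%N then sin_int n L / sin_int n (pi / 2) else
  Gamma ((n%:R + 1) / 2) / (Gamma (1 / 2) * Gamma ((n%:R + 2) / 2))
  * cos L * sin L ^+ n * jacobiJ (3 / 2) (n%:R / 2 + 1) k.-1 (cos L ^+ 2).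

Definition mult_CP (n k : nat) : R :=
  if k == 0%N then 1 else
  (2 * k%:R + n%:R) / n%:R * binR (k + n - 1) (n - 1) ^+ 2.
Definition eig_CP (L : R) (n k : nat) : R :=
  if k == 0%N then sin L ^+ (2 * n) else
  cos L ^+ 2 * sin L ^+ (2 * n) * jacobiJ 2 (n%:R + 1) k.-1 (cos L ^+ 2).

Definition mult_HP (n k : nat) : R :=
  if k == 0%N then 1 else
  (2 * k%:R + 2 * n%:R + 1) / ((2 * n%:R + 1) * (k%:R + 1))
  * binR (k + 2 * n) (2 * n) * binR (k + 2 * n - 1) (2 * n - 1).
Definition eig_HP (L : R) (n k : nat) : R :=
  if k == 0%N then sin L ^+ (4 * n) * (1 + 2 * n%:R * cos L ^+ 2) else
  (2 * n%:R + 1) * cos L ^+ 4 * sin L ^+ (4 * n)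
  * jacobiJ 3 (2 * n%:R + 1) k.-1 (cos L ^+ 2).

Definition mult_OP (k : nat) : R :=
  if k == 0%N then 1 else
  (2 * k%:R + 11) / 385 * binR (k + 7) 4 * binR (k + 10) 10.
Definition eig_OP (L : R) (k : nat) : R :=
  if k == 0%N then
    sin L ^+ 16 * (1 + 8 * cos L ^+ 2 + 36 * cos L ^+ 4 + 120 * cos L ^+ 6) else
  165 * cos L ^+ 8 * sin L ^+ 16 * jacobiJ 5 9 k.-1 (cos L ^+ 2).

End RGGDefs.

(* Main.v *)
(* The argument is a method of moments.  On each space the kernel is a function
   of t(x,y) = <x,y> (the ambient Euclidean product; on a projective space,
   points are rank-one projectors), namely the indicator of cos L <= t on the
   sphere and of cos^2 L <= t on a projective space.  Pick a polynomial q close to this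
   indicator in the L^2 norm nu of the law of t.  The matrix (q(t(x_i,x_j))/N)
   has traces of powers that converge almost surely by the law of large numbers
   applied to monomials in the coordinates, and the Hilbert-Schmidt distance to
   A(N,L)/N is small.  Convergence of the moments of order >= 2 of the spectrum
   together with Weierstrass approximation (Bernstein polynomials) yields the
   convergence of the ordered eigenvalues, first one by one and then in l^2.

   The limits of the traces come from two facts about the invariant law of t.
   A Pearson identity E[(tau0 q + sigma q')(t)] = 0, obtained by differentiating
   along plane rotations, makes nu a Beta-type law whose orthogonal polynomials
   p_k satisfy a Rodrigues formula.  And E_y[f(t(x,y)) g(t(y,z))] is a polynomial
   in t(x,z) of degree at most deg g, by moving (x,z) to a normal form.  Together
   they force the convolution of p_k with g to be nu(g p_k) p_k; hence the k-th
   eigenvalue is the integral of p_k over the cap, with multiplicity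
   1 / nu(p_k^2), and the Rodrigues formula evaluates both.

   The symmetries used on KP^n are real plane rotations and phases that change
   one off-diagonal entry; for the octonions the phases are given by triality,
   and their automorphism property is Moufang's identities. *)

(* No representation theory enters: neither spherical functions nor dimensions of representations
   are identified. The multiplicity appears only as 1 / nu(p_k^2), and is matched with the closed
   formula through d_0, d_1 and the ratio of consecutive terms. The law of t has two descriptions,
   an integral over theta and a mean over the space, and no change to polar coordinates links them:
   both vanish on the image of the Pearson operator and send 1 to 1, which determines a functional
   on polynomials.

   Two obstacles shape the analytic half. First powers of eigenvalues are not controlled by the
   Hilbert-Schmidt norm, so only moments of order at least 2 are available and every test function
   carries a factor x^2. And convergence of each ordered eigenvalue does not give l^2 convergence by
   itself: the second moment has to pass to the limit without loss, so that no mass escapes towards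
   0. The argument runs for a fixed outcome outside one null set, built from countably many
   monomials before the spectra are chosen, so measurability of eigenvalues never arises. *)
Require Import Defs.
From mathcomp Require Import all_boot all_order all_algebra all_fingroup.
From mathcomp Require Import all_classical all_reals all_analysis.
From mathcomp Require Import measurable_realfun.
From mathcomp Require Import ring lra.
Import Order.TTheory GRing.Theory Num.Theory.
Local Open Scope ring_scope.
Set Implicit Arguments.
Unset Strict Implicit.

(** * Orthogonal polynomials from a Pearson equation *)

Section Pearson.
Context {R : realType}.
Variables (sigma t0 : {poly R}).

(* With a weight rho satisfying (sigma rho)' = t0 rho, this is
   q |-> (sigma^(i+1) rho q)' / (sigma^i rho). *)
Definition Dop (i : nat) (q : {poly R}) : {poly R} :=
  (t0 + i%:R *: sigma^`()) * q + sigma * q^`().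

(** In terms of the weight rho this is (sigma^(i+k) rho)^(k) / (sigma^i rho), the k-th Rodrigues
    polynomial of the weight sigma^i rho. Keeping i free lets the derivatives be peeled off one at a
    time. *)
Fixpoint Rod (i k : nat) : {poly R} := if k is k'.+1 then Dop i (Rod i.+1 k') else 1.

(** Normalised at t = 1, which corresponds to coincident points, as zonal functions are. *)
Definition pk (k : nat) : {poly R} := (Rod 0 k).[1]^-1 *: Rod 0 k.

Variable nu : {poly R} -> R.
Hypothesis nu_lin : forall a (u v : {poly R}), nu (a *: u + v) = a * nu u + nu v.
Hypothesis nu_Dop : forall q, nu (Dop 0 q) = 0.

Lemma nu_add u v : nu (u + v) = nu u + nu v.
Proof. by rewrite -[u]scale1r nu_lin mul1r scale1r. Qed.

Lemma nu_zero : nu 0 = 0.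
Proof. by have := nu_add 0 0; rewrite addr0; move: (nu 0) => t; lra. Qed.

Lemma nu_scale a u : nu (a *: u) = a * nu u.
Proof. by rewrite -[a *: u]addr0 nu_lin nu_zero addr0. Qed.

Lemma Dop_sigma i u : Dop 0 (sigma ^+ i * u) = sigma ^+ i * Dop i u.
Proof.
rewrite /Dop derivM deriv_exp scale0r addr0 -scaler_nat.
case: i => [|i]; first by rewrite scale0r mul0r !expr0 !mul1r scale0r addr0 add0r.
rewrite -[i.+1.-1]/i !exprS -!mul_polyC; ring.
Qed.

Lemma nu_sigma_Dop i u : nu (sigma ^+ i * Dop i u) = 0.
Proof. by rewrite -Dop_sigma nu_Dop. Qed.

Lemma Dop_mul i q r : Dop i (q * r) = q * Dop i r + sigma * q^`() * r.
Proof. by rewrite /Dop derivM; ring. Qed.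

(** Integration by parts, k times: since [nu] vanishes on [sigma ^+ i * Dop i u], each step moves
    one derivative onto [q] at the price of a sign and one more factor [sigma]. *)
Lemma nu_sigma_Rod i k q :
  nu (sigma ^+ i * (q * Rod i k)) = (-1) ^+ k * nu (sigma ^+ (i + k) * q^`(k)).
Proof.
elim: k i q => [|k IH] i q; first by rewrite addn0 derivn0 mulr1 expr0 mul1r.
have := nu_sigma_Dop i (q * Rod i.+1 k).
rewrite Dop_mul mulrDr nu_add => h.
have -> : sigma ^+ i * (q * Rod i k.+1) = sigma ^+ i * (q * Dop i (Rod i.+1 k)) by [].
rewrite addnS -addSn derivSn exprS -mulrA -IH mulN1r.
apply/eqP; rewrite -subr_eq0 opprK -[X in _ == X]h; apply/eqP; congr (_ + nu _).
by rewrite exprSr; ring.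
Qed.

Hypothesis size_sigma : (size sigma <= 3)%N.
Hypothesis size_t0 : (size t0 <= 2)%N.
Variables (A B e : R).
Hypothesis sigma2 : sigma`_2 = -1.
Hypothesis t01 : t0`_1 = - A.
Hypothesis sigma_at1 : sigma.[1] = 0.
Hypothesis sigma'_at1 : sigma^`().[1] = - e.
Hypothesis t0_at1 : t0.[1] = - B.
Hypotheses (A0 : 0 < A) (B0 : 0 < B) (e0 : 0 <= e).

Lemma t0E : t0 = (t0`_0)%:P + (- A) *: 'X.
Proof.
apply/polyP => i; rewrite coefD coefC coefZ coefX.
case: i => [|[|i]] /=; rewrite ?mulr0 ?addr0 ?mulr1 ?add0r//.
by rewrite nth_default// (leq_trans size_t0).
Qed.

Lemma sigmaE : sigma = (sigma`_0)%:P + sigma`_1 *: 'X - 'X^2.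
Proof.
apply/polyP => i; rewrite coefB coefD coefC coefZ coefX coefXn.
case: i => [|[|[|i]]] /=; rewrite ?mulr0 ?addr0 ?mulr1 ?add0r ?subr0 ?sub0r//.
by rewrite oppr0 nth_default// (leq_trans size_sigma).
Qed.

Lemma DopE i q : Dop i q = (t0`_0 + i%:R * sigma`_1)%:P * q - (A + 2 * i%:R) *: ('X * q)
   + (sigma`_0 *: q^`() + sigma`_1 *: ('X * q^`()) - 'X * ('X * q^`())).
Proof.
have st := t0E; have ss := sigmaE.
set a0 := t0`_0 in st *; set b0 := sigma`_0 in ss *; set b1 := sigma`_1 in ss *.
clearbody a0 b0 b1; rewrite /Dop ss st.
rewrite !(derivD, derivB, derivC, derivZ, derivN, derivX, derivXn) -!mul_polyC !(polyCD, polyCM, polyCN, polyC_natr, polyC1) /=.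
ring.
Qed.

Lemma coef_Dop i (q : {poly R}) m : (size q <= m.+1)%N -> (Dop i q)`_m.+1 = - (A + 2 * i%:R + m%:R) * q`_m.
Proof.
move=> sq; rewrite DopE !coefD !coefN !coefZ coefCM !coefXM !coef_deriv /=.
rewrite [q`_m.+1]nth_default// [q`_m.+2]nth_default ?(leqW sq)//.
rewrite !mul0rn !mulr0 sub0r !add0r; case: m {sq} => [|m] /=.
  ring.
by rewrite -(mulr_natl (q`_m.+1) m.+1); ring.
Qed.

Lemma size_Dop i (q : {poly R}) m : (size q <= m)%N -> (size (Dop i q) <= m.+1)%N.
Proof.
move=> sq; apply/leq_sizeP => -[|j] // mj.
rewrite coef_Dop; last by rewrite (leq_trans sq)// ltnW.
by rewrite nth_default ?mulr0// (leq_trans sq).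
Qed.

Lemma size_Rod_le i k : (size (Rod i k) <= k.+1)%N.
Proof. by elim: k i => [|k IH] i; [rewrite size_poly1|exact: size_Dop]. Qed.

Definition rising (x : R) (k : nat) : R := \prod_(j < k) (x + j%:R).

Lemma risingS x k : rising x k.+1 = rising x k * (x + k%:R).
Proof. by rewrite /rising big_ord_recr. Qed.

Lemma rising_recl x k : rising x k.+1 = x * rising (x + 1) k.
Proof.
rewrite /rising big_ord_recl addr0; congr (_ * _); apply: eq_bigr => j _.
by rewrite /= /bump /= add1n -natr1; ring.
Qed.

Lemma coef_Rod i k : (Rod i k)`_k = (-1) ^+ k * rising (A + 2 * i%:R + k%:R - 1) k.
Proof.
elim: k i => [|k IH] i; first by rewrite coef1 /rising big_ord0 mulr1.
rewrite -[Rod i k.+1]/(Dop i (Rod i.+1 k)) coef_Dop ?size_Rod_le// IH rising_recl.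
have -> : A + 2 * i%:R + k.+1%:R - 1 = A + 2 * i%:R + k%:R by rewrite -natr1; ring.
have -> : A + 2 * i.+1%:R + k%:R - 1 = A + 2 * i%:R + k%:R + 1 by rewrite -natr1; ring.
by rewrite exprS; ring.
Qed.

(** [sigma] vanishes at 1, so the derivative term of [Dop] drops out there and each level of the
    recursion only multiplies by t0(1) + i sigma'(1) = -(B + i e). *)
Lemma Rod_at1 i k : (Rod i k).[1] = (-1) ^+ k * \prod_(j < k) (B + (i + j)%:R * e).
Proof.
elim: k i => [|k IH] i; first by rewrite hornerC big_ord0 mulr1.
rewrite -[Rod i k.+1]/(Dop i (Rod i.+1 k)) /Dop !hornerE sigma_at1 sigma'_at1 t0_at1 mul0r addr0 IH.
rewrite big_ord_recl addn0 exprS.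
have -> : \prod_(j < k) (B + (i + lift ord0 j)%:R * e) = \prod_(j < k) (B + (i.+1 + j)%:R * e).
  by apply: eq_bigr => j _; rewrite /= /bump /= add1n addnS addSn.
by ring.
Qed.

Lemma prodBe_gt0 i k : 0 < \prod_(j < k) (B + (i + j)%:R * e).
Proof. by apply: prodr_gt0 => j _; rewrite ltr_wpDr// mulr_ge0. Qed.

Lemma Rod_at1_neq0 k : (Rod 0 k).[1] != 0.
Proof. by rewrite Rod_at1 mulf_neq0 ?signr_eq0// lt0r_neq0// prodBe_gt0. Qed.

Lemma rising_gt0 x k : 0 < x -> 0 < rising x k.
Proof. by move=> x0; apply: prodr_gt0 => j _; rewrite ltr_wpDr. Qed.

Lemma Rod_lead_neq0 k : (Rod 0 k)`_k != 0.
Proof.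
rewrite coef_Rod mulf_neq0 ?signr_eq0//; case: k => [|k]; first by rewrite /rising big_ord0 oner_neq0.
by rewrite lt0r_neq0// rising_gt0// mulr0 addr0 -addrA ltr_wpDr// -natr1 addrK.
Qed.

Lemma size_pk k : size (pk k) = k.+1.
Proof.
rewrite /pk size_scale ?invr_neq0 ?Rod_at1_neq0//; apply/eqP.
rewrite eqn_leq size_Rod_le ltnNge; apply/negP => /(nth_default 0) h.
by have := Rod_lead_neq0 k; rewrite h eqxx.
Qed.

Lemma pk_at1 k : (pk k).[1] = 1.
Proof. by rewrite /pk hornerZ mulVf// Rod_at1_neq0. Qed.

Lemma nu_Rod q k : nu (q * Rod 0 k) = (-1) ^+ k * nu (sigma ^+ k * q^`(k)).
Proof. by have := nu_sigma_Rod 0 k q; rewrite expr0 mul1r add0n. Qed.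

Lemma derivn_small k (q : {poly R}) : (size q <= k)%N -> q^`(k) = 0.
Proof.
move=> h; apply/polyP => i; rewrite coef_derivn coef0 nth_default ?mul0rn//.
by rewrite (leq_trans h)// leq_addr.
Qed.

(** By [nu_Rod], pairing with the polynomial of larger index differentiates the other one more often
    than its degree allows. *)
Lemma pk_orth j k : j != k -> nu (pk j * pk k) = 0.
Proof.
have aux m n : (m < n)%N -> nu (pk m * pk n) = 0.
  move=> mn; rewrite {2}/pk -scalerAr nu_scale nu_Rod derivn_small ?mulr0 ?nu_zero ?mulr0//.
  by rewrite size_pk.
rewrite neq_ltn => /orP[/aux//|/aux]; by rewrite mulrC.
Qed.

Lemma derivn_Rod k : (Rod 0 k)^`(k) = ((-1) ^+ k * rising (A + k%:R - 1) k * k`!%:R)%:P.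
Proof.
apply/polyP => i; rewrite coef_derivn coefC; case: i => [|i] /=.
  by rewrite addn0 ffactnn coef_Rod mulr0 addr0 -[LHS]mulr_natr.
by rewrite nth_default ?mul0rn// (leq_trans (size_Rod_le _ _))// addnS ltnS leq_addr.
Qed.

(** The k-th derivative of [Rod 0 k] is constant, so integration by parts leaves only
    [nu (sigma ^+ k)]; the denominator is the square of the normalisation at 1. *)
Lemma pk_norm k : nu (pk k * pk k) =
  k`!%:R * rising (A + k%:R - 1) k * nu (sigma ^+ k) / (\prod_(j < k) (B + j%:R * e)) ^+ 2.
Proof.
rewrite {2}/pk -scalerAr nu_scale nu_Rod {1}/pk derivnZ derivn_Rod.
rewrite -mul_polyC -polyCM [_ * _%:P]mulrC mul_polyC nu_scale Rod_at1.
set P := \prod_(j < k) _; set s : R := (-1) ^+ k.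
have P0 : P != 0 := lt0r_neq0 (prodBe_gt0 0 k).
have s0 : s != 0 by rewrite signr_eq0.
by field; rewrite P0 s0.
Qed.

(* the family mult is pinned down by its first value and by the ratio of consecutive norms *)
Lemma pk_normS k (wk : R) : nu (sigma ^+ k.+2) = wk * nu (sigma ^+ k.+1) ->
  (A + k%:R) * (B + k.+1%:R * e) ^+ 2 * nu (pk k.+2 * pk k.+2) =
  k.+2%:R * (A + 2 * k%:R + 1) * (A + 2 * k%:R + 2) * wk * nu (pk k.+1 * pk k.+1).
Proof.
move=> hw; rewrite !pk_norm hw [in LHS]big_ord_recr/= factS natrM.
set P := \prod_(j < k.+1) _.
have P0 : P != 0 by rewrite lt0r_neq0//; have := prodBe_gt0 0 k.+1.
have Q0 : B + k.+1%:R * e != 0 by rewrite lt0r_neq0// ltr_wpDr// mulr_ge0.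
have E : (A + k%:R) * rising (A + k.+2%:R - 1) k.+2 =
   (A + 2 * k%:R + 1) * (A + 2 * k%:R + 2) * rising (A + k.+1%:R - 1) k.+1.
  rewrite [in LHS]risingS [in LHS]risingS [in RHS]rising_recl.
  have -> : A + k.+1%:R - 1 = A + k%:R by rewrite -natr1; ring.
  have -> : A + k.+2%:R - 1 = A + k%:R + 1 by rewrite -(natr1 k.+1) -(natr1 k); ring.
  by rewrite -(natr1 k); ring.
move: E; set x := rising _ k.+2; set y := rising _ k.+1 => E.
transitivity ((A + k%:R) * x * (k.+2%:R * (k.+1)`!%:R * wk * nu (sigma ^+ k.+1) / P ^+ 2)).
  by move: Q0; move: (B + k.+1%:R * e) => b Q0; field; rewrite P0 Q0.
by rewrite E; field; rewrite P0.
Qed.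

Lemma pk_norm0 : nu 1 = 1 -> nu (pk 0 * pk 0) = 1.
Proof. by rewrite pk_norm /rising !big_ord0 expr0 => ->; rewrite expr1n divr1 !mulr1. Qed.

Lemma pk_norm1 : nu (pk 1 * pk 1) = A * nu sigma / B ^+ 2.
Proof. by rewrite pk_norm /rising !big_ord1 expr1 mul0r !addr0 addrK mul1r. Qed.

End Pearson.

(** * Cayley-Dickson algebras *)

(* e_a e_b = +- e_c : the sign (true for -) and the index c *)
Fixpoint cdt (j a b : nat) : bool * nat :=
  if j is j'.+1 then
    let h := (2 ^ j')%N in
    if (a < h)%N then
      if (b < h)%N then cdt j' a b
      else let r := cdt j' (b - h) a in (r.1, h + r.2)%N
    else
      if (b < h)%N then let r := cdt j' (a - h) b in (r.1 (+) (b != 0%N), h + r.2)%N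
      else let r := cdt j' (b - h) (a - h) in (r.1 (+) (b - h == 0)%N, r.2)
  else (false, 0%N).

Lemma cdt_lt j a b : (a < 2 ^ j)%N -> (b < 2 ^ j)%N -> ((cdt j a b).2 < 2 ^ j)%N.
Proof.
elim: j a b => [|j IH] a b //=; rewrite expnS mul2n -addnn => ha hb.
have s (k : nat) : (2 ^ j <= k)%N -> (k < 2 ^ j + 2 ^ j)%N -> (k - 2 ^ j < 2 ^ j)%N.
  by move=> h1 h2; rewrite ltn_subLR.
case: (ltnP a _) => ha'; case: (ltnP b _) => hb' /=.
- by rewrite (leq_trans (IH _ _ ha' hb'))// leq_addr.
- by rewrite ltn_add2l IH// s.
- by rewrite ltn_add2l IH// s.
- by rewrite (leq_trans (IH _ _ _ _))// ?s// leq_addr.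
Qed.

Section CDSeq.
Context {R : realType}.

Lemma size_cdadd (x y : seq R) : size (cdadd x y) = minn (size x) (size y).
Proof. by rewrite /cdadd size_map size_zip. Qed.

Lemma size_cdscale a (x : seq R) : size (cdscale a x) = size x.
Proof. exact: size_map. Qed.

Lemma size_cdconj j (x : seq R) : size x = (2 ^ j)%N -> size (cdconj j x) = (2 ^ j)%N.
Proof.
elim: j x => [|j IH] x //= sx; have hx : (2 ^ j <= size x)%N by rewrite sx leq_exp2l.
rewrite size_cat size_map size_drop IH ?size_takel// sx expnS mul2n -addnn addnK//.
Qed.

Lemma size_half j (x : seq R) : size x = (2 ^ j.+1)%N ->
  size (take (2 ^ j) x) = (2 ^ j)%N /\ size (drop (2 ^ j) x) = (2 ^ j)%N.
Proof.
move=> sx; have e : (2 ^ j.+1 = 2 ^ j + 2 ^ j)%N by rewrite expnS mul2n addnn.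
by rewrite size_drop size_takel sx e ?leq_addr// addnK.
Qed.

Lemma size_cdmul j (x y : seq R) : size x = (2 ^ j)%N -> size y = (2 ^ j)%N ->
  size (cdmul j x y) = (2 ^ j)%N.
Proof.
elim: j x y => [|j IH] x y //= sx sy.
have [a1 a2] := size_half sx; have [b1 b2] := size_half sy.
rewrite size_cat !size_cdadd size_cdscale !IH ?size_cdconj// !minnn expnS mul2n addnn//.
Qed.

Lemma nth_cdadd (x y : seq R) c : size x = size y -> (cdadd x y)`_c = x`_c + y`_c.
Proof.
move=> s; have [h|h] := ltnP c (size x).
  rewrite /cdadd (nth_map (0, 0)) ?size_zip -?s ?minnn// nth_zip//.
by rewrite !nth_default ?addr0// -?s// size_cdadd -s minnn.
Qed.

Lemma nth_cdscale a (x : seq R) c : (cdscale a x)`_c = a * x`_c.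
Proof.
have [h|h] := ltnP c (size x); first by rewrite (nth_map 0).
by rewrite !nth_default ?mulr0// size_cdscale.
Qed.

Definition csg (c : nat) : R := if c == 0%N then 1 else -1.

Lemma nth_cdconj j (x : seq R) c : size x = (2 ^ j)%N -> (cdconj j x)`_c = csg c * x`_c.
Proof.
elim: j x c => [|j IH] x c /= sx.
  by rewrite /csg; case: c => [|c]; rewrite ?mul1r// nth_default ?mulr0// sx.
have [a1 a2] := size_half sx.
rewrite nth_cat size_cdconj//; case: ltnP => hc; first by rewrite IH// nth_take.
have c0 : (c == 0%N) = false by apply/negbTE; rewrite -lt0n (leq_trans _ hc)// expn_gt0.
rewrite /csg c0 mulN1r -{2}(subnKC hc) -nth_drop.
have [h|h] := ltnP (c - 2 ^ j) (size (drop (2 ^ j) x)); first by rewrite (nth_map 0).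
by rewrite !nth_default ?oppr0// size_map.
Qed.

(** Structure constants of the algebra: the coefficient of e_c in e_a e_b. *)
Definition tc j a b c : R := if (cdt j a b).2 == c then (-1) ^+ (cdt j a b).1 else 0.

(** The bridge from the recursion on lists to the finite table [cdt]. Splitting both arguments into
    halves gives four blocks; exactly two of them reach the half that contains c, and the other two
    vanish because their index lies in the wrong half. *)
Lemma nth_cdmul j (x y : seq R) c : size x = (2 ^ j)%N -> size y = (2 ^ j)%N -> (c < 2 ^ j)%N ->
  (cdmul j x y)`_c = \sum_(0 <= a < 2 ^ j) \sum_(0 <= b < 2 ^ j) x`_a * y`_b * tc j a b c.
Proof.
elim: j x y c => [|j IH] x y c sx sy hc.
  rewrite expn0 big_nat1 big_nat1 /tc /=; case: c hc => // _.
  by rewrite expr0 mulr1 -!nth0.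
have [a1 a2] := size_half sx; have [b1 b2] := size_half sy.
have e : (2 ^ j.+1 = 2 ^ j + 2 ^ j)%N by rewrite expnS mul2n addnn.
set h := (2 ^ j)%N in a1 a2 b1 b2 e.
have split2 (F : nat -> R) : \sum_(0 <= a < 2 ^ j.+1) F a = \sum_(0 <= a < h) F a + \sum_(0 <= a < h) F (a + h)%N.
  rewrite e (big_cat_nat (n := h))//= ?leq_addr//; congr (_ + _).
  by rewrite -{1}[h]add0n big_addn addnK.
rewrite split2; under eq_bigr do rewrite split2; under [X in _ + X]eq_bigr do rewrite split2.
have xl a : (a < h)%N -> (take h x)`_a = x`_a by move=> ha; rewrite nth_take.
have yl a : (a < h)%N -> (take h y)`_a = y`_a by move=> ha; rewrite nth_take.
have xr a : (drop h x)`_a = x`_(a + h) by rewrite nth_drop addnC.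
have yr a : (drop h y)`_a = y`_(a + h) by rewrite nth_drop addnC.
have ah a : (a + h < h)%N = false by rewrite ltnNge leq_addl.
have sc1 := size_cdmul a1 b1.
have sc2 : size (cdscale (-1) (cdmul j (cdconj j (drop h y)) (drop h x))) = h.
  by rewrite size_cdscale size_cdmul// size_cdconj.
have sc3 := size_cdmul b2 a1.
have sc4 : size (cdmul j (drop h x) (cdconj j (take h y))) = h by rewrite size_cdmul// size_cdconj.
rewrite [cdmul _ _ _]/= nth_cat size_cdadd sc1 sc2 minnn -/h !big_split/=.
case: (ltnP c h) => ch.
- rewrite nth_cdadd ?sc1 ?sc2// nth_cdscale !IH// ?size_cdconj//.
  rewrite [X in _ = _ + X + _]big_nat_cond [X in _ = _ + X + _]big1 ?addr0; last first.
    move=> a /andP[/andP[_ ha] _]; rewrite big_nat_cond big1// => b /andP[/andP[_ hb] _].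
    rewrite /tc /= -/h ha ah addnK /=; case: eqP; rewrite ?mulr0// => ec.
    by move: ch; rewrite -ec ltnNge leq_addr.
  rewrite [X in _ = _ + (X + _)]big_nat_cond [X in _ = _ + (X + _)]big1 ?add0r; last first.
    move=> a /andP[/andP[_ ha] _]; rewrite big_nat_cond big1// => b /andP[/andP[_ hb] _].
    rewrite /tc /= -/h hb ah addnK /=; case: eqP; rewrite ?mulr0// => ec.
    by move: ch; rewrite -ec ltnNge leq_addr.
  congr (_ + _).
    apply: eq_big_nat => a /andP[_ ha].
    apply: eq_big_nat => b /andP[_ hb].
    by rewrite xl// yl// /tc /= -/h ha hb.
  rewrite [RHS]exchange_big/= mulr_sumr -/h; apply: eq_big_nat => b /andP[_ hb].
  rewrite mulr_sumr -/h; apply: eq_big_nat => a /andP[_ ha].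
  rewrite nth_cdconj// xr yr /tc /= -/h !ah !addnK /csg; case: (cdt j b a) => sg d /=.
  by case: (b == 0)%N; case: (d == c); case: sg; rewrite /=; ring.
- have hc' : (c - h < h)%N by rewrite ltn_subLR// -e.
  rewrite nth_cdadd ?sc3 ?sc4// !IH// ?size_cdconj//.
  rewrite [X in _ = X + _ + _]big_nat_cond [X in _ = X + _ + _]big1 ?add0r; last first.
    move=> a /andP[/andP[_ ha] _]; rewrite big_nat_cond big1// => b /andP[/andP[_ hb] _].
    rewrite /tc /= -/h ha hb; case: eqP; rewrite ?mulr0// => ec.
    by have := cdt_lt ha hb; rewrite ec ltnNge ch.
  rewrite [X in _ = _ + (_ + X)]big_nat_cond [X in _ = _ + (_ + X)]big1 ?addr0; last first.
    move=> a /andP[/andP[_ ha] _]; rewrite big_nat_cond big1// => b /andP[/andP[_ hb] _].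
    rewrite /tc /= -/h !ah !addnK /=; case: eqP; rewrite ?mulr0// => ec.
    by have := cdt_lt hb ha; rewrite ec ltnNge ch.
  have ec (k : nat) : (h + k == c)%N = (k == c - h)%N by rewrite -(eqn_add2l h k) subnKC.
  congr (_ + _).
    rewrite [RHS]exchange_big/= -/h; apply: eq_big_nat => b /andP[_ hb].
    apply: eq_big_nat => a /andP[_ ha].
    by rewrite xl// yr /tc /= -/h ha ah addnK /= ec; case: eqP => _; ring.
  apply: eq_big_nat => a /andP[_ ha].
  apply: eq_big_nat => b /andP[_ hb].
  rewrite nth_cdconj// yl// xr /tc /= -/h hb ah addnK /= ec /csg; case: (cdt j a b) => sg d /=.
  by case: (b == 0)%N; case: (d == _); case: sg; rewrite /=; ring.
Qed.

End CDSeq.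

(** * Algebra elements as real vectors, and identities read off tables of basis products *)

Section KAlgebra.
Context {R : realType} (j : nat).
Notation D := (2 ^ j)%N.
Definition K := 'rV[R]_D.

Definition sq (x : K) : seq R := [seq x 0 i | i <- enum 'I_D].
Definition unsq (s : seq R) : K := \row_c s`_c.

Lemma size_sq x : size (sq x) = D.
Proof. by rewrite size_map size_enum_ord. Qed.

Lemma nth_sq x (c : 'I_D) : (sq x)`_c = x 0 c.
Proof. by rewrite (nth_map c) ?size_enum_ord// nth_ord_enum. Qed.

Lemma sqK : cancel sq unsq.
Proof. by move=> x; apply/rowP => c; rewrite mxE nth_sq. Qed.

Lemma unsqK s : size s = D -> sq (unsq s) = s.
Proof.
move=> ss; apply: (@eq_from_nth _ 0); first by rewrite size_sq ss.
by move=> i; rewrite size_sq => hi; rewrite (nth_sq _ (Ordinal hi)) mxE.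
Qed.

Lemma sq_inj (s : seq R) (x : K) : size s = D -> (forall c : 'I_D, s`_c = x 0 c) -> s = sq x.
Proof. by move=> ss h; rewrite -(unsqK ss); congr sq; apply/rowP => c; rewrite mxE. Qed.

Definition kmul (x y : K) : K := \row_c \sum_(a < D) \sum_(b < D) x 0 a * y 0 b * tc j a b c.
Definition kconj (x : K) : K := \row_c (csg c * x 0 c).
Definition ke (a : nat) : K := \row_c ((c : nat) == a)%:R.
Definition dot (x y : K) : R := \sum_c x 0 c * y 0 c.

Lemma sq_mul x y : cdmul j (sq x) (sq y) = sq (kmul x y).
Proof.
apply: sq_inj; first by rewrite size_cdmul ?size_sq.
move=> c; rewrite nth_cdmul ?size_sq// mxE big_mkord; apply: eq_bigr => a _.
by rewrite big_mkord; apply: eq_bigr => b _; rewrite !nth_sq.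
Qed.

Lemma sq_conj x : cdconj j (sq x) = sq (kconj x).
Proof.
apply: sq_inj; first by rewrite size_cdconj ?size_sq.
by move=> c; rewrite nth_cdconj ?size_sq// mxE nth_sq.
Qed.

Lemma sq_add x y : cdadd (sq x) (sq y) = sq (x + y).
Proof.
apply: sq_inj; first by rewrite size_cdadd !size_sq minnn.
by move=> c; rewrite nth_cdadd ?size_sq// !nth_sq mxE.
Qed.

Lemma sq_scale a x : cdscale a (sq x) = sq (a *: x).
Proof.
apply: sq_inj; first by rewrite size_cdscale size_sq.
by move=> c; rewrite nth_cdscale nth_sq mxE.
Qed.

Lemma sq_zero : cdzero j = sq 0.
Proof.
apply: sq_inj; first by rewrite size_nseq.
by move=> c; rewrite nth_nseq ltn_ord mxE.
Qed.

Lemma sq_one : cdone j = sq (ke 0).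
Proof.
apply: sq_inj; first by rewrite /= size_nseq prednK// expn_gt0.
move=> c; rewrite mxE; case: (nat_of_ord c) => [|c'] //=.
by rewrite nth_nseq; case: ifP.
Qed.

(** A predicate instead of a bundled linear map: it applies directly to partial applications such as
    [kmul^~ y], so that [linext] can reduce a multilinear identity to basis elements one variable at
    a time. *)
Definition lin (V W : lmodType R) (f : V -> W) := forall a x y, f (a *: x + y) = a *: f x + f y.

Lemma lin_add (V W : lmodType R) (f : V -> W) : lin f -> forall x y, f (x + y) = f x + f y.
Proof. by move=> h x y; rewrite -[x]scale1r h !scale1r. Qed.

Lemma lin0 (V W : lmodType R) (f : V -> W) : lin f -> f 0 = 0.
Proof. by move=> h; have := h (-1) 0 0; rewrite scaler0 addr0 scaleN1r addNr. Qed.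

Lemma lin_scale (V W : lmodType R) (f : V -> W) : lin f -> forall a x, f (a *: x) = a *: f x.
Proof. by move=> h a x; rewrite -[a *: x]addr0 h (lin0 h) addr0. Qed.

Lemma lin_sum (V W : lmodType R) (f : V -> W) J (r : seq J) (F : J -> V) : lin f ->
  f (\sum_(i <- r) F i) = \sum_(i <- r) f (F i).
Proof.
move=> h; elim: r => [|i r IH]; first by rewrite !big_nil lin0.
by rewrite !big_cons lin_add// IH.
Qed.

Lemma ke_sum (x : K) : x = \sum_(a < D) x 0 a *: ke a.
Proof.
apply/rowP => c; rewrite summxE (bigD1 c)//= !mxE eqxx mulr1 big1 ?addr0// => a ac.
by rewrite !mxE (_ : (c == a :> nat) = false) ?mulr0//; apply/negbTE; rewrite eq_sym.
Qed.

Lemma linext (W : lmodType R) (f g : K -> W) : lin f -> lin g ->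
  (forall a, (a < D)%N -> f (ke a) = g (ke a)) -> f =1 g.
Proof.
move=> hf hg h x; rewrite (ke_sum x) !lin_sum//; apply: eq_bigr => a _.
by rewrite !lin_scale// h.
Qed.

Lemma lin_mull y : lin (kmul^~ y).
Proof.
move=> a x x'; apply/rowP => c; rewrite !mxE mulr_sumr -big_split/=; apply: eq_bigr => i _.
by rewrite mulr_sumr -big_split/=; apply: eq_bigr => k _; rewrite !mxE; ring.
Qed.

Lemma lin_mulr x : lin (kmul x).
Proof.
move=> a y y'; apply/rowP => c; rewrite !mxE mulr_sumr -big_split/=; apply: eq_bigr => i _.
by rewrite mulr_sumr -big_split/=; apply: eq_bigr => k _; rewrite !mxE; ring.
Qed.

Lemma lin_conj : lin kconj.
Proof. by move=> a x y; apply/rowP => c; rewrite !mxE; ring. Qed.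

Lemma lin_dotl y : @lin K R^o (dot^~ y).
Proof.
move=> a x x'; rewrite /dot /GRing.scale/= mulr_sumr -big_split/=; apply: eq_bigr => c _.
by rewrite !mxE; ring.
Qed.

Lemma dotC x y : dot x y = dot y x.
Proof. by apply: eq_bigr => c _; rewrite mulrC. Qed.

Lemma lin_dotr x : @lin K R^o (dot x).
Proof. by move=> a y y'; rewrite ![dot x _]dotC; exact: lin_dotl. Qed.

Lemma ke_mul a b : (a < D)%N -> (b < D)%N -> kmul (ke a) (ke b) = (-1) ^+ (cdt j a b).1 *: ke (cdt j a b).2.
Proof.
move=> ha hb; apply/rowP => c; rewrite !mxE (bigD1 (Ordinal ha))//= (bigD1 (Ordinal hb))//=.
have ne (u : nat) (hu : (u < D)%N) (v : 'I_D) : v != Ordinal hu -> (v == u :> nat) = false.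
  by move=> h; apply: contraNF h => /eqP h; apply/eqP/val_inj.
rewrite [X in _ + X + _]big1 ?addr0; last by move=> b' /ne h; rewrite !mxE h mulr0 mul0r.
rewrite big1 ?addr0; last by move=> a' /ne h; rewrite big1// => b' _; rewrite !mxE h !mul0r.
by rewrite !mxE !eqxx !mul1r /tc eq_sym; case: eqP; rewrite ?mulr1 ?mulr0.
Qed.

Lemma ke_conj a : kconj (ke a) = csg a *: ke a.
Proof. by apply/rowP => c; rewrite !mxE; case: eqP => [->|]; rewrite ?mulr0. Qed.

Lemma dot_ke a b : (a < D)%N -> dot (ke a) (ke b) = (a == b)%:R.
Proof.
move=> ha; rewrite /dot (bigD1 (Ordinal ha))//= !mxE eqxx mul1r big1 ?addr0// => c h.
rewrite !mxE (_ : (c == a :> nat) = false) ?mul0r//.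
by apply: contraNF h => /eqP h; apply/eqP/val_inj.
Qed.

Lemma kmulZl a x y : kmul (a *: x) y = a *: kmul x y. Proof. exact: lin_scale (lin_mull y) a x. Qed.
Lemma kmulZr a x y : kmul x (a *: y) = a *: kmul x y. Proof. exact: lin_scale (lin_mulr x) a y. Qed.
Lemma dotZl a x y : dot (a *: x) y = a * dot x y. Proof. exact: lin_scale (lin_dotl y) a x. Qed.
Lemma dotZr a x y : dot x (a *: y) = a * dot x y. Proof. exact: lin_scale (lin_dotr x) a y. Qed.

Definition basis2 (P : nat -> nat -> bool) := all (fun a => all (P a) (iota 0 D)) (iota 0 D).
Definition basis3 (P : nat -> nat -> nat -> bool) := all (fun a => basis2 (P a)) (iota 0 D).
Definition basis4 (P : nat -> nat -> nat -> nat -> bool) := all (fun a => basis3 (P a)) (iota 0 D).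

Lemma basis2P P : basis2 P -> forall a b, (a < D)%N -> (b < D)%N -> P a b.
Proof.
move=> /allP h a b ha hb; have ia : a \in iota 0 D by rewrite mem_iota.
by have /allP h2 := h a ia; apply: h2; rewrite mem_iota.
Qed.

Lemma basis3P P : basis3 P -> forall a b c, (a < D)%N -> (b < D)%N -> (c < D)%N -> P a b c.
Proof.
move=> /allP h a b c ha; have ia : a \in iota 0 D by rewrite mem_iota.
by have /basis2P h2 := h a ia; exact: h2.
Qed.

Lemma basis4P P : basis4 P -> forall a b c d, (a < D)%N -> (b < D)%N -> (c < D)%N -> (d < D)%N -> P a b c d.
Proof.
move=> /allP h a b c d ha; have ia : a \in iota 0 D by rewrite mem_iota.
by have /basis3P h2 := h a ia; exact: h2.
Qed.

(** Signed basis elements are pairs (sign, index). Products, conjugates, opposites and inner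
    products of such pairs involve no real number, so an identity on the basis is a closed boolean
    that [vm_compute] decides; [bv] transports it back to [K]. *)
Definition bm (p q : bool * nat) : bool * nat :=
  let r := cdt j p.2 q.2 in (p.1 (+) q.1 (+) r.1, r.2).
Definition bc (p : bool * nat) : bool * nat := (p.1 (+) (p.2 != 0%N), p.2).
Definition bn (p : bool * nat) : bool * nat := (~~ p.1, p.2).
Definition be (a : nat) : bool * nat := (false, a).
Definition bd (p q : bool * nat) : int := if p.2 == q.2 then (-1) ^+ (p.1 (+) q.1) else 0.
Definition bv (p : bool * nat) : K := (-1) ^+ p.1 *: ke p.2.

Lemma bv_be a : bv (be a) = ke a.
Proof. by rewrite /bv scale1r. Qed.

Lemma bv_bn p : bv (bn p) = - bv p.
Proof. by rewrite /bv /bn signrN scaleNr. Qed.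

Lemma bm_lt p q : (p.2 < D)%N -> (q.2 < D)%N -> ((bm p q).2 < D)%N.
Proof. exact: cdt_lt. Qed.

Lemma bv_bm p q : (p.2 < D)%N -> (q.2 < D)%N -> kmul (bv p) (bv q) = bv (bm p q).
Proof.
by move=> hp hq; rewrite /bv kmulZl kmulZr ke_mul// !scalerA /bm /= !signr_addb.
Qed.

Lemma bv_bc p : kconj (bv p) = bv (bc p).
Proof.
rewrite /bv (lin_scale lin_conj) ke_conj scalerA /bc /= signr_addb /csg.
by case: (p.2 == 0)%N.
Qed.

Lemma bv_bd p q : (p.2 < D)%N -> dot (bv p) (bv q) = (bd p q)%:~R.
Proof.
move=> hp; rewrite /bv dotZl dotZr dot_ke// /bd; case: eqP => _; last by rewrite !mulr0.
by rewrite mulr1 -signr_addb; case: (_ (+) _).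
Qed.

End KAlgebra.

Arguments K : clear implicits.
Arguments ke {R j} a.
Arguments bv {R j} p.

(** Three sufficient ways for two sums of signed basis elements to agree: termwise, crosswise, or
    with both sums cancelling. These cover every case of the polarised Moufang identities. *)
Definition eq2 (p q r s : bool * nat) :=
  [|| (p == r) && (q == s), (p == s) && (q == r) | (p == bn q) && (r == bn s)].

Lemma eq2P (R : realType) j p q r s : eq2 p q r s -> bv p + bv q = bv r + bv s :> K R j.
Proof.
case/or3P => /andP[/eqP -> /eqP ->] //; first by rewrite addrC.
by rewrite !bv_bn !addNr.
Qed.

(* Multilinear identities need only be checked on basis elements, where they are statements on signs and indices. *)
Lemma table_conjM j : (j <= 3)%N ->
  basis2 j (fun a b => bc (bm j (be a) (be b)) == bm j (bc (be b)) (bc (be a))).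
Proof. by case: j => [|[|[|[|]]]]// _; vm_compute. Qed.

Lemma table_one j : (j <= 3)%N -> basis2 j (fun a _ =>
  (bm j (be a) (be 0) == be a) && (bm j (be 0) (be a) == be a)).
Proof. by case: j => [|[|[|[|]]]]// _; vm_compute. Qed.

Lemma table_re j : (j <= 3)%N ->
  basis2 j (fun a b => bd (bm j (be a) (be b)) (be 0) == bd (be a) (bc (be b))).
Proof. by case: j => [|[|[|[|]]]]// _; vm_compute. Qed.

Lemma table_adj j : (j <= 3)%N -> basis3 j (fun a b c =>
  bd (bm j (be a) (be b)) (be c) == bd (be b) (bm j (bc (be a)) (be c))).
Proof. by case: j => [|[|[|[|]]]]// _; vm_compute. Qed.

Lemma table_alt j : (j <= 3)%N -> basis3 j (fun a b c =>
  let p := bm j (bc (be a)) (bm j (be b) (be c)) in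
  let q := bm j (bc (be b)) (bm j (be a) (be c)) in
  if a == b then (p == be c) && (q == be c) else p == bn q).
Proof. by case: j => [|[|[|[|]]]]// _; vm_compute. Qed.

Lemma table_assoc j : (j <= 2)%N -> basis3 j (fun a b c =>
  bm j (bm j (be a) (be b)) (be c) == bm j (be a) (bm j (be b) (be c))).
Proof. by case: j => [|[|[|]]]// _; vm_compute. Qed.

Lemma table_comm j : (j <= 1)%N -> basis2 j (fun a b => bm j (be a) (be b) == bm j (be b) (be a)).
Proof. by case: j => [|[|]]// _; vm_compute. Qed.

Lemma table_moufang : basis4 3 (fun a b u v =>
  eq2 (bm 3 (bm 3 (be u) (be a)) (bm 3 (be b) (be v))) (bm 3 (bm 3 (be v) (be a)) (bm 3 (be b) (be u)))
      (bm 3 (bm 3 (be u) (bm 3 (be a) (be b))) (be v)) (bm 3 (bm 3 (be v) (bm 3 (be a) (be b))) (be u))).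
Proof. by vm_compute. Qed.

Lemma table_moufangr : basis4 3 (fun a b u v =>
  eq2 (bm 3 (bm 3 (bm 3 (be a) (be u)) (be b)) (be v)) (bm 3 (bm 3 (bm 3 (be a) (be v)) (be b)) (be u))
      (bm 3 (be a) (bm 3 (be u) (bm 3 (be b) (be v)))) (bm 3 (be a) (bm 3 (be v) (bm 3 (be b) (be u))))).
Proof. by vm_compute. Qed.

Section KLaws.
Context {R : realType} (j : nat).
Hypothesis j3 : (j <= 3)%N.
Notation D := (2 ^ j)%N.
Notation K := (K R j).
Implicit Types x y z w : K.

Lemma kmul_linl a x y z : kmul (a *: x + y) z = a *: kmul x z + kmul y z.
Proof. exact: lin_mull. Qed.
Lemma kmul_linr a x y z : kmul z (a *: x + y) = a *: kmul z x + kmul z y.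
Proof. exact: lin_mulr. Qed.
Lemma kconj_lin a x y : kconj (a *: x + y) = a *: kconj x + kconj y.
Proof. exact: lin_conj. Qed.
Lemma dot_linl a x y z : dot (a *: x + y) z = a * dot x z + dot y z.
Proof. exact: lin_dotl. Qed.
Lemma dot_linr a x y z : dot z (a *: x + y) = a * dot z x + dot z y.
Proof. exact: lin_dotr. Qed.
Definition linE := (kmul_linl, kmul_linr, kconj_lin, dot_linl, dot_linr).

Lemma kconjK x : kconj (kconj x) = x.
Proof.
apply/rowP => c; rewrite !mxE mulrA /csg; case: eqP => _; ring.
Qed.

Lemma kconjM x y : kconj (kmul x y) = kmul (kconj y) (kconj x).
Proof.
move: x; apply: linext => [a u v|a u v|a ha]; rewrite ?linE//.
move: y; apply: linext => [c u v|c u v|b hb]; rewrite ?linE//.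
by rewrite -!bv_be bv_bm// !bv_bc bv_bm// (eqP (basis2P (table_conjM j3) ha hb)).
Qed.

Lemma kmul1 x : kmul x (ke 0) = x.
Proof.
move: x; apply: linext => [a u v|a u v|a ha]; rewrite ?linE//.
have D0 : (0 < D)%N by rewrite expn_gt0.
by rewrite -!bv_be bv_bm//; have /andP[/eqP -> _] := basis2P (table_one j3) ha ha.
Qed.

Lemma k1mul x : kmul (ke 0) x = x.
Proof.
move: x; apply: linext => [a u v|a u v|a ha]; rewrite ?linE//.
have D0 : (0 < D)%N by rewrite expn_gt0.
by rewrite -!bv_be bv_bm//; have /andP[_ /eqP ->] := basis2P (table_one j3) ha ha.
Qed.

Lemma kre_mul x y : dot (kmul x y) (ke 0) = dot x (kconj y).
Proof.
move: x; apply: (@linext _ _ R^o) => [a u v|a u v|a ha]; rewrite ?linE//.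
move: y; apply: (@linext _ _ R^o) => [c u v|c u v|b hb]; rewrite ?linE//.
by rewrite -!bv_be bv_bm// bv_bc !bv_bd ?bm_lt// (eqP (basis2P (table_re j3) ha hb)).
Qed.

Lemma dot_adjl x y z : dot (kmul x y) z = dot y (kmul (kconj x) z).
Proof.
move: x; apply: (@linext _ _ R^o) => [a u v|a u v|a ha]; rewrite ?linE//.
move: y; apply: (@linext _ _ R^o) => [c u v|c u v|b hb]; rewrite ?linE//.
move: z; apply: (@linext _ _ R^o) => [d u v|d u v|c hc]; rewrite ?linE//.
by rewrite -!bv_be bv_bm// bv_bc bv_bm// !bv_bd ?bm_lt// (eqP (basis3P (table_adj j3) ha hb hc)).
Qed.

Lemma dot_conj x y : dot (kconj x) (kconj y) = dot x y.
Proof.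
apply: eq_bigr => c _; rewrite !mxE /csg; case: eqP => _; ring.
Qed.

Lemma dot_adjr x y z : dot (kmul x y) z = dot x (kmul z (kconj y)).
Proof. by rewrite -dot_conj kconjM dot_adjl -[LHS]dot_conj kconjM !kconjK. Qed.

(** Polarised form of conj(x) (x z) = |x|^2 z. The original is quadratic in x, hence not determined
    on a basis, whereas this form is multilinear. Alternativity and multiplicativity of the norm
    both follow from it, without associativity. *)
Lemma kalt_polar x y z :
  kmul (kconj x) (kmul y z) + kmul (kconj y) (kmul x z) = (2 * dot x y) *: z.
Proof.
move: x; apply: linext => [a u v|a u v|a ha].
- by rewrite !linE scalerDr addrACA.
- by rewrite !linE mulrDr scalerDl mulrCA scalerA.
move: y; apply: linext => [c u v|c u v|b hb].
- by rewrite !linE scalerDr addrACA.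
- by rewrite !linE mulrDr scalerDl mulrCA scalerA.
move: z; apply: linext => [d u v|d u v|c hc].
- by rewrite !linE scalerDr addrACA.
- by rewrite scalerDr !scalerA mulrC.
have := basis3P (table_alt j3) ha hb hc; rewrite /= dot_ke//.
rewrite -!bv_be !bv_bc ?(bv_bm ha hc, bv_bm hb hc)// !bv_bm ?bm_lt//.
case: eqP => _; first by move=> /andP[/eqP -> /eqP ->]; rewrite mulr1 scalerDl scale1r.
by move=> /eqP ->; rewrite bv_bn addNr mulr0 scale0r.
Qed.

Lemma kaltl x z : kmul (kconj x) (kmul x z) = dot x x *: z.
Proof.
have := kalt_polar x x z; rewrite -mulr2n -scaler_nat -scalerA.
by move=> /(scalerI _) -> //; rewrite pnatr_eq0.
Qed.

Lemma kaltl' x z : kmul x (kmul (kconj x) z) = dot x x *: z.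
Proof. by have := kaltl (kconj x) z; rewrite kconjK dot_conj. Qed.

Lemma kaltr x z : kmul (kmul z x) (kconj x) = dot x x *: z.
Proof.
apply: (can_inj kconjK); rewrite !kconjM kconjK kaltl' (lin_scale (lin_conj (R := R) (j := j)))//.
Qed.

Lemma kaltr' x z : kmul (kmul z (kconj x)) x = dot x x *: z.
Proof. by have := kaltr (kconj x) z; rewrite kconjK dot_conj. Qed.

Lemma dot_mull x y z : dot (kmul x y) (kmul x z) = dot x x * dot y z.
Proof. by rewrite dot_adjl kaltl dotZr. Qed.

Lemma dot_mulr x y z : dot (kmul y x) (kmul z x) = dot x x * dot y z.
Proof. by rewrite dot_adjr kaltr dotZr. Qed.

Lemma dot_ge0 x : 0 <= dot x x.
Proof. by apply: sumr_ge0 => c _; rewrite -expr2 sqr_ge0. Qed.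

Lemma dot_eq0 x : dot x x = 0 -> x = 0.
Proof.
move=> h; apply/rowP => c; rewrite mxE; apply/eqP; rewrite -sqrf_eq0 expr2.
by apply/eqP/(psumr_eq0P _ h) => // i _; rewrite -expr2 sqr_ge0.
Qed.

Lemma kmulA : (j <= 2)%N -> forall x y z, kmul (kmul x y) z = kmul x (kmul y z).
Proof.
move=> j2 x y z.
move: x; apply: linext => [a u v|a u v|a ha]; rewrite ?linE//.
move: y; apply: linext => [c u v|c u v|b hb]; rewrite ?linE//.
move: z; apply: linext => [d u v|d u v|c hc]; rewrite ?linE//.
by rewrite -!bv_be !bv_bm ?bm_lt// (eqP (basis3P (table_assoc j2) ha hb hc)).
Qed.

Lemma kmulC : (j <= 1)%N -> forall x y, kmul x y = kmul y x.
Proof.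
move=> j1 x y.
move: x; apply: linext => [a u v|a u v|a ha]; rewrite ?linE//.
move: y; apply: linext => [c u v|c u v|b hb]; rewrite ?linE//.
by rewrite -!bv_be !bv_bm ?bm_lt// (eqP (basis2P (table_comm j1) ha hb)).
Qed.

End KLaws.

Section Moufang.
Context {R : realType}.
Notation K := (K R 3).
Implicit Types a b u v : K.

(** The Moufang identity is quadratic in u. Symmetrising it in u and v makes it multilinear, so the
    table over four basis elements suffices; setting v = u and halving recovers the identity
    itself. *)
Lemma moufang_polar a b u v :
  kmul (kmul u a) (kmul b v) + kmul (kmul v a) (kmul b u) =
  kmul (kmul u (kmul a b)) v + kmul (kmul v (kmul a b)) u.
Proof.
move: a; apply: linext => [t p q|t p q|a ha]; try by rewrite !linE scalerDr addrACA.
move: b; apply: linext => [t p q|t p q|b hb]; try by rewrite !linE scalerDr addrACA.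
move: u; apply: linext => [t p q|t p q|c hc]; try by rewrite !linE scalerDr addrACA.
move: v; apply: linext => [t p q|t p q|d hd]; try by rewrite !linE scalerDr addrACA.
by rewrite -!bv_be !bv_bm ?bm_lt//; apply/eq2P/(basis4P table_moufang).
Qed.

Lemma moufangr_polar a b u v :
  kmul (kmul (kmul a u) b) v + kmul (kmul (kmul a v) b) u =
  kmul a (kmul u (kmul b v)) + kmul a (kmul v (kmul b u)).
Proof.
move: a; apply: linext => [t p q|t p q|a ha]; try by rewrite !linE scalerDr addrACA.
move: b; apply: linext => [t p q|t p q|b hb]; try by rewrite !linE scalerDr addrACA.
move: u; apply: linext => [t p q|t p q|c hc]; try by rewrite !linE scalerDr addrACA.
move: v; apply: linext => [t p q|t p q|d hd]; try by rewrite !linE scalerDr addrACA.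
by rewrite -!bv_be !bv_bm ?bm_lt//; apply/eq2P/(basis4P table_moufangr).
Qed.

Lemma double_inj (x y : K) : x + x = y + y -> x = y.
Proof.
move=> /rowP h; apply/rowP => c; have := h c; rewrite !mxE; move: (x 0 c) (y 0 c) => p q; lra.
Qed.

Lemma moufang u a b : kmul (kmul u a) (kmul b u) = kmul (kmul u (kmul a b)) u.
Proof. exact/double_inj/moufang_polar. Qed.

Lemma moufangr u a b : kmul (kmul (kmul a u) b) u = kmul a (kmul u (kmul b u)).
Proof. exact/double_inj/moufangr_polar. Qed.

Lemma flexible u b : kmul u (kmul b u) = kmul (kmul u b) u.
Proof. by have := moufang u (ke 0) b; rewrite kmul1// k1mul. Qed.

Lemma moufangl u a b : kmul u (kmul a (kmul u b)) = kmul (kmul (kmul u a) u) b.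
Proof.
apply: (can_inj (kconjK (R := R) (j := 3))); rewrite !kconjM// moufangr.
by rewrite flexible.
Qed.

End Moufang.

Local Open Scope classical_set_scope.
Local Open Scope ring_scope.

(** * From moments to ordered eigenvalues *)

Section Bernstein.
Context {R : realType}.

(* Bernstein operator through its degree recursion; no binomials appear *)
Fixpoint bern (n : nat) (h : nat -> R) : {poly R} :=
  if n is n'.+1 then 'X * bern n' (fun k => h k.+1) + (1 - 'X) * bern n' h
  else (h 0%N)%:P.

Lemma bernS n h (x : R) :
  (bern n.+1 h).[x] = x * (bern n (fun k => h k.+1)).[x] + (1 - x) * (bern n h).[x].
Proof. by rewrite /= !hornerE. Qed.

Lemma bern_le n (h g : nat -> R) (x : R) : 0 <= x <= 1 ->
  (forall k, h k <= g k) -> (bern n h).[x] <= (bern n g).[x].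
Proof.
move=> /andP[x0 x1]; elim: n h g => [|n IH] h g hg; first by rewrite /= !hornerC.
rewrite !bernS lerD// ler_wpM2l ?subr_ge0//; exact: IH.
Qed.

Lemma bern_lin n (h : nat -> R) (a b x : R) :
  (bern n (fun k => a * h k + b)).[x] = a * (bern n h).[x] + b.
Proof.
elim: n h => [|n IH] h; first by rewrite /= !hornerC.
by rewrite !bernS !IH; ring.
Qed.

(** [bern n h] at x is the expectation of h under the binomial law with parameters n and x; this is
    its second moment about a, with variance n x (1 - x). *)
Lemma bern_sqr n (a x : R) :
  (bern n (fun k => (k%:R - a) ^+ 2)).[x] = (n%:R * x - a) ^+ 2 + n%:R * x * (1 - x).
Proof.
elim: n a => [|n IH] a; first by rewrite /= hornerC; ring.
rewrite bernS IH.
have -> : (fun k => (k.+1%:R - a) ^+ 2) = (fun k : nat => (k%:R - (a - 1)) ^+ 2 : R).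
  by apply/funext => k; rewrite -natr1; ring.
by rewrite IH -natr1; ring.
Qed.

(** Since |u| <= u^2 / eta + eta, the deviation of f is dominated by a quadratic polynomial in k.
    The Bernstein operator is positive and linear, so the variance formula bounds the error by K /
    (eta n) + K eta, and both terms are at most e / 2. *)
Lemma lipschitz_poly_approx01 (f : R -> R) (K : R) :
  (forall x y : R, 0 <= x <= 1 -> 0 <= y <= 1 -> `|f x - f y| <= K * `|x - y|) ->
  forall e : R, 0 < e -> exists p : {poly R}, forall x : R, 0 <= x <= 1 -> `|p.[x] - f x| <= e.
Proof.
move=> fK e e0.
wlog K0 : K fK / 0 < K.
  move=> /(_ (`|K| + 1)); apply; last by rewrite ltr_wpDl.
  move=> x y hx hy; apply: le_trans (fK _ _ hx hy) _.
  by rewrite ler_wpM2r// (le_trans (ler_norm _))// lerDl.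
pose eta := e / (2 * K).
have eta0 : 0 < eta by rewrite divr_gt0// mulr_gt0.
have [n n0 hn] : exists2 n, (0 < n)%N & eta ^- 2 <= n%:R.
  exists (Num.truncn (eta ^- 2)).+1 => //.
  by rewrite ltW// truncnS_gt.
have nR : (0 : R) < n%:R by rewrite ltr0n.
(* The nodes are cut off at 1 because [bern_le] compares sequences at every natural k, also beyond
   n, where k / n would leave the interval on which f is controlled. *)
exists (bern n (fun k => f (Num.min 1 (k%:R / n%:R)))) => x hx.
have bnd k : `|f (Num.min 1 (k%:R / n%:R)) - f x|
    <= (K / (eta * n%:R ^+ 2)) * (k%:R - n%:R * x) ^+ 2 + K * eta.
  have h1 : `|Num.min 1 (k%:R / n%:R) - x| <= `|k%:R / n%:R - x|.
    case/andP: hx => x0 x1.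
    case: (leP 1 (k%:R / n%:R)) => // h.
    by rewrite !ger0_norm ?subr_ge0// ?lerB// (le_trans x1).
  have h2 : 0 <= Num.min (1 : R) (k%:R / n%:R) <= 1.
    by rewrite le_min ler01 divr_ge0//= ge_min lexx.
  apply: le_trans (fK _ _ h2 hx) _.
  apply: (@le_trans _ _ (K * `|k%:R / n%:R - x|)); first by rewrite ler_pM2l.
  have -> : (k%:R - n%:R * x) ^+ 2 = n%:R ^+ 2 * (k%:R / n%:R - x) ^+ 2.
    rewrite -exprMn mulrBr mulrCA divff ?mulr1//; exact: lt0r_neq0.
  set u := k%:R / n%:R - x.
  have -> : K / (eta * n%:R ^+ 2) * (n%:R ^+ 2 * u ^+ 2) + K * eta = K * (u ^+ 2 / eta + eta).
    by field; rewrite !lt0r_neq0.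
  rewrite ler_pM2l//.
  have : 0 <= (`|u| - eta) ^+ 2 + `|u| * eta by rewrite addr_ge0 ?sqr_ge0// mulr_ge0// ltW.
  have -> : u ^+ 2 = `|u| ^+ 2 by rewrite real_normK// num_real.
  move=> h; rewrite -(ler_pM2r eta0) mulrDl divfK ?lt0r_neq0//.
  by rewrite -subr_ge0; move: h; congr (0 <= _); ring.
have key : `|(bern n (fun k => f (Num.min 1 (k%:R / n%:R)))).[x] - f x|
    <= (K / (eta * n%:R ^+ 2)) * (n%:R * x * (1 - x)) + K * eta.
  have -> : n%:R * x * (1 - x) = (bern n (fun k => (k%:R - n%:R * x) ^+ 2)).[x].
    by rewrite bern_sqr subrr expr0n add0r.
  rewrite -bern_lin ler_norml; apply/andP; split.
    rewrite -mulN1r -[X in _ <= X]mul1r -[X in X <= _]addr0.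
    have -> : 1 * ((bern n (fun k => f (Num.min 1 (k%:R / n%:R)))).[x] - f x) =
       (bern n (fun k => 1 * f (Num.min 1 (k%:R / n%:R)) + - f x)).[x].
      by rewrite (bern_lin n (fun k => f (Num.min 1 (k%:R / n%:R)))) !mul1r.
    rewrite -(bern_lin n (fun k => _ * _ + _)); apply: bern_le => // k.
    by rewrite mul1r mulN1r addr0; have := bnd k; rewrite ler_norml => /andP[].
  have -> : (bern n (fun k => f (Num.min 1 (k%:R / n%:R)))).[x] - f x =
       (bern n (fun k => 1 * f (Num.min 1 (k%:R / n%:R)) + - f x)).[x].
    by rewrite (bern_lin n (fun k => f (Num.min 1 (k%:R / n%:R)))) mul1r.
  apply: bern_le => // k.
  by rewrite mul1r; have := bnd k; rewrite ler_norml => /andP[].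
apply: le_trans key _.
have -> : e = K * eta + K * eta by rewrite /eta; field; rewrite lt0r_neq0.
rewrite lerD2r.
have h4 : x * (1 - x) <= 1.
  by case/andP: hx => x0 x1; nra.
have -> : K / (eta * n%:R ^+ 2) * (n%:R * x * (1 - x)) = (K / (eta * n%:R)) * (x * (1 - x)).
  by field; rewrite !lt0r_neq0.
apply: (@le_trans _ _ (K / (eta * n%:R) * 1)).
  by apply: ler_wpM2l => //; apply/ltW; rewrite divr_gt0// mulr_gt0.
have h5 : 1 <= eta ^+ 2 * n%:R by rewrite -ler_pdivrMl ?exprn_gt0// mulr1.
rewrite mulr1 ler_pdivrMr; last exact: mulr_gt0.
have -> : K * eta * (eta * n%:R) = K * (eta ^+ 2 * n%:R) by ring.
by rewrite ler_peMr// ltW.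
Qed.

Lemma lipschitz_poly_approx (f : R -> R) (K : R) :
  (forall x y : R, -1 <= x <= 1 -> -1 <= y <= 1 -> `|f x - f y| <= K * `|x - y|) ->
  forall e : R, 0 < e -> exists p : {poly R}, forall x : R, -1 <= x <= 1 -> `|p.[x] - f x| <= e.
Proof.
move=> fK e e0.
have [|p hp] := @lipschitz_poly_approx01 (fun u => f (2 * u - 1)) (K * 2) _ e e0.
  move=> x y hx hy; apply: le_trans (fK _ _ _ _) _; [lra|lra|].
  have -> : 2 * x - 1 - (2 * y - 1) = 2 * (x - y) by ring.
  by rewrite normrM ger0_norm// mulrA.
exists (p \Po (2^-1 *: 'X + (2^-1)%:P)) => x hx.
rewrite horner_comp !hornerE.
have := hp (2^-1 * x + 2^-1).
have -> : 2 * (2^-1 * x + 2^-1) - 1 = x by field.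
by apply; lra.
Qed.

End Bernstein.

(** * Ordered positive parts of multisets *)

Section PosOrd.
Context {R : realType}.
Implicit Types (v m : nat -> R) (t : R) (s : seq R).

Local Notation ngt t := (count (fun x => (t < x)%R)).

Lemma count_gt_le_mono v m t t' i : t <= t' -> (forall k, 0 <= m k) ->
  count_gt_le v m t i -> count_gt_le v m t' i.
Proof.
move=> tt' m0 [l [ul hl hs]]; exists l; split => //.
  by move=> k mk tk; apply: hl => //; exact: le_lt_trans tk.
apply: le_trans hs; rewrite big_mkcond [leRHS]big_mkcond/=; apply: ler_sum => k _.
case: ifPn => [h|_]; first by rewrite (le_lt_trans tt' h).
by case: ifP.
Qed.

Lemma count_gt_le_bound v m t i : (forall k, v k <= t) -> count_gt_le v m t i.
Proof.
move=> vt; exists [::]; split => //; last by rewrite big_nil.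
by move=> k _ /(le_lt_trans (vt k)); rewrite ltxx.
Qed.

Lemma pos_ord_le v m t i : 0 <= t -> count_gt_le v m t i -> pos_ord v m i <= t.
Proof.
move=> t0 h; apply: ge_inf; last by split.
by exists 0 => x [].
Qed.

(** The bound by 1 puts the threshold 1 into the set whose infimum is taken, so the infimum is not
    the default value of an empty set. *)
Lemma pos_ord_ge v m t i : (forall k, v k <= 1) -> (forall k, 0 <= m k) ->
  (0 <= t -> ~ count_gt_le v m t i) -> t <= pos_ord v m i.
Proof.
move=> v1 m0 h; apply: lb_le_inf; first by exists 1; split => //; exact: count_gt_le_bound.
move=> x [x0 hx]; case: (leP t x) => // xt; exfalso.
by apply: h; [rewrite (le_trans x0)// ltW|apply: count_gt_le_mono hx => //; exact: ltW].
Qed.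

Lemma pos_ord_ge0 v m i : (forall k, v k <= 1) -> (forall k, 0 <= m k) -> 0 <= pos_ord v m i.
Proof.
move=> v1 m0; apply: lb_le_inf; first by exists 1; split => //; exact: count_gt_le_bound.
by move=> x [].
Qed.

(** A finite list in the encoding that [delta2_sq] expects: the j-th entry with weight 1 below the
    length, and weight 0 beyond it. *)
Definition seqv s := fun j => nth 0 s j.
Definition seqm s : nat -> R := fun j => (j < size s)%N%:R.

Lemma sum_seqm_gt s t (l : seq nat) : uniq l ->
  {subset [pred k | (k < size s)%N && (t < nth 0 s k)] <= l} ->
  \sum_(k <- l | t < seqv s k) seqm s k = (ngt t s)%:R.
Proof.
move=> ul hl.
rewrite (eq_bigl (fun k => t < nth 0 s k))//.
transitivity (\sum_(k <- [seq k <- l | (t < nth 0 s k) && (k < size s)%N]) (1 : R)).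
  rewrite big_filter [LHS]big_mkcond [RHS]big_mkcond; apply: eq_bigr => k _.
  by rewrite /seqm; case: (t < _); case: (k < _)%N.
transitivity (\sum_(k <- [seq k <- iota 0 (size s) | t < nth 0 s k]) (1 : R)).
  apply: perm_big; apply: uniq_perm; rewrite ?filter_uniq ?iota_uniq//.
  move=> k; rewrite !mem_filter mem_iota /= add0n.
  case: (boolP (t < nth 0 s k)) => //= tk; case: (boolP (k < size s)%N) => //= ks.
  by apply: hl; rewrite inE ks.
rewrite big_filter -[in RHS](mkseq_nth 0 s) /mkseq count_map -sum1_count natr_sum.
by apply: eq_bigr.
Qed.

Lemma count_gt_le_seq s t i : 0 <= t ->
  count_gt_le (seqv s) (seqm s) t i <-> (ngt t s <= i)%N.
Proof.
move=> t0; split.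
  move=> [l [ul hl]]; rewrite sum_seqm_gt ?ler_nat// => k; rewrite inE => /andP[ks tk].
  by apply: hl => //; rewrite /seqm ks ltr01.
move=> h; exists (iota 0 (size s)); split; rewrite ?iota_uniq//.
  by move=> k; rewrite /seqm mem_iota; case: (k < size s)%N; rewrite ?ltxx.
by rewrite sum_seqm_gt ?ler_nat ?iota_uniq// => k; rewrite inE mem_iota => /andP[].
Qed.

Definition decr_pos s := sort (fun x y => y <= x) [seq x <- s | 0 < x].

Lemma count_decr_pos s t : 0 <= t ->
  ngt t (decr_pos s) = ngt t s.
Proof.
move=> t0; rewrite count_sort count_filter; apply: eq_count => x /=.
by case: ltP => //= tx; rewrite (le_lt_trans t0 tx).
Qed.

Lemma geT : total (fun x y : R => y <= x).
Proof. by move=> x y; rewrite orbC; exact: le_total. Qed.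

Lemma decr_nth_gt (l : seq R) t i : sorted (fun x y => y <= x) l -> 0 <= t ->
  (t < nth 0 l i) = (i < ngt t l)%N.
Proof.
have tr : transitive (fun x y : R => y <= x) by move=> x y z yx zx; exact: le_trans zx yx.
elim: l i => [|a l IH] i /=; first by rewrite nth_nil => _; rewrite leNgt => /negbTE.
move=> hs t0; move: (hs); rewrite path_sortedE// => /andP[ha sl].
case: i => [|i] /=; last first.
  rewrite IH//; case: ltP => // at_.
  rewrite add0n; have /eqP -> : ngt t l == 0%N.
    rewrite -leqn0 leqNgt -has_count; apply/hasPn => x xl; rewrite -leNgt.
    by move/allP : ha => /(_ _ xl) /le_trans; exact.
  by rewrite !ltn0.
case: ltP => //= at_; rewrite add0n; apply/esym/negbTE; rewrite -leqNgt leqn0.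
rewrite -leqn0 leqNgt -has_count; apply/hasPn => x xl; rewrite -leNgt.
by move/allP : ha => /(_ _ xl) /le_trans; exact.
Qed.

(** The infimum of thresholds and the sorted list are compared through counts: [decr_nth_gt] says
    that the i-th sorted entry exceeds t exactly when more than i entries do. A midpoint threshold
    excludes a gap between the two. *)
Lemma pos_ord_seq s i : (forall x, x \in s -> x <= 1) ->
  pos_ord (seqv s) (seqm s) i = nth 0 (decr_pos s) i.
Proof.
move=> s1.
have ss : sorted (fun x y => y <= x) (decr_pos s) by apply: sort_sorted; exact: geT.
have n0 : 0 <= nth 0 (decr_pos s) i.
  case: (ltnP i (size (decr_pos s))) => h; last by rewrite nth_default.
  by have := mem_nth 0 h; rewrite mem_sort mem_filter => /andP[/ltW].
apply/eqP; rewrite eq_le; apply/andP; split.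
  apply: pos_ord_le => //; apply/count_gt_le_seq => //.
  by rewrite leqNgt -count_decr_pos// -decr_nth_gt// ltxx.
case: (leP (nth 0 (decr_pos s) i) (pos_ord (seqv s) (seqm s) i)) => // h; exfalso.
have v1 k : seqv s k <= 1.
  rewrite /seqv; case: (ltnP k (size s)) => ks; last by rewrite nth_default.
  by apply: s1; rewrite mem_nth.
have m0 k : 0 <= seqm s k by rewrite /seqm.
have p0 := pos_ord_ge0 i v1 m0.
set p := pos_ord _ _ _ in h p0.
pose t := (p + nth 0 (decr_pos s) i) / 2.
have : t <= p.
  apply: pos_ord_ge => // t0 /(count_gt_le_seq _ _ t0).
  by rewrite leqNgt -count_decr_pos// -decr_nth_gt// /t; lra.
by rewrite /t; lra.
Qed.

Lemma pos_ord_sqr_sum s I : (forall x, x \in s -> x <= 1) ->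
  \sum_(0 <= i < I) pos_ord (seqv s) (seqm s) i ^+ 2 =
  \sum_(x <- take I (decr_pos s)) x ^+ 2.
Proof.
move=> s1; under eq_bigr do rewrite pos_ord_seq//.
elim: I (decr_pos s) => [|I IH] l; first by rewrite take0 big_nil big_nil.
rewrite big_nat_recl//; case: l => [|a l] /=.
  by rewrite big_nil big1 ?expr0n ?addr0// => i _; rewrite nth_nil expr0n.
by rewrite big_cons -IH.
Qed.

Lemma decr_pos_sum s (P : pred R) (F : R -> R) :
  \sum_(x <- decr_pos s | P x) F x = \sum_(x <- s | (0 < x) && P x) F x.
Proof.
rewrite -big_filter_cond; apply: perm_big; rewrite /decr_pos; exact/permPl/perm_sort.
Qed.

Lemma pos_ord_sqr_le s I : (forall x, x \in s -> x <= 1) ->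
  \sum_(0 <= i < I) pos_ord (seqv s) (seqm s) i ^+ 2 <= \sum_(x <- s | 0 < x) x ^+ 2.
Proof.
move=> s1; rewrite pos_ord_sqr_sum//.
have -> : \sum_(x <- s | 0 < x) x ^+ 2 = \sum_(x <- decr_pos s) x ^+ 2.
  by rewrite (decr_pos_sum s xpredT); apply: eq_bigl => x; rewrite andbT.
rewrite -[X in _ <= \sum_(i <- X) _](cat_take_drop I) big_cat/= lerDl.
by apply: sumr_ge0 => x _; exact: sqr_ge0.
Qed.

(** When at most I entries exceed t, all of them are among the first I ordered values. *)
Lemma pos_ord_sqr_ge s t I : (forall x, x \in s -> x <= 1) -> 0 <= t ->
  (ngt t s <= I)%N ->
  \sum_(x <- s | t < x) x ^+ 2 <= \sum_(0 <= i < I) pos_ord (seqv s) (seqm s) i ^+ 2.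
Proof.
move=> s1 t0 cI; rewrite pos_ord_sqr_sum//.
have -> : \sum_(x <- s | t < x) x ^+ 2 = \sum_(x <- decr_pos s | t < x) x ^+ 2.
  rewrite decr_pos_sum; apply: eq_bigl => x.
  by case: (ltP t x) => tx; rewrite ?andbF// andbT (le_lt_trans t0 tx).
rewrite -[X in \sum_(i <- X | _) _ <= _](cat_take_drop I) big_cat/=.
rewrite [X in _ + X]big1_seq ?addr0; last first.
  move=> x /andP[tx xd]; exfalso; move: tx; apply/negP; rewrite -leNgt.
  have [j jd <-] := nthP 0 xd; rewrite nth_drop leNgt decr_nth_gt//; last first.
    by apply: sort_sorted; exact: geT.
  by rewrite count_decr_pos// -leqNgt (leq_trans cI)// leq_addr.
by rewrite big_mkcond; apply: ler_sum => x _; case: ifP => // _; exact: sqr_ge0.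
Qed.

End PosOrd.

Import numFieldNormedType.Exports.

Section Close.
Context {R : realType}.
Implicit Types (u v : nat -> R).

(** Both sequences converge, and to the same limit, stated without naming the limit. This allows the
    partial sums of the limiting moments to be used before their series is known to converge. *)
Definition asymp u v := forall e : R, 0 < e ->
  \forall N \near \oo, \forall K \near \oo, `|u N - v K| <= e.

Lemma asympD u v u' v' : asymp u v -> asymp u' v' ->
  asymp (fun N => u N + u' N) (fun K => v K + v' K).
Proof.
move=> h h' e e0; have e2 : 0 < e / 2 by rewrite divr_gt0.
near=> N.
have a : \forall K \near \oo, `|u N - v K| <= e / 2 by near: N; exact: h.
have a' : \forall K \near \oo, `|u' N - v' K| <= e / 2 by near: N; exact: h'.
near=> K.
have -> : u N + u' N - (v K + v' K) = (u N - v K) + (u' N - v' K) by ring.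
apply: le_trans (ler_normD _ _) _; rewrite [e]splitr lerD//; near: K; [exact: a|exact: a'].
Unshelve. all: by end_near. Qed.

Lemma asympZ u v (a : R) : asymp u v -> asymp (fun N => a * u N) (fun K => a * v K).
Proof.
move=> h e e0; have e2 : 0 < e / (`|a| + 1) by rewrite divr_gt0// ltr_wpDl.
apply: filterS (h _ e2) => N; apply: filterS => K.
rewrite ler_pdivlMr ?ltr_wpDl// => hN.
rewrite -mulrBr normrM mulrC; apply: le_trans hN; rewrite ler_wpM2l//.
by rewrite lerDl.
Qed.

Lemma asymp0 : asymp (fun=> 0) (fun=> 0).
Proof. by move=> e e0; near=> N; near=> K; rewrite subrr normr0 ltW. Unshelve. all: by end_near. Qed.

Lemma asymp_approx u v : (forall e : R, 0 < e -> exists u' v', [/\ asymp u' v',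
  \forall N \near \oo, `|u N - u' N| <= e & \forall K \near \oo, `|v K - v' K| <= e]) -> asymp u v.
Proof.
move=> H e e0; have e3 : 0 < e / 3 by rewrite divr_gt0.
have [u' [v' [h hu hv]]] := H _ e3.
near=> N.
have a : \forall K \near \oo, `|u' N - v' K| <= e / 3 by near: N; exact: h.
have b : `|u N - u' N| <= e / 3 by near: N.
near=> K.
have c : `|v K - v' K| <= e / 3 by near: K.
have d : `|u' N - v' K| <= e / 3 by near: K.
have -> : u N - v K = (u N - u' N) + (u' N - v' K) - (v K - v' K) by ring.
apply: le_trans (ler_normB _ _) _; apply: le_trans (lerD (ler_normD _ _) (lexx _)) _.
lra.
Unshelve. all: by end_near. Qed.

Lemma asymp_le u v (a b : R) : asymp u v -> a < b ->
  (\forall K \near \oo, b <= v K) -> \forall N \near \oo, a <= u N.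
Proof.
move=> h ab hv; have e0 : 0 < b - a by rewrite subr_gt0.
near=> N.
have c : \forall K \near \oo, `|u N - v K| <= b - a by near: N; exact: h.
near \oo => K.
have d : `|u N - v K| <= b - a by near: K.
have f : b <= v K by near: K.
move: d; rewrite ler_norml => /andP[]; lra.
Unshelve. all: by end_near. Qed.

Lemma asymp_ge u v (a b : R) : asymp u v -> a < b ->
  (\forall K \near \oo, v K <= a) -> \forall N \near \oo, u N <= b.
Proof.
move=> h ab hv; have := @asymp_le (fun N => -1 * u N) (fun N => -1 * v N) (- b) (- a) (asympZ _ h).
rewrite ltrN2 => /(_ ab) H.
have {}H : \forall N \near \oo, -b <= -1 * u N.
  by apply: H; apply: filterS hv => K; rewrite mulN1r lerN2.
by apply: filterS H => K; rewrite mulN1r lerN2.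
Qed.

Lemma cvgn_sum (I : Type) (r : seq I) (F : I -> nat -> R) (l : I -> R) :
  (forall i, F i @ \oo --> l i) -> (fun N => \sum_(i <- r) F i N) @ \oo --> \sum_(i <- r) l i.
Proof.
move=> h; elim: r => [|i r IH].
  by rewrite big_nil (_ : (fun _ => _) = fun=> 0); [exact: cvg_cst|apply/funext => N; rewrite big_nil].
rewrite big_cons (_ : (fun N => _) = (fun N => F i N + \sum_(j <- r) F j N)).
  exact: cvgD.
by apply/funext => N; rewrite big_cons.
Qed.

End Close.

Section Ramp.
Context {R : realType}.
Variables (t t' : R).
Hypotheses (t0 : 0 < t) (tt' : t < t') (t1 : t' <= 1).

Definition ramp (x : R) : R := Num.max 0 (Num.min 1 ((x - t) / (t' - t))).

Lemma ramp01 x : 0 <= ramp x <= 1.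
Proof. by rewrite /ramp le_max lexx/= ge_max ler01/= ge_min lexx. Qed.

Lemma ramp_le x : x <= t -> ramp x = 0.
Proof.
move=> xt; rewrite /ramp max_l// ge_min; apply/orP; right.
by rewrite pmulr_lle0 ?invr_gt0 ?subr_gt0// subr_le0.
Qed.

Lemma ramp_ge x : t' <= x -> ramp x = 1.
Proof.
move=> xt; rewrite /ramp min_l ?max_r// ler_pdivlMr ?subr_gt0// mul1r; lra.
Qed.

Lemma ramp_lip (x y : R) : `|ramp x - ramp y| <= (t' - t)^-1 * `|x - y|.
Proof.
have c0 : 0 < (t' - t)^-1 by rewrite invr_gt0 subr_gt0.
rewrite -[X in _ <= X * _](gtr0_norm c0) -normrM mulrBr.
have -> : (t' - t)^-1 * x - (t' - t)^-1 * y = (x - t) / (t' - t) - (y - t) / (t' - t) by ring.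
rewrite /ramp; move: (_ / _) (_ / _) => a b.
have aux (c d : R) : `|Num.max 0 c - Num.max 0 d| <= `|c - d|.
  have h1 := ler_norm (c - d); have h2 := ler_norm (d - c); rewrite distrC in h2.
  by rewrite ler_norml; case: (leP 0 c) => h3; case: (leP 0 d) => h4; apply/andP; split; lra.
have aux' (c d : R) : `|Num.min 1 c - Num.min 1 d| <= `|c - d|.
  have h1 := ler_norm (c - d); have h2 := ler_norm (d - c); rewrite distrC in h2.
  by rewrite ler_norml; case: (leP 1 c) => h3; case: (leP 1 d) => h4; apply/andP; split; lra.
exact: le_trans (aux _ _) (aux' _ _).
Qed.

(** The ramp divided by x^2, with the denominator frozen below t, where the ramp vanishes anyway. It
    writes a smoothed counting function as x^2 times a Lipschitz function, the form to which moments
    of order at least 2 apply. *)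
Definition cramp (x : R) : R := ramp x / (Num.max x t) ^+ 2.

Lemma crampE x : x ^+ 2 * cramp x = ramp x.
Proof.
rewrite /cramp; case: (leP x t) => h; first by rewrite ramp_le// mul0r mulr0.
by rewrite mulrC divfK// expf_neq0// lt0r_neq0// (lt_trans t0).
Qed.

Lemma cramp_lip (x y : R) : -1 <= x <= 1 -> -1 <= y <= 1 ->
  `|cramp x - cramp y| <= ((t' - t)^-1 * t ^- 2 + 2 * t ^- 3) * `|x - y|.
Proof.
move=> hx hy; rewrite /cramp.
set a := Num.max x t; set b := Num.max y t.
have ta : t <= a by rewrite le_max lexx orbT.
have tb : t <= b by rewrite le_max lexx orbT.
have lt1 : t <= 1 := ltW (lt_le_trans tt' t1).
have a1 : a <= 1 by rewrite ge_max lt1 andbT; case/andP: hx.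
have b1 : b <= 1 by rewrite ge_max lt1 andbT; case/andP: hy.
have ab : `|a - b| <= `|x - y|.
  have h1 := ler_norm (x - y); have h2 := ler_norm (y - x); rewrite distrC in h2.
  by rewrite /a /b ler_norml; case: (leP x t) => h3; case: (leP y t) => h4; apply/andP; split; lra.
have a0 : 0 < a := lt_le_trans t0 ta.
have b0 : 0 < b := lt_le_trans t0 tb.
have -> : ramp x / a ^+ 2 - ramp y / b ^+ 2 =
   (ramp x - ramp y) * a ^- 2 + ramp y * (a ^- 2 - b ^- 2) by ring.
apply: le_trans (ler_normD _ _) _; rewrite [X in _ <= X]mulrDl; apply: lerD.
  rewrite normrM mulrAC; apply: ler_pM => //; first exact: ramp_lip.
  by rewrite gtr0_norm ?invr_gt0 ?exprn_gt0// lef_pV2 ?posrE ?exprn_gt0// lerXn2r// nnegrE ltW.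
rewrite normrM.
have /andP[r0 r1] := ramp01 y; rewrite (ger0_norm r0).
apply: (@le_trans _ _ (`|a ^- 2 - b ^- 2|)); first by rewrite ler_piMl.
have -> : a ^- 2 - b ^- 2 = (b - a) * ((a * b ^+ 2)^-1 + (a ^+ 2 * b)^-1).
  by field; rewrite !lt0r_neq0.
rewrite normrM distrC mulrC; apply: ler_pM => //.
have p0 : 0 < (a * b ^+ 2)^-1 by rewrite invr_gt0 mulr_gt0 ?exprn_gt0.
have q0 : 0 < (a ^+ 2 * b)^-1 by rewrite invr_gt0 mulr_gt0 ?exprn_gt0.
rewrite gtr0_norm ?addr_gt0//.
have -> : 2 * t ^- 3 = t ^- 3 + t ^- 3 by ring.
apply: lerD; rewrite lef_pV2 ?posrE ?mulr_gt0 ?exprn_gt0//.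
  by rewrite exprS; apply: ler_pM => //; [exact: ltW|exact/exprn_ge0/ltW|rewrite lerXn2r// nnegrE ltW].
by rewrite exprSr; apply: ler_pM => //; [exact/exprn_ge0/ltW|exact: ltW|rewrite lerXn2r// nnegrE ltW].
Qed.

End Ramp.

Section Moments.
Context {R : realType}.
Variables (s : nat -> seq R) (c d : nat -> R).
Local Notation ngt t := (count (fun x => (t < x)%R)).
Hypothesis s_le1 : forall N, \sum_(x <- s N) x ^+ 2 <= 1.
Hypothesis d_ge1 : forall k, 1 <= d k.
Hypothesis moments : forall p, asymp (fun N => \sum_(x <- s N) x ^+ p.+2)
                             (fun K => \sum_(0 <= k < K) d k * c k ^+ p.+2).

Let S2 K : R := \sum_(0 <= k < K) d k * c k ^+ 2.

Lemma d_ge0 k : 0 <= d k.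
Proof. exact: le_trans (d_ge1 k). Qed.

Lemma sum_dterm_mono (F : nat -> R) K K' : (forall k, 0 <= F k) -> (K <= K')%N ->
  \sum_(0 <= k < K) F k <= \sum_(0 <= k < K') F k.
Proof.
move=> F0 KK; rewrite (@big_cat_nat _ _ _ K 0 K')//= lerDl; exact: sumr_ge0.
Qed.

Lemma dc2_ge0 k : 0 <= d k * c k ^+ 2.
Proof. by rewrite mulr_ge0 ?d_ge0 ?sqr_ge0. Qed.

Lemma S2_le1 K : S2 K <= 1.
Proof.
rewrite leNgt; apply/negP => h.
have := @asymp_le _ _ _ ((1 + S2 K) / 2) (S2 K) (moments 0).
have -> : (1 + S2 K) / 2 < S2 K by lra.
case=> //; first by near=> K'; apply: sum_dterm_mono; [exact: dc2_ge0|near: K'; exact: nbhs_infty_ge].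
move=> N _ /(_ N (leqnn _)) /=; have := s_le1 N; lra.
Unshelve. all: by end_near. Qed.

Lemma c_sqr_le1 k : c k ^+ 2 <= 1.
Proof.
apply: le_trans (S2_le1 k.+1); rewrite /S2 big_nat_recr//=.
rewrite -[X in X <= _]add0r lerD//; first by apply: sumr_ge0 => i _; exact: dc2_ge0.
by rewrite ler_peMl ?sqr_ge0.
Qed.

Lemma sqr_le1_itv (x : R) : x ^+ 2 <= 1 -> -1 <= x <= 1.
Proof. by move=> h; rewrite -ler_norml -(@ler_pXn2r _ 2)// ?nnegrE// expr1n real_normK// num_real. Qed.

Lemma s_itv N x : x \in s N -> -1 <= x <= 1.
Proof.
move=> xs; apply: sqr_le1_itv; apply: le_trans (s_le1 N).
by rewrite (big_rem x)//= lerDl; apply: sumr_ge0 => y _; exact: sqr_ge0.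
Qed.

Lemma asymp_poly (q : {poly R}) :
  asymp (fun N => \sum_(x <- s N) x ^+ 2 * q.[x]) (fun K => \sum_(0 <= k < K) d k * (c k ^+ 2 * q.[c k])).
Proof.
have aux (m : nat) (F : nat -> R) : asymp (fun N => \sum_(x <- s N) x ^+ 2 * \sum_(i < m) F i * x ^+ i)
    (fun K => \sum_(0 <= k < K) d k * (c k ^+ 2 * \sum_(i < m) F i * c k ^+ i)).
  elim: m => [|m IH].
    rewrite (_ : (fun N => _) = fun=> 0); last first.
      by apply/funext => N; rewrite big1// => x _; rewrite big_ord0 mulr0.
    rewrite (_ : (fun N => _) = fun=> 0); last first.
      by apply/funext => N; rewrite big1// => x _; rewrite big_ord0 !mulr0.
    exact: asymp0.
  have := asympD IH (asympZ (F m) (moments m)).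
  congr asymp; apply/funext => N.
    by rewrite mulr_sumr -big_split/=; apply: eq_bigr => x _; rewrite big_ord_recr/= !exprS; ring.
  by rewrite mulr_sumr -big_split/=; apply: eq_bigr => x _; rewrite big_ord_recr/= !exprS; ring.
have := aux (size q) (fun i => q`_i); congr asymp; apply/funext => N; apply: eq_bigr => x _;
  by rewrite horner_coef.
Qed.

(** Replacing f by a polynomial within e on [-1, 1] changes either side by at most e, because the
    squares have total mass at most 1 on both sides. *)
Lemma asymp_lip (f : R -> R) (A : R) :
  (forall x y : R, -1 <= x <= 1 -> -1 <= y <= 1 -> `|f x - f y| <= A * `|x - y|) ->
  asymp (fun N => \sum_(x <- s N) x ^+ 2 * f x) (fun K => \sum_(0 <= k < K) d k * (c k ^+ 2 * f (c k))).
Proof.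
move=> fA; apply: asymp_approx => e e0.
have [q hq] := lipschitz_poly_approx fA e0.
exists (fun N => \sum_(x <- s N) x ^+ 2 * q.[x]), (fun K => \sum_(0 <= k < K) d k * (c k ^+ 2 * q.[c k])).
split; first exact: asymp_poly.
  near=> N; rewrite -sumrB; apply: le_trans (ler_norm_sum _ _ _) _.
  apply: (@le_trans _ _ (\sum_(x <- s N) x ^+ 2 * e)).
    rewrite big_seq_cond [leRHS]big_seq_cond; apply: ler_sum => x /andP[xs _].
    rewrite -mulrBr normrM ger0_norm ?sqr_ge0// ler_wpM2l ?sqr_ge0// distrC hq//; exact: s_itv xs.
  by rewrite -mulr_suml -[leRHS]mul1r ler_wpM2r// ltW.
near=> K; rewrite -sumrB; apply: le_trans (ler_norm_sum _ _ _) _.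
apply: (@le_trans _ _ (\sum_(0 <= k < K) (d k * c k ^+ 2) * e)).
  apply: ler_sum => k _.
  rewrite -mulrBr -mulrBr mulrA normrM (ger0_norm (dc2_ge0 k)).
  by rewrite ler_wpM2l ?dc2_ge0// distrC hq// sqr_le1_itv// c_sqr_le1.
by rewrite -mulr_suml -[leRHS]mul1r ler_wpM2r ?S2_le1// ltW.
Unshelve. all: by end_near. Qed.

Lemma asymp_ramp (t t' : R) : 0 < t -> t < t' -> t' <= 1 ->
  asymp (fun N => \sum_(x <- s N) ramp t t' x) (fun K => \sum_(0 <= k < K) d k * ramp t t' (c k)).
Proof.
move=> t0 tt' t1; have := asymp_lip (cramp_lip t0 tt' t1).
by congr asymp; apply/funext => N; apply: eq_bigr => x _; rewrite crampE.
Qed.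

Lemma ngt_ramp_le (l : seq R) (t t' : R) : 0 < t -> t < t' ->
  (ngt t' l)%:R <= \sum_(x <- l) ramp t t' x.
Proof.
move=> t0 tt'; rewrite -sum1_count natr_sum big_mkcond/=; apply: ler_sum => x _.
by case: ltP => h; [rewrite ramp_ge// ltW|case/andP: (ramp01 t t' x)].
Qed.

Lemma ngt_ramp_ge (l : seq R) (t t' : R) : 0 < t -> t < t' ->
  \sum_(x <- l) ramp t t' x <= (ngt t l)%:R.
Proof.
move=> t0 tt'; rewrite -sum1_count natr_sum [leRHS]big_mkcond/=; apply: ler_sum => x _.
by case: ltP => h; [case/andP: (ramp01 t t' x)|rewrite ramp_le].
Qed.

(** The series of d_k c_k^2 has bounded partial sums, so its terms tend to 0, and d_k >= 1 passes
    this on to c_k. *)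
Lemma c_eventually_le (t : R) : 0 < t -> exists K0, forall k, (K0 <= k)%N -> `|c k| <= t.
Proof.
move=> t0.
have cv : cvgn (series (fun k => d k * c k ^+ 2)).
  apply: nondecreasing_is_cvgn.
    by move=> a b ab; rewrite /series/=; apply: sum_dterm_mono => // k; exact: dc2_ge0.
  by exists 1 => _ [K _ <-]; exact: S2_le1.
have /cvgrPdist_le /(_ (t ^+ 2)) := cvg_series_cvg_0 cv.
case=> [|K0 _ h]; first by rewrite exprn_gt0.
exists K0 => k /h /=; rewrite sub0r normrN ger0_norm ?dc2_ge0// => hk.
rewrite -(@ler_pXn2r _ 2)// ?nnegrE// ?(ltW t0)//.
rewrite real_normK ?num_real//; apply: le_trans hk.
by rewrite ler_peMl ?sqr_ge0.
Qed.

Lemma c_le1 k : c k <= 1.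
Proof. by have /andP[] := sqr_le1_itv (c_sqr_le1 k). Qed.

Lemma s_le1' N x : x \in s N -> x <= 1.
Proof. by move=> /s_itv /andP[]. Qed.

Lemma seqv_le1 N k : seqv (s N) k <= 1.
Proof.
rewrite /seqv; case: (ltnP k (size (s N))) => ks; last by rewrite nth_default.
by apply: (@s_le1' N); rewrite mem_nth.
Qed.

(** For t between the limiting value and tau, at most i limiting eigenvalues exceed t. The ramp from
    t to tau turns this into a bound on the number of entries of [s N] above tau. *)
Lemma pos_ord_upper i (tau : R) : 0 < tau -> tau <= 1 -> pos_ord c d i < tau ->
  \forall N \near \oo, pos_ord (seqv (s N)) (seqm (s N)) i <= tau.
Proof.
move=> tau0 tau1 hb.
have b0 : 0 <= pos_ord c d i by apply: pos_ord_ge0; [exact: c_le1|exact: d_ge0].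
pose t := (pos_ord c d i + tau) / 2.
have t0 : 0 < t by rewrite /t; lra.
have tt : t < tau by rewrite /t; lra.
have bt : pos_ord c d i < t by rewrite /t; lra.
have [l [ul hl hs]] : count_gt_le c d t i.
  apply: contrapT => hn; have : t <= pos_ord c d i.
    by apply: pos_ord_ge => //; [exact: c_le1|exact: d_ge0].
  lra.
(* The slack 1/2 is harmless: the count bounded by this sum is an integer. *)
have : \forall N \near \oo, \sum_(x <- s N) ramp t tau x <= i%:R + 2^-1.
  apply: (asymp_ge (asymp_ramp t0 tt tau1)) (_ : i%:R < i%:R + 2^-1) _; first by rewrite ltrDl.
  near=> K; apply: le_trans hs.
  apply: (@le_trans _ _ (\sum_(0 <= k < K | t < c k) d k)).
    rewrite [leRHS]big_mkcond; apply: ler_sum => k _.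
    have /andP[r0 r1] := ramp01 t tau (c k).
    case: ltP => h; last by rewrite ramp_le// mulr0.
    by rewrite ler_piMr ?d_ge0.
  rewrite -[leLHS]big_filter -[leRHS]big_filter.
  have sub : {subset [seq k <- index_iota 0 K | t < c k] <= [seq k <- l | t < c k]}.
    move=> k; rewrite !mem_filter => /andP[tk _]; rewrite tk hl//.
    exact: lt_le_trans (d_ge1 _).
  have : perm_eq [seq k <- l | t < c k] ([seq k <- index_iota 0 K | t < c k] ++
      [seq k <- [seq k <- l | t < c k] | k \notin [seq k <- index_iota 0 K | t < c k]]).
    rewrite -(perm_filterC [in [seq k <- index_iota 0 K | t < c k]]) perm_cat2r.
    apply: uniq_perm; rewrite ?filter_uniq ?iota_uniq//.
    move=> k; rewrite mem_filter; case: (boolP (k \in [seq k <- index_iota 0 K | t < c k])) => // hk.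
    by rewrite /= sub// -topredE/= hk.
  move=> /(perm_big _) ->; rewrite big_cat/= lerDl.
  by apply: sumr_ge0 => k _; exact: d_ge0.
apply: filterS => N hN; apply: pos_ord_le; first exact: ltW.
apply/count_gt_le_seq; first exact: ltW.
rewrite -ltnS -(ltr_nat R); apply: le_lt_trans (ngt_ramp_le _ t0 tt) _.
by apply: (le_lt_trans hN); rewrite -[X in _ < X]natr1; lra.
Unshelve. all: by end_near. Qed.

(** Dual to [pos_ord_upper]: only finitely many limiting eigenvalues exceed t', their total
    multiplicity v is larger than i, and the ramp from t to t' transfers this to [s N]. *)
Lemma pos_ord_lower i (tau : R) : 0 <= tau -> tau < pos_ord c d i ->
  \forall N \near \oo, tau <= pos_ord (seqv (s N)) (seqm (s N)) i.
Proof.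
move=> tau0 hb.
have b1 : pos_ord c d i <= 1 by apply: pos_ord_le => //; exact: count_gt_le_bound c_le1.
(* Two points with tau <= t < t' < [pos_ord c d i]; the weights keep t positive even when tau = 0,
   as the ramp estimates require. *)
pose t := tau / 3 + 2 * pos_ord c d i / 3; pose t' := tau / 6 + 5 * pos_ord c d i / 6.
have t0 : 0 < t by rewrite /t; lra.
have tt : t < t' by rewrite /t /t'; lra.
have bt : t' < pos_ord c d i by rewrite /t'; lra.
have taut : tau <= t by rewrite /t; lra.
have t'0 : 0 < t' by lra.
have t'1 : t' <= 1 by lra.
have hn : ~ count_gt_le c d t' i.
  by move=> /(pos_ord_le (ltW t'0)); rewrite leNgt bt.
have [K0 hK0] := c_eventually_le t'0.
set v := \sum_(k <- iota 0 K0 | t' < c k) d k.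
have vi : i%:R < v.
  rewrite ltNge; apply/negP => h; apply: hn; exists (iota 0 K0); split => //; first exact: iota_uniq.
  move=> k _ tk; rewrite mem_iota/= add0n ltnNge; apply/negP => /hK0; rewrite leNgt.
  by rewrite (lt_le_trans tk)// ler_norm.
have : \forall N \near \oo, (i%:R + v) / 2 <= \sum_(x <- s N) ramp t t' x.
  apply: (asymp_le (asymp_ramp t0 tt t'1)) (_ : (i%:R + v) / 2 < v) _; first lra.
  near=> K.
  apply: (@le_trans _ _ (\sum_(0 <= k < K0) d k * ramp t t' (c k))).
    rewrite /v /index_iota subn0 big_mkcond; apply: ler_sum => k _.
    have /andP[r0 r1] := ramp01 t t' (c k).
    by case: ltP => h; [rewrite ramp_ge ?mulr1// ltW|rewrite mulr_ge0// d_ge0].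
  apply: sum_dterm_mono; last by near: K; exact: nbhs_infty_ge.
  by move=> k; rewrite mulr_ge0 ?d_ge0//; case/andP: (ramp01 t t' (c k)).
apply: filterS => N hN; apply: (le_trans taut); apply: pos_ord_ge; first exact: seqv_le1.
  by move=> k; rewrite /seqm.
move=> _ /(count_gt_le_seq _ _ (ltW t0)); rewrite -(ler_nat R) => h.
have := ngt_ramp_ge (s N) t0 tt; lra.
Unshelve. all: by end_near. Qed.

Lemma pos_ord_cvg i : (fun N => pos_ord (seqv (s N)) (seqm (s N)) i) @ \oo --> pos_ord c d i.
Proof.
have b0 : 0 <= pos_ord c d i by apply: pos_ord_ge0; [exact: c_le1|exact: d_ge0].
have b1 : pos_ord c d i <= 1 by apply: pos_ord_le => //; exact: count_gt_le_bound c_le1.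
have a1 N : pos_ord (seqv (s N)) (seqm (s N)) i <= 1.
  by apply: pos_ord_le => //; apply: count_gt_le_bound; exact: seqv_le1.
have a0 N : 0 <= pos_ord (seqv (s N)) (seqm (s N)) i.
  by apply: pos_ord_ge0; [exact: seqv_le1|by move=> k; rewrite /seqm].
apply/cvgrPdist_le => e e0.
have hl : \forall N \near \oo, pos_ord c d i - e <= pos_ord (seqv (s N)) (seqm (s N)) i.
  case: (leP 0 (pos_ord c d i - e)) => h; first by apply: pos_ord_lower => //; lra.
  by near=> N; rewrite (le_trans (ltW h)).
have hu : \forall N \near \oo, pos_ord (seqv (s N)) (seqm (s N)) i <= pos_ord c d i + e.
  case: (leP (pos_ord c d i + e) 1) => h; first by apply: pos_ord_upper => //; lra.
  by near=> N; rewrite (le_trans (a1 N))// ltW.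
near=> N; have h1 : pos_ord c d i - e <= pos_ord (seqv (s N)) (seqm (s N)) i by near: N.
have h2 : pos_ord (seqv (s N)) (seqm (s N)) i <= pos_ord c d i + e by near: N.
rewrite ler_norml; apply/andP; split; lra.
Unshelve. all: by end_near. Qed.

End Moments.

(** * From single ordered eigenvalues to the l^2 distance *)

Section MomentsDelta2.
Context {R : realType}.
Variables (s : nat -> seq R) (c d : nat -> R).
Local Notation ngt t := (count (fun x => (t < x)%R)).
Hypothesis s_le1 : forall N, \sum_(x <- s N) x ^+ 2 <= 1.
Hypothesis d_ge1 : forall k, 1 <= d k.
Hypothesis moments : forall p, asymp (fun N => \sum_(x <- s N) x ^+ p.+2)
                             (fun K => \sum_(0 <= k < K) d k * c k ^+ p.+2).

(** The negative part of a spectrum is treated as the positive part of its opposite, so every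
    estimate is applied twice. *)
Let s' N := [seq - x | x <- s N].
Let c' k := - c k.

Lemma opp_s_le1 N : \sum_(x <- s' N) x ^+ 2 <= 1.
Proof. by rewrite big_map; under eq_bigr do rewrite sqrrN. Qed.

Lemma opp_moments p : asymp (fun N => \sum_(x <- s' N) x ^+ p.+2)
                            (fun K => \sum_(0 <= k < K) d k * c' k ^+ p.+2).
Proof.
have := asympZ ((-1) ^+ p) (moments p); congr asymp; apply/funext => N.
  by rewrite big_map mulr_sumr; apply: eq_bigr => x _; rewrite [in RHS]exprNn !exprS; ring.
by rewrite mulr_sumr; apply: eq_bigr => x _; rewrite /c' [in RHS]exprNn !exprS; ring.
Qed.

Let a N i := pos_ord (seqv (s N)) (seqm (s N)) i.
Let a' N i := pos_ord (seqv (s' N)) (seqm (s' N)) i.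
Let b i := pos_ord c d i.
Let b' i := pos_ord c' d i.

Let SA N I : R := \sum_(0 <= i < I) (a N i ^+ 2 + a' N i ^+ 2).
Let SB I : R := \sum_(0 <= i < I) (b i ^+ 2 + b' i ^+ 2).
Let S2 K : R := \sum_(0 <= k < K) d k * c k ^+ 2.
Let SL N : R := \sum_(x <- s N) x ^+ 2.

Lemma SA_le N I : SA N I <= SL N.
Proof.
rewrite /SA big_split/=.
have s1 x : x \in s N -> x <= 1 by exact: s_le1'.
have s1' x : x \in s' N -> x <= 1 by apply: s_le1'; exact: opp_s_le1.
apply: le_trans (lerD (pos_ord_sqr_le _ s1) (pos_ord_sqr_le _ s1')) _.
rewrite /s' big_map /SL big_mkcond [X in _ + X]big_mkcond -big_split/=.
apply: ler_sum => x _; rewrite oppr_gt0 sqrrN.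
by case: (ltgtP 0 x); rewrite ?addr0 ?add0r ?sqr_ge0.
Qed.

Lemma SA_cvg I : SA ^~ I @ \oo --> SB I.
Proof.
apply: cvgn_sum => i; apply: cvgD.
  by rewrite /a /b !expr2; apply: cvgM; exact: pos_ord_cvg.
by rewrite /a' /b' !expr2; apply: cvgM; apply: pos_ord_cvg => //;
   [exact: opp_s_le1|exact: opp_moments|exact: opp_s_le1|exact: opp_moments].
Qed.

(** The first I ordered squares never exceed the full second moment of [s N]; letting N grow gives
    the same for the limiting values, up to e. *)
Lemma SB_le_S2 (e : R) : 0 < e -> \forall K \near \oo, forall I, SB I <= S2 K + e.
Proof.
move=> e0; have e2 : 0 < e / 2 by rewrite divr_gt0.
have hm : \forall K \near \oo, forall K', S2 K' <= S2 K + e / 2.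
  have hub : has_sup (range S2).
    by split; [exists (S2 0), 0%N|exists 1 => _ [k _ <-]; exact: S2_le1].
  have [_ [K0 _ <-] hK0] := sup_adherent e2 hub.
  near=> K1 => K'.
  have : S2 K' <= sup (range S2) by apply: ub_le_sup; [case: hub|exists K'].
  have : S2 K0 <= S2 K1.
    by apply: sum_dterm_mono; [exact: dc2_ge0|near: K1; exact: nbhs_infty_ge].
  lra.
near=> K => I.
suff : limn (SA ^~ I) <= S2 K + e by rewrite (cvg_lim _ (@SA_cvg I)).
apply: limr_le; first by apply: cvgP; exact: (@SA_cvg).
have H := moments 0 e2.
near=> N; apply: le_trans (SA_le N I) _.
have hN : \forall K' \near \oo, `|SL N - S2 K'| <= e / 2 by near: N; exact: H.
have [K' [hK' hSK]] : exists K', `|SL N - S2 K'| <= e / 2 /\ S2 K' <= S2 K + e / 2; last first.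
  by move: hK'; rewrite ler_norml => /andP[]; lra.
near \oo => K'; exists K'; split; first by near: K'.
by have : forall K', S2 K' <= S2 K + e / 2 by near: K; exact: hm.
Unshelve. all: by end_near. Qed.

Lemma lower_gap (K : nat) : exists2 t : R, 0 < t <= 1 & forall k, (k < K)%N -> c k != 0 -> t <= `|c k|.
Proof.
elim: K => [|K [t /andP[t0 t1] ht]]; first by exists 1; rewrite ?ltr01 ?lexx.
have [cK|cK] := eqVneq (c K) 0.
  exists t; first by rewrite t0.
  by move=> k; rewrite ltnS leq_eqVlt => /orP[/eqP -> /eqP//|/ht].
exists (Num.min t `|c K|); first by rewrite lt_min t0 normr_gt0 cK/= ge_min t1.
move=> k; rewrite ltnS leq_eqVlt => /orP[/eqP -> _|/ht h /h hk].
  by rewrite ge_min lexx orbT.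
by rewrite ge_min hk.
Qed.

(** No second moment is lost in the ordering. All but e / 2 of it comes from finitely many c_k,
    whose nonzero values stay at distance t' from 0, and a bounded number of ordered values accounts
    for everything of modulus above t = t' / 2. *)
Lemma S2_le_SB (e : R) : 0 < e -> exists I, forall K, S2 K <= SB I + e.
Proof.
move=> e0; have e2 : 0 < e / 2 by rewrite divr_gt0.
have hub : has_sup (range S2).
  by split; [exists (S2 0), 0%N|exists 1 => _ [k _ <-]; exact: S2_le1].
have [_ [K1 _ <-] hK1] := sup_adherent e2 hub.
have [t' /andP[t'0 t'1] ht'] := lower_gap K1.
pose t := t' / 2.
have t0 : 0 < t by rewrite divr_gt0.
have tt : t < t' by rewrite /t; lra.
(* The squares sum to at most 1, so at most t^-2 entries can exceed t. *)
pose I := (Num.truncn (t ^- 2)).+1.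
exists I => K.
have hK : S2 K <= S2 K1 + e / 2.
  have : S2 K <= sup (range S2) by apply: ub_le_sup; [case: hub|exists K].
  lra.
suff : S2 K1 - e / 2 <= SB I by lra.
suff : S2 K1 - e / 2 <= limn (SA ^~ I) by rewrite (cvg_lim _ (@SA_cvg I)).
apply: limr_ge; first by apply: cvgP; exact: (@SA_cvg).
pose rho (x : R) := ramp t t' x + ramp t t' (- x).
have rho_lip (x y : R) : -1 <= x <= 1 -> -1 <= y <= 1 ->
    `|rho x - rho y| <= 2 * (t' - t)^-1 * `|x - y|.
  move=> _ _; rewrite /rho.
  have -> : ramp t t' x + ramp t t' (- x) - (ramp t t' y + ramp t t' (- y)) =
    (ramp t t' x - ramp t t' y) + (ramp t t' (- x) - ramp t t' (- y)) by ring.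
  apply: le_trans (ler_normD _ _) _.
  have := ramp_lip tt x y; have := ramp_lip tt (- x) (- y).
  by rewrite -opprD normrN -mulrA; lra.
have rho0 x : 0 <= rho x.
  by rewrite addr_ge0//; [case/andP: (ramp01 t t' x)|case/andP: (ramp01 t t' (- x))].
have rhoc := asymp_lip s_le1 d_ge1 moments rho_lip.
have : \forall N \near \oo, S2 K1 - e / 2 <= \sum_(x <- s N) x ^+ 2 * rho x.
  apply: (asymp_le rhoc) (_ : _ < S2 K1) _; first lra.
  near=> K'.
  apply: (@le_trans _ _ (\sum_(0 <= k < K1) d k * (c k ^+ 2 * rho (c k)))).
    rewrite /S2 big_nat_cond [leRHS]big_nat_cond; apply: ler_sum => k; rewrite andbT => /andP[_ kK].
    have dk := le_trans ler01 (d_ge1 k).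
    rewrite ler_wpM2l//; have [->|ck] := eqVneq (c k) 0; first by rewrite expr0n/= mul0r.
    rewrite ler_peMr ?sqr_ge0//; have := ht' _ kK ck.
    case: (ltP 0 (c k)) => h; [rewrite gtr0_norm// => hc|rewrite ler0_norm// => hc]; rewrite /rho.
      by rewrite (ramp_ge tt hc) lerDl; case/andP: (ramp01 t t' (- c k)).
    by rewrite (ramp_ge tt hc) lerDr; case/andP: (ramp01 t t' (c k)).
  apply: sum_dterm_mono; last by near: K'; exact: nbhs_infty_ge.
  by move=> k; apply: mulr_ge0; [exact: le_trans (d_ge1 k)|exact: mulr_ge0 (sqr_ge0 _) (rho0 _)].
apply: filterS => N hN; apply: (le_trans hN).
have s1 x : x \in s N -> x <= 1 by exact: s_le1'.
have s1' x : x \in s' N -> x <= 1 by apply: s_le1'; exact: opp_s_le1.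
have cnt (l : seq R) : \sum_(x <- l) x ^+ 2 <= 1 -> (ngt t l <= I)%N.
  move=> hl; rewrite -(ler_nat R); apply: (@le_trans _ _ (t ^- 2)); last by rewrite ltW// truncnS_gt.
  rewrite -[leRHS]mul1r ler_pdivlMr ?exprn_gt0//; apply: le_trans hl.
  rewrite -sum1_count natr_sum mulr_suml big_mkcond/=; apply: ler_sum => x _.
  by case: ltP => h; [rewrite mul1r; nra|exact: sqr_ge0].
rewrite /SA big_split/=.
apply: le_trans (lerD (pos_ord_sqr_ge s1 (ltW t0) (cnt _ (s_le1 N)))
                     (pos_ord_sqr_ge s1' (ltW t0) (cnt _ (opp_s_le1 N)))).
rewrite /s' big_map [X in X + _]big_mkcond [X in _ + X]big_mkcond -big_split/=.
apply: ler_sum => x _; rewrite /rho mulrDr; apply: lerD.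
  case: ltP => h; last by rewrite ramp_le// mulr0.
  by rewrite ler_piMr ?sqr_ge0//; case/andP: (ramp01 t t' x).
rewrite sqrrN; case: ltP => h; last by rewrite ramp_le// mulr0.
by rewrite ler_piMr ?sqr_ge0//; case/andP: (ramp01 t t' (- x)).
Unshelve. all: by end_near. Qed.

Let SD N J : R := \sum_(0 <= i < J) ((a N i - b i) ^+ 2 + (a' N i - b' i) ^+ 2).

(** The first I terms are small by convergence of each ordered value. In the tail (a - b)^2 <= 2 a^2
    + 2 b^2, and both tails are small because the partial sums up to I already nearly exhaust the
    second moment. *)
Lemma SD_small (e : R) : 0 < e -> \forall N \near \oo, forall J, SD N J <= e.
Proof.
(* The budget: h for the first I terms, tails of at most 3 h for [SA] and 2 h for [SB], each
   doubled. *)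
move=> e0; pose h := e / 11; have h0 : 0 < h by rewrite divr_gt0.
have [I hI] := S2_le_SB h0.
have hSD : SD ^~ I @ \oo --> (0 : R).
  have -> : 0 = \sum_(0 <= i < I) (0 : R) by rewrite big1.
  apply: cvgn_sum => i.
  have ca : (fun N => a N i - b i) @ \oo --> (0 : R).
    by rewrite -(subrr (b i)); apply: cvgB; [exact: pos_ord_cvg|exact: cvg_cst].
  have ca' : (fun N => a' N i - b' i) @ \oo --> (0 : R).
    rewrite -(subrr (b' i)); apply: cvgB; last exact: cvg_cst.
    by apply: pos_ord_cvg => //; [exact: opp_s_le1|exact: opp_moments].
  rewrite -(addr0 0) -[X in X + _](mulr0 0) -[X in _ + X](mulr0 0); apply: cvgD.
    by under eq_fun do rewrite expr2; exact: cvgM.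
  by under eq_fun do rewrite expr2; exact: cvgM.
have hSA := @SA_cvg I.
have hSB := SB_le_S2 h0.
have hm := moments 0 h0.
move/cvgrPdist_le : hSA => /(_ _ h0) hSA.
move/cvgrPdist_le : hSD => /(_ _ h0) hSD.
near=> N => J.
have h1 : `|SB I - SA N I| <= h by near: N; exact: hSA.
have h2 : `|0 - SD N I| <= h by near: N; exact: hSD.
have hN : \forall K \near \oo, `|SL N - S2 K| <= h by near: N; exact: hm.
have [K [hK1 hK2]] : exists K, `|SL N - S2 K| <= h /\ forall I, SB I <= S2 K + h.
  near \oo => K; exists K; split; first by near: K; exact: hN.
  by near: K; exact: hSB.
have mono J' : (J <= J')%N -> SD N J <= SD N J'.
  by apply: sum_dterm_mono => k; rewrite addr_ge0 ?sqr_ge0.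
apply: (le_trans (mono (I + J)%N (leq_addl _ _))).
have split_sum (F : nat -> R) : \sum_(0 <= i < I + J) F i =
    \sum_(0 <= i < I) F i + \sum_(I <= i < I + J) F i.
  by rewrite (@big_cat_nat _ _ _ I)// leq_addr.
have e1 := SA_le N (I + J)%N.
have e2 := hK2 (I + J)%N.
have e3 := hI K.
have tail : \sum_(I <= i < I + J) ((a N i - b i) ^+ 2 + (a' N i - b' i) ^+ 2) <=
   2 * \sum_(I <= i < I + J) (a N i ^+ 2 + a' N i ^+ 2) + 2 * \sum_(I <= i < I + J) (b i ^+ 2 + b' i ^+ 2).
  rewrite !mulr_sumr -big_split/=; apply: ler_sum => i _.
  have := sqr_ge0 (a N i + b i); have := sqr_ge0 (a' N i + b' i); rewrite !expr2; nra.
move: e1 e2; rewrite /SD /SA {1}/SB !split_sum.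
rewrite -/(SA N I) -/(SB I) -/(SD N I).
move: h1 h2 hK1; rewrite sub0r normrN !ler_norml => /andP[? ?] /andP[? ?] /andP[? ?] ? ?.
have -> : e = 11 * h by rewrite /h; field.
lra.
Unshelve. all: by end_near. Qed.

Lemma moments_delta2 :
  (fun N => delta2_sq (seqv (s N)) (seqm (s N)) c d) @ \oo --> 0%E.
Proof.
have a'E N i : pos_ord (fun k => - seqv (s N) k) (seqm (s N)) i = a' N i.
  rewrite /a' /seqm size_map; congr (pos_ord _ _ _); apply/funext => k.
  rewrite /seqv /s'; case: (ltnP k (size (s N))) => ks; first by rewrite (nth_map 0).
  by rewrite !nth_default ?size_map// oppr0.
have DE N : delta2_sq (seqv (s N)) (seqm (s N)) c d =
   (\sum_(i <oo) ((a N i - b i) ^+ 2)%:E + \sum_(i <oo) ((a' N i - b' i) ^+ 2)%:E)%E.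
  rewrite /delta2_sq; congr (_ + _)%E; apply: eq_eseriesr => i _.
  by rewrite /neg_ord a'E; congr (_%:E); rewrite /b' /c'; ring.
have D0 N : (0 <= delta2_sq (seqv (s N)) (seqm (s N)) c d)%E.
  by rewrite DE adde_ge0//; apply: nneseries_ge0 => i _ _; rewrite lee_fin sqr_ge0.
have Dle e : 0 < e -> \forall N \near \oo, (delta2_sq (seqv (s N)) (seqm (s N)) c d <= e%:E)%E.
  move=> e0; have e2 : 0 < e / 2 by rewrite divr_gt0.
  apply: filterS (SD_small e2) => N hN; rewrite DE [e]splitr EFinD.
  apply: leeD; apply: lime_le; do ?[by apply: is_cvg_nneseries => i _ _; rewrite lee_fin sqr_ge0];
    apply: nearW => J; rewrite sumEFin lee_fin; apply: le_trans (hN J); apply: ler_sum => i _.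
    by rewrite lerDl sqr_ge0.
  by rewrite lerDr sqr_ge0.
apply/fine_cvgP; split.
  apply: filterS (Dle 1 ltr01) => N hN.
  by rewrite ge0_fin_numE//; apply: le_lt_trans hN _; rewrite ltry.
apply/cvgrPdist_le => e e0; apply: filterS (Dle e e0) => N hN.
rewrite sub0r normrN /= ger0_norm ?fine_ge0// -lee_fin fineK//.
by rewrite ge0_fin_numE//; apply: le_lt_trans hN _; rewrite ltry.
Qed.

End MomentsDelta2.

(** * Traces of powers *)

Section TracePowers.
Context {F : fieldType}.

Lemma char_poly_conj n (P A : 'M[F]_n) : P \in unitmx ->
  char_poly (P *m A *m invmx P) = char_poly A.
Proof.
move=> uP; rewrite /char_poly /char_poly_mx !map_mxM map_invmx.
set Q := map_mx _ P; have uQ : Q \in unitmx by rewrite map_unitmx.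
have -> : 'X%:M - Q *m map_mx (@polyC F) A *m invmx Q =
   Q *m ('X%:M - map_mx (@polyC F) A) *m invmx Q.
  by rewrite mulmxBr mulmxBl scalar_mxC mulmxK.
by rewrite !det_mulmx mulrAC -det_mulmx mulmxV// det1 mul1r.
Qed.

Lemma conj_expr n (P A : 'M[F]_n) p : P \in unitmx ->
  (P *m A *m invmx P) ^+ p = P *m (A ^+ p) *m invmx P.
Proof.
move=> uP; elim: p => [|p IH]; first by rewrite !expr0 mulmx1 mulmxV.
by rewrite !exprS IH -!mulmxE !mulmxA mulmxKV.
Qed.

Lemma lblock_expr n (x : 'M[F]_1) (c : 'M[F]_(n, 1)) (D : 'M[F]_n) p :
  exists c', (block_mx x 0 c D : 'M[F]_(1 + n)) ^+ p = block_mx (x ^+ p) 0 c' (D ^+ p).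
Proof.
elim: p => [|p [c' IH]].
  by exists 0; rewrite !expr0 -(scalar_mx_block 1).
exists (c *m x ^+ p + D *m c').
by rewrite !exprS IH -!mulmxE mulmx_block !mul0mx !mulmx0 !addr0 add0r.
Qed.

Lemma char_poly_lblock n (x : 'M[F]_1) (c : 'M[F]_(n, 1)) (D : 'M[F]_n) :
  char_poly (block_mx x 0 c D : 'M[F]_(1 + n)) = ('X - (x 0 0)%:P) * char_poly D.
Proof.
rewrite /char_poly /char_poly_mx map_block_mx map_mx0 scalar_mx_block opp_block_mx add_block_mx.
rewrite subrr det_lblock; congr (_ * _).
by rewrite det_mx11 !mxE eqxx mulr1n.
Qed.

Lemma pid_mx_mulr n (P : 'M[F]_(1 + n)) : (pid_mx 1 : 'M[F]_(1, 1 + n)) *m P = usubmx P.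
Proof.
rewrite -[P in LHS]vsubmxK.
rewrite (_ : pid_mx 1 = row_mx 1%:M 0 :> 'M[F]_(1, 1 + n)); last first.
  by apply/rowP => j; rewrite !mxE; case: splitP => k ->; rewrite ?(ord1 k) mxE ?eqxx.
by rewrite mul_row_col mul1mx mul0mx addr0.
Qed.

(** Complete the row eigenvector to a basis; in it the first row of A is x followed by zeros. *)
Lemma eigenvector_block n (A : 'M[F]_(1 + n)) (v : 'rV_(1 + n)) (x : F) :
  v *m A = x *: v -> v != 0 ->
  exists P c D, P \in unitmx /\ P *m A *m invmx P = block_mx x%:M 0 c D.
Proof.
move=> vA v0.
pose P := row_ebase v.
have uP : P \in unitmx by exact: row_ebase_unit.
pose u := usubmx P.
have [a a0 uE] : exists2 a, a != 0 & v = a *: u.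
  have rv : \rank v = 1%N by rewrite rank_rV v0.
  exists (col_ebase v 0 0).
    by have := col_ebase_unit v; rewrite unitmxE det_mx11 unitfE.
  rewrite -[LHS]mulmx_ebase rv [col_ebase v]mx11_scalar mul_scalar_mx -scalemxAl mxE eqxx mulr1n.
  by rewrite pid_mx_mulr.
have uA : u *m A = x *: u.
  by apply: (scalerI a0); rewrite scalemxAl -uE vA uE !scalerA mulrC.
pose B := P *m A *m invmx P.
have uB : usubmx B = row_mx x%:M 0.
  rewrite /B -!mul_usub_mx -/u uA -scalemxAl.
  have -> : u *m invmx P = row_mx 1%:M 0.
    by rewrite /u mul_usub_mx mulmxV// (scalar_mx_block 1) /block_mx col_mxKu.
  by rewrite scale_row_mx scaler0 scale_scalar_mx mulr1.
exists P, (dlsubmx B), (drsubmx B); split => //.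
by rewrite -/B -[LHS]vsubmxK uB -[dsubmx _]hsubmxK.
Qed.

(** [is_spectrum] gives only a factorisation of the characteristic polynomial. Splitting off one
    eigenvector at a time triangularises by blocks, which works over any field and for any matrix
    whose characteristic polynomial splits. *)
Lemma mxtrace_expr_roots n (A : 'M[F]_n) (s : seq F) :
  char_poly A = \prod_(x <- s) ('X - x%:P) -> forall p, \tr (A ^+ p) = \sum_(x <- s) x ^+ p.
Proof.
elim: n A s => [|n IH] A s hs p.
  have : size (char_poly A) = 1%N by rewrite size_char_poly.
  rewrite hs size_prod_XsubC => -[/size0nil ->].
  by rewrite big_nil /mxtrace big_ord0.
have : size (char_poly A) = n.+2 by rewrite size_char_poly.
case: s hs => [|x s] hs; first by rewrite hs big_nil size_poly1.
move=> _.
have : eigenvalue A x.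
  by rewrite eigenvalue_root_char hs big_cons rootM root_XsubC eqxx.
move=> /eigenvalueP [v vA v0].
have [P [c [D [uP BE]]]] := @eigenvector_block n A v x vA v0.
have cD : char_poly D = \prod_(y <- s) ('X - y%:P).
  apply: (@mulfI _ ('X - x%:P)); first by rewrite polyXsubC_eq0.
  have := @char_poly_conj (1 + n) P A uP; rewrite BE char_poly_lblock mxE eqxx mulr1n => E.
  by apply: (etrans E); apply: (etrans hs); rewrite big_cons.
have -> : \tr (A ^+ p) = \tr ((P *m A *m invmx P) ^+ p).
  by rewrite conj_expr// mxtrace_mulC mulmxA mulVmx// mul1mx.
have [c' E] := lblock_expr x%:M c D p.
rewrite BE E mxtrace_block (IH _ _ cD) big_cons; congr (_ + _).
rewrite /mxtrace big_ord1; elim: p {E} => [|p IHp]; first by rewrite !expr0 mxE.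
by rewrite !exprS -IHp -mulmxE mul_scalar_mx mxE.
Qed.

End TracePowers.

(** * Hilbert-Schmidt estimates for traces of powers *)

Section HilbertSchmidt.
Context {R : realType}.

(** Lagrange's identity: the defect is half of the sum of the squares (a_i b_j - a_j b_i)^2. *)
Lemma cauchy_schwarz (I : Type) (r : seq I) (a b : I -> R) :
  (\sum_(i <- r) a i * b i) ^+ 2 <= (\sum_(i <- r) a i ^+ 2) * (\sum_(i <- r) b i ^+ 2).
Proof.
have h : 0 <= \sum_(i <- r) \sum_(j <- r) (a i * b j - a j * b i) ^+ 2.
  by apply: sumr_ge0 => i _; apply: sumr_ge0 => j _; exact: sqr_ge0.
suff E : \sum_(i <- r) \sum_(j <- r) (a i * b j - a j * b i) ^+ 2 =
  2 * ((\sum_(i <- r) a i ^+ 2) * (\sum_(i <- r) b i ^+ 2)) - 2 * (\sum_(i <- r) a i * b i) ^+ 2.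
  by move: h; rewrite E; lra.
have e1 : (\sum_(i <- r) a i ^+ 2) * (\sum_(i <- r) b i ^+ 2) =
   \sum_(i <- r) \sum_(j <- r) a i ^+ 2 * b j ^+ 2 by rewrite big_distrlr.
have e2 : (\sum_(i <- r) a i ^+ 2) * (\sum_(i <- r) b i ^+ 2) =
   \sum_(i <- r) \sum_(j <- r) a j ^+ 2 * b i ^+ 2.
  by rewrite e1 exchange_big.
have e3 : (\sum_(i <- r) a i * b i) ^+ 2 =
   \sum_(i <- r) \sum_(j <- r) (a i * b i) * (a j * b j) by rewrite expr2 big_distrlr.
set X := _ * _ in e1 e2 *; set Y := _ ^+ 2 in e3 *.
have -> : 2 * X - 2 * Y = X + X - (Y + Y) by ring.
rewrite {1}e1 {}e2 {}e3 -!big_split/= -sumrB; apply: eq_bigr => i _.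
by rewrite -!big_split/= -sumrB; apply: eq_bigr => j _; ring.
Qed.

Definition hs (I : finType) (f : I -> R) : R := Num.sqrt (\sum_i f i ^+ 2).

Lemma hs_ge0 (I : finType) (f : I -> R) : 0 <= hs f.
Proof. exact: sqrtr_ge0. Qed.

Lemma hs_sqr (I : finType) (f : I -> R) : hs f ^+ 2 = \sum_i f i ^+ 2.
Proof. by rewrite sqr_sqrtr//; apply: sumr_ge0 => i _; exact: sqr_ge0. Qed.

Lemma hs_dot (I : finType) (f g : I -> R) : `|\sum_i f i * g i| <= hs f * hs g.
Proof.
rewrite -(@ler_pXn2r _ 2)// ?nnegrE ?mulr_ge0 ?hs_ge0//.
by rewrite exprMn !hs_sqr real_normK ?num_real// cauchy_schwarz.
Qed.

Lemma hs_add (I : finType) (f g : I -> R) : hs (fun i => f i + g i) <= hs f + hs g.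
Proof.
rewrite -(@ler_pXn2r _ 2)// ?nnegrE ?addr_ge0 ?hs_ge0//.
rewrite hs_sqr (eq_bigr (fun i => f i ^+ 2 + 2 * (f i * g i) + g i ^+ 2)); last by move=> i _; ring.
rewrite !big_split/= -mulr_sumr -!hs_sqr.
have := hs_dot f g; have := ler_norm (\sum_i f i * g i); rewrite !expr2; lra.
Qed.

Definition hsmx n (A : 'M[R]_n) := hs (fun ij : 'I_n * 'I_n => A ij.1 ij.2).

Lemma hsmx_sqr n (A : 'M[R]_n) : hsmx A ^+ 2 = \sum_i \sum_j A i j ^+ 2.
Proof. by rewrite hs_sqr pair_bigA. Qed.

Lemma hsmx_trmul n (A B : 'M[R]_n) : `|\tr (A *m B)| <= hsmx A * hsmx B.
Proof.
have -> : hsmx B = hs (fun ij : 'I_n * 'I_n => B ij.2 ij.1).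
  rewrite /hsmx /hs; congr Num.sqrt.
  by rewrite -(pair_bigA _ (fun i j => B i j ^+ 2)) exchange_big pair_bigA.
have -> : \tr (A *m B) = \sum_(ij : 'I_n * 'I_n) A ij.1 ij.2 * B ij.2 ij.1.
  rewrite -(pair_bigA _ (fun i j => A i j * B j i)); apply: eq_bigr => i _.
  by rewrite mxE.
exact: hs_dot.
Qed.

Lemma hsmx_mul n (A B : 'M[R]_n) : hsmx (A *m B) <= hsmx A * hsmx B.
Proof.
rewrite -(@ler_pXn2r _ 2)// ?nnegrE ?mulr_ge0 ?hs_ge0// exprMn !hsmx_sqr.
rewrite [X in _ * X]exchange_big big_distrl/=; apply: ler_sum => i _.
rewrite mulr_sumr; apply: ler_sum => j _.
by rewrite mxE; exact: cauchy_schwarz.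
Qed.

Lemma hsmx_add n (A B : 'M[R]_n) : hsmx (A + B) <= hsmx A + hsmx B.
Proof.
apply: le_trans (hs_add _ _); rewrite /hsmx /hs; congr (_ <= _): (lexx (hsmx (A + B))).
by congr Num.sqrt; apply: eq_bigr => i _; rewrite mxE.
Qed.

Lemma hsmx_expr n (A : 'M[R]_n) p (C : R) : hsmx A <= C -> hsmx (A ^+ p.+1) <= C ^+ p.+1.
Proof.
move=> hA; have C0 : 0 <= C := le_trans (hs_ge0 _) hA.
elim: p => [|p IH]; first by rewrite !expr1.
rewrite exprS [leRHS]exprS; apply: le_trans (hsmx_mul _ _) _.
by apply: ler_pM => //; exact: hs_ge0.
Qed.

Lemma hsmx_exprB n (A B : 'M[R]_n) p (C : R) : hsmx A <= C -> hsmx B <= C ->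
  hsmx (A ^+ p.+1 - B ^+ p.+1) <= p.+1%:R * C ^+ p * hsmx (A - B).
Proof.
move=> hA hB; have C0 : 0 <= C := le_trans (hs_ge0 _) hA.
elim: p => [|p IH]; first by rewrite expr0 !expr1 !mul1r.
have -> : A ^+ p.+2 - B ^+ p.+2 = A ^+ p.+1 *m (A - B) + (A ^+ p.+1 - B ^+ p.+1) *m B.
  by rewrite mulmxBr mulmxBl !mulmxE -!exprSr addrA subrK.
apply: le_trans (hsmx_add _ _) _.
have -> : p.+2%:R * C ^+ p.+1 * hsmx (A - B) = C ^+ p.+1 * hsmx (A - B) +
   p.+1%:R * C ^+ p * hsmx (A - B) * C by rewrite -(natr1 p.+1) exprS; ring.
apply: lerD; apply: le_trans (hsmx_mul _ _) _.
  by apply: ler_pM; rewrite ?hs_ge0//; exact: hsmx_expr.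
by apply: ler_pM; rewrite ?hs_ge0.
Qed.

(** The power is at least 2 because a trace is bounded by Hilbert-Schmidt norms only when it is the
    trace of a product; then the bound does not depend on the size of the matrices. *)
Lemma mxtrace_exprB n (A B : 'M[R]_n) p (C : R) : hsmx A <= C -> hsmx B <= C ->
  `|\tr (A ^+ p.+2) - \tr (B ^+ p.+2)| <= p.+2%:R * C ^+ p.+1 * hsmx (A - B).
Proof.
move=> hA hB; have C0 : 0 <= C := le_trans (hs_ge0 _) hA.
have -> : \tr (A ^+ p.+2) - \tr (B ^+ p.+2) =
    \tr (A ^+ p.+1 *m (A - B)) + \tr ((A ^+ p.+1 - B ^+ p.+1) *m B).
  by rewrite -!raddfD -raddfB/= mulmxBr mulmxBl !mulmxE -!exprSr addrA subrK.
apply: le_trans (ler_normD _ _) _.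
have -> : p.+2%:R * C ^+ p.+1 * hsmx (A - B) = C ^+ p.+1 * hsmx (A - B) +
   p.+1%:R * C ^+ p * hsmx (A - B) * C by rewrite -(natr1 p.+1) exprS; ring.
apply: lerD; apply: le_trans (hsmx_trmul _ _) _.
  by apply: ler_pM; rewrite ?hs_ge0//; exact: hsmx_expr.
by apply: ler_pM; rewrite ?hs_ge0//; exact: hsmx_exprB.
Qed.

(** The counterpart of [mxtrace_exprB] for the limiting spectrum: diagonal operators whose entries
    x_i, y_i carry the weights d_i. *)
Lemma weighted_exprB (I : Type) (r : seq I) (d x y : I -> R) p (C E : R) :
  0 <= E -> 0 <= C ->
  (forall i, 0 <= d i) -> (forall i, `|x i| <= C) -> (forall i, `|y i| <= C) ->
  \sum_(i <- r) d i * x i ^+ 2 <= C ^+ 2 -> \sum_(i <- r) d i * y i ^+ 2 <= C ^+ 2 ->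
  \sum_(i <- r) d i * (x i - y i) ^+ 2 <= E ^+ 2 ->
  `|\sum_(i <- r) d i * x i ^+ p.+2 - \sum_(i <- r) d i * y i ^+ p.+2| <=
   p.+2%:R * C ^+ p.+1 * E.
Proof.
move=> E0 C0 d0 xC yC hx hy hxy.
have pw i m : `|x i ^+ m.+1 - y i ^+ m.+1| <= m.+1%:R * C ^+ m * `|x i - y i|.
  elim: m => [|m IH]; first by rewrite !expr1 expr0 !mul1r.
  have -> : x i ^+ m.+2 - y i ^+ m.+2 = x i ^+ m.+1 * (x i - y i) + (x i ^+ m.+1 - y i ^+ m.+1) * y i.
    by rewrite !exprS; ring.
  apply: le_trans (ler_normD _ _) _; rewrite !normrM normrX.
  have -> : m.+2%:R * C ^+ m.+1 * `|x i - y i| = C ^+ m.+1 * `|x i - y i| +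
    m.+1%:R * C ^+ m * `|x i - y i| * C by rewrite -(natr1 m.+1) exprS; ring.
  by apply: lerD; apply: ler_pM; rewrite ?exprn_ge0// lerXn2r// nnegrE.
have cs (z : I -> R) : \sum_(i <- r) d i * z i ^+ 2 <= C ^+ 2 ->
   \sum_(i <- r) d i * (`|z i| * `|x i - y i|) <= C * E.
  move=> hz; rewrite -(@ler_pXn2r _ 2)// ?nnegrE ?mulr_ge0//; last first.
    by apply: sumr_ge0 => i _; rewrite !mulr_ge0.
  have := cauchy_schwarz r (fun i => Num.sqrt (d i) * `|z i|) (fun i => Num.sqrt (d i) * `|x i - y i|).
  rewrite (eq_bigr (fun i => d i * (`|z i| * `|x i - y i|))); last first.
    by move=> i _; rewrite -[in RHS](sqr_sqrtr (d0 i)); ring.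
  move=> h; apply: (le_trans h); rewrite exprMn; apply: ler_pM; rewrite ?sumr_ge0//.
  - apply: le_trans hz; rewrite le_eqVlt; apply/orP; left; apply/eqP; apply: eq_bigr => i _.
    by rewrite exprMn sqr_sqrtr// real_normK ?num_real.
  - apply: le_trans hxy; rewrite le_eqVlt; apply/orP; left; apply/eqP; apply: eq_bigr => i _.
    by rewrite exprMn sqr_sqrtr// real_normK ?num_real.
rewrite -sumrB; apply: le_trans (ler_norm_sum _ _ _) _.
apply: (@le_trans _ _ (\sum_(i <- r) (C ^+ p * (d i * (`|x i| * `|x i - y i|)) +
    p.+1%:R * C ^+ p * (d i * (`|y i| * `|x i - y i|))))).
  apply: ler_sum => i _; rewrite -mulrBr normrM (ger0_norm (d0 i)).
  have -> : x i ^+ p.+2 - y i ^+ p.+2 = x i ^+ p * x i * (x i - y i) + (x i ^+ p.+1 - y i ^+ p.+1) * y i.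
    by rewrite !exprS; ring.
  have -> : C ^+ p * (d i * (`|x i| * `|x i - y i|)) + p.+1%:R * C ^+ p * (d i * (`|y i| * `|x i - y i|))
    = d i * (C ^+ p * `|x i| * `|x i - y i| + p.+1%:R * C ^+ p * `|x i - y i| * `|y i|) by ring.
  apply: ler_wpM2l => //; apply: le_trans (ler_normD _ _) _; rewrite !normrM normrX.
  apply: lerD; last by apply: ler_pM.
  by rewrite -!mulrA; apply: ler_pM; rewrite ?exprn_ge0 ?mulr_ge0// lerXn2r// nnegrE.
rewrite big_split/= -!mulr_sumr.
have -> : p.+2%:R * C ^+ p.+1 * E = C ^+ p * (C * E) + p.+1%:R * C ^+ p * (C * E).
  by rewrite -(natr1 p.+1) exprS; ring.
by apply: lerD; apply: ler_wpM2l; rewrite ?mulr_ge0 ?exprn_ge0//; exact: cs.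
Qed.

End HilbertSchmidt.

(** * Law of large numbers *)

Section BoundedMean.
Context {R : realType} {d : measure_display} {T : measurableType d}.
Variables (mu : probability T R) (D : set T).
Hypothesis mD : measurable D.

Definition bmf (f : T -> R) :=
  measurable_fun D f /\ exists M : R, forall x, D x -> `|f x| <= M.

Definition mean (f : T -> R) : R := \int[mu]_(x in D) f x.

Lemma bmf_int f : bmf f -> mu.-integrable D (EFin \o f).
Proof.
move=> [mf [M hM]]; apply: measurable_bounded_integrable => //.
  by apply: le_lt_trans (probability_le1 mu mD) _; rewrite ltry.
by exists M; split; [exact: num_real|move=> A MA x Dx; apply: le_trans (hM x Dx) _; exact: ltW].
Qed.

Lemma bmf_cst c : bmf (fun=> c).
Proof. by split; [exact: measurable_cst|exists `|c|]. Qed.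

Lemma bmfD f g : bmf f -> bmf g -> bmf (fun x => f x + g x).
Proof.
move=> [mf [M hM]] [mg [M' hM']]; split; first exact: measurable_funD.
by exists (M + M') => x Dx; apply: le_trans (ler_normD _ _) _; rewrite lerD ?hM ?hM'.
Qed.

Lemma bmfM f g : bmf f -> bmf g -> bmf (fun x => f x * g x).
Proof.
move=> [mf [M hM]] [mg [M' hM']]; split; first exact: measurable_funM.
by exists (M * M') => x Dx; rewrite normrM ler_pM ?hM ?hM'.
Qed.

Lemma bmfZ c f : bmf f -> bmf (fun x => c * f x).
Proof. by move=> h; apply: bmfM => //; exact: bmf_cst. Qed.

Lemma bmf_sum (I : Type) (r : seq I) (F : I -> T -> R) :
  (forall i, bmf (F i)) -> bmf (fun x => \sum_(i <- r) F i x).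
Proof.
move=> h; elim: r => [|i r IH].
  by rewrite (_ : (fun _ => _) = (fun=> 0)); [exact: bmf_cst|apply/funext => x; rewrite big_nil].
rewrite (_ : (fun _ => _) = (fun x => F i x + \sum_(j <- r) F j x)); first exact: bmfD.
by apply/funext => x; rewrite big_cons.
Qed.

Lemma bmf_indic A : measurable A -> bmf (\1_A).
Proof.
move=> mA; split; first exact: measurable_funTS (measurable_indic mA).
exists 1 => x _; rewrite indicE; case: (_ \in _); rewrite ?normr1 ?normr0//.
Qed.

Lemma meanD f g : bmf f -> bmf g -> mean (fun x => f x + g x) = mean f + mean g.
Proof. by move=> hf hg; rewrite /mean RintegralD//; exact: bmf_int. Qed.

Lemma meanZ c f : bmf f -> mean (fun x => c * f x) = c * mean f.
Proof. by move=> hf; rewrite /mean RintegralZl//; exact: bmf_int. Qed.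

Lemma mean0 : mean (fun=> 0) = 0.
Proof.
by have := meanZ 0 (bmf_cst 0); rewrite !mul0r.
Qed.

Lemma mean_sum (I : Type) (r : seq I) (F : I -> T -> R) :
  (forall i, bmf (F i)) -> mean (fun x => \sum_(i <- r) F i x) = \sum_(i <- r) mean (F i).
Proof.
move=> h; elim: r => [|i r IH].
  by rewrite big_nil -[RHS]mean0; congr mean; apply/funext => x; rewrite big_nil.
rewrite big_cons -IH -meanD//; last exact: bmf_sum.
by congr mean; apply/funext => x; rewrite big_cons.
Qed.

Lemma eq_mean f g : (forall x, D x -> f x = g x) -> mean f = mean g.
Proof. by move=> h; apply: eq_Rintegral => x; rewrite inE; exact: h. Qed.

Lemma le_mean f g : bmf f -> bmf g -> (forall x, D x -> f x <= g x) -> mean f <= mean g.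
Proof. by move=> hf hg h; apply: le_Rintegral => //; exact: bmf_int. Qed.

Lemma mean_cst c : mu D = 1%E -> mean (fun=> c) = c.
Proof. by move=> h; transitivity (c * fine (mu D)); [exact: Rintegral_cst|rewrite h mulr1]. Qed.

Lemma mean_indic A : measurable A -> mean (\1_A) = fine (mu (A `&` D)).
Proof. by move=> mA; rewrite /mean /Rintegral integral_indic. Qed.

Lemma mean_EFin f : bmf f -> (\int[mu]_(x in D) (f x)%:E = (mean f)%:E)%E.
Proof.
move=> hf; rewrite /mean /Rintegral fineK//; apply: integrable_fin_num => //; exact: bmf_int.
Qed.

Lemma mean_close f g c : mu D = 1%E -> bmf f -> bmf g ->
  (forall x, D x -> `|f x - g x| <= c) -> `|mean f - mean g| <= c.
Proof.
move=> D1 hf hg h.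
have aux u v : bmf u -> bmf v -> (forall x, D x -> `|u x - v x| <= c) -> mean u <= mean v + c.
  move=> hu hv huv; rewrite -(mean_cst c D1) -meanD//; last exact: bmf_cst.
  apply: le_mean => //; first by apply: bmfD => //; exact: bmf_cst.
  by move=> x /huv; rewrite ler_norml => /andP[]; lra.
have h1 := aux _ _ hf hg h.
have h2 := aux _ _ hg hf (fun x Dx => etrans (congr1 (fun u => u <= c) (distrC _ _)) (h x Dx)).
rewrite ler_norml; apply/andP; split; lra.
Qed.

End BoundedMean.

Section SLLN.
Context {R : realType} {dO dT : measure_display}.
Context {Om : measurableType dO} {T : measurableType dT}.
Variables (P : probability Om R) (mu : probability T R) (V : nat -> Om -> T).
Hypothesis HV : iid_with_law P V mu.

Lemma V_measurable i : measurable_fun setT (V i).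
Proof. by case: HV. Qed.

Lemma V_law i A : measurable A -> P (V i @^-1` A) = mu A.
Proof. by case: HV => _ h _; exact: h. Qed.

Lemma V_preimage i A : measurable A -> measurable (V i @^-1` A).
Proof. by move=> mA; rewrite -[_ @^-1` _]setTI; exact: V_measurable. Qed.

Lemma V_pair i j A : measurable A -> i != j ->
  fine (P (V i @^-1` A `&` V j @^-1` A)) = fine (mu A) ^+ 2.
Proof.
move=> mA ij; case: HV => _ _ /(_ [:: i; j] (fun=> A)).
rewrite /= inE ij => /(_ erefl (fun=> mA)).
rewrite !big_cons big_nil mulr1 !V_law// -expr2 => <-; congr (fine (P _)).
apply/seteqP; split => w /=.
  by move=> [h1 h2] k /=; rewrite !inE => /orP[/eqP ->|/eqP ->].
by move=> h; split; apply: h; rewrite /= !inE eqxx ?orbT.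
Qed.

Section OneSet.
Variable A : set T.
Hypothesis mA : measurable A.

Let p : R := fine (mu A).
Let X i (w : Om) : R := \1_(V i @^-1` A) w.
Let S n w : R := \sum_(i < n) X i w.
(** Deviations are first controlled only along the squares n = (m+1)^2, where the Chebyshev bound
    1/n becomes summable. *)
Let Y m (w : Om) : R := (S (m.+1 ^ 2)%N w / (m.+1 ^ 2)%N%:R - p) ^+ 2.

Lemma X_bmf i : bmf setT (X i).
Proof. by apply: bmf_indic; exact: V_preimage. Qed.

Lemma p01 : 0 <= p <= 1.
Proof.
have h1 : (mu A <= 1)%E := probability_le1 mu mA.
rewrite /p fine_ge0//= -lee_fin fineK// ge0_fin_numE//.
by apply: le_lt_trans h1 _; rewrite ltry.
Qed.

Lemma mean_X i : mean P setT (X i) = p.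
Proof. by rewrite /X mean_indic ?setIT ?V_law//; exact: V_preimage. Qed.

Lemma mean_XX i j : mean P setT (fun w => X i w * X j w) = if i == j then p else p ^+ 2.
Proof.
have -> : (fun w => X i w * X j w) = \1_(V i @^-1` A `&` V j @^-1` A).
  by apply/funext => w; rewrite indicI.
rewrite mean_indic ?setIT//; last by apply: measurableI; exact: V_preimage.
by case: eqVneq => [->|ij]; [rewrite setIid V_law|rewrite V_pair].
Qed.

Lemma S_bmf n : bmf setT (S n).
Proof. by apply: bmf_sum => i; exact: X_bmf. Qed.

Lemma Y_bmf m : bmf setT (Y m).
Proof.
rewrite /Y (_ : (fun _ => _) = (fun w => (((m.+1 ^ 2)%N%:R)^-1 * S (m.+1 ^ 2)%N w + - p) *
   (((m.+1 ^ 2)%N%:R)^-1 * S (m.+1 ^ 2)%N w + - p))); last first.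
  by apply/funext => w; rewrite expr2 [_ / _]mulrC.
by apply: bmfM; (apply: bmfD; [apply: bmfZ; exact: S_bmf|exact: bmf_cst]).
Qed.

(** Pairwise independence kills the off-diagonal covariances; each of the n diagonal terms is p -
    p^2 <= 1. *)
Lemma mean_dev n : mean P setT (fun w => (S n w - n%:R * p) ^+ 2) <= n%:R.
Proof.
have E w : (S n w - n%:R * p) ^+ 2 = \sum_(i < n) \sum_(j < n)
    (X i w * X j w + (- p * X i w + (- p * X j w + p ^+ 2))).
  have -> : S n w - n%:R * p = \sum_(i < n) (X i w - p).
    by rewrite sumrB sumr_const card_ord mulr_natl.
  rewrite expr2 big_distrlr/=; apply: eq_bigr => i _; apply: eq_bigr => j _; ring.
rewrite (funext E).
have hb i j : bmf setT (fun w => X i w * X j w + (- p * X i w + (- p * X j w + p ^+ 2))).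
  apply: bmfD; first by apply: bmfM; exact: X_bmf.
  apply: bmfD; first by apply: bmfZ; exact: X_bmf.
  by apply: bmfD; [apply: bmfZ; exact: X_bmf|exact: bmf_cst].
rewrite (mean_sum _ measurableT); last by move=> i; apply: bmf_sum => j; exact: hb.
have hm i j : mean P setT (fun w => X i w * X j w + (- p * X i w + (- p * X j w + p ^+ 2))) =
   if i == j then p - p ^+ 2 else 0.
  rewrite !(meanD _ measurableT);
    try by do ?[exact: bmf_cst|exact: X_bmf|apply: bmfD|apply: bmfM].
  rewrite (meanZ P measurableT (- p) (X_bmf i)) (meanZ P measurableT (- p) (X_bmf j)) !mean_X.
  rewrite mean_cst//; last exact: probability_setT.
  by rewrite mean_XX; case: eqP => _; ring.
have -> : n%:R = \sum_(i < n) (1 : R) by rewrite sumr_const card_ord.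
apply: ler_sum => i _; rewrite (mean_sum _ measurableT); last by move=> j; exact: hb.
rewrite (eq_bigr (fun j : 'I_n => if j == i then p - p ^+ 2 else 0)); last first.
  by move=> j _; rewrite hm eq_sym.
rewrite -big_mkcond big_pred1_eq; have /andP[p0 p1] := p01; nra.
Qed.

Lemma mean_Y m : mean P setT (Y m) <= 1 / (m.+1)%:R ^+ 2.
Proof.
have n0 : (0 : R) < (m.+1 ^ 2)%N%:R by rewrite ltr0n expn_gt0.
have E : Y m = fun w => ((m.+1 ^ 2)%N%:R) ^- 2 * (S (m.+1 ^ 2)%N w - (m.+1 ^ 2)%N%:R * p) ^+ 2.
  by apply/funext => w; rewrite /Y; field; rewrite lt0r_neq0.
rewrite E (meanZ _ measurableT); last first.
  rewrite (_ : (fun _ => _) = (fun w => (S (m.+1 ^ 2)%N w + - ((m.+1 ^ 2)%N%:R * p)) *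
     (S (m.+1 ^ 2)%N w + - ((m.+1 ^ 2)%N%:R * p)))); last by apply/funext => w; rewrite expr2.
  by apply: bmfM; (apply: bmfD; [exact: S_bmf|exact: bmf_cst]).
apply: (@le_trans _ _ (((m.+1 ^ 2)%N%:R) ^- 2 * (m.+1 ^ 2)%N%:R)).
  by rewrite ler_pM2l ?invr_gt0 ?exprn_gt0//; exact: mean_dev.
rewrite le_eqVlt; apply/orP; left; apply/eqP.
have -> : (m.+1 ^ 2)%N%:R = m.+1%:R ^+ 2 :> R by rewrite natrX.
have : (0 : R) < m.+1%:R by rewrite ltr0n.
by move: (m.+1%:R : R) => x x0; field; rewrite lt0r_neq0.
Qed.

Lemma sum_inv_sqr n : \sum_(0 <= m < n.+1) 1 / (m.+1)%:R ^+ 2 <= 2 - (n.+1)%:R^-1 :> R.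
Proof.
elim: n => [|n IH]; first by rewrite big_nat1 expr1n; lra.
rewrite big_nat_recr//=; apply: le_trans (lerD IH (lexx _)) _.
have n1 : (0 : R) < n.+1%:R by rewrite ltr0n.
rewrite -(natr1 n.+1) -subr_ge0; set x := n.+1%:R in n1 *.
have x1 : 0 < x + 1 by rewrite addr_gt0.
have -> : 2 - (x + 1)^-1 - (2 - x^-1 + 1 / (x + 1) ^+ 2) = (x * (x + 1) ^+ 2)^-1.
  by field; rewrite !lt0r_neq0.
by rewrite invr_ge0 mulr_ge0 ?exprn_ge0 ?ltW.
Qed.

Lemma sum_inv_sqr_le2 n : \sum_(0 <= m < n) 1 / (m.+1)%:R ^+ 2 <= 2 :> R.
Proof.
case: n => [|n]; first by rewrite big_nil.
by apply: le_trans (sum_inv_sqr n) _; rewrite gerBl invr_ge0.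
Qed.

(** The expectations of [Y m] are summable, so the sum of the [Y m] is integrable, hence almost
    surely finite, and its terms tend to 0. *)
Lemma Y_ae : {ae P, forall w, Y ^~ w @ \oo --> (0 : R)}.
Proof.
have Y0 m w : 0 <= Y m w by exact: sqr_ge0.
have mY m : measurable_fun setT (EFin \o Y m) by apply/measurable_EFinP; case: (Y_bmf m).
have hI : (\int[P]_(w in setT) (\sum_(m <oo) (Y m w)%:E) <= 2%:E)%E.
  rewrite integral_nneseries//; last by move=> m w _; rewrite lee_fin.
  apply: lime_le; first by apply: is_cvg_nneseries => m _ _; apply: integral_ge0 => w _; rewrite lee_fin.
  apply: nearW => n; apply: le_trans (_ : ((\sum_(0 <= m < n) 1 / (m.+1)%:R ^+ 2)%:E <= _)%E); last first.
    by rewrite lee_fin sum_inv_sqr_le2.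
  rewrite -sumEFin; apply: lee_sum => m _.
  by rewrite mean_EFin//; [rewrite lee_fin mean_Y|exact: Y_bmf].
have fint : P.-integrable setT (fun w => \sum_(m <oo) (Y m w)%:E)%E.
  apply/integrableP; split.
    apply: (@ge0_emeasurable_sum _ _ _ setT (fun m => EFin \o Y m) xpredT) => // m w _ _.
    by rewrite lee_fin.
  have -> : (fun w => `|\sum_(m <oo) (Y m w)%:E|)%E = (fun w => \sum_(m <oo) (Y m w)%:E)%E.
    by apply/funext => w; rewrite gee0_abs//; apply: nneseries_ge0 => m _ _; rewrite lee_fin.
  by apply: le_lt_trans hI _; rewrite ltry.
have := integrable_ae measurableT fint.
apply: filterS => w /(_ I) hw.
have cv : cvgn (series (Y ^~ w)).
  apply: nondecreasing_is_cvgn.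
    move=> a b ab; rewrite /series/= (@big_cat_nat _ _ _ a 0 b)//= lerDl.
    by apply: sumr_ge0.
  exists (fine (\sum_(m <oo) (Y m w)%:E)%E) => _ [n _ <-].
  rewrite -lee_fin fineK// /series/= -sumEFin.
  by apply: nneseries_lim_ge => m _; rewrite lee_fin.
exact: cvg_series_cvg_0.
Qed.

Lemma S_mono n n' w : (n <= n')%N -> S n w <= S n' w.
Proof.
move=> nn; rewrite /S -!(big_mkord xpredT (fun i => X i w)) (@big_cat_nat _ _ _ n 0 n')//= lerDl.
by apply: sumr_ge0 => i _; rewrite /X indicE.
Qed.

Lemma S_ge0 n w : 0 <= S n w.
Proof. by apply: sumr_ge0 => i _; rewrite /X indicE. Qed.

Lemma nat_sqr_floor n : (0 < n)%N -> exists m, (m.+1 ^ 2 <= n < m.+2 ^ 2)%N.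
Proof.
elim: n => // -[_ _|n /(_ isT) [m /andP[h1 h2]] _]; first by exists 0%N.
case: (ltnP n.+2 (m.+2 ^ 2)) => h3; first by exists m; rewrite h3 (leq_trans h1).
by exists m.+1; rewrite h3/=; apply: leq_ltn_trans h2 _; rewrite ltn_sqr.
Qed.

(* the monotone sum S is squeezed between consecutive squares *)
Lemma S_cvg w : Y ^~ w @ \oo --> (0 : R) -> (fun n => S n w / n%:R) @ \oo --> p.
Proof.
move=> hY; have /andP[p0 p1] := p01.
apply/cvgrPdist_le => e; rewrite /= => e0.
pose h := Num.min 1 (e / 3).
have h0 : 0 < h by rewrite lt_min ltr01/= divr_gt0.
have h1 : h <= 1 by rewrite ge_min lexx.
have he : h <= e / 3 by rewrite ge_min lexx orbT.
move/cvgrPdist_le : hY => /(_ (h ^+ 2)); rewrite exprn_gt0// => /(_ isT) [M _ hM].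
(* Besides M, this forces h (m + 1) >= 3, which makes consecutive squares differ by a factor of at
   most 1 + h. *)
pose M' := maxn M.+1 (Num.truncn (3 / h)).+1.
exists (M' ^ 2)%N => //= n hn.
have n0 : (0 < n)%N by apply: leq_trans hn; rewrite expn_gt0 /M' leq_max.
have [m /andP[m1 m2]] := nat_sqr_floor n0.
have Mm : (M' <= m.+1)%N by rewrite -ltnS -ltn_sqr; exact: leq_ltn_trans hn m2.
have nx (a x : R) : 0 < x -> `|a / x - p| * x = `|a - p * x|.
  by move=> x0; rewrite -[X in _ * X = _](gtr0_norm x0) -normrM mulrBl divfK// lt0r_neq0.
have dev k : (M <= k)%N -> `|S (k.+1 ^ 2)%N w - p * (k.+1 ^ 2)%N%:R| <= h * (k.+1 ^ 2)%N%:R.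
  move=> /hM /=; rewrite sub0r normrN ger0_norm ?sqr_ge0// /Y.
  have k0 : (0 : R) < (k.+1 ^ 2)%N%:R by rewrite ltr0n expn_gt0.
  move=> hk; have : `|S (k.+1 ^ 2)%N w / (k.+1 ^ 2)%N%:R - p| <= h.
    by rewrite -(@ler_pXn2r _ 2)// ?nnegrE ?(ltW h0)// real_normK ?num_real.
  by rewrite -(ler_pM2r k0) nx.
have Mm1 : (M <= m)%N by rewrite -ltnS (leq_trans _ Mm)// /M' leq_max leqnn.
have d1 := dev m Mm1; have d2 := dev m.+1 (leqW Mm1).
have s1 := S_mono w m1; have s2 := S_mono w (ltnW m2).
have n1 : (m.+1 ^ 2)%N%:R <= n%:R :> R by rewrite ler_nat.
have n2 : n%:R <= (m.+2 ^ 2)%N%:R :> R by rewrite ler_nat ltnW.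
have q2 : (m.+2 ^ 2)%N%:R <= (1 + h) * (m.+1 ^ 2)%N%:R.
  have hm : 3 <= h * m.+1%:R.
    rewrite mulrC -ler_pdivrMr//; apply: ltW; apply: lt_le_trans (truncnS_gt _) _.
    by rewrite ler_nat (leq_trans _ Mm)// /M' leq_max leqnn orbT.
  rewrite !natrX -(natr1 m.+1).
  have m0 : (1 : R) <= m.+1%:R by rewrite ler1n.
  nra.
have nR : (0 : R) < n%:R by rewrite ltr0n.
set q := (m.+1 ^ 2)%N%:R in d1 n1 q2; set q' := (m.+2 ^ 2)%N%:R in d2 n2 q2.
have q0 : 0 < q by rewrite /q ltr0n expn_gt0.
rewrite distrC -(ler_pM2r nR) nx//.
apply: (@le_trans _ _ (3 * h * n%:R)); last by rewrite ler_pM2r//; lra.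
move: d1 d2; rewrite !ler_norml => /andP[d1 _] /andP[_ d2].
have S0 := S_ge0 n w.
apply/andP; split; first by nra.
case: (leP p (3 * h)) => ph; first by nra.
have : (p - 3 * h) * n%:R <= (p - 3 * h) * ((1 + h) * q).
  by rewrite ler_pM2l ?subr_gt0//; lra.
by nra.
Qed.

Lemma slln_set : {ae P, forall w,
  (fun n => (\sum_(i < n) \1_A (V i w)) / n%:R) @ \oo --> fine (mu A)}.
Proof. by apply: filterS Y_ae => w; exact: S_cvg. Qed.

End OneSet.
End SLLN.

Section SLLNBounded.
Context {R : realType} {dO dT : measure_display}.
Context {Om : measurableType dO} {T : measurableType dT}.
Variables (P : probability Om R) (mu : probability T R) (V : nat -> Om -> T) (X : set T).
Hypothesis HV : iid_with_law P V mu.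
Hypothesis mX : measurable X.
Hypothesis muX : mu X = 1%E.

Lemma V_in_X : {ae P, forall w, forall i, X (V i w)}.
Proof.
apply: ae_foralln => i; exists (~` (V i @^-1` X)); split.
- by apply: measurableC; exact: (V_preimage HV).
- have mV := V_preimage HV i mX.
  transitivity (1 - P (V i @^-1` X))%E; first exact: probability_setC.
  by rewrite (V_law HV)// muX subee.
- by [].
Qed.

Lemma mu_setIX B : measurable B -> mu (B `&` X) = mu B.
Proof.
move=> mB; have mXC : measurable (~` X) by exact: measurableC.
have XC : mu (~` X) = 0%E.
  transitivity (1 - mu X)%E; first exact: probability_setC.
  by rewrite muX subee.
have BX : mu (B `\` X) = 0%E.
  apply: (@subset_measure0 _ _ _ mu _ (~` X)); [exact: measurableD|exact: mXC| |exact: XC].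
  by move=> x [].
apply/esym; apply: (etrans (@measureDI _ _ _ mu B X mB mX)).
by transitivity (0 + mu (B `&` X))%E; [congr (_ + _)%E; exact: BX|exact: add0e].
Qed.

(** The sum counts the r with r + 1 <= K y, so it is the integer part of K y. *)
Lemma level_sum (K : nat) (y : R) : (0 < K)%N -> 0 <= y <= 1 ->
  `|y - K%:R^-1 * \sum_(r < K) ((r.+1%:R <= K%:R * y)%R : nat)%:R| <= K%:R^-1.
Proof.
move=> K0 /andP[y0 y1].
have KR : (0 : R) < K%:R by rewrite ltr0n.
have z0 : 0 <= K%:R * y by rewrite mulr_ge0// ltW.
set t := Num.truncn (K%:R * y).
have /andP[t1 t2] : t%:R <= K%:R * y < t.+1%:R by exact: truncn_itv.
have tK : (t <= K)%N by rewrite -(ler_nat R) (le_trans t1)// ler_piMr// ltW.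
have -> : \sum_(r < K) ((r.+1%:R <= K%:R * y)%R : nat)%:R = t%:R :> R.
  rewrite -natr_sum; congr (_%:R).
  under eq_bigr do rewrite -truncn_gt_nat.
  rewrite -(big_mkord xpredT (fun r => (r < t)%N : nat)) (@big_cat_nat _ _ _ t)//=.
  rewrite [X in (X + _)%N](eq_big_nat _ _ (F2 := fun=> 1%N)); last by move=> i /andP[_ ->].
  rewrite [X in (_ + X)%N](eq_big_nat _ _ (F2 := fun=> 0%N)); last first.
    by move=> i /andP[ti _]; rewrite ltnNge ti.
  by rewrite !sum_nat_const_nat subn0 muln1 muln0 addn0.
rewrite -(ler_pM2r KR) mulVf ?lt0r_neq0// -[X in `|_| * X](gtr0_norm KR) -normrM.
rewrite mulrBl mulrAC mulVf ?lt0r_neq0// mul1r mulrC ler_norml; move: t2; rewrite -natr1.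
by move=> t2; apply/andP; split; lra.
Qed.

Section UnitInterval.
Variable g : T -> R.
Hypothesis mg : measurable_fun setT g.
Hypothesis g01 : forall x, X x -> 0 <= g x <= 1.

Let A K r : set T := [set x | r.+1%:R <= K%:R * g x].

Lemma mA K r : measurable (A K r).
Proof.
have mK : measurable_fun setT (fun x => K%:R * g x) by apply: measurable_funM.
rewrite -[A K r]setTI (_ : A K r = (fun x => K%:R * g x) @^-1` `[r.+1%:R, +oo[); last first.
  by apply/seteqP; split => x; rewrite /A /= in_itv /= andbT.
by apply: mK => //; exact: measurable_itv.
Qed.

(** By [level_sum], g is a uniform limit of averages of indicators of its level sets. Only the
    countably many sets [A K r] occur, so the law of large numbers for sets applies to all of them
    outside one null set. *)
Lemma slln_unit : {ae P, forall w,
  (fun n => (\sum_(i < n) g (V i w)) / n%:R) @ \oo --> mean mu X g}.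
Proof.
have : {ae P, forall w, forall K r, (fun n => (\sum_(i < n) \1_(A K r) (V i w)) / n%:R) @ \oo --> fine (mu (A K r))}.
  by apply: ae_foralln => K; apply: ae_foralln => r; apply: (slln_set HV); exact: mA.
apply: filterS2 V_in_X => w hX hA.
have bg : bmf X g.
  split; first exact: measurable_funTS.
  by exists 1 => x /g01 /andP[h1 h2]; rewrite ger0_norm.
pose gK K x : R := K%:R^-1 * \sum_(r < K) \1_(A K r) x.
have gKE K x : (0 < K)%N -> X x -> `|g x - gK K x| <= K%:R^-1.
  move=> K0 Xx; have := level_sum K0 (g01 Xx); congr (`|_ - _ * _| <= _).
  by apply: eq_bigr => r _; rewrite indicE mem_setE.
have bK K : bmf X (gK K).
  by apply: bmfZ; apply: bmf_sum => r; apply: bmf_indic; exact: mA.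
have mK K : (0 < K)%N -> `|mean mu X g - mean mu X (gK K)| <= K%:R^-1.
  by move=> K0; apply: mean_close => // x Xx; exact: gKE.
have cK K : (fun n => (\sum_(i < n) gK K (V i w)) / n%:R) @ \oo --> mean mu X (gK K).
  rewrite /gK (meanZ _ mX); last by apply: bmf_sum => r; apply: bmf_indic; exact: mA.
  rewrite (mean_sum _ mX); last by move=> r; apply: bmf_indic; exact: mA.
  rewrite (_ : (fun n => _) = (fun n => K%:R^-1 * \sum_(r < K) ((\sum_(i < n) \1_(A K r) (V i w)) / n%:R))); last first.
    apply/funext => n; rewrite -mulr_sumr -mulrA; congr (_ * _).
    by rewrite exchange_big/= mulr_suml.
  apply: cvgM; first exact: cvg_cst.
  apply: cvgn_sum => r; rewrite (mean_indic _ mX); last exact: mA.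
  by rewrite mu_setIX; [exact: hA|exact: mA].
apply/cvgrPdist_le => e /= e0.
pose K := (Num.truncn (3 / e)).+1.
have Ke : K%:R^-1 <= e / 3.
  by rewrite -[leRHS]invf_div lef_pV2 ?posrE ?divr_gt0 ?ltr0n// ltW// truncnS_gt.
have e3 : 0 < e / 3 by rewrite divr_gt0.
move/cvgrPdist_le : (cK K) => /(_ _ e3) hK.
near=> n.
have h1 : `|mean mu X (gK K) - (\sum_(i < n) gK K (V i w)) / n%:R| <= e / 3 by near: n; exact: hK.
have h2 := mK K isT.
have n0 : (0 : R) < n%:R by rewrite ltr0n; near: n; exact: nbhs_infty_gt.
have h3 : `|(\sum_(i < n) gK K (V i w)) / n%:R - (\sum_(i < n) g (V i w)) / n%:R| <= K%:R^-1.
  rewrite -mulrBl -sumrB normrM [`|n%:R^-1|]gtr0_norm ?invr_gt0// ler_pdivrMr//.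
  apply: le_trans (ler_norm_sum _ _ _) _.
  apply: (@le_trans _ _ (\sum_(i < n) K%:R^-1)); last by rewrite sumr_const card_ord mulr_natr.
  by apply: ler_sum => i _; rewrite distrC; apply: gKE.
move: h1 h2 h3; rewrite !ler_norml => /andP[? ?] /andP[? ?] /andP[? ?].
apply/andP; split; lra.
Unshelve. all: by end_near. Qed.

End UnitInterval.
Lemma slln_bounded (f : T -> R) (M : R) : measurable_fun setT f ->
  (forall x, X x -> `|f x| <= M) ->
  {ae P, forall w, (fun n => (\sum_(i < n) f (V i w)) / n%:R) @ \oo --> mean mu X f}.
Proof.
move=> mf fM; pose C := `|M| + 1; have C0 : 0 < C by rewrite ltr_wpDl.
pose g x := (2 * C)^-1 * f x + 2^-1.
have mg : measurable_fun setT g by apply: measurable_funD => //; apply: measurable_funM.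
have fC x : X x -> - C <= f x <= C.
  move=> /fM h; rewrite -ler_norml; apply: (le_trans h).
  by rewrite (le_trans (ler_norm _))// lerDl.
have fg x : f x = 2 * C * g x + - C by rewrite /g; field; rewrite lt0r_neq0.
have g01 x : X x -> 0 <= g x <= 1.
  move=> /fC /andP[h1 h2]; rewrite fg in h1 h2.
  by apply/andP; split; rewrite -(ler_pM2l (mulr_gt0 (ltr0n R 2) C0)); lra.
have bg : bmf X g.
  split; first exact: measurable_funTS.
  by exists 1 => x /g01 /andP[h1 h2]; rewrite ger0_norm.
apply: filterS (slln_unit mg g01) => w hw.
have -> : mean mu X f = 2 * C * mean mu X g + - C.
  rewrite (funext fg) meanD//; [|exact: bmfZ|exact: bmf_cst].
  by rewrite meanZ// mean_cst.
have H : (fun n => 2 * C * ((\sum_(i < n) g (V i w)) / n%:R) + - C) @ \oo --> 2 * C * mean mu X g + - C.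
  by apply: cvgD; [apply: cvgM; [exact: cvg_cst|exact: hw]|exact: cvg_cst].
apply/cvgrPdist_le => e e0; move/cvgrPdist_le : H => /(_ e e0) H.
near=> n.
have n0 : (0 : R) < n%:R by rewrite ltr0n; near: n; exact: nbhs_infty_gt.
have -> : (\sum_(i < n) f (V i w)) / n%:R = 2 * C * ((\sum_(i < n) g (V i w)) / n%:R) + - C.
  rewrite (eq_bigr (fun i : 'I_n => 2 * C * g (V i w) + - C)); last by move=> i _; rewrite fg.
  rewrite big_split/= -mulr_sumr sumr_const card_ord -mulr_natl.
  by field; rewrite lt0r_neq0.
by near: n; exact: H.
Unshelve. all: by end_near. Qed.

End SLLNBounded.

(** * The spectral criterion *)

Section PolyFun.
Context {R : realType} {T : Type} {I : finType}.
Variable coord : I -> T -> R.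

Definition mono (a : seq I) (x : T) : R := \prod_(i <- a) coord i x.

Definition polyfun (f : T -> R) : Prop :=
  exists l : seq (R * seq I), forall x, f x = \sum_(u <- l) u.1 * mono u.2 x.

Definition tk (x y : T) : R := \sum_i coord i x * coord i y.

Lemma tkC x y : tk x y = tk y x.
Proof. by apply: eq_bigr => i _; rewrite mulrC. Qed.

Lemma polyfun_mono a : polyfun (mono a).
Proof. by exists [:: (1, a)] => x; rewrite big_seq1 mul1r. Qed.

Lemma polyfun_cst c : polyfun (fun=> c).
Proof. by exists [:: (c, [::])] => x; rewrite big_seq1 /mono big_nil mulr1. Qed.

Lemma polyfun_coord i : polyfun (coord i).
Proof. by exists [:: (1, [:: i])] => x; rewrite big_seq1 /mono big_seq1 mul1r. Qed.

Lemma polyfunD f g : polyfun f -> polyfun g -> polyfun (fun x => f x + g x).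
Proof. by move=> [l hl] [m hm]; exists (l ++ m) => x; rewrite big_cat/= hl hm. Qed.

Lemma polyfunM f g : polyfun f -> polyfun g -> polyfun (fun x => f x * g x).
Proof.
move=> [l hl] [m hm].
exists [seq (u.1 * v.1, u.2 ++ v.2) | u <- l, v <- m] => x.
rewrite hl hm big_distrlr/= big_allpairs_dep; apply: eq_bigr => u _; apply: eq_bigr => v _.
by rewrite /= /mono big_cat/=; ring.
Qed.

Lemma polyfunZ c f : polyfun f -> polyfun (fun x => c * f x).
Proof. by move=> h; apply: polyfunM => //; exact: polyfun_cst. Qed.

Lemma polyfun_ext f g : f =1 g -> polyfun f -> polyfun g.
Proof. by move=> fg [l hl]; exists l => x; rewrite -fg. Qed.

Lemma polyfun_sum (J : Type) (r : seq J) (F : J -> T -> R) :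
  (forall j, polyfun (F j)) -> polyfun (fun x => \sum_(j <- r) F j x).
Proof.
move=> h; elim: r => [|j r IH].
  by apply: (polyfun_ext _ (polyfun_cst 0)) => x; rewrite big_nil.
by apply: (polyfun_ext _ (polyfunD (h j) IH)) => x; rewrite big_cons.
Qed.

Lemma polyfunX f n : polyfun f -> polyfun (fun x => f x ^+ n).
Proof.
move=> h; elim: n => [|n IH].
  by apply: (polyfun_ext _ (polyfun_cst 1)) => x; rewrite expr0.
by apply: (polyfun_ext _ (polyfunM h IH)) => x; rewrite exprS.
Qed.

Lemma polyfun_horner (q : {poly R}) f : polyfun f -> polyfun (fun x => q.[f x]).
Proof.
move=> h; apply: (@polyfun_ext (fun x => \sum_(i < size q) q`_i * f x ^+ i)).
  by move=> x; rewrite horner_coef.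
by apply: polyfun_sum => i; apply: polyfunZ; exact: polyfunX.
Qed.

Lemma polyfun_tk x : polyfun (tk x).
Proof. by apply: polyfun_sum => i; apply: polyfunZ; exact: polyfun_coord. Qed.

Lemma polyfun_tkr x : polyfun (tk^~ x).
Proof. by apply: (polyfun_ext _ (polyfun_tk x)) => y; rewrite tkC. Qed.

(** Kernels of finite rank, for which Fubini reduces to linearity of the mean. *)
Definition sep (K : T -> T -> R) : Prop :=
  exists l : seq (R * seq I * seq I), forall x y, K x y = \sum_(u <- l) u.1.1 * mono u.1.2 x * mono u.2 y.

Lemma sep_tk : sep tk.
Proof.
exists [seq (1, [:: i], [:: i]) | i <- index_enum I] => x y.
by rewrite big_map/=; apply: eq_bigr => i _; rewrite /mono !big_seq1 mul1r.
Qed.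

Lemma sepM K L : sep K -> sep L -> sep (fun x y => K x y * L x y).
Proof.
move=> [l hl] [m hm].
exists [seq (u.1.1 * v.1.1, u.1.2 ++ v.1.2, u.2 ++ v.2) | u <- l, v <- m] => x y.
rewrite hl hm big_distrlr/= big_allpairs_dep; apply: eq_bigr => u _; apply: eq_bigr => v _.
by rewrite /= /mono !big_cat/=; ring.
Qed.

Lemma sep_horner (q : {poly R}) : sep (fun x y => q.[tk x y]).
Proof.
elim/poly_ind: q => [|q c [l hl]].
  by exists [::] => x y; rewrite horner0 big_nil.
have [m hm] := sepM (ex_intro _ l hl) sep_tk.
exists ((c, [::], [::]) :: m) => x y.
by rewrite hornerMXaddC hm big_cons /= /mono !big_nil !mulr1 addrC.
Qed.

Variable X : set T.

(** Integration enters the convolution argument only through these three properties, so that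
    calculus is purely algebraic; boundedness and measurability are settled once, in
    [mean_mean_on]. *)
Record mean_on (E : (T -> R) -> R) : Prop := MeanOn {
  mean_on_lin : forall (J : Type) (r : seq J) (c : J -> R) (F : J -> T -> R),
     (forall j, polyfun (F j)) -> E (fun x => \sum_(j <- r) c j * F j x) = \sum_(j <- r) c j * E (F j);
  mean_on_ext : forall f g, (forall x, X x -> f x = g x) -> E f = E g;
  mean_on1 : E (fun=> 1) = 1 }.

Section Mean.
Variable E : (T -> R) -> R.
Hypothesis HE : mean_on E.

Lemma monD f g : polyfun f -> polyfun g -> E (fun x => f x + g x) = E f + E g.
Proof.
move=> hf hg.
have := mean_on_lin HE [:: true; false] (fun=> 1) (F := fun b => if b then f else g).
rewrite big_cons big_seq1 !mul1r => <-; last by case.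
by apply: (mean_on_ext HE) => x _; rewrite big_cons big_seq1 !mul1r.
Qed.

Lemma monZ c f : polyfun f -> E (fun x => c * f x) = c * E f.
Proof.
move=> hf.
have := mean_on_lin HE [:: tt] (fun=> c) (F := fun=> f); rewrite big_seq1 => <- //.
by apply: (mean_on_ext HE) => x _; rewrite big_seq1.
Qed.

Lemma mon_cst c : E (fun=> c) = c.
Proof.
rewrite -[RHS]mulr1 -(mean_on1 HE) -monZ; last exact: polyfun_cst.
by apply: (mean_on_ext HE) => x _; rewrite mulr1.
Qed.

Lemma mon_sum (J : Type) (r : seq J) (F : J -> T -> R) :
  (forall j, polyfun (F j)) -> E (fun x => \sum_(j <- r) F j x) = \sum_(j <- r) E (F j).
Proof.
move=> h; have := mean_on_lin HE r (fun=> 1) h.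
under [in RHS]eq_bigr do rewrite mul1r; move=> <-.
by apply: (mean_on_ext HE) => x _; apply: eq_bigr => j _; rewrite mul1r.
Qed.

(* Fubini for E, since the middle kernel is separable *)
Lemma mon_swap (f h : T -> R) (K : T -> T -> R) : polyfun f -> polyfun h -> sep K ->
  E (fun z => E (fun y => f y * K y z) * h z) = E (fun y => f y * E (fun z => K y z * h z)).
Proof.
move=> hf hh [l hl].
have L z : E (fun y => f y * K y z) = \sum_(u <- l) (u.1.1 * E (fun y => f y * mono u.1.2 y)) * mono u.2 z.
  transitivity (E (fun y => \sum_(u <- l) (u.1.1 * mono u.2 z) * (f y * mono u.1.2 y))).
    by apply: (mean_on_ext HE) => y _; rewrite hl mulr_sumr; apply: eq_bigr => u _; ring.
  rewrite (mean_on_lin HE); last by move=> u; apply: polyfunM => //; exact: polyfun_mono.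
  by apply: eq_bigr => u _; ring.
have L' y : E (fun z => K y z * h z) = \sum_(u <- l) (u.1.1 * E (fun z => mono u.2 z * h z)) * mono u.1.2 y.
  transitivity (E (fun z => \sum_(u <- l) (u.1.1 * mono u.1.2 y) * (mono u.2 z * h z))).
    by apply: (mean_on_ext HE) => z _; rewrite hl mulr_suml; apply: eq_bigr => u _; ring.
  rewrite (mean_on_lin HE); last by move=> u; apply: polyfunM => //; exact: polyfun_mono.
  by apply: eq_bigr => u _; ring.
transitivity (E (fun z => \sum_(u <- l) (u.1.1 * E (fun y => f y * mono u.1.2 y)) * (mono u.2 z * h z))).
  by apply: (mean_on_ext HE) => z _; rewrite L mulr_suml; apply: eq_bigr => u _; ring.
transitivity (E (fun y => \sum_(u <- l) (u.1.1 * E (fun z => mono u.2 z * h z)) * (f y * mono u.1.2 y))); last first.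
  by apply: (mean_on_ext HE) => y _; rewrite L' mulr_sumr; apply: eq_bigr => u _; ring.
rewrite !(mean_on_lin HE); try by move=> u; apply: polyfunM => //; exact: polyfun_mono.
by apply: eq_bigr => u _; ring.
Qed.

End Mean.

Section Zonal.
Hypothesis tk1 : forall x, X x -> tk x x = 1.
Variables (p : nat -> {poly R}) (nu : {poly R} -> R) (d : nat -> R).
Hypothesis size_p : forall k, size (p k) = k.+1.
Hypothesis p_at1 : forall k, (p k).[1] = 1.
Hypothesis nu_lin : forall a (u v : {poly R}), nu (a *: u + v) = a * nu u + nu v.
Hypothesis nu_orth : forall j k, j != k -> nu (p j * p k) = 0.
Hypothesis nu_norm : forall k, d k * nu (p k * p k) = 1.

Lemma nu0 : nu 0 = 0.
Proof. by have := nu_lin 1 0 0; rewrite scaler0 addr0 mul1r; move: (nu 0) => t; lra. Qed.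

Lemma nuZ a u : nu (a *: u) = a * nu u.
Proof. by have := nu_lin a u 0; rewrite nu0 !addr0. Qed.

Lemma nu_sum (J : Type) (r : seq J) (a : J -> R) (F : J -> {poly R}) :
  nu (\sum_(j <- r) a j *: F j) = \sum_(j <- r) a j * nu (F j).
Proof.
elim: r => [|j r IH]; first by rewrite !big_nil nu0.
by rewrite !big_cons nu_lin IH.
Qed.

Lemma p_basis n (h : {poly R}) : (size h <= n)%N ->
  exists a : nat -> R, h = \sum_(0 <= k < n) a k *: p k.
Proof.
elim: n h => [|n IH] h hn.
  exists (fun=> 0); rewrite big_nil; apply/eqP.
  by rewrite -size_poly_eq0 -leqn0.
have lead0 : (p n)`_n != 0.
  by have := lead_coef_eq0 (p n); rewrite lead_coefE size_p/= => ->; rewrite -size_poly_eq0 size_p.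
pose c := h`_n / (p n)`_n.
have [|a ha] := IH (h - c *: p n).
  apply/leq_sizeP => j; rewrite leq_eqVlt => /orP[/eqP <-|nj].
    by rewrite coefB coefZ /c divfK// subrr.
  rewrite coefB coefZ [h`_j]nth_default ?[(p n)`_j]nth_default ?size_p ?mulr0 ?subrr//.
  exact: leq_trans hn nj.
exists (fun k => if k == n then c else a k).
rewrite big_nat_recr//= eqxx -[LHS](subrK (c *: p n)) ha; congr (_ + _).
by rewrite !big_nat; apply: eq_bigr => k /andP[_ kn]; rewrite ltn_eqF.
Qed.

Lemma nu_norm_neq0 k : nu (p k * p k) != 0.
Proof. by apply/eqP => h; have := nu_norm k; rewrite h mulr0 => /eqP; rewrite eq_sym oner_eq0. Qed.

Lemma nu_p_low k (h : {poly R}) : (size h <= k)%N -> nu (p k * h) = 0.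
Proof.
move=> /p_basis [a ->]; rewrite mulr_sumr.
under eq_bigr do rewrite -scalerAr.
rewrite nu_sum big_nat big1// => j /andP[_ jk].
by rewrite nu_orth ?mulr0//; rewrite gtn_eqF.
Qed.

Section Convolution.
Variable E : (T -> R) -> R.
Hypothesis HE : mean_on E.
Hypothesis E_nu : forall x, X x -> forall q : {poly R}, E (fun y => q.[tk x y]) = nu q.
Hypothesis E_conv : forall f g : {poly R}, exists2 h : {poly R}, (size h <= size g)%N &
  forall x z, X x -> X z -> E (fun y => f.[tk x y] * g.[tk y z]) = h.[tk x z].

(** The convolution is a polynomial h(t(x,z)) of degree at most k, hence a combination of p_0, ...,
    p_k. Its components below k vanish by duality, and the coefficient of p_k is found by putting z
    = x. *)
Lemma conv_p k (g : {poly R}) x z : X x -> X z ->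
  E (fun y => (p k).[tk x y] * g.[tk y z]) = nu (p k * g) * (p k).[tk x z].
Proof.
move=> Xx Xz.
have pf (q : {poly R}) u : polyfun (fun y => q.[tk u y]) by apply/polyfun_horner/polyfun_tk.
have pfr (q : {poly R}) u : polyfun (fun y => q.[tk y u]) by apply/polyfun_horner/polyfun_tkr.
have [h hs hE] := E_conv g (p k).
have {}hE u v : X u -> X v -> E (fun y => (p k).[tk u y] * g.[tk y v]) = h.[tk u v].
  move=> Xu Xv; rewrite tkC -hE//; apply: (mean_on_ext HE) => y _.
  by rewrite mulrC [tk y v]tkC [tk u y]tkC.
rewrite size_p in hs; have [a ah] := p_basis hs.
have nuh j : (j <= k)%N -> nu (p j * h) = a j * nu (p j * p j).
  move=> jk; rewrite ah mulr_sumr; under eq_bigr do rewrite -scalerAr.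
  rewrite nu_sum (@big_cat_nat _ _ _ j)//=; last exact: leqW.
  rewrite big_nat big1 ?add0r; last first.
    by move=> i /andP[_ ij]; rewrite nu_orth ?mulr0// gtn_eqF.
  rewrite big_ltn ?ltnS// big_nat big1 ?addr0//.
  by move=> i /andP[ij _]; rewrite nu_orth ?mulr0// ltn_eqF.
(* Pair h with p_j and exchange the two means: g is then convolved with p_j, which gives degree at
   most j < k, and this is orthogonal to p_k. *)
have a0 j : (j < k)%N -> a j = 0.
  move=> jk; suff: nu (p j * h) = 0.
    rewrite (nuh _ (ltnW jk)) => /eqP; rewrite mulf_eq0 (negbTE (nu_norm_neq0 j)) orbF.
    by move/eqP.
  have [h2 h2s h2E] := E_conv g (p j).
  rewrite mulrC -(E_nu Xx (h * p j)).
  transitivity (E (fun u => E (fun y => (p k).[tk x y] * g.[tk y u]) * (p j).[tk u x])).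
    by apply: (mean_on_ext HE) => u Xu; rewrite hE// hornerM [tk u x]tkC.
  rewrite (mon_swap HE (K := fun y u => g.[tk y u]))//; last exact: sep_horner.
  transitivity (E (fun y => (p k * h2).[tk x y])).
    by apply: (mean_on_ext HE) => y Xy; rewrite hornerM h2E// [tk y x]tkC.
  rewrite E_nu// nu_p_low//; apply: leq_trans h2s _; by rewrite size_p.
have hk : h = a k *: p k.
  rewrite ah big_nat_recr//= big_nat big1 ?add0r// => j /andP[_ jk].
  by rewrite a0// scale0r.
rewrite hE// hk hornerZ; congr (_ * _).
have : h.[tk x x] = nu (p k * g).
  rewrite -hE// -(E_nu Xx); apply: (mean_on_ext HE) => y _.
  by rewrite hornerM [tk y x]tkC.
by rewrite tk1// hk hornerZ p_at1 mulr1.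
Qed.

Section TraceLimit.
Variables (x_ : nat -> T).
Hypothesis Xx_ : forall i, X (x_ i).
Hypothesis x_lln : forall a, (fun n => (\sum_(i < n) mono a (x_ i)) / n%:R) @ \oo --> E (mono a).

Definition kernel_mx (q : {poly R}) (N : nat) : 'M[R]_N :=
  N%:R^-1 *: \matrix_(i, j) q.[tk (x_ i) (x_ j)].

Lemma mxpow_cvg m (A : nat -> 'M[R]_m) (C : 'M[R]_m) :
  (forall a b, (fun N => A N a b) @ \oo --> C a b) ->
  forall k a b, (fun N => (A N ^+ k) a b) @ \oo --> (C ^+ k) a b.
Proof.
move=> h; elim=> [|k IH] a b.
  under eq_fun do rewrite expr0.
  by rewrite expr0; exact: cvg_cst.
rewrite exprS -mulmxE mxE.
rewrite (_ : (fun N => _) = (fun N => \sum_j A N a j * (A N ^+ k) j b)); last first.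
  by apply/funext => N; rewrite exprS -mulmxE mxE.
by apply: cvgn_sum => j; apply: cvgM.
Qed.

(** The kernel has finite rank, so the traces of powers are those of a matrix of fixed size whose
    entries are empirical means of monomials. The law of large numbers gives its limit C, and tr
    C^(k+1) is evaluated by iterated convolution. *)
Lemma kernel_mx_trace (q : {poly R}) k :
  (fun N => \tr (kernel_mx q N ^+ k.+1)) @ \oo -->
  \sum_(0 <= j < size q) d j * nu (p j * q) ^+ k.+1.
Proof.
have [l hl] := sep_horner q.
pose m := size l; pose u (a : 'I_m) := tnth (in_tuple l) a.
have hq x y : q.[tk x y] = \sum_(a < m) (u a).1.1 * mono (u a).1.2 x * mono (u a).2 y.
  by rewrite hl (big_tnth _ _ l).
(* The N x N matrix is F G / N, and tr (F G)^(k+1) = tr (G F)^(k+1), where G F is m x m. *)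
pose F N : 'M[R]_(N, m) := \matrix_(i, a) ((u a).1.1 * mono (u a).1.2 (x_ i)).
pose G N : 'M[R]_(m, N) := \matrix_(a, i) mono (u a).2 (x_ i).
pose M N : 'M[R]_m := N%:R^-1 *: (G N *m F N).
have KE N : kernel_mx q N = N%:R^-1 *: (F N *m G N).
  rewrite /kernel_mx; congr (_ *: _); apply/matrixP => i j; rewrite !mxE hq.
  by apply: eq_bigr => a _; rewrite !mxE.
have trE N : \tr (kernel_mx q N ^+ k.+1) = \tr (M N ^+ k.+1).
  have E1 n : kernel_mx q N ^+ n.+1 = F N *m (M N ^+ n) *m (N%:R^-1 *: G N).
    elim: n => [|n IH].
      by rewrite expr1 expr0 mulmx1 KE -scalemxAr.
    by rewrite exprSr IH KE [M N ^+ n.+1]exprSr -!mulmxE /M -!scalemxAr -!scalemxAl !mulmxA.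
  rewrite E1 mxtrace_mulC mulmxA -scalemxAl -/(M N) mulmxE -exprS//.
pose C : 'M[R]_m := \matrix_(a, b) E (fun x => mono (u a).2 x * ((u b).1.1 * mono (u b).1.2 x)).
have pm a : polyfun (mono a) by exact: polyfun_mono.
have MC a b : (fun N => M N a b) @ \oo --> C a b.
  rewrite mxE (_ : (fun N => _) = (fun N => (u b).1.1 * ((\sum_(i < N) mono ((u a).2 ++ (u b).1.2) (x_ i)) / N%:R))); last first.
    apply/funext => N; rewrite !mxE mulrA [RHS]mulrC; congr (_ * _); rewrite [RHS]mulr_sumr.
    by apply: eq_bigr => i _; rewrite !mxE /mono big_cat/=; ring.
  have -> : E (fun x => mono (u a).2 x * ((u b).1.1 * mono (u b).1.2 x)) =
     (u b).1.1 * E (mono ((u a).2 ++ (u b).1.2)).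
    rewrite -monZ//; apply: (mean_on_ext HE) => x _; rewrite /mono big_cat/=; ring.
  by apply: cvgM; [exact: cvg_cst|exact: x_lln].
have -> : \sum_(0 <= j < size q) d j * nu (p j * q) ^+ k.+1 = \tr (C ^+ k.+1); last first.
  under eq_fun do rewrite trE.
  by apply: cvgn_sum => a; exact: mxpow_cvg.
have [b bq] := p_basis (leqnn (size q)).
have bE j : (j < size q)%N -> b j = d j * nu (p j * q).
  move=> jq; rewrite [in RHS]bq mulr_sumr; under eq_bigr do rewrite -scalerAr.
  rewrite nu_sum (@big_cat_nat _ _ _ j)//=; last exact: ltnW.
  rewrite big_nat big1 ?add0r; last first.
    by move=> i /andP[_ ij]; rewrite nu_orth ?mulr0// gtn_eqF.
  rewrite big_ltn// big_nat big1 ?addr0; last first.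
    by move=> i /andP[ij _]; rewrite nu_orth ?mulr0// ltn_eqF.
  by rewrite mulrCA nu_norm mulr1.
(* [KK n] is the (n+1)-fold convolution of q with itself. By [conv_p] it is diagonal in the p_j, and
   its mean over x = z is tr C^(n+1). *)
pose KK n x z := \sum_a \sum_c (u a).1.1 * mono (u a).1.2 x * (C ^+ n) a c * mono (u c).2 z.
have KKE n x z : X x -> X z ->
   KK n x z = \sum_(0 <= j < size q) b j * nu (p j * q) ^+ n * (p j).[tk x z].
  elim: n x z => [|n IH] x z Xx Xz.
    have -> : KK 0%N x z = q.[tk x z].
      rewrite hq; apply: eq_bigr => a _; rewrite expr0 (bigD1 a)//= mxE eqxx mulr1.
      rewrite big1 ?addr0// => c ca; rewrite mxE eq_sym (negbTE ca) mulr0 mul0r//.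
    rewrite [in LHS]bq horner_sum; apply: eq_bigr => j _.
    by rewrite hornerZ expr0 mulr1.
  have -> : KK n.+1 x z = E (fun y => KK n x y * q.[tk y z]).
    transitivity (E (fun y => \sum_e (mono (u e).2 z) *
       (\sum_a \sum_c ((u a).1.1 * mono (u a).1.2 x * (C ^+ n) a c) *
          (mono (u c).2 y * ((u e).1.1 * mono (u e).1.2 y))))); last first.
      apply: (mean_on_ext HE) => y _; rewrite hq mulr_sumr; apply: eq_bigr => e _.
      rewrite mulr_sumr [RHS]mulrC mulr_sumr; apply: eq_bigr => a _.
      by rewrite !mulr_sumr; apply: eq_bigr => c _; ring.
    have pp c e : polyfun (fun y => mono (u c).2 y * ((u e).1.1 * mono (u e).1.2 y)).
      by apply: polyfunM => //; exact: polyfunZ.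
    rewrite (mean_on_lin HE); last first.
      by move=> e; apply: polyfun_sum => a; apply: polyfun_sum => c; exact: polyfunZ.
    rewrite /KK [LHS]exchange_big/=; apply: eq_bigr => e _.
    rewrite (mon_sum HE); last by move=> a; apply: polyfun_sum => c; exact: polyfunZ.
    rewrite mulr_sumr; apply: eq_bigr => a _.
    rewrite (mean_on_lin HE)// exprSr -mulmxE mxE mulr_sumr mulr_suml mulr_sumr.
    by apply: eq_bigr => c _; rewrite [C c e]mxE; ring.
  transitivity (E (fun y => \sum_(0 <= j < size q) (b j * nu (p j * q) ^+ n) * ((p j).[tk x y] * q.[tk y z]))).
    apply: (mean_on_ext HE) => y Xy; rewrite IH// mulr_suml; apply: eq_bigr => j _; ring.
  rewrite (mean_on_lin HE); last first.
    by move=> j; apply: polyfunM; [apply/polyfun_horner/polyfun_tk|apply/polyfun_horner/polyfun_tkr].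
  by apply: eq_bigr => j _; rewrite conv_p// exprSr; ring.
transitivity (E (fun x => KK k x x)).
  transitivity (E (fun=> \sum_(0 <= j < size q) d j * nu (p j * q) ^+ k.+1)); first by rewrite (mon_cst HE).
  apply: (mean_on_ext HE) => x Xx; rewrite KKE// !big_nat; apply: eq_bigr => j /andP[_ jq].
  by rewrite tk1// p_at1 mulr1 bE// exprS; ring.
rewrite exprS -mulmxE /mxtrace.
transitivity (E (fun x => \sum_a \sum_c (C ^+ k) a c * (mono (u c).2 x * ((u a).1.1 * mono (u a).1.2 x)))).
  apply: (mean_on_ext HE) => x _; apply: eq_bigr => a _; apply: eq_bigr => c _; ring.
have pp c e : polyfun (fun y => mono (u c).2 y * ((u e).1.1 * mono (u e).1.2 y)).
  by apply: polyfunM => //; exact: polyfunZ.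
rewrite (mon_sum HE); last by move=> a; apply: polyfun_sum => c; exact: polyfunZ.
under [RHS]eq_bigr do rewrite mxE.
rewrite [RHS]exchange_big/=; apply: eq_bigr => a _.
rewrite (mean_on_lin HE)//; apply: eq_bigr => c _.
by rewrite [C c a]mxE mulrC.
Qed.

End TraceLimit.
End Convolution.
End Zonal.
End PolyFun.

Section PolyMean.
Context {R : realType} {dT : measure_display} {T : measurableType dT} {I : finType}.
Variables (coord : I -> T -> R) (X : set T).
Hypothesis coord_meas : forall i, measurable_fun setT (coord i).
Hypothesis mX : measurable X.
Hypothesis tk1 : forall x, X x -> tk coord x x = 1.

Lemma coord_le1 i x : X x -> `|coord i x| <= 1.
Proof.
move=> /tk1 h; rewrite -(@ler_pXn2r _ 2)// ?nnegrE// expr1n real_normK ?num_real//.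
rewrite -h /tk (bigD1 i)//= -expr2 lerDl; apply: sumr_ge0 => j _.
by rewrite -expr2 sqr_ge0.
Qed.

Lemma tk_itv x y : X x -> X y -> -1 <= tk coord x y <= 1.
Proof.
move=> /tk1 hx /tk1 hy; rewrite -ler_norml -(@ler_pXn2r _ 2)// ?nnegrE// expr1n real_normK ?num_real//.
have := cauchy_schwarz (index_enum I) (fun i => coord i x) (fun i => coord i y).
rewrite -/(tk coord x y); congr (_ <= _); rewrite -[RHS]mulr1 -{2}hx -hy /tk.
by rewrite mulrC; congr (_ * _); apply: eq_bigr => i _; rewrite expr2.
Qed.

Lemma mono_meas a : measurable_fun setT (mono coord a).
Proof. by apply: measurable_prod => i _; exact: coord_meas. Qed.

Lemma mono_le1 a x : X x -> `|mono coord a x| <= 1.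
Proof.
move=> Xx; rewrite /mono normr_prod; apply: prodr_ile1 => i _.
by rewrite normr_ge0 coord_le1.
Qed.

Lemma polyfun_bmf f : polyfun coord f -> bmf X f.
Proof.
move=> [l hl]; rewrite (funext hl); apply: bmf_sum => u; apply: bmfZ; split.
  exact: measurable_funTS (mono_meas _).
by exists 1 => x Xx; exact: mono_le1.
Qed.

Lemma mean_mean_on (mu : probability T R) : mu X = 1%E -> mean_on coord X (mean mu X).
Proof.
move=> muX; split.
- move=> J r c F hF; rewrite (mean_sum _ mX); last by move=> j; apply: bmfZ; exact: polyfun_bmf.
  by apply: eq_bigr => j _; rewrite meanZ//; exact: polyfun_bmf.
- by move=> f g h; exact: eq_mean.
- exact: mean_cst.
Qed.

End PolyMean.

(** * Replacing the indicator kernel by a polynomial kernel *)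

Section Criterion.
Context {R : realType} {dT : measure_display} {T : measurableType dT} {I : finType}.
Variables (coord : I -> T -> R) (X : set T) (dist : T -> T -> R) (G : set (T -> T)) (L : R).
Variables (c d : nat -> R) (p : nat -> {poly R}) (nu : {poly R} -> R) (tau0 : R).
Hypothesis coord_meas : forall i, measurable_fun setT (coord i).
Hypothesis mX : measurable X.
Hypothesis tk1 : forall x, X x -> tk coord x x = 1.
Hypothesis dist_tk : forall x y, X x -> X y -> (dist x y <= L) = (tau0 <= tk coord x y).
Hypothesis size_p : forall k, size (p k) = k.+1.
Hypothesis p_at1 : forall k, (p k).[1] = 1.
Hypothesis nu_lin : forall a (u v : {poly R}), nu (a *: u + v) = a * nu u + nu v.
Hypothesis nu_orth : forall j k, j != k -> nu (p j * p k) = 0.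
Hypothesis nu_norm : forall k, d k * nu (p k * p k) = 1.
Hypothesis d_ge1 : forall k, 1 <= d k.
Hypothesis c_bessel : forall K, \sum_(0 <= k < K) d k * c k ^+ 2 <= 1.
Hypothesis approx : forall e : R, 0 < e -> exists q Q : {poly R},
  [/\ forall t, -1 <= t <= 1 -> ((tau0 <= t)%R%:R - q.[t]) ^+ 2 <= Q.[t],
      nu Q <= e &
      forall K, \sum_(0 <= k < K) d k * (c k - nu (p k * q)) ^+ 2 <= e].
Hypothesis mean_inv : forall mu : probability T R, mu X = 1%E -> invariant_under G mu ->
  (forall x, X x -> forall q : {poly R}, mean mu X (fun y => q.[tk coord x y]) = nu q) /\
  (forall f g : {poly R}, exists2 h : {poly R}, (size h <= size g)%N &
    forall x z, X x -> X z ->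
      mean mu X (fun y => f.[tk coord x y] * g.[tk coord y z]) = h.[tk coord x z]).

Lemma mulr_inv_sqr (x y : R) : 0 < x -> x * (x ^- 2 * y) = y / x.
Proof. by move=> x0; field; exact: lt0r_neq0. Qed.

Section Path.
Variables (mu : probability T R) (x_ : nat -> T) (s : nat -> seq R).
Hypothesis muX : mu X = 1%E.
Hypothesis mu_inv : invariant_under G mu.
Hypothesis Xx_ : forall i, X (x_ i).
Hypothesis x_lln : forall a, (fun n => (\sum_(i < n) mono coord a (x_ i)) / n%:R) @ \oo --> mean mu X (mono coord a).

Let A N : 'M[R]_N := N%:R^-1 *: \matrix_(i < N, j < N)
    (if (i != j) && (dist (x_ i) (x_ j) <= L) then 1 else 0).
Hypothesis s_spec : forall N, is_spectrum (A N) (s N).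

Let B q N := kernel_mx coord x_ q N.

Lemma A_trace N k : \sum_(x <- s N) x ^+ k = \tr (A N ^+ k).
Proof. by rewrite (mxtrace_expr_roots (s_spec N)). Qed.

Lemma A_hs N : hsmx (A N) <= 1.
Proof.
rewrite -(@ler_pXn2r _ 2)// ?nnegrE ?hs_ge0// expr1n hsmx_sqr.
case: N => [|N]; first by rewrite big_ord0.
have N0 : (0 : R) < N.+1%:R by rewrite ltr0n.
have -> : 1 = \sum_(i < N.+1) \sum_(j < N.+1) (N.+1%:R ^- 2 : R).
  by rewrite !sumr_const card_ord -mulrnA -[RHS]mulr_natl natrM -expr2 mulfV// expf_neq0// lt0r_neq0.
apply: ler_sum => i _; apply: ler_sum => j _; rewrite !mxE.
case: ifP => _; last by rewrite mulr0 expr0n invr_ge0 exprn_ge0// ltW.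
by rewrite mulr1 exprVn.
Qed.

Lemma s_le1 N : \sum_(x <- s N) x ^+ 2 <= 1.
Proof.
rewrite A_trace expr2 -mulmxE; apply: le_trans (ler_norm _) _.
apply: le_trans (hsmx_trmul _ _) _; have h := A_hs N.
by rewrite -[leRHS]mulr1; apply: ler_pM; rewrite ?hs_ge0.
Qed.

Lemma kernel_avg_cvg (Q : {poly R}) :
  (fun N => \sum_(i < N) \sum_(j < N) N%:R ^- 2 * Q.[tk coord (x_ i) (x_ j)]) @ \oo --> nu Q.
Proof.
have [Enu _] := mean_inv muX mu_inv.
have HE := mean_mean_on coord_meas mX tk1 muX.
have [l hl] := sep_horner coord Q.
rewrite (_ : (fun N => _) = (fun N => \sum_(u <- l) u.1.1 * ((\sum_(i < N) mono coord u.1.2 (x_ i)) / N%:R) *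
   ((\sum_(i < N) mono coord u.2 (x_ i)) / N%:R))); last first.
  apply/funext => N.
  transitivity (\sum_(i < N) \sum_(j < N) \sum_(u <- l)
     N%:R ^- 2 * (u.1.1 * mono coord u.1.2 (x_ i) * mono coord u.2 (x_ j))).
    by apply: eq_bigr => i _; apply: eq_bigr => j _; rewrite hl mulr_sumr.
  under eq_bigr do rewrite exchange_big/=.
  rewrite exchange_big/=; apply: eq_bigr => u _.
  have -> : u.1.1 * ((\sum_(i < N) mono coord u.1.2 (x_ i)) / N%:R) *
     ((\sum_(i < N) mono coord u.2 (x_ i)) / N%:R) = N%:R ^- 2 * u.1.1 *
     ((\sum_(i < N) mono coord u.1.2 (x_ i)) * (\sum_(i < N) mono coord u.2 (x_ i))).
    by rewrite -exprVn; ring.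
  rewrite big_distrlr/= mulr_sumr; apply: eq_bigr => i _; rewrite mulr_sumr; apply: eq_bigr => j _.
  by ring.
have -> : nu Q = \sum_(u <- l) u.1.1 * mean mu X (mono coord u.1.2) * mean mu X (mono coord u.2).
  have pm a : polyfun coord (mono coord a) by exact: polyfun_mono.
  transitivity (mean mu X (fun x => \sum_(u <- l) u.1.1 * mean mu X (mono coord u.2) * mono coord u.1.2 x)).
    transitivity (mean mu X (fun=> nu Q)); first by rewrite mean_cst.
    apply: (mean_on_ext HE) => x Xx; rewrite -(Enu x Xx).
    transitivity (mean mu X (fun y => \sum_(u <- l) (u.1.1 * mono coord u.1.2 x) * mono coord u.2 y)).
      by apply: (mean_on_ext HE) => y _; rewrite hl.
    by rewrite (mean_on_lin HE)//; apply: eq_bigr => u _; ring.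
  by rewrite (mean_on_lin HE)//; apply: eq_bigr => u _; ring.
by apply: cvgn_sum => u; apply: cvgM => //; apply: cvgM => //; exact: cvg_cst.
Qed.

(** Off the diagonal, Q dominates the squared error of q. On it the adjacency matrix is 0 while the
    kernel equals q(1): N entries, each contributing q(1)^2 / N^2. *)
Lemma AB_hs (q Q : {poly R}) N : (forall t, -1 <= t <= 1 -> ((tau0 <= t)%R%:R - q.[t]) ^+ 2 <= Q.[t]) ->
  hsmx (A N - B q N) ^+ 2 <=
  \sum_(i < N) \sum_(j < N) N%:R ^- 2 * Q.[tk coord (x_ i) (x_ j)] + q.[1] ^+ 2 / N%:R.
Proof.
move=> hQ; rewrite hsmx_sqr.
case: N => [|N]; first by rewrite !big_ord0 invr0 mulr0 addr0.
have N0 : (0 : R) < N.+1%:R by rewrite ltr0n.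
have Q0 t : -1 <= t <= 1 -> 0 <= Q.[t] by move=> /hQ; apply: le_trans; exact: sqr_ge0.
have -> : q.[1] ^+ 2 / N.+1%:R = \sum_(i < N.+1) N.+1%:R ^- 2 * q.[1] ^+ 2.
  by rewrite sumr_const card_ord -[RHS]mulr_natl mulr_inv_sqr.
rewrite -big_split/=; apply: ler_sum => i _.
rewrite [X in X <= _](bigD1 i)//= [X in X + _ <= _](_ : _ = N.+1%:R ^- 2 * q.[1] ^+ 2); last first.
  by rewrite !mxE eqxx/= tk1// mulr0 sub0r sqrrN exprMn exprVn.
rewrite [leLHS]addrC lerD2r [leRHS](bigD1 i)//=.
have c0 : (0 : R) <= N.+1%:R ^- 2 by rewrite invr_ge0 exprn_ge0// ltW.
rewrite -[leLHS]add0r; apply: lerD.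
  by rewrite mulr_ge0// Q0// (tk_itv tk1).
apply: ler_sum => j ji; rewrite !mxE eq_sym ji/= dist_tk// -mulrBr exprMn exprVn.
by apply: ler_wpM2l => //; apply: le_trans (hQ _ (tk_itv tk1 (Xx_ i) (Xx_ j))); case: (tau0 <= _).
Qed.

Lemma moments_asymp k : asymp (fun N => \sum_(x <- s N) x ^+ k.+2)
                              (fun K => \sum_(0 <= j < K) d j * c j ^+ k.+2).
Proof.
have d0 j : 0 <= d j := le_trans ler01 (d_ge1 j).
apply: asymp_approx => e e0.
(* The Lipschitz constant of the moment of order k+2 on the Hilbert-Schmidt ball of radius 4. The
   radius is generous: the norm of A is at most 1 and that of B at most 1 + r <= 2, and likewise for
   the two limiting sequences. *)
pose D : R := k.+2%:R * 4 ^+ k.+1.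
have D0 : 0 < D by rewrite mulr_gt0 ?ltr0n// exprn_gt0.
pose r := Num.min 1 (e / D).
have r0 : 0 < r by rewrite lt_min ltr01 divr_gt0.
have r1 : r <= 1 by rewrite ge_min lexx.
have re : D * r <= e by rewrite mulrC -ler_pdivlMr// ge_min lexx orbT.
(* Half of r^2 goes to [nu Q]; the other half is shared by the law of large numbers and the diagonal
   term. *)
have r22 : 0 < r ^+ 2 / 2 by rewrite divr_gt0// exprn_gt0.
have [q [Q [hQ nuQ hK]]] := approx r22.
have [Enu Econv] := mean_inv muX mu_inv.
have HE := mean_mean_on coord_meas mX tk1 muX.
have trB q' n := @kernel_mx_trace _ _ _ _ _ tk1 p nu d size_p p_at1 nu_lin nu_orth nu_norm _ HE Enu Econv _ x_lln q' n.
exists (fun N => \tr (B q N ^+ k.+2)), (fun K => \sum_(0 <= j < K) d j * nu (p j * q) ^+ k.+2).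
have hK' K : \sum_(0 <= j < K) d j * (c j - nu (p j * q)) ^+ 2 <= r ^+ 2.
  by apply: le_trans (hK K) _; rewrite ler_pdivrMr// ler_peMr ?sqr_ge0// ler1n.
have hq4 K : \sum_(0 <= j < K) d j * nu (p j * q) ^+ 2 <= 4 ^+ 2.
  apply: (@le_trans _ _ (\sum_(0 <= j < K) (2 * (d j * c j ^+ 2) + 2 * (d j * (c j - nu (p j * q)) ^+ 2)))).
    apply: ler_sum => j _.
    have -> : 2 * (d j * c j ^+ 2) + 2 * (d j * (c j - nu (p j * q)) ^+ 2) =
      d j * (nu (p j * q) ^+ 2 + (2 * c j - nu (p j * q)) ^+ 2) by ring.
    by rewrite ler_wpM2l// lerDl sqr_ge0.
  rewrite big_split/= -!mulr_sumr.
  have := c_bessel K; have := hK' K; have : r ^+ 2 <= 1 by rewrite exprn_ile1// ltW.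
  by rewrite expr2; lra.
have le4 (z : nat -> R) : (forall K, \sum_(0 <= j < K) d j * z j ^+ 2 <= 4 ^+ 2) -> forall j, `|z j| <= 4.
  move=> hz j; rewrite -(@ler_pXn2r _ 2)// ?nnegrE// real_normK ?num_real//.
  apply: le_trans (hz j.+1); rewrite big_nat_recr//= -[leLHS]add0r; apply: lerD.
    by apply: sumr_ge0 => i _; rewrite mulr_ge0 ?sqr_ge0.
  by rewrite ler_peMl ?sqr_ge0.
have c4 K : \sum_(0 <= j < K) d j * c j ^+ 2 <= 4 ^+ 2.
  by apply: le_trans (c_bessel K) _; rewrite exprn_ege1// ler1n.
split.
- move=> e' e'0; have := trB q k.+1; move/cvgrPdist_le => /(_ _ e'0).
  apply: filterS => N hN; near=> K; rewrite distrC.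
  have -> : \sum_(0 <= j < K) d j * nu (p j * q) ^+ k.+2 =
     \sum_(0 <= j < size q) d j * nu (p j * q) ^+ k.+2; last exact: hN.
  rewrite (@big_cat_nat _ _ _ (size q) 0 K)//=; last by near: K; exact: nbhs_infty_ge.
  rewrite [X in _ + X]big_nat [X in _ + X]big1 ?addr0// => j /andP[qj _].
  by rewrite (nu_p_low size_p nu_lin nu_orth)// expr0n mulr0.
- have e2 : 0 < r ^+ 2 / 4 by rewrite divr_gt0// exprn_gt0.
  have := @kernel_avg_cvg Q => /cvgrPdist_le /(_ _ e2) H.
  pose M := (Num.truncn (q.[1] ^+ 2 / (r ^+ 2 / 4))).+1.
  near=> N.
  have h1 : `|nu Q - \sum_(i < N) \sum_(j < N) N%:R ^- 2 * Q.[tk coord (x_ i) (x_ j)]| <= r ^+ 2 / 4.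
    by near: N; exact: H.
  have MN : (M <= N)%N by near: N; exact: nbhs_infty_ge.
  have N0 : (0 : R) < N%:R by rewrite ltr0n; apply: leq_trans MN.
  have h2 : q.[1] ^+ 2 / N%:R <= r ^+ 2 / 4.
    rewrite ler_pdivrMr// -ler_pdivrMl// mulrC ltW//; apply: lt_le_trans (truncnS_gt _) _.
    by rewrite ler_nat.
  have hAB : hsmx (A N - B q N) <= r.
    rewrite -(@ler_pXn2r _ 2)// ?nnegrE ?hs_ge0 ?(ltW r0)//; apply: le_trans (AB_hs N hQ) _.
    by move: h1; rewrite ler_norml => /andP[]; lra.
  have hA4 : hsmx (A N) <= 4 by apply: le_trans (A_hs N) _; rewrite ler1n.
  have hB4 : hsmx (B q N) <= 4.
    have -> : B q N = A N + (B q N - A N) by rewrite addrC subrK.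
    apply: le_trans (hsmx_add _ _) _.
    have -> : hsmx (B q N - A N) = hsmx (A N - B q N).
      by rewrite /hsmx /hs; congr Num.sqrt; apply: eq_bigr => i _; rewrite !mxE -sqrrN opprB.
    by have := A_hs N; lra.
  rewrite A_trace; apply: le_trans re.
  apply: le_trans (mxtrace_exprB _ hA4 hB4) _.
  by rewrite -/D ler_pM2l.
- near=> K; apply: le_trans re; rewrite /D.
  by apply: weighted_exprB => //; [exact: ltW|exact: le4|exact: le4].
Unshelve. all: by end_near. Qed.

End Path.

Theorem GK_criterion : GK_spectral_limit X dist G L c d.
Proof.
move=> dO Om P mu V muX mu_inv HV.
(* Monomials are enumerated by [unpickle] so that countably many almost sure statements merge into
   one, independent of the spectra and of the approximating polynomials chosen later. *)
have lln : {ae P, forall w, forall n, forall a : seq I, a = odflt [::] (choice.unpickle n) ->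
   (fun n => (\sum_(i < n) mono coord a (V i w)) / n%:R) @ \oo --> mean mu X (mono coord a)}.
  apply: ae_foralln => n.
  have := slln_bounded HV mX muX (mono_meas coord_meas (odflt [::] (choice.unpickle n)))
    (fun x => @mono_le1 _ _ _ _ _ _ tk1 _ x).
  by apply: filterS => w hw a ->.
apply: filterS2 (V_in_X HV mX muX) lln => w hX hw s hs.
have x_lln a : (fun n => (\sum_(i < n) mono coord a (V i w)) / n%:R) @ \oo --> mean mu X (mono coord a).
  by apply: (hw (choice.pickle a)); rewrite choice.pickleK.
apply: (moments_delta2 (s := s)) => //.
- exact: (s_le1 (x_ := fun i => V i w) hs).
- exact: (moments_asymp (x_ := fun i => V i w) muX mu_inv hX x_lln hs).
Qed.

End Criterion.

(** * Polynomial approximation of the step function in mean square *)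

Section Band.
Context {R : realType}.
Variables (s e : R).
Hypothesis e0 : 0 < e.

(** A trapezoidal bump, 1 within e / 2 of s and 0 beyond e. It dominates the squared error between
    the step at s and the ramp that replaces it. *)
Let b (x : R) := ramp (s - e) (s - e / 2) x - ramp (s + e / 2) (s + e) x.

Let o1 : s - e / 2 < s + e / 2. Proof. by move: e0; lra. Qed.
Let o2 : s - e < s - e / 2. Proof. by move: e0; lra. Qed.
Let o3 : s + e / 2 < s + e. Proof. by move: e0; lra. Qed.

Lemma band_step (t : R) : ((s <= t)%R%:R - ramp (s - e / 2) (s + e / 2) t) ^+ 2 <= b t.
Proof.
have := e0; rewrite /b => ?.
have /andP[] := ramp01 (s - e / 2) (s + e / 2) t.
case: (leP t (s - e / 2)) => h3.
  have -> : (s <= t) = false by apply/negbTE; rewrite -ltNge; lra.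
  rewrite (ramp_le o1 h3) subrr expr0n/= (ramp_le o3); last lra.
  by have /andP[] := ramp01 (s - e) (s - e / 2) t; lra.
case: (leP (s + e / 2) t) => h4.
  have -> : (s <= t) by lra.
  rewrite (ramp_ge o1 h4) subrr expr0n/= (ramp_ge o2); last lra.
  by have /andP[] := ramp01 (s + e / 2) (s + e) t; lra.
rewrite (ramp_ge o2 (ltW h3)) (ramp_le o3 (ltW h4)) subr0.
move: (ramp _ _ _) => r; case: (s <= t); rewrite expr2 /=; nra.
Qed.

Lemma band_le1 (t : R) : b t <= 1.
Proof.
have := ramp01 (s - e) (s - e / 2) t; have := ramp01 (s + e / 2) (s + e) t.
by rewrite /b; move: (ramp _ _ _) (ramp _ _ _) => x y /andP[? ?] /andP[? ?]; lra.
Qed.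

Lemma band_ge (t : R) : s + e <= t -> b t = 0.
Proof. by move=> h; rewrite /b (ramp_ge o3 h) (ramp_ge o2) ?subrr//; move: e0 h; lra. Qed.

Lemma band_le (t : R) : t <= s - e -> b t = 0.
Proof. by move=> h; rewrite /b (ramp_le o2 h) (ramp_le o3) ?subrr//; move: e0 h; lra. Qed.

Lemma band_lip (x y : R) :
  `|b x - b y| <= ((s - e / 2 - (s - e))^-1 + (s + e - (s + e / 2))^-1) * `|x - y|.
Proof.
rewrite /b.
set u := ramp _ _ x; set v := ramp _ _ x; set u' := ramp _ _ y; set v' := ramp _ _ y.
have -> : u - v - (u' - v') = (u - u') - (v - v') by ring.
apply: le_trans (ler_normB _ _) _; rewrite mulrDl.
by apply: lerD; exact: ramp_lip.
Qed.

(** With r the ramp, (step - q)^2 <= 2 (step - r)^2 + 2 (r - q)^2 <= 2 b + 2 d^2, and b <= qb + d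
    for the polynomial qb that approximates the bump. *)
Lemma step_approx (d : R) : 0 < d -> d <= 1 -> exists q qb : {poly R},
  [/\ forall t : R, -1 <= t <= 1 ->
        ((s <= t)%R%:R - q.[t]) ^+ 2 <= (2 *: (qb + d%:P) + (2 * d ^+ 2)%:P).[t],
      forall t : R, -1 <= t <= 1 -> qb.[t] <= 2,
      forall t : R, -1 <= t <= 1 -> s + e <= t -> qb.[t] <= d &
      forall t : R, -1 <= t <= 1 -> t <= s - e -> qb.[t] <= d].
Proof.
move=> d0 d1.
have [q hq] := lipschitz_poly_approx (fun x y _ _ => ramp_lip o1 x y) d0.
have [qb hqb] := lipschitz_poly_approx (fun x y _ _ => band_lip x y) d0.
have qle (t : R) : -1 <= t <= 1 -> qb.[t] <= b t + d.
  by move=> /hqb; rewrite ler_norml -/(b t) => /andP[_]; move: (b t) => u; lra.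
exists q, qb; split.
- move=> t ht; rewrite hornerD hornerZ hornerD !hornerC.
  have h1 := hq t ht; have := hqb t ht; have := band_step t.
  rewrite -/(b t).
  move: h1; move: (ramp _ _ t) => r h1 hb; rewrite ler_norml => /andP[h2 _].
  have h5 : (r - q.[t]) ^+ 2 <= d ^+ 2.
    by move: h1; rewrite distrC => h1; rewrite -[X in X <= _]real_normK ?num_real// lerXn2r ?nnegrE// ltW.
  have : 0 <= (((s <= t)%R%:R - r) - (r - q.[t])) ^+ 2 by exact: sqr_ge0.
  move: hb h5 h2; move: (b t) => B; move: ((s <= t)%R%:R) => S.
  rewrite !expr2; nra.
- by move=> t /qle h; apply: (le_trans h); rewrite -[2]/(1 + 1); apply: lerD (band_le1 t) d1.
- by move=> t /qle h /band_ge bt; rewrite bt add0r in h.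
- by move=> t /qle h /band_le bt; rewrite bt add0r in h.
Qed.
End Band.

Section Model.
Context {R : realType}.
Variables (th L C : R) (tau w : R -> R) (Prm : {poly R} -> R -> R).
Hypotheses (L0 : 0 < L) (Lth : L < th).
Hypothesis Prm_lin : forall a u v x, 0 <= x <= th -> Prm (a *: u + v) x = a * Prm u x + Prm v x.
Hypothesis Prm0 : forall q, Prm q 0 = 0.
Hypothesis Prm_der : forall q x, 0 <= x <= th -> is_derive x 1 (Prm q) (q.[tau x] * w x).
Hypothesis w_itv : forall x, 0 <= x <= th -> 0 <= w x <= C.
Hypothesis Prm1 : Prm 1 th = 1.
Hypothesis tau_decr : forall x y, 0 <= x -> x < y -> y <= th -> tau y < tau x.
Hypothesis tau_itv : forall x, 0 <= x <= th -> -1 <= tau x <= 1.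

Let nu q := Prm q th.

Lemma Prm_add u v x : 0 <= x <= th -> Prm (u + v) x = Prm u x + Prm v x.
Proof. by move=> hx; rewrite -[u in LHS]scale1r Prm_lin// mul1r. Qed.

Lemma Prm_zero x : 0 <= x <= th -> Prm 0 x = 0.
Proof. by move=> hx; have := Prm_add 0 0 hx; rewrite addr0; move: (Prm 0 x) => t; lra. Qed.

Lemma Prm_scale a u x : 0 <= x <= th -> Prm (a *: u) x = a * Prm u x.
Proof. by move=> hx; rewrite -[a *: u]addr0 Prm_lin// Prm_zero// addr0. Qed.

Lemma th0 : 0 < th. Proof. exact: lt_trans Lth. Qed.

(** [Prm q x] stands for the integral of q(tau) w over [0, x] but is known only through its
    derivative, so comparison rests on the mean value theorem. *)
Lemma le_Prm (u v : {poly R}) x y : 0 <= x -> x <= y -> y <= th ->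
  (forall z, x < z < y -> u.[tau z] <= v.[tau z]) -> Prm u y - Prm u x <= Prm v y - Prm v x.
Proof.
move=> x0; rewrite le_eqVlt => /orP[/eqP -> _ _|xy yth h]; first by rewrite !subrr.
have inside z : x <= z <= y -> 0 <= z <= th.
  by move=> /andP[h1 h2]; rewrite (le_trans x0 h1) (le_trans h2 yth).
pose f z := Prm v z - Prm u z.
have fd z : x <= z <= y -> is_derive z 1 f ((v.[tau z] - u.[tau z]) * w z).
  move=> hz; rewrite mulrBl; apply: is_deriveB; exact: Prm_der (inside _ hz).
have [||c hc hfc] := @MVT R f (fun z => (v.[tau z] - u.[tau z]) * w z) x y xy.
- by move=> z; rewrite in_itv/= => /andP[h1 h2]; apply: fd; rewrite !ltW.
- apply: derivable_within_continuous => z; rewrite in_itv/= => hz.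
  by case: (fd z hz).
suff : f x <= f y by rewrite /f; lra.
rewrite -subr_ge0 hfc mulr_ge0 ?subr_ge0 ?(ltW xy)//.
move: hc; rewrite in_itv/= => hc; rewrite mulr_ge0 ?subr_ge0 ?h//.
case/andP: hc => h1 h2.
have /w_itv/andP[] // : 0 <= c <= th by apply: inside; rewrite !ltW.
Qed.

Lemma Prm1_mono x y : 0 <= x -> x <= y -> y <= th -> 0 <= Prm 1 y - Prm 1 x.
Proof.
move=> x0 xy yth.
have h1 : 0 <= x <= th by rewrite x0 (le_trans xy).
have h2 : 0 <= y <= th by rewrite (le_trans x0 xy).
have := @le_Prm 0 1 x y x0 xy yth; rewrite !Prm_zero// subrr; apply=> z _.
by rewrite !hornerE.
Qed.

Lemma Prm1_le x y : 0 <= x -> x <= y -> y <= th -> Prm 1 y - Prm 1 x <= C * (y - x).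
Proof.
move=> x0; rewrite le_eqVlt => /orP[/eqP -> _|xy yth]; first by rewrite !subrr mulr0.
have inside z : x <= z <= y -> 0 <= z <= th.
  by move=> /andP[h1 h2]; rewrite (le_trans x0 h1) (le_trans h2 yth).
have fd z : x <= z <= y -> is_derive z 1 (Prm 1) (w z).
  by move=> hz; have := Prm_der 1 (inside _ hz); rewrite hornerC mul1r.
have [||c hc ->] := @MVT R (Prm 1) w x y xy.
- by move=> z; rewrite in_itv/= => /andP[h1 h2]; apply: fd; rewrite !ltW.
- by apply: derivable_within_continuous => z; rewrite in_itv/= => hz; case: (fd z hz).
rewrite ler_wpM2r ?subr_ge0 ?(ltW xy)//.
move: hc; rewrite in_itv/= => /andP[h1 h2].
by have /w_itv/andP[] : 0 <= c <= th by apply: inside; rewrite !ltW.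
Qed.

Lemma Prm_cst_le (u : {poly R}) (b x y : R) : 0 <= x -> x <= y -> y <= th ->
  (forall z, x < z < y -> u.[tau z] <= b) -> Prm u y - Prm u x <= b * (Prm 1 y - Prm 1 x).
Proof.
move=> x0 xy yth h.
have h1 : 0 <= x <= th by rewrite x0 (le_trans xy).
have h2 : 0 <= y <= th by rewrite (le_trans x0 xy).
have := @le_Prm u (b *: 1) x y x0 xy yth; rewrite !Prm_scale// -mulrBr; apply=> z hz.
by rewrite hornerZ hornerC mulr1 h.
Qed.

Section Zonal.
Variables (p : nat -> {poly R}) (d : nat -> R).
Hypothesis nu_orth : forall j k, j != k -> nu (p j * p k) = 0.
Hypothesis nu_norm : forall k, d k * nu (p k * p k) = 1.
Hypothesis d_ge0 : forall k, 0 <= d k.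
Let c k := Prm (p k) L.

Let hL : 0 <= L <= th. Proof. by rewrite !ltW. Qed.
Let hth : 0 <= th <= th. Proof. by rewrite lexx ltW// th0. Qed.

Lemma Prm_sum (J : Type) (r : seq J) (a : J -> R) (F : J -> {poly R}) x : 0 <= x <= th ->
  Prm (\sum_(j <- r) a j *: F j) x = \sum_(j <- r) a j * Prm (F j) x.
Proof.
move=> hx; elim: r => [|j r IH]; first by rewrite !big_nil Prm_zero.
by rewrite !big_cons Prm_lin// IH.
Qed.

(* mean of (1_{theta <= L} - q)^2 *)
Definition dev q := Prm ((1 - q) ^+ 2) L + (Prm (q ^+ 2) th - Prm (q ^+ 2) L).

Lemma dev_ge0 q : 0 <= dev q.
Proof.
apply: addr_ge0.
  have := @le_Prm 0 ((1 - q) ^+ 2) 0 L (lexx 0) (ltW L0) (ltW Lth).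
  rewrite !Prm0 !subr0 Prm_zero//; apply=> z _.
  by rewrite horner0 horner_exp sqr_ge0.
have := @le_Prm 0 (q ^+ 2) L th (ltW L0) (ltW Lth) (lexx th).
rewrite !Prm_zero// subrr; apply=> z _.
by rewrite horner0 horner_exp sqr_ge0.
Qed.

(** Bessel's inequality for the indicator minus q. Correcting q by its projection g onto p_0, ...,
    p_(K-1) gives [dev (q + g)] = [dev q] - S, with S the left-hand side, and [dev] is
    nonnegative. *)
Lemma bessel q K : \sum_(0 <= k < K) d k * (c k - nu (p k * q)) ^+ 2 <= dev q.
Proof.
pose b k := c k - nu (p k * q).
pose g := \sum_(0 <= k < K) (d k * b k) *: p k.
set S := \sum_(0 <= k < K) _.
have hg2 : nu (g ^+ 2) = S.
  have nupg k : (k < K)%N -> nu (p k * g) = b k.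
    move=> kK; rewrite /g mulr_sumr; under eq_bigr do rewrite -scalerAr.
    rewrite /nu Prm_sum// (@big_cat_nat _ _ _ k)//=; last exact: ltnW.
    rewrite big_nat big1 ?add0r; last first.
      by move=> i /andP[_ ik]; rewrite -/(nu _) nu_orth ?mulr0// gtn_eqF.
    rewrite big_ltn// big_nat big1 ?addr0; last first.
      by move=> i /andP[ki _]; rewrite -/(nu _) nu_orth ?mulr0// ltn_eqF.
    by rewrite -/(nu _) mulrAC nu_norm mul1r.
  rewrite expr2 {1}/g mulr_suml; under eq_bigr do rewrite -scalerAl.
  rewrite /nu Prm_sum// /S !big_nat; apply: eq_bigr => k /andP[_ kK].
  by rewrite -/(nu _) nupg//; rewrite -/(b k); ring.
have hg1 : Prm g L - nu (q * g) = S.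
  rewrite /nu /g mulr_sumr; under [in X in _ - X]eq_bigr do rewrite -scalerAr.
  rewrite !Prm_sum// -sumrB; apply: eq_bigr => k _.
  by rewrite -/(c k) [q * _]mulrC -/(nu _) /b; ring.
have := dev_ge0 (q + g); rewrite /dev.
have -> : (1 - (q + g)) ^+ 2 = (1 - q) ^+ 2 + (-2) *: g + 2 *: (q * g) + g ^+ 2.
  by rewrite -!mul_polyC !(polyCN, polyC_natr); ring.
have -> : (q + g) ^+ 2 = q ^+ 2 + 2 *: (q * g) + g ^+ 2.
  by rewrite -!mul_polyC !(polyCN, polyC_natr); ring.
rewrite !Prm_add// !Prm_scale//.
move: hg1 hg2; rewrite /nu => hg1 hg2; lra.
Qed.

Lemma c_bessel K : \sum_(0 <= k < K) d k * c k ^+ 2 <= 1.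
Proof.
have := bessel 0 K.
have -> : \sum_(0 <= k < K) d k * (c k - nu (p k * 0)) ^+ 2 = \sum_(0 <= k < K) d k * c k ^+ 2.
  by apply: eq_bigr => k _; rewrite mulr0 /nu Prm_zero// subr0.
move=> h; apply: (le_trans h); rewrite /dev subr0 expr1n expr0n/= !Prm_zero// subrr addr0.
by have := @Prm1_mono L th (ltW L0) (ltW Lth) (lexx th); rewrite Prm1 subr_ge0.
Qed.

Lemma dev_le (q Q : {poly R}) :
  (forall t : R, -1 <= t <= 1 -> ((tau L <= t)%R%:R - q.[t]) ^+ 2 <= Q.[t]) -> dev q <= nu Q.
Proof.
move=> hQ; rewrite /dev /nu -[leRHS](subrK (Prm Q L)) addrC; apply: lerD.
  have := @le_Prm (q ^+ 2) Q L th (ltW L0) (ltW Lth) (lexx th); apply=> z /andP[z1 z2].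
  have hz : 0 <= z <= th by rewrite (le_trans (ltW L0) (ltW z1)) ltW.
  have := hQ _ (tau_itv hz).
  have -> : (tau L <= tau z) = false by apply/negbTE; rewrite -ltNge (tau_decr (ltW L0) z1 (ltW z2)).
  by rewrite sub0r sqrrN horner_exp.
have := @le_Prm ((1 - q) ^+ 2) Q 0 L (lexx 0) (ltW L0) (ltW Lth); rewrite !Prm0 !subr0; apply=> z /andP[z1 z2].
have hz : 0 <= z <= th by rewrite (ltW z1) (ltW (lt_trans z2 Lth)).
have := hQ _ (tau_itv hz).
have -> : (tau L <= tau z) = true by apply: ltW; exact: (tau_decr (ltW z1) z2 (ltW Lth)).
by rewrite horner_exp !hornerE.
Qed.

Lemma C_ge0 : 0 <= C.
Proof. by have /w_itv/andP[h1 /(le_trans h1)] := hth. Qed.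

(** The bump around tau L is placed in a window of t that pulls back to [L - h, L + h], where Q is
    bounded and the mass is at most 2 C h; elsewhere Q is small pointwise. *)
Lemma approx_exists (e : R) : 0 < e -> exists q Q : {poly R},
  [/\ forall t : R, -1 <= t <= 1 -> ((tau L <= t)%R%:R - q.[t]) ^+ 2 <= Q.[t],
      nu Q <= e &
      forall K, \sum_(0 <= k < K) d k * (c k - nu (p k * q)) ^+ 2 <= e].
Proof.
move=> e0.
suff [q [Q [hQ nuQ]]] : exists q Q : {poly R},
    (forall t : R, -1 <= t <= 1 -> ((tau L <= t)%R%:R - q.[t]) ^+ 2 <= Q.[t]) /\ nu Q <= e.
  exists q, Q; split => // K.
  by apply: le_trans (bessel q K) _; apply: le_trans nuQ; exact: dev_le.
have C0 := C_ge0.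
(* The final bound on [nu Q] is 6 eta + 8 C h, where eta <= e / 20 is chosen below. *)
pose h : R := Num.min (Num.min L (th - L)) (e / (20 * (C + 1))).
have h0 : 0 < h.
  by rewrite !lt_min L0 subr_gt0 Lth/= divr_gt0// mulr_gt0// ltr_wpDl.
have hhL : h <= L by rewrite !ge_min lexx.
have hhth : h <= th - L by rewrite !ge_min lexx orbT.
have hhe : h * (20 * (C + 1)) <= e by rewrite -ler_pdivlMr ?mulr_gt0 ?ltr_wpDl// ge_min lexx orbT.
pose L1 := L - h; pose L2 := L + h.
have L10 : 0 <= L1 by rewrite /L1; lra.
have L1L : L1 < L by rewrite /L1; lra.
have LL2 : L < L2 by rewrite /L2; lra.
have L2th : L2 <= th by rewrite /L2; lra.
have t1 := tau_decr L10 L1L (ltW Lth).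
have t2 := tau_decr (ltW L0) LL2 L2th.
pose s0 := tau L.
pose del : R := Num.min (tau L1 - s0) (s0 - tau L2).
have del0 : 0 < del by rewrite lt_min !subr_gt0 t1.
have del1 : s0 + del <= tau L1.
  have dl : del <= tau L1 - s0 by rewrite ge_min lexx.
  by move: dl; lra.
have del2 : tau L2 <= s0 - del.
  have dl : del <= s0 - tau L2 by rewrite ge_min lexx orbT.
  by move: dl; lra.
pose eta : R := Num.min (1:R) (e / 20).
have eta0 : 0 < eta by rewrite lt_min ltr01 divr_gt0.
have eta1 : eta <= 1 by rewrite ge_min lexx.
have etae : eta <= e / 20 by rewrite ge_min lexx orbT.
have [q [qb [hq qb2 qb_ge qb_le]]] := step_approx s0 del0 eta0 eta1.
exists q, (2 *: (qb + eta%:P) + (2 * eta ^+ 2)%:P); split=> //.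
rewrite /nu Prm_add// Prm_scale// Prm_add//.
have PC a : Prm a%:P th = a by rewrite -[a%:P]mulr1 mul_polyC Prm_scale// Prm1 mulr1.
rewrite !PC.
have mid u v z : 0 <= u -> v <= th -> u < z -> z < v -> 0 <= z <= th.
  by move=> h1 h2 h3 h4; rewrite (le_trans h1 (ltW h3)) (le_trans (ltW h4) h2).
have L1th := ltW (lt_trans L1L Lth); have L20 := ltW (lt_trans L0 LL2).
have L12 := ltW (lt_trans L1L LL2).
have part1 : Prm qb L1 - Prm qb 0 <= eta * (Prm 1 L1 - Prm 1 0).
  apply: Prm_cst_le => // z /andP[z1 z2]; apply: qb_ge.
    exact: tau_itv (mid _ _ _ (lexx 0) L1th z1 z2).
  by apply: le_trans del1 _; apply/ltW/(tau_decr (ltW z1) z2).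
have part3 : Prm qb th - Prm qb L2 <= eta * (Prm 1 th - Prm 1 L2).
  apply: Prm_cst_le => // z /andP[z1 z2]; apply: qb_le.
    exact: tau_itv (mid _ _ _ L20 (lexx th) z1 z2).
  by apply: le_trans del2; apply/ltW/(tau_decr L20 z1 (ltW z2)).
have part2 : Prm qb L2 - Prm qb L1 <= 2 * (Prm 1 L2 - Prm 1 L1).
  apply: Prm_cst_le => // z /andP[z1 z2]; apply: qb2.
  exact: tau_itv (mid _ _ _ L10 L2th z1 z2).
have w1 := @Prm1_le L1 L2 L10 (ltW (lt_trans L1L LL2)) L2th.
have m1 := @Prm1_mono 0 L1 (lexx 0) L10 (ltW (lt_trans L1L Lth)).
have m3 := @Prm1_mono L2 th (ltW (lt_trans L0 LL2)) L2th (lexx th).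
have m2 := @Prm1_mono L1 L2 L10 (ltW (lt_trans L1L LL2)) L2th.
rewrite !Prm0 !subr0 in part1 m1; rewrite Prm1 in part3 m3.
have L21 : L2 - L1 = 2 * h by rewrite /L1 /L2; ring.
rewrite L21 in w1.
have e1 : eta ^+ 2 <= eta by rewrite expr2 ger_pMl.
have e2 : eta * Prm 1 L1 + eta * (1 - Prm 1 L2) <= eta.
  by rewrite -mulrDr ger_pMr//; move: m2; lra.
move: part1 part2 part3 w1 e1 e2 etae hhe h0.
move: (Prm qb th) (Prm qb L1) (Prm qb L2) (Prm 1 L1) (Prm 1 L2) => a1 a2 a3 a4 a5.
rewrite expr2; nra.
Qed.

End Zonal.
End Model.

(** * Integrals, Gamma values and Rodrigues formulas *)

Section FTC.
Context {R : realType}.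
Let mu := @lebesgue_measure R.

Lemma is_derive_continuous (F : R -> R) (x df : R) : is_derive x 1 F df -> {for x, continuous F}.
Proof. by move=> [/derivable1_diffP h _]; exact: differentiable_continuous. Qed.

Lemma cont_itv_integrable (f : R -> R) (a b : R) :
  (forall x : R, a <= x <= b -> {for x, continuous f}) -> mu.-integrable `[a, b] (EFin \o f).
Proof.
move=> cf; apply: continuous_compact_integrable; first exact: segment_compact.
by apply: continuous_in_subspaceT => x; rewrite inE/= in_itv/=; exact: cf.
Qed.

Lemma FTC_itv (f F : R -> R) (a b : R) : a < b ->
  (forall x : R, a <= x <= b -> {for x, continuous f}) ->
  (forall x : R, a <= x <= b -> is_derive x 1 F (f x)) ->
  (\int[mu]_(x in `[a, b]) (f x)%:E = (F b - F a)%:E)%E.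
Proof.
move=> ab cf dF; rewrite EFinB; apply: continuous_FTC2 => //.
- by apply: continuous_in_subspaceT => x; rewrite inE/= in_itv/=; exact: cf.
- have cF (x : R) : a <= x <= b -> {for x, continuous F}.
    by move=> hx; exact: is_derive_continuous (dF x hx).
  split.
  + by move=> x; rewrite in_itv/= => /andP[h1 h2]; case: (dF x _) => //; rewrite !ltW.
  + by apply: cvg_at_right_filter; apply: cF; rewrite lexx ltW.
  + by apply: cvg_at_left_filter; apply: cF; rewrite lexx ltW.
- move=> x; rewrite in_itv/= => /andP[h1 h2].
  have hx : a <= x <= b by rewrite !ltW.
  by rewrite derive1E; have := dF x hx => hd; rewrite derive_val.
Qed.

Lemma primitive_exists (f : R -> R) : continuous f ->
  exists F : R -> R, (forall x : R, -1 < x -> is_derive x 1 F (f x)) /\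
    (forall x : R, 0 <= x -> F x = Rintegral mu `[0, x] f).
Proof.
(* Starting at -1 makes 0 an interior point, so the primitive has a two-sided derivative there. *)
move=> cf; pose F (x : R) := Rintegral mu `[-1, x] f.
have dF (x : R) : -1 < x -> is_derive x 1 F (f x).
  move=> x1.
  have [d1 d2] := @continuous_FTC1_closed R f (-1) x (x + 1) (ltr_pwDr ltr01 (lexx x))
    (cont_itv_integrable (fun y _ => cf y)) x1 (cf x).
  by rewrite derive1E in d2; exact: DeriveDef.
exists (fun x => F x - F 0); split.
  move=> x x1; have h := dF x x1; have h2 := @is_derive_cst R R R (F 0) x 1.
  by rewrite -[f x]subr0; exact: is_deriveB.
move=> x; rewrite le_eqVlt => /orP[/eqP <-|x0].
  by rewrite subrr set_itv1 Rintegral_set1.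
have dF' (y : R) : 0 <= y <= x -> is_derive y 1 F (f y).
  by move=> /andP[y0 _]; apply: dF; rewrite (lt_le_trans _ y0)// ltrN10.
by have /(congr1 fine) := FTC_itv x0 (fun y _ => cf y) dF'.
Qed.

End FTC.

(** * Gamma at positive half-integers *)

Section GammaHalf.
Context {R : realType}.
Let mu := @lebesgue_measure R.

Definition gam_int (x t : R) : R := powR t (x - 1) * expR (- t).
Definition gam_itv (n : nat) : set R := `[(n.+1%:R)^-1, n.+1%:R].
Definition gam (x : R) (n : nat) : R := Rintegral mu (gam_itv n) (gam_int x).

Lemma is_derive_expRN (t : R) : is_derive t 1 (fun t => expR (- t)) (- expR (- t)).
Proof.
have -> : - expR (- t) = expR (- t) *: (-1) :> R by rewrite /GRing.scale/= mulrN1.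
apply: (@is_derive1_comp _ expR (fun t => - t)).
Qed.

Lemma is_derive_gam (x t : R) : 0 < t ->
  is_derive t 1 (fun t => powR t x * expR (- t)) (x * gam_int x t - gam_int (x + 1) t).
Proof.
move=> t0; have h1 := is_derive1_powR x t0; have h2 := is_derive_expRN t.
apply: is_derive_eq; rewrite /gam_int addrK /GRing.scale/=; ring.
Qed.

Lemma gam_int_cont (x t : R) : 0 < t -> {for t, continuous (gam_int x)}.
Proof.
by move=> t0; apply: is_derive_continuous; rewrite /gam_int; exact: is_derive_gam.
Qed.

Lemma gam_lt n : n.+2%:R^-1 < n.+2%:R :> R.
Proof. by apply: (@lt_trans _ _ 1); rewrite ?invf_lt1 ?ltr1n. Qed.

Lemma gam_in n (t : R) : n.+1%:R^-1 <= t <= n.+1%:R -> 0 < t.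
Proof. by move=> /andP[h _]; apply: lt_le_trans h; rewrite invr_gt0. Qed.

Lemma gam_integrable x n : mu.-integrable (gam_itv n) (EFin \o gam_int x).
Proof. by apply: cont_itv_integrable => t /gam_in; exact: gam_int_cont. Qed.

(** The functional equation of Gamma on a truncated interval, with the boundary values of t^x e^(-t)
    as error; for positive half-integers x they tend to 0. *)
Lemma gam_step (x : R) n :
  gam (x + 1) n.+1 = x * gam x n.+1 -
    (powR n.+2%:R x * expR (- n.+2%:R) - powR n.+2%:R^-1 x * expR (- n.+2%:R^-1)).
Proof.
have i1 := gam_integrable x n.+1; have i2 := gam_integrable (x + 1) n.+1.
have mI : measurable (gam_itv n.+1) by exact: measurable_itv.
pose f t := x * gam_int x t - gam_int (x + 1) t.
have cf (t : R) : n.+2%:R^-1 <= t <= n.+2%:R -> {for t, continuous f}.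
  move=> /gam_in t0; apply: continuousB; last exact: gam_int_cont.
  by apply: continuousM; [exact: cst_continuous|exact: gam_int_cont].
have df (t : R) : n.+2%:R^-1 <= t <= n.+2%:R ->
    is_derive t 1 (fun t => powR t x * expR (- t)) (f t).
  by move=> /gam_in; exact: is_derive_gam.
have /(congr1 fine) := FTC_itv (gam_lt n) cf df.
rewrite [RHS]/= => <-.
have h := @RintegralB _ _ R mu (gam_itv n.+1) (fun t => x * gam_int x t) (gam_int (x + 1)) mI.
have -> : fine (\int[lebesgue_measure]_(x0 in `[n.+2%:R^-1%R, n.+2%:R]) (f x0)%:E) =
  Rintegral mu (gam_itv n.+1) f by [].
rewrite h//; last first.
  have -> : EFin \o (fun t => x * gam_int x t) = (fun t => x%:E * (EFin \o gam_int x) t)%E by [].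
  exact: integrableZl.
by rewrite RintegralZl// /gam; ring.
Qed.

(** Monotone convergence: the integrand is nonnegative and the intervals increase to the
    half-line. *)
Lemma gam_cvg (x l : R) : gam x n @[n --> \oo] --> l -> Gamma x = l.
Proof.
move=> hl.
have U : \bigcup_n gam_itv n = `]0, +oo[%classic.
  apply/seteqP; split=> [t [n _]/= |t].
    by rewrite /gam_itv/= !in_itv/= andbT => /gam_in.
  rewrite /= in_itv/= andbT => t0.
  exists (Num.truncn (Num.max t t^-1)) => //; rewrite /gam_itv/= in_itv/=.
  have := truncnS_gt (Num.max t t^-1); set m := (Num.truncn _).+1; rewrite gt_max => /andP[h1 h2].
  by rewrite ltW//= ?andbT ?ltW// -[t]invrK ltf_pV2 ?posrE ?invr_gt0.
have nd : nondecreasing_seq (gam_itv : (set R)^nat).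
  apply/nondecreasing_seqP => n; rewrite subsetEset => t; rewrite /gam_itv/= !in_itv/= => /andP[h1 h2].
  apply/andP; split; last by apply: (le_trans h2); rewrite ler_nat.
  by apply: le_trans h1; rewrite lef_pV2 ?posrE// ler_nat.
have mI i : measurable (gam_itv i) by exact: measurable_itv.
have h := @ge0_nondecreasing_set_cvg_integral _ (measurableTypeR R) R gam_itv (EFin \o gam_int x)
  lebesgue_measure nd mI (fun i => measurable_int _ (gam_integrable x i))
  (fun i t _ => mulr_ge0 (powR_ge0 _ _) (expR_ge0 _)).
rewrite U in h.
have hE : (fun n => \int[lebesgue_measure]_(t in gam_itv n) (EFin \o gam_int x) t)%E = EFin \o gam x.
  apply/funext => n; rewrite /= /gam /Rintegral fineK//.
  exact: (@integrable_fin_num _ (measurableTypeR R) R lebesgue_measure (gam_itv n) (mI n) _ (gam_integrable x n)).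
rewrite hE in h.
have hl' : (EFin \o gam x) n @[n --> \oo] --> l%:E by apply/cvg_EFin => //; exact: nearW.
rewrite /Gamma /Rintegral -[l]/(fine l%:E); congr fine.
by apply: cvg_unique h hl'; exact: ereal_hausdorff.
Qed.

Lemma powR_half (t : R) (m : nat) : 0 <= t -> powR t (m%:R / 2) = Num.sqrt t ^+ m.
Proof. by move=> t0; rewrite mulrC powRrM powR12_sqrt// powR_mulrn// sqrtr_ge0. Qed.

Lemma invn_cvg0 : (n.+2%:R^-1 : R) @[n --> \oo] --> (0 : R).
Proof.
by have h := @cvg_harmonic R; rewrite -cvg_shiftS in h; exact: h.
Qed.

Lemma sqrt_invn_cvg0 : (Num.sqrt n.+2%:R^-1 : R) @[n --> \oo] --> (0 : R).
Proof.
rewrite -[X in _ --> X]sqrtr0; apply: continuous_cvg; last exact: invn_cvg0.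
exact: sqrt_continuous.
Qed.

Lemma gam_bnd0 (m : nat) :
  (powR n.+2%:R^-1 (m.+1%:R / 2) * expR (- n.+2%:R^-1) : R) @[n --> \oo] --> (0 : R).
Proof.
apply: (@squeeze_cvgr _ _ _ _ (fun=> 0) (fun n => Num.sqrt n.+2%:R^-1)).
- apply: nearW => n; rewrite mulr_ge0 ?powR_ge0 ?expR_ge0//=.
  rewrite powR_half ?invr_ge0// exprS -mulrA ler_piMr ?sqrtr_ge0//.
  rewrite mulr_ile1 ?exprn_ge0 ?sqrtr_ge0 ?expR_ge0//.
  by rewrite exprn_ile1 ?sqrtr_ge0// -[X in _ <= X]sqrtr1 ler_wsqrtr// invf_le1// ler1n.
- exact: cvg_cst.
- exact: sqrt_invn_cvg0.
Qed.

Lemma gam_bndy (m : nat) :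
  (powR n.+2%:R (m%:R / 2) * expR (- n.+2%:R) : R) @[n --> \oo] --> (0 : R).
Proof.
apply: (@squeeze_cvgr _ _ _ _ (fun=> 0) (fun n => (m.+1)`!%:R * n.+2%:R^-1)).
- apply: nearW => n; rewrite mulr_ge0 ?powR_ge0 ?expR_ge0//=.
  have n0 : 0 < n.+2%:R :> R by [].
  rewrite expRN ler_pdivrMr ?expR_gt0//.
  have h := @expR_ge1Dxn R n.+2%:R m (ltW n0).
  have h1 : (n.+2%:R : R) ^+ m.+1 <= (m.+1)`!%:R * expR n.+2%:R.
    by rewrite mulrC -ler_pdivrMr ?ltr0n ?fact_gt0//; apply: le_trans h; rewrite lerDr.
  rewrite mulrAC ler_pdivlMr//; apply: le_trans h1; rewrite exprSr ler_pM2r//.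
  rewrite -[leRHS](powR_mulrn _ (ltW n0)); apply: ler_powR; first by rewrite ler1n.
  by rewrite ler_pdivrMr// ler_peMr// ler1n.
- exact: cvg_cst.
- by rewrite -[X in _ --> X](mulr0 ((m.+1)`!%:R : R)); exact: (cvgMl_tmp invn_cvg0).
Qed.

Lemma cvgsB (u v : nat -> R) (a b : R) :
  u @ \oo --> a -> v @ \oo --> b -> (fun n => u n - v n) @ \oo --> a - b.
Proof. by move=> h1 h2; exact: (cvgB h1 h2). Qed.

Lemma cvgsZ (c : R) (u : nat -> R) (a : R) :
  u @ \oo --> a -> (fun n => c * u n) @ \oo --> c * a.
Proof. by move=> h1; exact: (cvgMl_tmp h1). Qed.

Lemma gam_cvgS (m : nat) (l : R) :
  gam (m.+1%:R / 2) n.+1 @[n --> \oo] --> l ->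
  gam (m.+1%:R / 2 + 1) n.+1 @[n --> \oo] --> m.+1%:R / 2 * l.
Proof.
move=> h; have hb := cvgsB (@gam_bndy m.+1) (@gam_bnd0 m); rewrite subr0 in hb.
have := cvgsB (cvgsZ (c := m.+1%:R / 2) h) hb; rewrite subr0.
suff -> : (fun n => gam (m.+1%:R / 2 + 1 : R) n.+1) = (fun n => m.+1%:R / 2 * gam (m.+1%:R / 2) n.+1 -
  (powR n.+2%:R (m.+1%:R / 2) * expR (- n.+2%:R) - powR n.+2%:R^-1 (m.+1%:R / 2) * expR (- n.+2%:R^-1))) by [].
by apply/funext => n; exact: gam_step.
Qed.

Lemma gam1_cvg : gam 1 n.+1 @[n --> \oo] --> (1 : R).
Proof.
have hE n : gam 1 n.+1 = expR (- n.+2%:R^-1) - expR (- n.+2%:R).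
  have cf (t : R) : n.+2%:R^-1 <= t <= n.+2%:R -> {for t, continuous (gam_int 1)}.
    by move=> /gam_in; exact: gam_int_cont.
  have df (t : R) : n.+2%:R^-1 <= t <= n.+2%:R -> is_derive t 1 (fun t => - expR (- t)) (gam_int 1 t).
    move=> _; have h := is_derive_expRN t; rewrite /gam_int subrr powRr0 mul1r -[expR (- t)]opprK.
    exact: is_deriveN.
  have /(congr1 fine) := FTC_itv (gam_lt n) cf df.
  by rewrite [RHS]/= opprK addrC.
have -> : (fun n => gam (1 : R) n.+1) = (fun n => expR (- n.+2%:R^-1) - expR (- n.+2%:R)).
  exact/funext.
have h0 : (expR (- n.+2%:R) : R) @[n --> \oo] --> (0 : R).
  have h := @gam_bndy 0; have e : (fun n => powR n.+2%:R (0%:R / 2) * expR (- n.+2%:R)) =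
    (fun n => expR (- n.+2%:R) : R) by apply/funext => n; rewrite mul0r powRr0 mul1r.
  by rewrite e in h.
have h1 : (expR (- n.+2%:R^-1) : R) @[n --> \oo] --> (1 : R).
  have : expR (- n.+2%:R^-1) @[n --> \oo] --> (expR (- 0) : R).
    apply: continuous_cvg; first exact: continuous_expR.
    by apply: cvgN; exact: invn_cvg0.
  by rewrite oppr0 expR0.
by have := cvgsB h1 h0; rewrite subr0.
Qed.

(** The substitution t = s^2 turns the integrand into a Gaussian: 2 F(sqrt t) is a primitive, with F
    a primitive of e^(-s^2). *)
Lemma gam_half_cvg : gam (1 / 2) n.+1 @[n --> \oo] --> Num.sqrt (pi : R).
Proof.
have [F [dF FI]] := primitive_exists (@continuous_gauss_fun R).
pose H t := 2 * F (Num.sqrt t).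
have hE n : gam (1 / 2) n.+1 = H n.+2%:R - H (n.+2%:R^-1).
  have cf (t : R) : n.+2%:R^-1 <= t <= n.+2%:R -> {for t, continuous (gam_int (1 / 2))}.
    by move=> /gam_in; exact: gam_int_cont.
  have df (t : R) : n.+2%:R^-1 <= t <= n.+2%:R -> is_derive t 1 H (gam_int (1 / 2) t).
    move=> /gam_in t0; have s0 : 0 < Num.sqrt t by rewrite sqrtr_gt0.
    have h1 := is_derive1_sqrt t0.
    have h2 := dF (Num.sqrt t) (lt_trans (ltrN10 _) s0).
    have h3 := @is_derive1_comp R F Num.sqrt t _ _ h2 h1.
    apply: is_derive_eq; rewrite /gam_int /gauss_fun sqr_sqrtr ?ltW//.
    rewrite (_ : 1 / 2 - 1 = - (2^-1)) ?powRN ?powR12_sqrt ?ltW//; last by field.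
    by rewrite /GRing.scale/=; field; rewrite gt_eqF.
  by have /(congr1 fine) := FTC_itv (gam_lt n) cf df.
have -> : (fun n => gam (1 / 2 : R) n.+1) = (fun n => H n.+2%:R - H (n.+2%:R^-1)) by exact/funext.
have F0 : F 0 = 0 by rewrite FI// set_itv1 Rintegral_set1.
have cF0 : {for 0, continuous F} by apply: is_derive_continuous (dF 0 (ltrN10 _)).
have h0 : H n.+2%:R^-1 @[n --> \oo] --> (0 : R).
  have : F (Num.sqrt n.+2%:R^-1) @[n --> \oo] --> F 0.
    by apply: continuous_cvg => //; exact: sqrt_invn_cvg0.
  by rewrite F0 => /(cvgsZ (c := 2)); rewrite mulr0.
suff h1 : H n.+2%:R @[n --> \oo] --> Num.sqrt (pi : R) by have := cvgsB h1 h0; rewrite subr0.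

pose J := fun x : R => @gauss_integral_proof.integral0_gauss R x.
have hs : (Num.sqrt n.+2%:R : R) @[n --> \oo] --> +oo.
  apply/cvgryPge => A; near=> n.
  have : A ^+ 2 <= n.+2%:R.
    apply: (@le_trans _ _ n%:R); last by rewrite ler_nat ltnW.
    by near: n; exact: nbhs_infty_ger.
  move=> h; apply: (le_trans (ler_norm A)).
  by rewrite -sqrtr_sqr ler_wsqrtr.
have h2 : J (Num.sqrt n.+2%:R) ^+ 2 @[n --> \oo] --> (pi / 4 : R).
  exact: (cvg_comp _ _ hs gauss_integral_proof.cvg_integral0_gauss_sqr).
have h3 : Num.sqrt (J (Num.sqrt n.+2%:R) ^+ 2) @[n --> \oo] --> (Num.sqrt (pi / 4) : R).
  by apply: continuous_cvg => //; exact: sqrt_continuous.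
have h4 := cvgsZ (c := 2) h3.
have e1 : 2 * Num.sqrt (pi / 4) = Num.sqrt pi :> R.
  rewrite sqrtrM ?pi_ge0// sqrtrV// (_ : 4 = 2 ^+ 2); last by rewrite expr2 -natrM.
  by rewrite sqrtr_sqr ger0_norm//; field.
rewrite e1 in h4.
suff -> : (fun n => H n.+2%:R) = (fun n => 2 * Num.sqrt (J (Num.sqrt n.+2%:R) ^+ 2)) by [].
apply/funext => n; rewrite sqrtr_sqr ger0_norm ?gauss_integral_proof.integral0_gauss_ge0//.
by rewrite /H FI// sqrtr_ge0.
Unshelve. all: by end_near. Qed.

(* Gamma is a limit of its truncated integrals, which avoids improper integration by parts *)
Lemma gam_half_pos (m : nat) : exists2 l : R, 0 < l & gam (m.+1%:R / 2) n.+1 @[n --> \oo] --> l.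
Proof.
have [h1 h2] : (exists2 l : R, 0 < l & gam (m.+1%:R / 2) n.+1 @[n --> \oo] --> l) /\
    (exists2 l : R, 0 < l & gam (m.+2%:R / 2) n.+1 @[n --> \oo] --> l).
  elim: m => [|m [[l l0 hl] IH]]; split.
  - by exists (Num.sqrt pi); [rewrite sqrtr_gt0 pi_gt0|exact: gam_half_cvg].
  - by exists 1; [exact: ltr01|rewrite divff//; exact: gam1_cvg].
  - exact: IH.
  - exists (m.+1%:R / 2 * l); first by rewrite mulr_gt0// divr_gt0.
    have -> : m.+3%:R / 2 = m.+1%:R / 2 + 1 :> R by rewrite -[m.+3]addn2 natrD; field.
    exact: gam_cvgS.
exact: h1.
Qed.

(** The shift by one is there because [gam_itv 0] is the single point 1, on which the fundamental
    theorem for a < b does not apply. *)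
Lemma gam_cvg1 (x l : R) : gam x n.+1 @[n --> \oo] --> l -> Gamma x = l.
Proof. by move=> h; apply: gam_cvg; rewrite -cvg_shiftS; exact: h. Qed.

Lemma Gamma_half_gt0 (m : nat) : 0 < Gamma (m.+1%:R / 2 : R).
Proof. by have [l l0 /gam_cvg1 ->] := gam_half_pos m. Qed.

Lemma Gamma_halfS (m : nat) : Gamma (m.+1%:R / 2 + 1 : R) = m.+1%:R / 2 * Gamma (m.+1%:R / 2).
Proof.
have [l l0 hl] := gam_half_pos m.
by rewrite (gam_cvg1 (gam_cvgS hl)) (gam_cvg1 hl).
Qed.

Lemma Gamma_half : Gamma (1 / 2 : R) = Num.sqrt pi.
Proof. exact: gam_cvg1 gam_half_cvg. Qed.

Lemma Gamma_1 : Gamma (1 : R) = 1.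
Proof. exact: gam_cvg1 gam1_cvg. Qed.

End GammaHalf.

Section Rodrigues.
Context {R : realType}.
Variables (sigma t0 : {poly R}) (phi : nat -> R -> R) (lo hi : R).
Hypothesis phi_der : forall i (q : {poly R}) (u : R), lo < u < hi ->
  is_derive u 1 (fun y => phi i.+1 y * q.[y]) (phi i u * (Dop sigma t0 i q).[u]).

(** Each derivative lowers the exponent of [phi] by one and applies [Dop]. The induction hypothesis
    is used on a neighbourhood of u, hence the open interval. *)
Lemma rodrigues j i (u : R) : lo < u < hi ->
  derive1n j (phi (i + j)%N) u = phi i u * (Rod sigma t0 i j).[u].
Proof.
elim: j i u => [|j IH] i u hu; first by rewrite addn0 /= hornerC mulr1.
rewrite derive1nS derive1E addnS -addSn.
have -> : 'D_1 (derive1n j (phi (i.+1 + j)%N)) u = 'D_1 (fun y => phi i.+1 y * (Rod sigma t0 i.+1 j).[y]) u.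
  apply: near_eq_derive; move: hu => /andP[h1 h2].
  near=> y; apply: IH; apply/andP; split; near: y; [exact: lt_nbhsr|exact: lt_nbhsl].
have h := phi_der i (Rod sigma t0 i.+1 j) hu.
by rewrite derive_val.
Unshelve. all: by end_near. Qed.

End Rodrigues.

(** * The explicit weight on [0, th], integrals over caps, and uniqueness of the law *)

Section Zonal.
Context {R : realType}.
Variables (th L C : R) (tau W bd : R -> R) (sigma t0 : {poly R}) (A B e : R).
Hypotheses (L0 : 0 < L) (Lth : L < th).
Hypothesis W_cont : continuous W.
Hypothesis W_itv : forall x : R, 0 <= x <= th -> 0 <= W x <= C.
Hypothesis W_gt0 : forall x : R, 0 < x < th -> 0 < W x.
Hypothesis tau_cont : continuous tau.
Hypothesis tau_decr : forall x y : R, 0 <= x -> x < y -> y <= th -> tau y < tau x.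
Hypothesis tau_itv : forall x : R, 0 <= x <= th -> -1 <= tau x <= 1.
Hypothesis bd_der : forall (q : {poly R}) (x : R),
  is_derive x 1 (fun y => bd y * q.[tau y]) (- (W x * (Dop sigma t0 0 q).[tau x])).
Hypotheses (bd0 : bd 0 = 0) (bdth : bd th = 0).
Hypothesis size_sigma : (size sigma <= 3)%N.
Hypothesis size_t0 : (size t0 <= 2)%N.
Hypothesis sigma2 : sigma`_2 = -1.
Hypothesis t01 : t0`_1 = - A.
Hypothesis sigma_at1 : sigma.[1] = 0.
Hypothesis sigma'_at1 : sigma^`().[1] = - e.
Hypothesis t0_at1 : t0.[1] = - B.
Hypotheses (A0 : 0 < A) (B0 : 0 < B) (e0 : 0 <= e).

Definition massZ : R := Rintegral lebesgue_measure `[0, th] W.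

Let Wq (q : {poly R}) (x : R) := q.[tau x] * W x.

Let Wq_cont q : continuous (Wq q).
Proof.
move=> x; have h : {for x, continuous (fun y => q.[tau y])}.
  by apply: continuous_comp; [exact: tau_cont|exact: continuous_horner].
change {for (x : R), continuous (fun y : R => q.[tau y] * W y)}.
by apply: continuousM; [exact: h|exact: W_cont].
Qed.

Let prim q := projT1 (cid (primitive_exists (@Wq_cont q))).

Let prim_der q (x : R) : -1 < x -> is_derive x 1 (prim q) (Wq q x).
Proof. by rewrite /prim; case: cid => F /= [dF _]; exact: dF. Qed.

Let prim_int q (x : R) : 0 <= x -> prim q x = Rintegral lebesgue_measure `[0, x] (Wq q).
Proof. by rewrite /prim; case: cid => F /= [_ h]; exact: h. Qed.

Definition Prm q (x : R) : R := massZ^-1 * prim q x.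

Let th_gt0 : 0 < th. Proof. exact: lt_trans Lth. Qed.

Let inN1 (x : R) : 0 <= x <= th -> -1 < x.
Proof. by move=> /andP[h _]; exact: lt_le_trans (ltrN10 _) h. Qed.

Let prim0 q : prim q 0 = 0.
Proof. by rewrite prim_int// set_itv1 Rintegral_set1. Qed.

Let massZE : massZ = prim 1 th.
Proof.
rewrite prim_int ?(ltW th_gt0)//; apply: eq_Rintegral => x _.
by rewrite /Wq hornerC mul1r.
Qed.

Lemma massZ_gt0 : 0 < massZ.
Proof.
suff : 0 < prim 1 th - prim 1 0 by rewrite massZE prim0 subr0.
have [||c hc ->] := @MVT R (prim 1) (Wq 1) 0 th th_gt0.
- by move=> x; rewrite in_itv/= => /andP[h1 _]; apply: prim_der; exact: lt_trans (ltrN10 _) h1.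
- by apply: derivable_within_continuous => x; rewrite in_itv/= => /inN1 h; case: (prim_der 1 h).
rewrite subr0 mulr_gt0// /Wq hornerC mul1r; apply: W_gt0.
by move: hc; rewrite in_itv.
Qed.

Let Z0 : massZ != 0. Proof. by rewrite gt_eqF// massZ_gt0. Qed.

Lemma Prm_prim q (G : R -> R) (x : R) :
  (forall y : R, 0 <= y <= th -> is_derive y 1 G (q.[tau y] * W y)) -> 0 <= x <= th ->
  Prm q x = massZ^-1 * (G x - G 0).
Proof.
move=> dG /andP[]; rewrite le_eqVlt => /orP[/eqP <-|x0] xth; first by rewrite /Prm prim0 subrr.
have hx (y : R) : 0 <= y <= x -> 0 <= y <= th.
  by move=> /andP[h1 h2]; rewrite h1 (le_trans h2 xth).
have cf (y : R) : 0 <= y <= x -> {for y, continuous (Wq q)} by move=> _; exact: Wq_cont.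
have d1 (y : R) : 0 <= y <= x -> is_derive y 1 (prim q) (Wq q y).
  by move=> /hx/inN1; exact: prim_der.
have d2 (y : R) : 0 <= y <= x -> is_derive y 1 G (Wq q y) by move=> /hx; exact: dG.
have := FTC_itv x0 cf d1; rewrite (FTC_itv x0 cf d2) => -[] ->.
by rewrite prim0 subr0.
Qed.

Lemma Prm_at0 q : Prm q 0 = 0.
Proof. by rewrite /Prm prim0 mulr0. Qed.

Lemma Prm_is_derive q (x : R) : 0 <= x <= th -> is_derive x 1 (Prm q) (q.[tau x] * (massZ^-1 * W x)).
Proof.
move=> /inN1 hx; have h := prim_der q hx.
have -> : q.[tau x] * (massZ^-1 * W x) = massZ^-1 *: Wq q x by rewrite /Wq /GRing.scale/=; ring.
exact: is_deriveZ.
Qed.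

Lemma Prm_linear a u v (x : R) : 0 <= x <= th -> Prm (a *: u + v) x = a * Prm u x + Prm v x.
Proof.
move=> hx.
have dG (y : R) : 0 <= y <= th ->
    is_derive y 1 (fun y => a *: prim u y + prim v y) ((a *: u + v).[tau y] * W y).
  move=> /inN1 hy; have h1 := prim_der u hy; have h2 := prim_der v hy.
  have -> : (a *: u + v).[tau y] * W y = a *: Wq u y + Wq v y.
    by rewrite hornerD hornerZ /Wq /GRing.scale/=; ring.
  by apply: is_deriveD.
by rewrite (Prm_prim dG hx) !prim0 /GRing.scale/= mulr0 addr0 subr0 /Prm; ring.
Qed.

Lemma Prm_one : Prm 1 th = 1.
Proof. by rewrite /Prm -massZE mulVf. Qed.

(** By [bd_der], the integrand has the primitive - bd q(tau), so the integral over a cap is a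
    boundary value; it vanishes on the whole space because [bd th] = 0. *)
Lemma Prm_stokes q (x : R) : 0 <= x <= th ->
  Prm (Dop sigma t0 0 q) x = - (massZ^-1 * bd x * q.[tau x]).
Proof.
move=> hx; have dG (y : R) : 0 <= y <= th ->
    is_derive y 1 (fun y => - (bd y * q.[tau y])) ((Dop sigma t0 0 q).[tau y] * W y).
  move=> _; have h := bd_der q y.
  by rewrite mulrC -[W y * _]opprK; exact: is_deriveN.
by rewrite (Prm_prim dG hx) bd0; ring.
Qed.

Let hth : 0 <= th <= th. Proof. by rewrite lexx ltW. Qed.
Let hL : 0 <= L <= th. Proof. by rewrite !ltW. Qed.
Let nu q := Prm q th.
Let p := pk sigma t0.

Lemma nu_linear a u v : nu (a *: u + v) = a * nu u + nu v.
Proof. exact: Prm_linear. Qed.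

Lemma nu_stokes q : nu (Dop sigma t0 0 q) = 0.
Proof. by rewrite /nu Prm_stokes// bdth; ring. Qed.

Lemma Prm_pk0 (x : R) : Prm (p 0) x = Prm 1 x.
Proof. by rewrite /p /pk /= hornerC invr1 scale1r. Qed.

(** p_(k+1) is a multiple of [Dop 0 (Rod 1 k)], so its integral over the cap is the boundary term at
    L. The index 1 is what shifts the Legendre and Jacobi parameters in the stated eigenvalues. *)
Lemma Prm_pkS k : Prm (p k.+1) L =
  bd L / massZ / B * ((-1) ^+ k / \prod_(j < k) (B + e + j%:R * e) * (Rod sigma t0 1 k).[tau L]).
Proof.
have lin0 x : 0 <= x <= th -> Prm 0 x = 0.
  by move=> hx; have := Prm_linear (-1) 0 0 hx; rewrite scaler0 addr0; move: (Prm 0 x) => z; lra.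
rewrite /p /pk -[_ *: _]addr0 Prm_linear// lin0// addr0 Prm_stokes//.
rewrite (Rod_at1 sigma_at1 sigma'_at1 t0_at1) big_ord_recl mul0r addr0.
have -> : \prod_(i < k) (B + (0 + bump 0 i)%:R * e) = \prod_(j < k) (B + e + j%:R * e).
  by apply: eq_bigr => i _; rewrite add0n /bump /= natrD; ring.
set P := \prod_(i < k) _.
have P0 : P != 0 by apply/prodf_neq0 => i _; rewrite gt_eqF// ltr_wpDr ?mulr_ge0// ltr_wpDr.
have s0 : (-1) ^+ k != 0 :> R by rewrite signr_eq0.
have B1 : B != 0 by rewrite gt_eqF.
rewrite exprS; move: s0; have : (-1) ^+ k * (-1) ^+ k = 1 :> R by rewrite -expr2 sqrr_sign.
move: ((-1) ^+ k : R) => s ss s0.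
set r := (Rod sigma t0 1 k).[tau L]; rewrite [in LHS](_ : r = s * s * r); last by rewrite ss mul1r.
by field; rewrite P0 Z0 B1 s0.
Qed.

Section Norms.
Variable d : nat -> R.
Hypothesis d_norm : forall k, d k * nu (p k * p k) = 1.
Hypothesis d_ge1 : forall k, 1 <= d k.

Let porth j k : j != k -> nu (p j * p k) = 0.
Proof.
exact: (pk_orth nu_linear nu_stokes size_sigma size_t0 sigma2 t01 sigma_at1 sigma'_at1 t0_at1 A0 B0 e0).
Qed.

Let psize k : size (p k) = k.+1.
Proof. exact: (size_pk size_sigma size_t0 sigma2 t01 sigma_at1 sigma'_at1 t0_at1 A0 B0 e0). Qed.

Let p1 k : (p k).[1] = 1.
Proof. exact: (pk_at1 sigma_at1 sigma'_at1 t0_at1 B0 e0). Qed.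

(** Every p_k with k > 0 lies in the image of [Dop], so the three properties fix l on a basis. This
    identifies the mean under any invariant measure with the explicit integral. *)
Lemma nu_unique (l : {poly R} -> R) : (forall a u v, l (a *: u + v) = a * l u + l v) ->
  l 1 = 1 -> (forall q, l (Dop sigma t0 0 q) = 0) -> l =1 nu.
Proof.
move=> lin one dop q.
have [a ->] := @p_basis _ p psize (size q) q (leqnn _).
have aux (m : {poly R} -> R) : (forall a u v, m (a *: u + v) = a * m u + m v) ->
  m 1 = 1 -> (forall q, m (Dop sigma t0 0 q) = 0) -> forall n,
  m (\sum_(0 <= k < n) a k *: p k) = \sum_(0 <= k < n) a k * (k == 0)%N%:R.
  move=> mlin m1 mdop; elim=> [|n IH].
    rewrite !big_nil; have := mlin (-1) 0 0; rewrite scaler0 addr0; move: (m 0) => z; lra.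
  rewrite big_nat_recr//= addrC mlin IH.
  rewrite [RHS]big_nat_recr//= [RHS]addrC; congr (_ * _ + _).
  case: n {IH} => [|n]; first by rewrite /p /pk /= hornerC invr1 scale1r m1.
  have m0 : m 0 = 0 by have := mlin (-1) 0 0; rewrite scaler0 addr0; move: (m 0) => z; lra.
  by rewrite /p /pk -[_ *: _]addr0 mlin mdop m0 mulr0 addr0.
rewrite (aux l lin one dop) (aux nu nu_linear Prm_one nu_stokes)//.
Qed.

Section Geometry.
Context {dT : measure_display} {T : measurableType dT} {I : finType}.
Variables (coord : I -> T -> R) (X : set T) (dist : T -> T -> R) (G : set (T -> T)).
Hypothesis coord_meas : forall i, measurable_fun setT (coord i).
Hypothesis mX : measurable X.
Hypothesis tk1 : forall x, X x -> tk coord x x = 1.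
Hypothesis dist_tk : forall x y, X x -> X y -> (dist x y <= L) = (tau L <= tk coord x y).
Hypothesis mean_inv : forall mu : probability T R, mu X = 1%E -> invariant_under G mu ->
  (forall x, X x -> forall q : {poly R}, mean mu X (fun y => (Dop sigma t0 0 q).[tk coord x y]) = 0) /\
  (forall f g : {poly R}, exists2 h : {poly R}, (size h <= size g)%N &
    forall x z, X x -> X z -> mean mu X (fun y => f.[tk coord x y] * g.[tk coord y z]) = h.[tk coord x z]).

Theorem GK_zonal : GK_spectral_limit X dist G L (fun k => Prm (p k) L) d.
Proof.
have w_itv (x : R) : 0 <= x <= th -> 0 <= massZ^-1 * W x <= massZ^-1 * C.
  move=> /W_itv/andP[h1 h2]; have Z1 : 0 < massZ^-1 by rewrite invr_gt0 massZ_gt0.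
  by rewrite mulr_ge0 ?(ltW Z1)//= ler_pM2l.
apply: (@GK_criterion _ _ _ _ coord X dist G L _ d p nu (tau L)) => //.
- exact: nu_linear.
- exact: (c_bessel L0 Lth Prm_linear Prm_at0 Prm_is_derive w_itv Prm_one porth d_norm).
- move=> eps eps0.
  exact: (approx_exists L0 Lth Prm_linear Prm_at0 Prm_is_derive w_itv Prm_one tau_decr tau_itv
    porth d_norm eps0).
move=> mu muX mu_inv; have [h1 h2] := mean_inv muX mu_inv; split=> // x Xx q.
have Em := mean_mean_on coord_meas mX tk1 muX.
apply: (nu_unique (l := fun q => mean mu X (fun y => q.[tk coord x y]))) => [a u v| |r].
- pose F (b : bool) (y : T) := (if b then u else v).[tk coord x y].
  have := mean_on_lin Em [:: true; false] (fun b => if b then a else 1) (F := F).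
  rewrite !big_cons !big_nil !addr0 mul1r => <-; last first.
    by move=> b; apply: polyfun_horner; exact: polyfun_tk.
  apply: (mean_on_ext Em) => y _; rewrite !big_cons big_nil addr0 mul1r /F.
  by rewrite hornerD hornerZ.
- rewrite -[RHS](mean_on1 Em); apply: (mean_on_ext Em) => y _; by rewrite hornerC.
- exact: h1.
Qed.

End Geometry.
End Norms.
End Zonal.

Section RealDerivatives.
Context {R : realType}.
Implicit Types (f g : R -> R) (x a b : R).

Lemma rd_eq f x a b : is_derive x 1 f a -> a = b -> is_derive x 1 f b.
Proof. by move=> h <-. Qed.

Lemma rdM f g x a b : is_derive x 1 f a -> is_derive x 1 g b ->
  is_derive x 1 (fun y => f y * g y) (a * g x + f x * b).
Proof.
move=> h1 h2; have h := @is_deriveM R R f g x 1 a b h1 h2.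
by apply: rd_eq h _; rewrite /GRing.scale/=; ring.
Qed.

Lemma rdX f n x a : is_derive x 1 f a ->
  is_derive x 1 (fun y => f y ^+ n.+1) (n.+1%:R * f x ^+ n * a).
Proof.
move=> h1; elim: n => [|n IH]; first by rewrite expr0 !mul1r.
have h := rdM h1 IH; apply: rd_eq h _.
by rewrite -[n.+2%:R]natr1 exprS; ring.
Qed.

Lemma rd_horner (q : {poly R}) f x a : is_derive x 1 f a ->
  is_derive x 1 (fun y => q.[f y]) (q^`().[f x] * a).
Proof.
move=> h1; have h2 := is_derive_poly q (f x).
have h := @is_derive1_comp R (horner q) f x _ _ h2 h1.
by apply: rd_eq h _; rewrite /GRing.scale/=; ring.
Qed.

Lemma rdZ c f x a : is_derive x 1 f a -> is_derive x 1 (fun y => c * f y) (c * a).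
Proof. by move=> h1; exact: (@is_deriveZ R R R f c x 1 a h1). Qed.

Lemma rd_cos x : is_derive x 1 (@cos R) (- sin x). Proof. exact: is_derive_cos. Qed.
Lemma rd_sin x : is_derive x 1 (@sin R) (cos x). Proof. exact: is_derive_sin. Qed.

Lemma rdXp f n x a : (0 < n)%N -> is_derive x 1 f a ->
  is_derive x 1 (fun y => f y ^+ n) (n%:R * f x ^+ n.-1 * a).
Proof. by case: n => // n _; exact: rdX. Qed.

Lemma rd_powR f x a (r : R) : 0 < f x -> is_derive x 1 f a ->
  is_derive x 1 (fun y => powR (f y) (r + 1)) ((r + 1) * powR (f x) r * a).
Proof.
move=> fx h1; have h2 := is_derive1_powR (r + 1) fx.
have h := @is_derive1_comp R (fun y => powR y (r + 1)) f x _ _ h2 h1.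
by apply: rd_eq h _; rewrite addrK /GRing.scale/=; ring.
Qed.

Lemma powRS (x r : R) : 0 < x -> powR x (r + 1) = x * powR x r.
Proof.
move=> x0; rewrite powRD; first by rewrite powRr1 ?ltW// mulrC.
by rewrite (gt_eqF x0) implybT.
Qed.

End RealDerivatives.

Section GammaRising.
Context {R : realType}.

Lemma Gamma_half_rising (m k : nat) :
  Gamma (m.+1%:R / 2 + k%:R : R) = rising (m.+1%:R / 2) k * Gamma (m.+1%:R / 2).
Proof.
elim: k => [|k IH]; first by rewrite addr0 /rising big_ord0 mul1r.
have e : m.+1%:R / 2 + k%:R = (m + k.*2).+1%:R / 2 :> R.
  by rewrite -addSn natrD -muln2 natrM; field.
by rewrite -[k.+1%:R]natr1 addrA e Gamma_halfS -e IH risingS; ring.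
Qed.

End GammaRising.

Section Orthogonal.
Context {R : realType}.
Variables (nu : {poly R} -> R) (d : nat -> R).
Hypothesis nu_lin : forall a (u v : {poly R}), nu (a *: u + v) = a * nu u + nu v.
Hypothesis nu1 : nu 1 = 1.
Hypothesis d0 : d 0 = 1.

(** The recursion is compared factor by factor: a <= b, and (k+2)(A+2k+1) <= (A+k)(A+2k+3), with
    equality when A = 1. *)
Lemma mult_ge1 (A a b : R) : 0 < a -> a <= b -> 1 <= A -> 1 <= d 1 ->
  (forall k, d k.+2 * (k.+2%:R * (a + k.+1%:R) * (A + 2 * k%:R + 1)) =
             d k.+1 * ((A + k%:R) * (b + k.+1%:R) * (A + 2 * k%:R + 3))) ->
  forall k, 1 <= d k.
Proof.
move=> a0 ab A1 d1 rec; elim=> [|[|k] IH] //; first by rewrite d0.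
have k0 : 0 <= k%:R :> R by [].
have h := rec k.
have f1 : 0 < k.+2%:R * (a + k.+1%:R) * (A + 2 * k%:R + 1).
  by rewrite !mulr_gt0// ?ltr_wpDr//; lra.
have f2 : k.+2%:R * (A + 2 * k%:R + 1) <= (A + k%:R) * (A + 2 * k%:R + 3).
  rewrite -natr1 -natr1; move: k0; move: (k%:R : R) => x x0; nra.
have f3 : k.+2%:R * (a + k.+1%:R) * (A + 2 * k%:R + 1) <=
    (A + k%:R) * (b + k.+1%:R) * (A + 2 * k%:R + 3).
  rewrite [X in X <= _]mulrAC [X in _ <= X]mulrAC; apply: ler_pM => //; last by rewrite lerD2r.
    by rewrite mulr_ge0//; lra.
  by rewrite addr_ge0// ltW.
rewrite -(ler_pM2r f1) mul1r h; apply: (le_trans f3).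
rewrite ler_peMl// !mulr_ge0 ?addr_ge0//; lra.
Qed.

Section Pearson.
Variables (sigma t0 : {poly R}) (A B e : R).
Hypothesis nu_Dop : forall q, nu (Dop sigma t0 0 q) = 0.
Hypothesis size_sigma : (size sigma <= 3)%N.
Hypothesis size_t0 : (size t0 <= 2)%N.
Hypothesis sigma2 : sigma`_2 = -1.
Hypothesis t01 : t0`_1 = - A.
Hypothesis sigma_at1 : sigma.[1] = 0.
Hypothesis sigma'_at1 : sigma^`().[1] = - e.
Hypothesis t0_at1 : t0.[1] = - B.
Hypotheses (A0 : 0 < A) (B0 : 0 < B) (e0 : 0 <= e).

Lemma mult_norm (wk : nat -> R) :
  (forall k, nu (sigma ^+ k.+1) = wk k * nu (sigma ^+ k)) ->
  d 1 * (A * wk 0) = B ^+ 2 ->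
  (forall k, d k.+2 * (k.+2%:R * (A + 2 * k%:R + 1) * (A + 2 * k%:R + 2) * wk k.+1) =
             d k.+1 * ((A + k%:R) * (B + k.+1%:R * e) ^+ 2)) ->
  forall k, d k * nu (pk sigma t0 k * pk sigma t0 k) = 1.
Proof.
move=> hw d1 rec; elim=> [|[|k] IH].
- by rewrite d0 mul1r (pk_norm0 nu_lin nu_Dop size_sigma size_t0 sigma2 t01 sigma_at1 sigma'_at1 t0_at1 B0 e0).
- rewrite (pk_norm1 nu_lin nu_Dop size_sigma size_t0 sigma2 t01 sigma_at1 sigma'_at1 t0_at1 B0 e0).
  rewrite -[sigma]expr1 hw expr0 nu1 mulr1 mulrA d1 divff// expf_neq0// gt_eqF//.
have h := pk_normS nu_lin nu_Dop size_sigma size_t0 sigma2 t01 sigma_at1 sigma'_at1 t0_at1 B0 e0 (hw k.+1).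
have r := rec k.
set N2 := nu (pk _ _ k.+2 * _) in h *; set N1 := nu (pk _ _ k.+1 * _) in h IH.
have P0 : (A + k%:R) * (B + k.+1%:R * e) ^+ 2 != 0.
  rewrite gt_eqF// mulr_gt0 ?exprn_gt0//; first by rewrite ltr_wpDr.
  by rewrite ltr_wpDr// mulr_ge0.
apply: (mulfI P0); rewrite mulr1 mulrCA h.
by rewrite mulrA r mulrAC IH mul1r.
Qed.

End Pearson.
End Orthogonal.

Section Jacobi.
Context {R : realType}.

(** With [t0J a b], the Pearson data of the Beta weight rho = s^(a-1) (1-s)^(b-1): indeed (s (1-s)
    rho)' = (a - (a+b) s) rho. *)
Definition sigJ : {poly R} := 'X - 'X^2.
Definition t0J (a b : R) : {poly R} := a%:P - (a + b) *: 'X.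

Lemma size_sigJ : (size sigJ <= 3)%N.
Proof. by rewrite (leq_trans (size_polyD _ _))// size_polyN size_polyX size_polyXn. Qed.

Lemma size_t0J a b : (size (t0J a b) <= 2)%N.
Proof.
rewrite (leq_trans (size_polyD _ _))// size_polyN geq_max (leq_trans (size_polyC_leq1 _))//=.
by rewrite (leq_trans (size_scale_leq _ _))// size_polyX.
Qed.

Lemma sigJ2 : sigJ`_2 = -1. Proof. by rewrite coefB coefX coefXn /= sub0r. Qed.

Lemma t0J1 a b : (t0J a b)`_1 = - (a + b).
Proof. by rewrite coefB coefC coefZ coefX /= mulr1 sub0r. Qed.

Lemma sigJ_at1 : sigJ.[1] = 0. Proof. by rewrite !hornerE expr1n subrr. Qed.

Lemma sigJ' : sigJ^`() = 1 - 2 *: 'X.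
Proof. by rewrite /sigJ derivB derivX derivXn /= expr1 scaler_nat. Qed.

Lemma sigJ'_at1 : sigJ^`().[1] = - 1.
Proof. by rewrite sigJ' !hornerE; ring. Qed.

Lemma t0J_at1 a b : (t0J a b).[1] = - b.
Proof. by rewrite /t0J !hornerE; ring. Qed.

Lemma DopJ a b i (q : {poly R}) (u : R) : (Dop sigJ (t0J a b) i q).[u] =
  ((a + i%:R) * (1 - u) - (b + i%:R) * u) * q.[u] + u * (1 - u) * q^`().[u].
Proof. by rewrite /Dop sigJ' /sigJ /t0J !hornerE; ring. Qed.

(** Raising both parameters by 1 multiplies the weight by [sigJ], which is why [Rod] starts at 1.
    The Gamma quotient becomes a rising factorial because the parameters are half-integers. *)
Lemma jacobiJ_Rod (p m k : nat) (s : R) : 0 < s < 1 ->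
  jacobiJ (p%:R / 2 + 1) (m%:R / 2 + 1) k s =
  (-1) ^+ k / rising (m%:R / 2 + 1) k * (Rod sigJ (t0J (p%:R / 2) (m%:R / 2)) 1 k).[s].
Proof.
move=> hs; set a : R := p%:R / 2; set b : R := m%:R / 2.
pose phi (i : nat) (u : R) := powR u (a + i%:R - 1) * powR (1 - u) (b + i%:R - 1).
have phi_der i (q : {poly R}) (u : R) : 0 < u < 1 ->
    is_derive u 1 (fun y => phi i.+1 y * q.[y]) (phi i u * (Dop sigJ (t0J a b) i q).[u]).
  move=> /andP[u0 u1]; have u1' : 0 < 1 - u by rewrite subr_gt0.
  set r := a + i%:R - 1; set r' := b + i%:R - 1.
  have i1 : is_derive u 1 (fun y : R => y) 1 by exact: is_derive_id.
  have i2 : is_derive u 1 (fun y : R => 1 - y) (-1).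
    have c1 := @is_derive_cst R R R 1 u 1.
    by rewrite -[X in is_derive _ _ _ X]add0r -[X in is_derive _ _ _ X]/(0 - 1); exact: is_deriveB.
  have h := rdM (rdM (rd_powR (f := fun y => y) r u0 i1) (rd_powR (f := fun y => 1 - y) r' u1' i2)) (rd_horner (f := fun y => y) q i1).
  have -> : (fun y => phi i.+1 y * q.[y]) = (fun y => powR y (r + 1) * powR (1 - y) (r' + 1) * q.[y]).
    apply/funext => y; rewrite /phi -[i.+1%:R]natr1.
    by congr (powR _ _ * powR _ _ * _); rewrite /r /r'; ring.
  apply: rd_eq h _; rewrite DopJ !powRS// /phi -/r -/r'.
  have -> : a + i%:R = r + 1 by rewrite /r; ring.
  have -> : b + i%:R = r' + 1 by rewrite /r'; ring.
  ring.
rewrite /jacobiJ.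
have -> : (fun u => powR u (a + 1 + k%:R - 1) * powR (1 - u) (b + 1 + k%:R - 1)) = phi (1 + k)%N.
  by apply/funext => u; rewrite /phi natrD; congr (powR _ _ * powR _ _); ring.
rewrite (rodrigues phi_der)// /phi ?mulr1n.
have -> : a + 1 - 1 = a by ring.
have -> : b + 1 - 1 = b by ring.
have G := @Gamma_half_rising R m.+1 k; have G0 := @Gamma_half_gt0 R m.+1.
have eb : b + 1 = m.+2%:R / 2 by rewrite -addn2 natrD /b; field.
rewrite eb G.
have r0 : rising (m.+2%:R / 2) k != 0 :> R by rewrite gt_eqF// rising_gt0// divr_gt0.
case/andP: hs => s0 s1.
have p1 : powR s a != 0 by rewrite gt_eqF// powR_gt0.
have p2 : powR (1 - s) b != 0 by rewrite gt_eqF// powR_gt0// subr_gt0.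
move: G0; move: (Gamma _) => g g0; have g1 : g != 0 by rewrite gt_eqF.
move: r0; move: (rising _ _) => rr r0; move: p1 p2; move: (powR s a) (powR (1 - s) b) => x y p1 p2.
by field; rewrite p1 p2 g1 r0.
Qed.

End Jacobi.

Section Sphere.
Context {R : realType}.

(** With [t0S n], the Pearson data of (1 - t^2)^(n/2 - 1), the law of one coordinate on the
    n-sphere. *)
Definition sigS : {poly R} := 1 - 'X^2.
Definition t0S (n : R) : {poly R} := - n *: 'X.

Lemma size_sigS : (size sigS <= 3)%N.
Proof. by rewrite (leq_trans (size_polyD _ _))// size_polyN size_poly1 size_polyXn. Qed.

Lemma size_t0S n : (size (t0S n) <= 2)%N.
Proof. by rewrite (leq_trans (size_scale_leq _ _))// size_polyX. Qed.

Lemma sigS2 : sigS`_2 = -1. Proof. by rewrite coefB coef1 coefXn /= sub0r. Qed.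

Lemma t0S1 n : (t0S n)`_1 = - n.
Proof. by rewrite coefZ coefX /= mulr1. Qed.

Lemma sigS_at1 : sigS.[1] = 0. Proof. by rewrite !hornerE expr1n subrr. Qed.

Lemma sigS' : sigS^`() = - 2 *: 'X.
Proof. by rewrite /sigS derivB derivC derivXn /= expr1 scaleNr sub0r scaler_nat. Qed.

Lemma sigS'_at1 : sigS^`().[1] = - 2.
Proof. by rewrite sigS' !hornerE. Qed.

Lemma t0S_at1 n : (t0S n).[1] = - n.
Proof. by rewrite /t0S !hornerE. Qed.

Lemma DopS n i (q : {poly R}) (u : R) : (Dop sigS (t0S n) i q).[u] =
  - ((n + 2 * i%:R) * u * q.[u]) + (1 - u ^+ 2) * q^`().[u].
Proof. rewrite /Dop sigS' /sigS /t0S !hornerE /=; ring. Qed.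

Lemma legendreP_Rod (n k : nat) (s : R) : -1 < s < 1 ->
  legendreP (n + 2) k s =
  (-1) ^+ k / (2 ^+ k * rising (n%:R / 2 + 1) k) * (Rod sigS (t0S n%:R) 1 k).[s].
Proof.
move=> hs; set b : R := n%:R / 2.
pose phi (i : nat) (u : R) := powR (1 - u ^+ 2) (b + i%:R - 1).
have pos (u : R) : -1 < u < 1 -> 0 < 1 - u ^+ 2.
  by move=> /andP[h1 h2]; rewrite expr2; nra.
have phi_der i (q : {poly R}) (u : R) : -1 < u < 1 ->
    is_derive u 1 (fun y => phi i.+1 y * q.[y]) (phi i u * (Dop sigS (t0S n%:R) i q).[u]).
  move=> /pos u0; set r := b + i%:R - 1.
  have i1 : is_derive u 1 (fun y : R => y) 1 by exact: is_derive_id.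
  have i2 : is_derive u 1 (fun y : R => 1 - y ^+ 2) (0 - 2 * u ^+ 1 * 1).
    have c1 := @is_derive_cst R R R 1 u 1; have c2 := rdX 1 i1.
    exact: is_deriveB.
  have h := rdM (rd_powR (f := fun y => 1 - y ^+ 2) r u0 i2) (rd_horner (f := fun y => y) q i1).
  have -> : (fun y => phi i.+1 y * q.[y]) = (fun y => powR (1 - y ^+ 2) (r + 1) * q.[y]).
    apply/funext => y; rewrite /phi -[i.+1%:R]natr1.
    by congr (powR _ _ * _); rewrite /r; ring.
  apply: rd_eq h _; rewrite DopS !powRS// /phi -/r.
  have -> : n%:R = 2 * (r + 1 - i%:R) by rewrite /r /b; field.
  by rewrite expr1; ring.
rewrite /legendreP.
have e2 : (n + 2)%:R / 2 = b + 1 by rewrite natrD /b; field.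
have -> : (fun u : R => powR (1 - u ^+ 2) ((n + 2)%:R / 2 + k%:R - 1)) = phi (1 + k)%N.
  by apply/funext => u; rewrite /phi e2 natrD; congr (powR _ _); ring.
rewrite (rodrigues phi_der)// /phi e2 ?mulr1n.
have -> : b + 1 - 1 = b by ring.
have G := @Gamma_half_rising R n.+1 k; have G0 := @Gamma_half_gt0 R n.+1.
have eb : b + 1 = n.+2%:R / 2 by rewrite -addn2 natrD /b; field.
rewrite eb G.
have r0 : rising (n.+2%:R / 2) k != 0 :> R by rewrite gt_eqF// rising_gt0// divr_gt0.
have p1 : powR (1 - s ^+ 2) b != 0 by rewrite gt_eqF// powR_gt0// pos.
have t0 : 2 ^+ k != 0 :> R by rewrite expf_neq0.
move: G0; move: (Gamma _) => g g0; have g1 : g != 0 by rewrite gt_eqF.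
move: r0; move: (rising _ _) => rr r0; move: p1 t0; move: (powR _ b) (2 ^+ k : R) => x y p1 t0.
by field; rewrite p1 g1 r0 t0.
Qed.

End Sphere.

Section NuRatio.
Context {R : realType}.
Variable nu : {poly R} -> R.
Hypothesis nu_lin : forall a (u v : {poly R}), nu (a *: u + v) = a * nu u + nu v.

Let nuD u v : nu (u + v) = nu u + nu v.
Proof. by rewrite -[u]scale1r nu_lin mul1r scale1r. Qed.

Let nuZ a u : nu (a *: u) = a * nu u.
Proof.
have n0 : nu 0 = 0 by have := nuD 0 0; rewrite addr0; move: (nu 0) => t; lra.
by rewrite -[a *: u]addr0 nu_lin n0 addr0.
Qed.

(** Testing the Pearson identity on 1 and on X gives two linear relations, from which the auxiliary
    moment [nu (sigJ ^+ k * 'X)] is eliminated. *)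
Lemma nu_sigJ (a b : R) : 0 < a -> 0 < b ->
  (forall q, nu (Dop sigJ (t0J a b) 0 q) = 0) ->
  forall k, nu (sigJ ^+ k.+1) =
    (a + k%:R) * (b + k%:R) / ((a + b + 2 * k%:R) * (a + b + 2 * k%:R + 1)) * nu (sigJ ^+ k).
Proof.
move=> a0 b0 hD k; set A := a + b + 2 * k%:R.
have k0 : 0 <= k%:R :> R by [].
have A0 : 0 < A by rewrite /A; lra.
have h1 := nu_sigma_Dop hD k 1; have h2 := nu_sigma_Dop hD k 'X.
have e1 : sigJ ^+ k * Dop sigJ (t0J a b) k 1 = (a + k%:R) *: sigJ ^+ k + (- A) *: (sigJ ^+ k * 'X).
  rewrite /Dop sigJ' derivC /t0J mulr0 addr0 mulr1 -!mul_polyC /A !(polyCD, polyCN, polyCM); ring.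
have e2 : sigJ ^+ k * Dop sigJ (t0J a b) k 'X =
   (a + k%:R - A) *: (sigJ ^+ k * 'X) + (A + 1) *: sigJ ^+ k.+1.
  rewrite exprSr; move: (sigJ ^+ k) => s.
  by rewrite /Dop sigJ' derivX /t0J /sigJ -!mul_polyC /A !(polyCD, polyCN, polyCM, polyC1); ring.
rewrite e1 nuD !nuZ in h1; rewrite e2 nuD !nuZ in h2.
move: h1 h2; move: (nu _) (nu _) (nu _) => x y z h1 h2.
have -> : x = (A - (a + k%:R)) * y / (A + 1).
  rewrite -[LHS](mulfK (_ : A + 1 != 0)); last by rewrite gt_eqF//; lra.
  by congr (_ / _); lra.
have -> : y = (a + k%:R) * z / A.
  rewrite -[LHS](mulfK (_ : A != 0)); last by rewrite gt_eqF.
  by congr (_ / _); lra.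
have -> : b + k%:R = A - (a + k%:R) by rewrite /A; ring.
by field; rewrite !gt_eqF//; lra.
Qed.

Lemma nu_sigS (n : R) : 0 < n -> (forall q, nu (Dop sigS (t0S n) 0 q) = 0) ->
  forall k, nu (sigS ^+ k.+1) = (n + 2 * k%:R) / (n + 2 * k%:R + 1) * nu (sigS ^+ k).
Proof.
move=> n0 hD k; set A := n + 2 * k%:R.
have k0 : 0 <= k%:R :> R by [].
have A0 : 0 < A by rewrite /A; lra.
have h2 := nu_sigma_Dop hD k 'X.
have e2 : sigS ^+ k * Dop sigS (t0S n) k 'X = (A + 1) *: sigS ^+ k.+1 + (- A) *: sigS ^+ k.
  rewrite exprSr; move: (sigS ^+ k) => s.
  by rewrite /Dop sigS' derivX /t0S /sigS -!mul_polyC /A !(polyCD, polyCN, polyCM, polyC1); ring.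
rewrite e2 nuD !nuZ in h2.
move: h2; move: (nu _) (nu _) => x y h2.
rewrite -[LHS](mulfK (_ : A + 1 != 0)); last by rewrite gt_eqF//; lra.
by rewrite [RHS]mulrAC; congr (_ / _); lra.
Qed.

End NuRatio.

(** * The Jacobi model and the sphere model *)

Section Models.
Context {R : realType} {dT : measure_display} {T : measurableType dT} {I : finType}.
Variables (coord : I -> T -> R) (X : set T) (dist : T -> T -> R) (G : set (T -> T)).
Variables (L : R) (c d : nat -> R).
Hypotheses (L0 : 0 < L) (Lpi2 : L < pi / 2).
Hypothesis coord_meas : forall i, measurable_fun setT (coord i).
Hypothesis mX : measurable X.
Hypothesis tk1 : forall x, X x -> tk coord x x = 1.
Hypothesis d0 : d 0 = 1.

Lemma sc_itv (x : R) (i j : nat) : 0 <= cos x -> 0 <= sin x -> 0 <= cos x ^+ i * sin x ^+ j <= 1.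
Proof.
by move=> h1 h2; rewrite mulr_ge0 ?exprn_ge0//= mulr_ile1 ?exprn_ge0// exprn_ile1 ?cos_le1 ?sin_le1.
Qed.

Lemma cont_cosX i : continuous (fun x : R => cos x ^+ i).
Proof.
move=> x; apply: (@continuous_comp _ _ _ cos (fun y => y ^+ i)).
  exact: continuous_cos.
exact: exprn_continuous.
Qed.

Lemma cont_sinX i : continuous (fun x : R => sin x ^+ i).
Proof.
move=> x; apply: (@continuous_comp _ _ _ sin (fun y => y ^+ i)).
  exact: continuous_sin.
exact: exprn_continuous.
Qed.

Lemma cont_sc i j : continuous (fun x : R => cos x ^+ i * sin x ^+ j).
Proof.
move=> x; change {for (x : R), continuous (fun x : R => cos x ^+ i * sin x ^+ j)}.
by apply: continuousM; [exact: cont_cosX|exact: cont_sinX].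
Qed.

Section JacobiModel.
Variables p m : nat.
Hypotheses (p0 : (0 < p)%N) (m0 : (0 < m)%N) (pm : (p <= m)%N) (pm2 : (1 < m + p)%N).
Let a : R := p%:R / 2.
Let b : R := m%:R / 2.

(** Density of the distance to a point when p is the real dimension of the algebra and m = n p;
    under t = cos^2 it becomes the Beta(p/2, m/2) weight. *)
Definition sc_wt (x : R) : R := cos x ^+ p.-1 * sin x ^+ m.-1.
Definition sc_mass : R := Rintegral lebesgue_measure `[0, pi / 2] sc_wt.

Hypothesis dist_tk : forall x y, X x -> X y -> (dist x y <= L) = (cos L ^+ 2 <= tk coord x y).
Hypothesis mean_inv : forall mu : probability T R, mu X = 1%E -> invariant_under G mu ->
  (forall x, X x -> forall q : {poly R}, mean mu X (fun y => (Dop sigJ (t0J a b) 0 q).[tk coord x y]) = 0) /\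
  (forall f g : {poly R}, exists2 h : {poly R}, (size h <= size g)%N &
    forall x z, X x -> X z -> mean mu X (fun y => f.[tk coord x y] * g.[tk coord y z]) = h.[tk coord x z]).
Hypothesis d1 : d 1 * a = b * (a + b + 1).
Hypothesis d_rec : forall k, d k.+2 * (k.+2%:R * (a + k.+1%:R) * (a + b + 2 * k%:R + 1)) =
  d k.+1 * ((a + b + k%:R) * (b + k.+1%:R) * (a + b + 2 * k%:R + 3)).
Hypothesis c0 : c 0 = Rintegral lebesgue_measure `[0, L] sc_wt / sc_mass.
Hypothesis cS : forall k, c k.+1 =
  cos L ^+ p * sin L ^+ m / (m%:R * sc_mass) * jacobiJ (a + 1) (b + 1) k (cos L ^+ 2).

(** cos^p sin^m is sigma times the weight in the variable t = cos^2, and 1/2 comes from dt = -2 cos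
    sin dx. *)
Let bd (x : R) : R := 2^-1 * (cos x ^+ p * sin x ^+ m).

Theorem GK_jacobi : GK_spectral_limit X dist G L c d.
Proof.
have a0 : 0 < a by rewrite divr_gt0// ltr0n.
have b0 : 0 < b by rewrite divr_gt0// ltr0n.
have ab0 : 0 < a + b by rewrite addr_gt0.
have ab : a <= b by rewrite ler_pM2r// ler_nat.
have ab1 : 1 <= a + b.
  by rewrite /a /b -mulrDl -natrD ler_pdivlMr// mul1r ler_nat addnC.
have pi2 : pi / 2 < pi :> R by have := pi_gt0 R; lra.
have pi0 := pi_gt0 R.
have c_ge (x : R) : 0 <= x <= pi / 2 -> 0 <= cos x.
  by move=> /andP[h1 h2]; apply: cos_ge0_pihalf; rewrite h2 andbT; lra.
have s_ge (x : R) : 0 <= x <= pi / 2 -> 0 <= sin x.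
  by move=> /andP[h1 h2]; apply: sin_ge0_pi; rewrite h1 (le_trans h2 (ltW pi2)).
have W_cont : continuous sc_wt by exact: cont_sc.
have W_itv (x : R) : 0 <= x <= pi / 2 -> 0 <= sc_wt x <= 1.
  by move=> hx; apply: sc_itv; [exact: c_ge|exact: s_ge].
have W_gt0 (x : R) : 0 < x < pi / 2 -> 0 < sc_wt x.
  move=> /andP[h1 h2]; rewrite mulr_gt0// exprn_gt0//.
    by apply: cos_gt0_pihalf; rewrite h2 andbT; lra.
  by apply: sin_gt0_pihalf; rewrite h1.
have tau_decr (x y : R) : 0 <= x -> x < y -> y <= pi / 2 -> cos y ^+ 2 < cos x ^+ 2.
  move=> x0 xy yp.
  have hy : 0 <= cos y by apply: c_ge; rewrite yp andbT; lra.
  have hxy : cos y < cos x.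
    by rewrite ltr_cos ?in_itv/=//; apply/andP; split; lra.
  by rewrite ltrXn2r// ?nnegrE// ltW// (le_lt_trans hy).
have tau_itv (x : R) : 0 <= x <= pi / 2 -> -1 <= cos x ^+ 2 <= 1.
  move=> _; have h1 := cos2Dsin2 x; have h2 := sqr_ge0 (sin x); have h3 := sqr_ge0 (cos x).
  by apply/andP; split; lra.
have bd_der (q : {poly R}) (x : R) : is_derive x 1 (fun y => bd y * q.[cos y ^+ 2])
    (- (sc_wt x * (Dop sigJ (t0J a b) 0 q).[cos x ^+ 2])).
  have h := rdM (rdZ 2^-1 (rdM (rdXp p0 (rd_cos x)) (rdXp m0 (rd_sin x))))
    (rd_horner q (rdX 1 (rd_cos x))).
  apply: rd_eq h _; rewrite DopJ /sc_wt mulr0n !addr0 /a /b.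
  have e1 : cos x ^+ p = cos x * cos x ^+ p.-1 by rewrite -exprS prednK.
  have e2 : sin x ^+ m = sin x * sin x ^+ m.-1 by rewrite -exprS prednK.
  have e3 : 1 - cos x ^+ 2 = sin x ^+ 2 by rewrite sin2cos2.
  by rewrite e1 e2 e3 expr1; field.
have bd0 : bd 0 = 0 by rewrite /bd sin0 expr0n gtn_eqF// !mulr0.
have bdth : bd (pi / 2) = 0 by rewrite /bd cos_pihalf expr0n gtn_eqF// mul0r mulr0.
have tau_cont : continuous (fun x : R => cos x ^+ 2) by exact: cont_cosX.
have ZZ := massZ_gt0 L0 Lpi2 W_cont W_gt0 tau_cont.
pose P := @Prm R (pi / 2) (fun x => cos x ^+ 2) sc_wt W_cont tau_cont.
pose nu q := P q (pi / 2).
have nul a' u v : nu (a' *: u + v) = a' * nu u + nu v.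
  exact: (nu_linear L0 Lpi2 W_cont tau_cont).
have nu1 : nu 1 = 1 by exact: (Prm_one L0 Lpi2 W_cont W_gt0 tau_cont).
have nud q : nu (Dop sigJ (t0J a b) 0 q) = 0.
  exact: (nu_stokes L0 Lpi2 W_cont tau_cont bd_der bd0 bdth).
have dn : forall k, d k * nu (pk sigJ (t0J a b) k * pk sigJ (t0J a b) k) = 1.
  refine (mult_norm nul nu1 d0 nud size_sigJ (size_t0J a b) sigJ2 (t0J1 a b) sigJ_at1 sigJ'_at1
    (t0J_at1 a b) ab0 b0 ler01 (wk := fun k => (a + k%:R) * (b + k%:R) / ((a + b + 2 * k%:R) * (a + b + 2 * k%:R + 1))) (nu_sigJ nul a0 b0 nud) _ _).
    rewrite !mulr0n !mulr0 !addr0.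
    have -> : d 1 = b * (a + b + 1) / a by rewrite -d1 mulfK ?gt_eqF.
    by field; rewrite !gt_eqF//; lra.
  move=> k; have r := d_rec k.
  have k0 : 0 <= k%:R :> R by [].
  have h1 : a + b + 2 * k%:R + 3 != 0 by rewrite gt_eqF//; lra.
  have h2 : a + b + 2 * k%:R + 2 != 0 by rewrite gt_eqF//; lra.
  rewrite -[k.+2%:R]natr1 -[k.+1%:R]natr1 in r *.
  move: r h1 h2; move: (k%:R : R) (d k.+2) (d k.+1) => x y z r h1 h2.
  have -> : z * ((a + b + x) * (b + (x + 1) * 1) ^+ 2) =
    z * ((a + b + x) * (b + (x + 1)) * (a + b + 2 * x + 3)) * (b + (x + 1)) / (a + b + 2 * x + 3).
    by field; rewrite h1.
  rewrite -r; field; rewrite h1 /=.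
  have -> : a + b + 2 * (x + 1) = a + b + 2 * x + 2 by ring.
  by [].
have dge : forall k, 1 <= d k.
  apply: (mult_ge1 d0 a0 ab ab1 _ d_rec).
  by rewrite -(ler_pM2r a0) d1 mul1r; nra.
suff -> : c = fun k => P (pk sigJ (t0J a b) k) L.
  exact: (@GK_zonal R (pi / 2) L 1 (fun x => cos x ^+ 2) sc_wt bd sigJ (t0J a b) (a + b) b 1 L0 Lpi2
    W_cont W_itv W_gt0 tau_cont tau_decr tau_itv bd_der bd0 bdth size_sigJ (size_t0J a b) sigJ2 (t0J1 a b)
    sigJ_at1 sigJ'_at1 (t0J_at1 a b) ab0 b0 ler01 d dn dge dT T I coord X dist G coord_meas mX tk1 dist_tk mean_inv).
apply/funext => -[|k].
  rewrite c0 /P Prm_pk0 /Prm mulrC; congr (_ * _).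
  case: cid => F /= [_ ->]; last exact: ltW.
  by apply: eq_Rintegral => x _; rewrite hornerC mul1r.
have cL : 0 < cos L.
  by apply: cos_gt0_pihalf; rewrite Lpi2 andbT (lt_trans _ L0)// oppr_lt0 divr_gt0.
have sL : 0 < sin L by apply: sin_gt0_pihalf; rewrite L0.
have tL : 0 < cos L ^+ 2 < 1.
  have := cos2Dsin2 L; have := exprn_gt0 2 sL; have := exprn_gt0 2 cL => h1 h2 h3.
  by apply/andP; split => //; lra.
rewrite cS /P (Prm_pkS L0 Lpi2 W_cont W_gt0 tau_cont bd_der bd0 sigJ_at1 sigJ'_at1 (t0J_at1 a b) b0 ler01).
rewrite jacobiJ_Rod//.
have -> : \prod_(j < k) (b + 1 + j%:R * 1) = rising (b + 1) k.
  by apply: eq_bigr => j _; rewrite mulr1.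
congr (_ * _); rewrite /bd /b; move: ZZ; rewrite -/sc_mass.
have -> : massZ (pi / 2) sc_wt = sc_mass by [].
move: (sc_mass) => Z Z0; have m1 : m%:R != 0 :> R by rewrite pnatr_eq0 -lt0n.
by field; rewrite m1 gt_eqF.
Qed.

End JacobiModel.

Section SphereModel.
Variable n : nat.
Hypothesis n0 : (0 < n)%N.

Hypothesis dist_tk : forall x y, X x -> X y -> (dist x y <= L) = (cos L <= tk coord x y).
Hypothesis mean_inv : forall mu : probability T R, mu X = 1%E -> invariant_under G mu ->
  (forall x, X x -> forall q : {poly R}, mean mu X (fun y => (Dop sigS (t0S n%:R) 0 q).[tk coord x y]) = 0) /\
  (forall f g : {poly R}, exists2 h : {poly R}, (size h <= size g)%N &
    forall x z, X x -> X z -> mean mu X (fun y => f.[tk coord x y] * g.[tk coord y z]) = h.[tk coord x z]).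
Hypothesis d1 : d 1 = n%:R + 1.
Hypothesis d_rec : forall k, d k.+2 * (k.+2%:R * (n%:R + 2 * k%:R + 1)) =
  d k.+1 * ((n%:R + k%:R) * (n%:R + 2 * k%:R + 3)).
Hypothesis c0 : c 0 = sin_int n L / sin_int n pi.
Hypothesis cS : forall k, c k.+1 =
  sin L ^+ n / (n%:R * sin_int n pi) * legendreP (n + 2) k (cos L).

Theorem GK_sphere : GK_spectral_limit X dist G L c d.
Proof.
have nn : 0 < n%:R :> R by rewrite ltr0n.
have n1 : 1 <= n%:R :> R by rewrite ler1n.
have pi0 := pi_gt0 R.
have Lpi : L < pi by apply: (lt_trans Lpi2); lra.
pose W (x : R) := sin x ^+ n.-1.
pose bd (x : R) := sin x ^+ n.
have W_cont : continuous W by exact: cont_sinX.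
have W_itv (x : R) : 0 <= x <= pi -> 0 <= W x <= 1.
  by move=> hx; rewrite exprn_ge0 ?sin_ge0_pi//= exprn_ile1 ?sin_ge0_pi// sin_le1.
have W_gt0 (x : R) : 0 < x < pi -> 0 < W x.
  by move=> hx; rewrite exprn_gt0// sin_gt0_pi.
have tau_decr (x y : R) : 0 <= x -> x < y -> y <= pi -> cos y < cos x.
  by move=> x0 xy yp; rewrite ltr_cos ?in_itv/=//; apply/andP; split; lra.
have tau_itv (x : R) : 0 <= x <= pi -> -1 <= cos x <= 1.
  by move=> _; rewrite cos_geN1 cos_le1.
have bd_der (q : {poly R}) (x : R) : is_derive x 1 (fun y => bd y * q.[cos y])
    (- (W x * (Dop sigS (t0S n%:R) 0 q).[cos x])).
  have h := rdM (rdXp n0 (rd_sin x)) (rd_horner q (rd_cos x)).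
  apply: rd_eq h _; rewrite DopS /W mulr0n.
  have e2 : sin x ^+ n = sin x * sin x ^+ n.-1 by rewrite -exprS prednK.
  have e3 : 1 - cos x ^+ 2 = sin x ^+ 2 by rewrite sin2cos2.
  by rewrite e2 e3; ring.
have bd0 : bd 0 = 0 by rewrite /bd sin0 expr0n gtn_eqF.
have bdth : bd pi = 0 by rewrite /bd sinpi expr0n gtn_eqF.
have tau_cont := @continuous_cos R.
have ZZ := massZ_gt0 L0 Lpi W_cont W_gt0 tau_cont.
pose P := @Prm R pi (@cos R) W W_cont tau_cont.
pose nu q := P q pi.
have nul a' u v : nu (a' *: u + v) = a' * nu u + nu v.
  exact: (nu_linear L0 Lpi W_cont tau_cont).
have nu1 : nu 1 = 1 by exact: (Prm_one L0 Lpi W_cont W_gt0 tau_cont).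
have nud q : nu (Dop sigS (t0S n%:R) 0 q) = 0.
  exact: (nu_stokes L0 Lpi W_cont tau_cont bd_der bd0 bdth).
have e2 : 0 <= 2 :> R by [].
have dn : forall k, d k * nu (pk sigS (t0S n%:R) k * pk sigS (t0S n%:R) k) = 1.
  refine (mult_norm nul nu1 d0 nud size_sigS (size_t0S _) sigS2 (t0S1 _) sigS_at1 sigS'_at1
    (t0S_at1 _) nn nn e2 (wk := fun k => (n%:R + 2 * k%:R) / (n%:R + 2 * k%:R + 1)) (nu_sigS nul nn nud) _ _).
    rewrite !mulr0n !mulr0 !addr0 d1.
    by field; rewrite !gt_eqF//; lra.
  move=> k; have r := d_rec k.
  have k0 : 0 <= k%:R :> R by [].
  have h1 : n%:R + 2 * k%:R + 3 != 0 :> R by rewrite gt_eqF//; lra.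
  rewrite -[k.+2%:R]natr1 -[k.+1%:R]natr1 in r *.
  move: r h1; move: (k%:R : R) (d k.+2) (d k.+1) (n%:R : R) => x y z A r h1.
  have -> : z * ((A + x) * (A + (x + 1) * 2) ^+ 2) =
    z * ((A + x) * (A + 2 * x + 3)) * (A + (x + 1) * 2) ^+ 2 / (A + 2 * x + 3).
    by field; rewrite h1.
  have e : A + 2 * (x + 1) + 1 = A + 2 * x + 3 by ring.
  by rewrite -r e; field.
have dge : forall k, 1 <= d k.
  (* The recursion on the sphere has no factors involving a and b; a = b = 1 multiplies both of its
     sides by the same number. *)
  apply: (@mult_ge1 _ d d0 n%:R 1 1) => //; first by rewrite d1; lra.
  move=> k; move: (d_rec k); move: (k.+2%:R : R) (k.+1%:R : R) => y z r.
  transitivity (d k.+2 * (y * (n%:R + 2 * k%:R + 1)) * (1 + z)); first by ring.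
  by rewrite r; ring.
suff -> : c = fun k => P (pk sigS (t0S n%:R) k) L.
  exact: (@GK_zonal R pi L 1 (@cos R) W bd sigS (t0S n%:R) n%:R n%:R 2 L0 Lpi
    W_cont W_itv W_gt0 tau_cont tau_decr tau_itv bd_der bd0 bdth size_sigS (size_t0S _) sigS2 (t0S1 _)
    sigS_at1 sigS'_at1 (t0S_at1 _) nn nn e2 d dn dge dT T I coord X dist G coord_meas mX tk1 dist_tk mean_inv).
apply/funext => -[|k].
  rewrite c0 /P Prm_pk0 /Prm mulrC; congr (_ * _).
  case: cid => F /= [_ ->]; last exact: ltW.
  by apply: eq_Rintegral => x _; rewrite hornerC mul1r.
have sL : 0 < sin L by apply: sin_gt0_pi; rewrite L0.
have tL : -1 < cos L < 1.
  have := cos2Dsin2 L; have := exprn_gt0 2 sL => h1 h2.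
  by apply/andP; split; nra.
rewrite cS /P (Prm_pkS L0 Lpi W_cont W_gt0 tau_cont bd_der bd0 sigS_at1 sigS'_at1 (t0S_at1 _) nn e2).
rewrite legendreP_Rod//.
have -> : \prod_(j < k) (n%:R + 2 + j%:R * 2) = 2 ^+ k * rising (n%:R / 2 + 1) k :> R.
  elim: k => [|k IH]; first by rewrite /rising !big_ord0 mulr1.
  by rewrite big_ord_recr/= IH risingS exprS; field.
congr (_ * _); rewrite /bd; move: ZZ.
have -> : massZ pi W = sin_int n pi by [].
move: (sin_int n pi) => Z Z0.
by field; rewrite !gt_eqF.
Qed.

End SphereModel.
End Models.

(** * Normalising integrals and binomial recursions *)

Section Masses.
Context {R : realType}.
Let mu := @lebesgue_measure R.

Lemma Rint_FTC (f G : R -> R) (b : R) : 0 < b -> continuous f ->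
  (forall x : R, 0 <= x <= b -> is_derive x 1 G (f x)) -> Rintegral mu `[0, b] f = G b - G 0.
Proof.
move=> b0 cf dG; have cf' (x : R) : 0 <= x <= b -> {for x, continuous f} by move=> _; exact: cf.
by have /(congr1 fine) := FTC_itv b0 cf' dG.
Qed.

Lemma pi2_gt0 : 0 < pi / 2 :> R. Proof. by rewrite divr_gt0// pi_gt0. Qed.

(** Wallis: the combination is the integral of the derivative of - cos sin^n, which vanishes at both
    ends. *)
Lemma sin_int_rec (n : nat) : (0 < n)%N ->
  n.+1%:R * sin_int n.+2 (pi / 2) = n%:R * sin_int n (pi / 2) :> R.
Proof.
move=> n0.
have [F1 [d1 I1]] := primitive_exists (fun x : R => @cont_sinX R n.-1 x).
have [F2 [d2 I2]] := primitive_exists (fun x : R => @cont_sinX R n.+1 x).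
rewrite /sin_int -[n.+2.-1]/n.+1 -I1 ?(ltW pi2_gt0)// -I2 ?(ltW pi2_gt0)//.
have z1 : F1 0 = 0 by rewrite I1// set_itv1 Rintegral_set1.
have z2 : F2 0 = 0 by rewrite I2// set_itv1 Rintegral_set1.
pose f (x : R) := n.+1%:R * sin x ^+ n.+1 - n%:R * sin x ^+ n.-1.
have cf : continuous f.
  move=> x; change {for (x : R), continuous (fun x : R => n.+1%:R * sin x ^+ n.+1 - n%:R * sin x ^+ n.-1)}.
  apply: continuousB; (apply: continuousM; [exact: cst_continuous|exact: cont_sinX]).
have g1 (x : R) : 0 <= x <= pi / 2 -> is_derive x 1 (fun y => n.+1%:R * F2 y - n%:R * F1 y) (f x).
  move=> /andP[x0 _]; have x1 : -1 < x := lt_le_trans (ltrN10 _) x0.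
  have h1 := rdZ n.+1%:R (d2 x x1); have h2 := rdZ n%:R (d1 x x1).
  exact: is_deriveB.
have g2 (x : R) : 0 <= x <= pi / 2 -> is_derive x 1 (fun y => -1 * (cos y * sin y ^+ n)) (f x).
  move=> _; have h := rdZ (-1) (rdM (rd_cos x) (rdXp n0 (rd_sin x))).
  apply: rd_eq h _; rewrite /f -[n.+1%:R]natr1.
  have -> : sin x ^+ n.+1 = sin x * sin x * sin x ^+ n.-1 by rewrite -mulrA -!exprS prednK.
  have -> : sin x ^+ n = sin x * sin x ^+ n.-1 by rewrite -exprS prednK.
  have -> : -1 * (- sin x * (sin x * sin x ^+ n.-1) + cos x * (n%:R * sin x ^+ n.-1 * cos x)) =
    sin x * sin x * sin x ^+ n.-1 - n%:R * (cos x ^+ 2) * sin x ^+ n.-1 by ring.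
  by rewrite cos2sin2; ring.
have := Rint_FTC pi2_gt0 cf g1; rewrite (Rint_FTC pi2_gt0 cf g2).
rewrite cos_pihalf sin0 z1 z2 expr0n gtn_eqF// => h.
by apply/eqP; rewrite -subr_eq0; apply/eqP; move: h; rewrite !mulr0 !mul0r !mulr0 !subr0.
Qed.

Lemma sin_int1 : sin_int 1 (pi / 2) = pi / 2 :> R.
Proof.
have c1 : continuous (fun x : R => sin x ^+ 0) by exact: cont_sinX.
have d1 (x : R) : 0 <= x <= pi / 2 -> is_derive x 1 (fun y => y) (sin x ^+ 0).
  by move=> _; rewrite expr0; exact: is_derive_id.
by rewrite /sin_int (Rint_FTC pi2_gt0 c1 d1) subr0.
Qed.

Lemma sin_int2 : sin_int 2 (pi / 2) = 1 :> R.
Proof.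
have c1 : continuous (fun x : R => sin x ^+ 1) by exact: cont_sinX.
have d1 (x : R) : 0 <= x <= pi / 2 -> is_derive x 1 (fun y => -1 * cos y) (sin x ^+ 1).
  by move=> _; have h := rdZ (-1) (rd_cos x); apply: rd_eq h _; rewrite expr1; ring.
by rewrite /sin_int (Rint_FTC pi2_gt0 c1 d1) cos_pihalf cos0; ring.
Qed.

Lemma sin_int_gt0 n : 0 < sin_int n.+1 (pi / 2) :> R.
Proof.
suff [] : 0 < sin_int n.+1 (pi / 2) :> R /\ 0 < sin_int n.+2 (pi / 2) :> R by [].
elim: n => [|n [h1 h2]]; first by rewrite sin_int1 sin_int2 pi2_gt0.
split=> //; have h := @sin_int_rec n.+1 isT.
by rewrite -(@pmulr_rgt0 _ n.+2%:R)// h mulr_gt0.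
Qed.

(** Reconciles the Gamma constant in the statement for real projective space with the integral of
    sin^(n-1). Wallis' recursion has step 2, so the induction carries two consecutive values. *)
Lemma wallis_Gamma (n : nat) :
  Gamma (n.+2%:R / 2) / (Gamma (1 / 2) * Gamma ((n.+1%:R + 2) / 2)) * (n.+1%:R * sin_int n.+1 (pi / 2)) = 1 :> R.
Proof.
pose Q (n : nat) : R := Gamma (n.+2%:R / 2) / (Gamma (1 / 2) * Gamma ((n.+1%:R + 2) / 2)) *
  (n.+1%:R * sin_int n.+1 (pi / 2)).
suff [] : Q n = 1 /\ Q n.+1 = 1 by [].
have sp : 0 < Num.sqrt pi :> R by rewrite sqrtr_gt0 pi_gt0.
have sp2 : Num.sqrt pi * Num.sqrt pi = pi :> R by rewrite -expr2 sqr_sqrtr// pi_ge0.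
have G32 : Gamma (3 / 2) = 1 / 2 * Num.sqrt pi :> R.
  by rewrite (_ : 3 / 2 = 1 / 2 + 1) ?(Gamma_halfS 0) ?Gamma_half//; field.
elim: n => [|n [h1 h2]].
  split; rewrite /Q.
    rewrite Gamma_half divff// Gamma_1 sin_int1 (_ : (1 + 2) = 3 :> R) ?G32; last by ring.
    rewrite -[X in 1 * (X / 2)]sp2; move: sp; move: (Num.sqrt _) => s s0.
    by field; rewrite gt_eqF.
  rewrite Gamma_half sin_int2 G32 (_ : (2 + 2) / 2 = 2 / 2 + 1 :> R); last by field.
  by rewrite (Gamma_halfS 1) divff// Gamma_1; field; rewrite gt_eqF.
split=> //; rewrite -h1 /Q.
have e1 : n.+4%:R / 2 = n.+2%:R / 2 + 1 :> R by rewrite -[n.+4]addn2 natrD; field.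
have e2 : (n.+3%:R + 2) / 2 = n.+3%:R / 2 + 1 :> R by field.
have e3 : (n.+1%:R + 2) / 2 = n.+3%:R / 2 :> R by rewrite -[n.+3]addn2 natrD.
have r := @sin_int_rec n.+1 isT.
rewrite e1 e2 e3 (Gamma_halfS n.+1) (Gamma_halfS n.+2).
have g3 := Gamma_half_gt0 (R := R) n.+2; have g1 := Gamma_half_gt0 (R := R) 0.
rewrite -[RHS]mulr1 -[in X in _ = X]r.
move: r g3 g1; move: (Gamma (n.+3%:R / 2)) (Gamma (1 / 2)) (Gamma (n.+2%:R / 2)) => x y z.
move: (sin_int n.+3 _) (sin_int n.+1 _) => u v r x0 y0.
rewrite mulr1; have n2 : n.+2%:R != 0 :> R by []. have n3 : n.+3%:R != 0 :> R by [].
move: n2 n3 r; move: (n.+3%:R : R) (n.+2%:R : R) => p q q0 p0 r.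
have x1 : x != 0 by rewrite gt_eqF.
have y1 : y != 0 by rewrite gt_eqF.
by field; rewrite x1 y1 p0.
Qed.

(** In the complex, quaternionic and octonionic cases c_0, as a function of the radius, is an
    elementary primitive G of the density; one such G yields both the mass and c_0. *)
Lemma sc_mass_prim (p m : nat) (G : R -> R) (kap L : R) : 0 < L -> kap != 0 ->
  G 0 = 0 -> G (pi / 2) = 1 -> (forall x : R, is_derive x 1 G (kap * sc_wt p m x)) ->
  sc_mass p m = kap^-1 /\ Rintegral mu `[0, L] (sc_wt p m) / sc_mass p m = G L.
Proof.
move=> L0 k0 G0 G1 dG.
have dG' (x : R) : is_derive x 1 (fun y => kap^-1 * G y) (sc_wt p m x).
  by apply: rd_eq (rdZ kap^-1 (dG x)) _; rewrite mulrA mulVf// mul1r.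
have cs : continuous (@sc_wt R p m) by exact: cont_sc.
have I (b : R) : 0 < b -> Rintegral mu `[0, b] (sc_wt p m) = kap^-1 * G b.
  by move=> b0; rewrite (Rint_FTC b0 cs (fun x _ => dG' x)) G0 mulr0 subr0.
have M : sc_mass p m = kap^-1 by rewrite /sc_mass I ?pi2_gt0// G1 mulr1.
by split=> //; rewrite M I// mulrAC divff ?mul1r// invr_eq0.
Qed.

Lemma binR_step (k m : nat) : binR (k.+1 + m) m * k.+1%:R = (k.+1%:R + m%:R) * binR (k + m) m :> R.
Proof.
have h := mul_bin_down (k.+1 + m) m; rewrite addSn /= subSn ?leq_addl// addnK in h.
by rewrite /binR -natrD -!natrM addSn h mulnC.
Qed.

Lemma binR_succ (k m : nat) : binR (k.+1 + m) m = (k.+1%:R + m%:R) / k.+1%:R * binR (k + m) m :> R.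
Proof. by apply: (@mulIf _ k.+1%:R) => //; rewrite binR_step mulrAC divfK. Qed.

Lemma binR_1 m : binR (1 + m) m = 1 + m%:R :> R.
Proof. by have := @binR_step 0 m; rewrite /binR add0n binn !mulr1. Qed.

Lemma binR_2 m : binR (2 + m) m = (2 + m%:R) * (1 + m%:R) / 2 :> R.
Proof. by rewrite -binR_1 -(@binR_step 1 m) mulfK. Qed.

End Masses.

Section Spaces.
Context {R : realType} {dT : measure_display} {T : measurableType dT} {I : finType}.
Variables (coord : I -> T -> R) (X : set T) (dist : T -> T -> R) (G : set (T -> T)).
Variables (L : R).
Hypotheses (L0 : 0 < L) (Lpi2 : L < pi / 2).
Hypothesis coord_meas : forall i, measurable_fun setT (coord i).
Hypothesis mX : measurable X.
Hypothesis tk1 : forall x, X x -> tk coord x x = 1.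

Definition mean_invariant (sigma t0 : {poly R}) : Prop :=
  forall mu : probability T R, mu X = 1%E -> invariant_under G mu ->
  (forall x, X x -> forall q : {poly R}, mean mu X (fun y => (Dop sigma t0 0 q).[tk coord x y]) = 0) /\
  (forall f g : {poly R}, exists2 h : {poly R}, (size h <= size g)%N &
    forall x z, X x -> X z -> mean mu X (fun y => f.[tk coord x y] * g.[tk coord y z]) = h.[tk coord x z]).

Theorem GK_RS (n : nat) : (0 < n)%N ->
  (forall x y, X x -> X y -> (dist x y <= L) = (cos L <= tk coord x y)) ->
  mean_invariant sigS (t0S n%:R) -> GK_spectral_limit X dist G L (eig_RS L n) (mult_RS n).
Proof.
move=> n0 dist_tk mi.
apply: (GK_sphere L0 Lpi2 coord_meas mX tk1 _ n0 dist_tk mi) => //.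
- case: n n0 {dist_tk mi} => // n _; rewrite /mult_RS /=.
  rewrite addnS !subn1 /= binR_1 -[n.+1%:R]natr1.
  have n1 : 0 <= n%:R :> R by []; move: n1; move: (n%:R : R) => x x0.
  by field; rewrite gt_eqF//; lra.
- move=> k; case: n n0 {dist_tk mi} => // n _; rewrite /mult_RS /=.
  have e0 j : (j + n.+1 - 1 = j + n)%N by rewrite addnS subn1.
  rewrite !e0 !subn1 /=.
  rewrite binR_succ -[n.+1%:R]natr1 -[k.+2%:R]natr1 -[k.+1%:R]natr1.
  have n1 : 0 <= n%:R :> R by []. have k1 : 0 <= k%:R :> R by [].
  move: n1 k1; move: (n%:R : R) (k%:R : R) (binR _ _) => x y u x0 y0.
  have p1 : y + 1 + 1 + (x + 1) - 1 != 0 by rewrite gt_eqF//; lra.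
  have p2 : y + 1 + (x + 1) - 1 != 0 by rewrite gt_eqF//; lra.
  have p3 : y + 1 + 1 != 0 by rewrite gt_eqF//; lra.
  by field; rewrite p1 p2 p3.
Qed.

Theorem GK_RP (n : nat) : (1 < n)%N ->
  (forall x y, X x -> X y -> (dist x y <= L) = (cos L ^+ 2 <= tk coord x y)) ->
  mean_invariant sigJ (t0J ((2 ^ 0)%N%:R / 2) ((n * 2 ^ 0)%N%:R / 2)) ->
  GK_spectral_limit X dist G L (eig_RP L n) (mult_RP n).
Proof.
rewrite expn0 muln1 => n1 dist_tk mi; have n0 := ltnW n1.
have M : @sc_mass R 1 n = sin_int n (pi / 2).
  by apply: eq_Rintegral => x _; rewrite /sc_wt /= expr0 mul1r.
apply: (GK_jacobi (p := 1) (m := n) L0 Lpi2 coord_meas mX tk1 _ isT n0 n0 _ dist_tk mi) => //.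
- by rewrite addn1 ltnS.
- case: n n0 {n1 dist_tk mi M} => // n _; rewrite /mult_RP /= muln1.
  rewrite addnS !subn1 /= binR_2 -[n.+1%:R]natr1.
  have n1 : 0 <= n%:R :> R by []; move: n1; move: (n%:R : R) => x x0.
  by field; rewrite gt_eqF//; lra.
- move=> k; case: n n0 {n1 dist_tk mi M} => // n _; rewrite /mult_RP /=.
  have e0 j : (2 * j + n.+1 - 1 = 2 * j + n)%N by rewrite addnS subn1.
  rewrite !e0 !subn1 /=.
  (* From k+1 to k+2 the upper index of the binomial coefficient grows by 2, hence two applications
     of the recursion. *)
  have h1 := @binR_step R (k.+1.*2) n; have h2 := @binR_step R (k.+1.*2).+1 n.
  have e1 : (2 * k.+2 = (k.+1.*2).+2)%N by rewrite mul2n doubleS.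
  have e2 : (2 * k.+1 = k.+1.*2)%N by rewrite mul2n.
  rewrite e1 e2.
  have e3 : (k.+1.*2)%:R = 2 * (k%:R + 1) :> R by rewrite -mul2n natrM natr1.
  rewrite -[(k.+1.*2).+2%:R]natr1 -[(k.+1.*2).+1%:R]natr1 in h1 h2.
  rewrite e3 in h1 h2.
  rewrite -[n.+1%:R]natr1 -[k.+2%:R]natr1 -[k.+1%:R]natr1.
  have n1 : 0 <= n%:R :> R by []. have k1 : 0 <= k%:R :> R by [].
  move: h1 h2 n1 k1; move: (n%:R : R) (k%:R : R) (binR _ _) (binR _ _) (binR _ _) => x y u v w h1 h2 x0 y0.
  have p1 : 2 * (y + 1 + 1) + (x + 1) - 1 != 0 by rewrite gt_eqF//; lra.
  have p2 : 2 * (y + 1) + (x + 1) - 1 != 0 by rewrite gt_eqF//; lra.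
  have p3 : 2 * (y + 1) + 1 != 0 by rewrite gt_eqF//; lra.
  transitivity ((4 * (y + 1 + 1) + (x + 1) - 1) / (2 * (y + 1 + 1) + (x + 1) - 1) *
    (u * (2 * (y + 1) + 1 + 1)) * ((2 * (y + 1) + 1) / 4) * (1 / 2 + (x + 1) / 2 + 2 * y + 1)).
    by field; rewrite p1.
  rewrite h2.
  transitivity ((4 * (y + 1 + 1) + (x + 1) - 1) / (2 * (y + 1 + 1) + (x + 1) - 1) *
    (2 * (y + 1) + 1 + 1 + x) * (w * (2 * (y + 1) + 1)) / 4 * (1 / 2 + (x + 1) / 2 + 2 * y + 1)).
    by field; rewrite p1.
  rewrite h1; field; rewrite p1 p2.
  by [].
- by rewrite /eig_RP /= M; congr (_ / _); apply: eq_Rintegral => x _; rewrite /sc_wt /= expr0 mul1r.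
- move=> k; rewrite /eig_RP /= M expr1.
  have -> : 1 / 2 + 1 = 3 / 2 :> R by field.
  have nZ : n%:R * sin_int n (pi / 2) != 0 :> R.
    by case: (n) n0 => // n' _; rewrite gt_eqF// mulr_gt0// sin_int_gt0.
  have -> : Gamma ((n%:R + 1) / 2) / (Gamma (1 / 2) * Gamma ((n%:R + 2) / 2)) =
      (n%:R * sin_int n (pi / 2))^-1 :> R.
    apply: (mulIf nZ); rewrite mulVf//; case: (n) n0 => // n' _.
    by rewrite natr1 wallis_Gamma.
  by congr (_ * _); move: (_^-1) => z; ring.
Qed.

Theorem GK_CP (n : nat) : (1 < n)%N ->
  (forall x y, X x -> X y -> (dist x y <= L) = (cos L ^+ 2 <= tk coord x y)) ->
  mean_invariant sigJ (t0J ((2 ^ 1)%N%:R / 2) ((n * 2 ^ 1)%N%:R / 2)) ->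
  GK_spectral_limit X dist G L (eig_CP L n) (mult_CP n).
Proof.
rewrite expn1 => n1 dist_tk mi; have n0 := ltnW n1.
have m0 : (0 < n * 2)%N by rewrite muln_gt0 n0.
have nn : n%:R != 0 :> R by rewrite pnatr_eq0 -lt0n.
have k0 : (n * 2)%:R != 0 :> R by rewrite pnatr_eq0 -lt0n.
have dG (x : R) : is_derive x 1 (fun y => sin y ^+ (n * 2)) ((n * 2)%:R * sc_wt 2 (n * 2) x).
  by apply: rd_eq (rdXp m0 (rd_sin x)) _; rewrite /sc_wt /= expr1; ring.
have G0 : sin 0 ^+ (n * 2) = 0 :> R by rewrite sin0 expr0n gtn_eqF.
have G1 : sin (pi / 2) ^+ (n * 2) = 1 :> R by rewrite sin_pihalf expr1n.
have [M M'] := sc_mass_prim (p := 2) L0 k0 G0 G1 dG.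
have pm : (2 <= n * 2)%N by rewrite leq_pmull.
apply: (GK_jacobi (p := 2) (m := (n * 2)%N) L0 Lpi2 coord_meas mX tk1 _ isT m0 pm _ dist_tk mi) => //.
- by rewrite ltn_addl.
- case: n {n1 dist_tk mi pm dG M M' G0 G1 k0 m0} nn n0 => // n _ _.
  rewrite /mult_CP /= addnS !subn1 /= binR_1 natrM -[n.+1%:R]natr1.
  have n1 : 0 <= n%:R :> R by []; move: n1; move: (n%:R : R) => x x0.
  by field; rewrite gt_eqF//; lra.
- move=> k; case: n {n1 dist_tk mi pm dG M M' G0 G1 k0 m0} nn n0 => // n _ _; rewrite /mult_CP /=.
  have e0 j : (j + n.+1 - 1 = j + n)%N by rewrite addnS subn1.
  rewrite !e0 !subn1 /= natrM.
  rewrite binR_succ -[n.+1%:R]natr1 -[k.+2%:R]natr1 -[k.+1%:R]natr1.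
  have n1 : 0 <= n%:R :> R by []. have k1 : 0 <= k%:R :> R by [].
  move: n1 k1; move: (n%:R : R) (k%:R : R) (binR _ _) => x y u x0 y0.
  have p1 : x + 1 != 0 by rewrite gt_eqF//; lra.
  have p2 : y + 1 + 1 != 0 by rewrite gt_eqF//; lra.
  by field; rewrite p1 p2.
- by rewrite M' /eig_CP /= mulnC.
- move=> k; rewrite /eig_CP /= M natrM mulnC.
  have -> : 2 / 2 + 1 = 2 :> R by field.
  have -> : n%:R * 2 / 2 + 1 = n%:R + 1 :> R by field.
  by congr (_ * _); field.
Qed.

Theorem GK_HP (n : nat) : (1 < n)%N ->
  (forall x y, X x -> X y -> (dist x y <= L) = (cos L ^+ 2 <= tk coord x y)) ->
  mean_invariant sigJ (t0J ((2 ^ 2)%N%:R / 2) ((n * 2 ^ 2)%N%:R / 2)) ->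
  GK_spectral_limit X dist G L (eig_HP L n) (mult_HP n).
Proof.
rewrite -[(2 ^ 2)%N]/4%N => n1 dist_tk mi; have n0 := ltnW n1.
have m0 : (0 < n * 4)%N by rewrite muln_gt0 n0.
have n0R : 0 < n%:R :> R by rewrite ltr0n.
pose kap : R := (n * 4)%:R * (2 * n%:R + 1).
have k0 : kap != 0 by rewrite gt_eqF// mulr_gt0 ?ltr0n//; move: n0R; move: (n%:R : R) => x; lra.
(* The claimed c_0 as a function of the radius. In its derivative 1 + 2n cos^2 - sin^2 = (2n+1)
   cos^2, which leaves a multiple of cos^3 sin^(4n-1). *)
pose Gf (y : R) := sin y ^+ (n * 4) * (1 + 2 * n%:R * cos y ^+ 2).
have dG (x : R) : is_derive x 1 Gf (kap * sc_wt 4 (n * 4) x).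
  have d0 : is_derive x 1 (fun y : R => 1 + 2 * n%:R * cos y ^+ 2) (0 + 2 * n%:R * (2%:R * cos x ^+ 1 * - sin x)).
    have c1 := @is_derive_cst R R R 1 x 1; have c2 := rdZ (2 * n%:R) (rdX 1 (rd_cos x)).
    exact: is_deriveD.
  apply: rd_eq (rdM (rdXp m0 (rd_sin x)) d0) _; rewrite /sc_wt /kap natrM.
  have -> : sin x ^+ (n * 4) = sin x * sin x ^+ (n * 4).-1 by rewrite -exprS prednK.
  have -> : sin x * sin x ^+ (n * 4).-1 * (0 + 2 * n%:R * (2 * cos x ^+ 1 * - sin x)) =
    - 4 * n%:R * sin x ^+ 2 * cos x * sin x ^+ (n * 4).-1 by ring.
  by rewrite sin2cos2 /=; ring.
have G0 : Gf 0 = 0 by rewrite /Gf sin0 expr0n gtn_eqF// mul0r.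
have G1 : Gf (pi / 2) = 1 by rewrite /Gf sin_pihalf cos_pihalf expr1n; ring.
have [M M'] := sc_mass_prim (p := 4) L0 k0 G0 G1 dG.
have pm : (4 <= n * 4)%N by rewrite leq_pmull.
apply: (GK_jacobi (p := 4) (m := (n * 4)%N) L0 Lpi2 coord_meas mX tk1 _ isT m0 pm _ dist_tk mi) => //.
- by rewrite ltn_addl.
- case: n {n1 dist_tk mi pm dG M M' G0 G1 k0 m0 kap Gf} n0R n0 => // n _ _.
  rewrite /mult_HP mulnS -[(2 + 2 * n)%N]/(2 * n).+2 addnS !subn1 /= binR_1 -[(1 + _).+1]addnS binR_1.
  rewrite natrM -[(2 * n).+2%:R]natr1 -[(2 * n).+1%:R]natr1 !natrM -[n.+1%:R]natr1.
  have n1 : 0 <= n%:R :> R by []; move: n1; move: (n%:R : R) => x x0.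
  by field; rewrite gt_eqF//; lra.
- move=> k; case: n {n1 dist_tk mi pm dG M M' G0 G1 k0 m0 kap Gf} n0R n0 => // n _ _.
  rewrite /mult_HP mulnS -[(2 + 2 * n)%N]/(2 * n).+2 /=.
  have e0 j i : (j + i.+2 - 1 = j + i.+1)%N by rewrite addnS subn1.
  rewrite !e0 !subn1 /= !(binR_succ k.+1).
  rewrite natrM -[(2 * n).+2%:R]natr1 -[(2 * n).+1%:R]natr1 !natrM -[n.+1%:R]natr1 -[k.+2%:R]natr1 -[k.+1%:R]natr1.
  have n1 : 0 <= n%:R :> R by []. have k1 : 0 <= k%:R :> R by [].
  move: n1 k1; move: (n%:R : R) (k%:R : R) (binR _ _) (binR _ _) => x y u v x0 y0.
  have p1 : 2 * (x + 1) + 1 != 0 by rewrite gt_eqF//; lra.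
  have p2 : y + 1 + 1 != 0 by rewrite gt_eqF//; lra.
  have p3 : y + 1 + 1 + 1 != 0 by rewrite gt_eqF//; lra.
  by field; rewrite p1 p2 p3.
- by rewrite M' /eig_HP /= mulnC.
- move=> k; rewrite /eig_HP /= M /kap natrM mulnC.
  have -> : 4 / 2 + 1 = 3 :> R by field.
  have -> : n%:R * 4 / 2 + 1 = 2 * n%:R + 1 :> R by field.
  have p1 : 2 * n%:R + 1 != 0 :> R by rewrite gt_eqF//; move: n0R; move: (n%:R : R) => x; lra.
  by congr (_ * _); field; rewrite p1 gt_eqF.
Qed.

Theorem GK_OP :
  (forall x y, X x -> X y -> (dist x y <= L) = (cos L ^+ 2 <= tk coord x y)) ->
  mean_invariant sigJ (t0J ((2 ^ 3)%N%:R / 2) ((2 * 2 ^ 3)%N%:R / 2)) ->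
  GK_spectral_limit X dist G L (eig_OP L) mult_OP.
Proof.
rewrite -[(2 ^ 3)%N]/8%N -[(2 * 8)%N]/16%N => dist_tk mi.
(* In the derivative of [Gf] all lower powers of cos cancel and 2640 cos^7 sin^15 remains. *)
pose kap : R := 16 * 165.
have k0 : kap != 0 by rewrite mulf_neq0.
pose Gf (y : R) := sin y ^+ 16 * (1 + (8 * cos y ^+ 2 + (36 * cos y ^+ 4 + 120 * cos y ^+ 6))).
have dG (x : R) : is_derive x 1 Gf (kap * sc_wt 8 16 x).
  have d0 := @is_derive_cst R R R 1 x 1.
  have d2 := rdZ 8 (rdX 1 (rd_cos x)); have d4 := rdZ 36 (rdX 3 (rd_cos x)).
  have d6 := rdZ 120 (rdX 5 (rd_cos x)).
  have d := is_deriveD d0 (is_deriveD d2 (is_deriveD d4 d6)).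
  apply: rd_eq (rdM (rdX 15 (rd_sin x)) d) _; rewrite /sc_wt /kap.
  rewrite -[(8.-1)%N]/7%N -[(16.-1)%N]/15%N.
  have -> : sin x ^+ 16 = sin x * sin x ^+ 15 by rewrite -exprS.
  rewrite -[(_ + _) x]/(1 + (8 * cos x ^+ 2 + (36 * cos x ^+ 4 + 120 * cos x ^+ 6))).
  move: (sin x ^+ 15) => S.
  transitivity (S * (16 * cos x * (1 + (8 * cos x ^+ 2 + (36 * cos x ^+ 4 + 120 * cos x ^+ 6))) -
    sin x ^+ 2 * (16 * cos x + 144 * cos x ^+ 3 + 720 * cos x ^+ 5))); first by ring.
  by rewrite sin2cos2; ring.
have G0 : Gf 0 = 0 by rewrite /Gf sin0 expr0n mul0r.
have G1 : Gf (pi / 2) = 1 by rewrite /Gf sin_pihalf cos_pihalf expr1n !expr0n /= !mulr0 !addr0 mulr1.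
have [M M'] := sc_mass_prim (p := 8) L0 k0 G0 G1 dG.
apply: (GK_jacobi (p := 8) (m := 16) L0 Lpi2 coord_meas mX tk1 _ isT isT isT isT dist_tk mi) => //.
- have b1 : binR (1 + 7) 4 = 70 :> R by rewrite /binR.
  have b2 : binR (1 + 10) 10 = 11 :> R by rewrite /binR.
  by rewrite /mult_OP /= b1 b2; field.
- move=> k; rewrite /mult_OP /=.
  have -> : (k.+2 + 7 = k.+4.+1 + 4)%N by rewrite addnC [RHS]addnC.
  have -> : (k.+1 + 7 = k.+4 + 4)%N by rewrite addnC [RHS]addnC.
  rewrite !(binR_succ k.+4) !(binR_succ k.+1).
  rewrite -[k.+4.+1%:R]natr1 -[k.+4%:R]natr1 -[k.+3%:R]natr1 -[k.+2%:R]natr1 -[k.+1%:R]natr1.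
  have k1 : 0 <= k%:R :> R by [].
  move: k1; move: (k%:R : R) (binR _ _) (binR _ _) => y u v y0.
  have p2 : y + 1 + 1 != 0 by rewrite gt_eqF//; lra.
  have p3 : y + 1 + 1 + 1 + 1 + 1 != 0 by rewrite gt_eqF//; lra.
  by field; rewrite p2 p3.
- by rewrite M' /eig_OP /Gf /= -!addrA.
- move=> k; rewrite /eig_OP /= M /kap.
  have -> : 8 / 2 + 1 = 5 :> R by field.
  have -> : 16 / 2 + 1 = 9 :> R by field.
  by congr (_ * _); field.
Qed.

End Spaces.

(** * Invariant means *)

Section PolyCoef.
Context {R : realType} {T : Type} {I : finType}.
Variable coord : I -> T -> R.
Notation polyfun := (polyfun coord).

Definition polycoef (F : T -> {poly R}) := forall i, polyfun (fun y => (F y)`_i).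

Lemma polycoefC f : polyfun f -> polycoef (fun y => (f y)%:P).
Proof.
move=> hf [|i]; first by apply: polyfun_ext hf => y; rewrite coefC.
by apply: polyfun_ext (polyfun_cst coord 0) => y; rewrite coefC.
Qed.

Lemma polycoef_cst p : polycoef (fun=> p).
Proof. by move=> i; exact: polyfun_cst. Qed.

Lemma polycoefD F G : polycoef F -> polycoef G -> polycoef (fun y => F y + G y).
Proof. by move=> hF hG i; apply: polyfun_ext (polyfunD (hF i) (hG i)) => y; rewrite coefD. Qed.

Lemma polycoefM F G : polycoef F -> polycoef G -> polycoef (fun y => F y * G y).
Proof.
move=> hF hG i.
have h : polyfun (fun y => \sum_(j < i.+1) (F y)`_j * (G y)`_(i - j)).
  by apply: polyfun_sum => j; apply: polyfunM.
by apply: polyfun_ext h => y; rewrite coefM.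
Qed.

Lemma polycoefX F n : polycoef F -> polycoef (fun y => F y ^+ n).
Proof.
move=> hF; elim: n => [|n IH] i; first exact: (polycoef_cst 1).
by apply: polyfun_ext (polycoefM hF IH i) => y; rewrite exprS.
Qed.

Lemma polyfun_comp (g : T -> T) f : (forall i, polyfun (fun x => coord i (g x))) ->
  polyfun f -> polyfun (fun x => f (g x)).
Proof.
move=> hg [l hl].
have h : polyfun (fun x => \sum_(u <- l) u.1 * mono coord u.2 (g x)).
  apply: polyfun_sum => u; apply: polyfunZ; rewrite /mono.
  elim: (u.2) => [|i a IH].
    by apply: polyfun_ext (polyfun_cst coord 1) => x; rewrite big_nil.
  by apply: polyfun_ext (polyfunM (hg i) IH) => x; rewrite big_cons.
by apply: polyfun_ext h => x; rewrite hl.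
Qed.

End PolyCoef.

Section Symmetries.
Context {R : realType} {T : Type} {I : finType}.
Variables (coord : I -> T -> R) (X : set T) (E : (T -> R) -> R).
Hypothesis HE : mean_on coord X E.
Notation polyfun := (polyfun coord).
Notation tk := (tk coord).

(** All that is kept of a group element. The notion is closed under composition, so normal forms can
    be reached step by step without returning to the group. *)
Definition symm (g : T -> T) : Prop :=
  [/\ forall x, X x -> X (g x),
      forall x y, X x -> X y -> tk (g x) (g y) = tk x y,
      forall f, polyfun f -> polyfun (fun x => f (g x)) &
      forall f, polyfun f -> E (fun x => f (g x)) = E f].

Lemma symm_id : symm id. Proof. by split. Qed.

Lemma symm_comp g h : symm g -> symm h -> symm (g \o h).
Proof.
move=> [g1 g2 g3 g4] [h1 h2 h3 h4]; split.
- by move=> x Xx; apply: g1; exact: h1.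
- by move=> x y Xx Xy; rewrite /= g2 ?h2//; exact: h1.
- by move=> f hf; apply: h3 (g3 f hf).
- by move=> f hf; rewrite -(g4 f hf); exact: (h4 _ (g3 f hf)).
Qed.

Lemma polyfun_conv (f h : {poly R}) x z : polyfun (fun y => f.[tk x y] * h.[tk y z]).
Proof.
by apply: polyfunM; apply: polyfun_horner; [exact: polyfun_tk|exact: polyfun_tkr].
Qed.

Lemma conv_symm g (f h : {poly R}) x z : symm g -> X x -> X z ->
  E (fun y => f.[tk (g x) y] * h.[tk y (g z)]) = E (fun y => f.[tk x y] * h.[tk y z]).
Proof.
move=> [g1 g2 g3 g4] Xx Xz; rewrite -(g4 _ (polyfun_conv f h (g x) (g z))).
by apply: (mean_on_ext HE) => y Xy; rewrite !g2.
Qed.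

Lemma E_horner (F : T -> {poly R}) N (t : R) : polycoef coord F -> (forall y, (size (F y) <= N)%N) ->
  E (fun y => (F y).[t]) = (\poly_(i < N) E (fun y => (F y)`_i)).[t].
Proof.
move=> hF sF.
have -> : (fun y => (F y).[t]) = (fun y => \sum_(i < N) t ^+ i * (F y)`_i).
  by apply/funext => y; rewrite (horner_coef_wide _ (sF y)); apply: eq_bigr => i _; rewrite mulrC.
rewrite (mean_on_lin HE (index_enum 'I_N) (fun i : 'I_N => t ^+ i) (F := fun (i : 'I_N) y => (F y)`_i)); last first.
  by move=> i; exact: hF.
rewrite (horner_coef_wide _ (size_poly _ _)); apply: eq_bigr => i _.
by rewrite coef_poly ltn_ord mulrC.
Qed.

(* an even polynomial in t has no linear term *)
Lemma E_even (F : T -> {poly R}) N : polycoef coord F -> (forall y, (size (F y) <= N)%N) ->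
  (forall t : R, E (fun y => (F y).[t]) = E (fun y => (F y).[- t])) -> E (fun y => (F y)`_1) = 0.
Proof.
move=> hF sF ev.
have sF' y : (size (F y) <= maxn N 2)%N by rewrite (leq_trans (sF y))// leq_maxl.
pose p := \poly_(i < maxn N 2) E (fun y => (F y)`_i).
have pe : p \Po (- 'X) = p.
  apply/eqP; rewrite -subr_eq0; apply/eqP; set q := _ - _.
  apply: (@roots_geq_poly_eq0 _ q [seq i%:R | i <- iota 0 (size q)]).
  - apply/allP => _ /mapP[i _ ->]; rewrite /root /q hornerD hornerN horner_comp hornerN hornerX.
    by rewrite -!(E_horner _ hF sF') -ev subrr.
  - by rewrite map_inj_uniq ?iota_uniq// => i j /eqP; rewrite eqr_nat => /eqP.
  - by rewrite size_map size_iota.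
have p1 : p`_1 = E (fun y => (F y)`_1) by rewrite coef_poly leq_maxr.
have d : (p \Po (- 'X))^`().[0] = - p`_1.
  by rewrite deriv_comp hornerM horner_comp derivN derivX hornerN hornerX oppr0 hornerN hornerC mulrN1 horner_coef0 coef_deriv mulr1n.
rewrite pe horner_coef0 coef_deriv mulr1n in d; rewrite -p1; move: d; move: (p`_1) => u; lra.
Qed.

Lemma E_Dop (sigma t0 : {poly R}) (A : T -> R) : polyfun A ->
  (forall a, E (fun y => (Dop sigma t0 0 'X^a).[A y]) = 0) ->
  forall q, E (fun y => (Dop sigma t0 0 q).[A y]) = 0.
Proof.
move=> pA h q.
have qE : Dop sigma t0 0 q = \sum_(a < size q) q`_a *: Dop sigma t0 0 'X^a.
  rewrite -{1}[q]coefK poly_def /Dop scale0r addr0 (big_morph (@deriv R) (@derivD R) (@deriv0 R)) !mulr_sumr -big_split/=.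
  by apply: eq_bigr => a _; rewrite derivZ -!scalerAr -scalerDr.
have -> : (fun y => (Dop sigma t0 0 q).[A y]) =
    (fun y => \sum_(a < size q) q`_a * (Dop sigma t0 0 'X^a).[A y]).
  by apply/funext => y; rewrite qE horner_sum; apply: eq_bigr => a _; rewrite hornerZ.
rewrite (mean_on_lin HE (index_enum 'I_(size q)) (fun a : 'I_(size q) => q`_a)
  (F := fun (a : 'I_(size q)) y => (Dop sigma t0 0 'X^a).[A y])).
  by rewrite big1// => a _; rewrite h mulr0.
by move=> a; exact: polyfun_horner.
Qed.

Section Convolution.
Variables (A A0 A1 B : T -> R) (rho : {poly R}).
Hypotheses (pA : polyfun A) (pA0 : polyfun A0) (pA1 : polyfun A1) (pB : polyfun B).
Hypothesis size_rho : (size rho <= 3)%N.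
Hypothesis normal_form : forall x z, X x -> X z -> exists2 r : R, r ^+ 2 = rho.[tk x z] &
  forall f h : {poly R}, E (fun y => f.[tk x y] * h.[tk y z]) =
    E (fun y => f.[A y] * h.[A0 y + tk x z * A1 y + r * B y]).
Hypothesis reflect : forall (f h : {poly R}) (s r : R), r ^+ 2 = rho.[s] ->
  E (fun y => f.[A y] * h.[A0 y + s * A1 y + r * B y]) =
  E (fun y => f.[A y] * h.[A0 y + s * A1 y - r * B y]).

Let U (y : T) : {poly R} := (A0 y)%:P + (A1 y)%:P * 'X.

(** Even and odd parts in r of (A0 + s A1 + r B)^m, as polynomials in s, computed with r^2 =
    rho(s). *)
Fixpoint evodd (m : nat) (y : T) : {poly R} * {poly R} :=
  if m is m'.+1 then
    let u := evodd m' y in (U y * u.1 + rho * (B y)%:P * u.2, (B y)%:P * u.1 + U y * u.2)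
  else (1, 0).

Lemma evoddE m y (s r : R) : r ^+ 2 = rho.[s] ->
  (A0 y + s * A1 y + r * B y) ^+ m = (evodd m y).1.[s] + r * (evodd m y).2.[s].
Proof.
move=> hr; elim: m => [|m IH]; first by rewrite /= !hornerC mulr0 addr0.
rewrite exprS IH /= /U !hornerE /= -hr; ring.
Qed.

Lemma polycoef_U : polycoef coord U.
Proof.
apply: polycoefD; first exact: polycoefC.
by apply: polycoefM; [exact: polycoefC|exact: polycoef_cst].
Qed.

Lemma polycoef_evodd m : polycoef coord (fun y => (evodd m y).1) /\ polycoef coord (fun y => (evodd m y).2).
Proof.
elim: m => [|m [h1 h2]]; first by split; exact: polycoef_cst.
have hB : polycoef coord (fun y => (B y)%:P) by exact: polycoefC.
split; apply: polycoefD; apply: polycoefM => //; try exact: polycoef_U.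
by apply: polycoefM => //; exact: polycoef_cst.
Qed.

Lemma size_U y : (size (U y) <= 2)%N.
Proof.
rewrite /U (leq_trans (size_polyD _ _))// geq_max (leq_trans (size_polyC_leq1 _))//=.
rewrite mul_polyC (leq_trans (size_scale_leq _ _))// size_polyX //.
Qed.

Lemma size_mul_le (p q : {poly R}) a b : (size p <= a.+1)%N -> (size q <= b)%N -> (size (p * q)%R <= a + b)%N.
Proof.
move=> h1 h2; apply: leq_trans (size_polyMleq _ _) _.
by rewrite -subn1 leq_subLR addnA add1n leq_add.
Qed.

(** Since rho has degree at most 2, r counts as degree 1: the even part has degree at most m and the
    odd part at most m - 1. *)
Lemma size_evodd m y : (size (evodd m y).1 <= m.+1)%N /\ (size (evodd m y).2 <= m)%N.
Proof.
elim: m => [|m [h1 h2]]; first by rewrite size_poly1 size_poly0.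
have sU := size_U y; have sB := size_polyC_leq1 (B y).
split; rewrite /= (leq_trans (size_polyD _ _))// geq_max; apply/andP; split.
- exact: (size_mul_le (a := 1)).
- apply: (size_mul_le (a := 2)) => //.
  by have := size_mul_le (a := 2) size_rho sB; rewrite addn1.
- exact: (size_mul_le (a := 0)).
- by have := size_mul_le (a := 1) sU h2; rewrite add1n.
Qed.

(** By [reflect] the mean is unchanged under r -> -r. Averaging the two expressions removes the odd
    part, and with it the square root; what is left is a polynomial in s of degree at most that of
    h. *)
Lemma conv_poly (f h : {poly R}) : exists2 q : {poly R}, (size q <= size h)%N &
  forall x z, X x -> X z -> E (fun y => f.[tk x y] * h.[tk y z]) = q.[tk x z].
Proof.
pose F y := \sum_(i < size h) h`_i *: (f.[A y] *: (evodd i y).1).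
have pF : polycoef coord F.
  move=> i; have hs : polyfun (fun y => \sum_(j < size h) h`_j * (f.[A y] * (evodd j y).1`_i)).
    apply: polyfun_sum => j; apply: polyfunZ; apply: polyfunM; first exact: polyfun_horner.
    by have [h1 _] := polycoef_evodd j; exact: h1.
  by apply: polyfun_ext hs => y; rewrite coef_sum; apply: eq_bigr => j _; rewrite !coefZ.
have sF y : (size (F y) <= size h)%N.
  apply: (leq_trans (size_sum _ _ _)); apply/bigmax_leqP => i _.
  rewrite (leq_trans (size_scale_leq _ _))// (leq_trans (size_scale_leq _ _))//.
  by have [h1 _] := size_evodd i y; rewrite (leq_trans h1).
exists (\poly_(i < size h) E (fun y => (F y)`_i)); first exact: size_poly.
move=> x z Xx Xz; have [r hr ->] := normal_form Xx Xz; set s := tk x z in hr *.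
rewrite -(E_horner _ pF sF).
have hr' : (- r) ^+ 2 = rho.[s] by rewrite sqrrN.
pose H (e : R) y := f.[A y] * h.[A0 y + s * A1 y + e * B y].
have pH e : polyfun (H e).
  apply: polyfunM; apply: polyfun_horner => //.
  by apply: polyfunD; [apply: polyfunD => //|]; exact: polyfunZ.
have e1 : E (H (- r)) = E (H r).
  rewrite /H (reflect f h hr); apply: (mean_on_ext HE) => y _; by rewrite mulNr.
have -> : E (H r) = 2^-1 * (E (H r) + E (H (- r))) by rewrite e1; field.
rewrite -(monD HE (pH r) (pH (- r))) -(monZ HE); last exact: polyfunD.
apply: (mean_on_ext HE) => y _; rewrite /H /F.
rewrite (horner_coef h) (horner_coef h) horner_sum !mulr_sumr -big_split/= mulr_sumr.
apply: eq_bigr => i _; by rewrite (evoddE i y hr) (evoddE i y hr') !hornerZ; field.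
Qed.

End Convolution.
End Symmetries.

Section MeanInvariance.
Context {R : realType} {dT : measure_display} {T : measurableType dT} {I : finType}.
Variables (coord : I -> T -> R) (X : set T) (G : set (T -> T)).
Hypothesis coord_meas : forall i, measurable_fun setT (coord i).
Hypothesis mX : measurable X.
Hypothesis tk1 : forall x, X x -> tk coord x x = 1.
Variable mu : probability T R.
Hypothesis muX : mu X = 1%E.
Hypothesis mu_inv : invariant_under G mu.

Lemma polyfun_meas f : polyfun coord f -> measurable_fun setT f.
Proof.
move=> [l hl]; rewrite (funext hl); apply: measurable_sum => u.
by apply: measurable_funM; [exact: measurable_cst|exact: mono_meas].
Qed.

(** g maps X into X, but its preimage of X may be larger; the difference is null because X has full
    measure. Then the image measure is compared with mu on measurable sets. *)
Lemma mean_symm (g : T -> T) f : G g -> measurable_fun setT g -> (forall x, X x -> X (g x)) ->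
  polyfun coord f -> mean mu X (fun x => f (g x)) = mean mu X f.
Proof.
move=> Gg mg gX pf.
have mf := polyfun_meas pf.
have [_ [M hM]] := polyfun_bmf coord_meas tk1 pf.
have mgX : measurable (g @^-1` X) by rewrite -[X in measurable X]setTI; exact: mg.
pose N := (g @^-1` X) `\` X.
have mN : measurable N by exact: measurableD.
have muN : mu N = 0%E.
  apply/eqP; rewrite eq_le measure_ge0 andbT.
  have muC : mu (~` X) = 0%E by rewrite probability_setC// muX subee.
  by rewrite -muC; apply: le_measure; rewrite ?inE//; [exact: measurableC|move=> x []].
have intg : mu.-integrable (g @^-1` X) (EFin \o (fun x => f (g x))).
  apply: measurable_bounded_integrable => //.
  - by rewrite (le_lt_trans (probability_le1 _ _))// ltry.
  - by apply: measurable_funTS; exact: measurableT_comp.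
  - by exists M; split; [exact: num_real|move=> z Mz x /= gx; rewrite (le_trans (hM _ gx))// ltW].
have XE : X = (g @^-1` X) `\` N.
  apply/seteqP; split=> x; last by move=> [gx nx]; apply: contrapT => nX; apply: nx.
  by move=> Xx; split; [exact: gX|move=> [_]].
rewrite /mean /Rintegral; congr fine.
transitivity (\int[mu]_(x in g @^-1` X) (f (g x))%:E)%E.
  by rewrite (negligible_integral mN mgX intg muN) -XE.
have mEf : measurable_fun setT (EFin \o f) by apply/measurable_EFinP.
rewrite -(integral_pushforward mg mEf intg mX).
apply: eq_measure_integral => A mA _; rewrite /pushforward; exact: mu_inv.
Qed.

End MeanInvariance.

Section SymmetryGroup.
Context {R : realType} {dT : measure_display} {T : measurableType dT} {I : finType}.
Variables (coord : I -> T -> R) (X : set T) (G : set (T -> T)).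
Hypothesis coord_meas : forall i, measurable_fun setT (coord i).
Hypothesis mX : measurable X.
Hypothesis tk1 : forall x, X x -> tk coord x x = 1.
Hypothesis meas_coord : forall g : T -> T, (forall i, measurable_fun setT (fun x => coord i (g x))) ->
  measurable_fun setT g.
Variable mu : probability T R.
Hypothesis muX : mu X = 1%E.
Hypothesis mu_inv : invariant_under G mu.

Lemma symm_of_group g : G g -> (forall i, polyfun coord (fun x => coord i (g x))) ->
  (forall x, X x -> X (g x)) -> (forall x y, X x -> X y -> tk coord (g x) (g y) = tk coord x y) ->
  symm coord X (mean mu X) g.
Proof.
move=> Gg pg gX gtk; split=> //; first by move=> f; exact: polyfun_comp.
move=> f pf; apply: (mean_symm coord_meas mX tk1 muX mu_inv Gg) => //.
by apply: meas_coord => i; apply: (polyfun_meas coord_meas); exact: pg.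
Qed.

End SymmetryGroup.

(** * Rotations in coordinate planes *)

Section PlaneRotation.
Context {R : realType} {n : nat}.
Variables (i j : 'I_n.+1).
Hypothesis ij : i != j.

Definition rotmx (c s : R) : 'M[R]_n.+1 :=
  1 + (c - 1) *: (delta_mx i i + delta_mx j j) + s *: (delta_mx i j - delta_mx j i).

(** The projection P onto the plane and the quarter turn J satisfy P^2 = P, PJ = JP = J and J^2 =
    -P, so the product is that of complex numbers. *)
Lemma rotmxM c s c' s' : rotmx c s * rotmx c' s' = rotmx (c * c' - s * s') (c * s' + s * c').
Proof.
have d (a b k l : 'I_n.+1) : (delta_mx a b : 'M[R]_n.+1) * delta_mx k l = (b == k)%:R *: delta_mx a l.
  by rewrite -[_ * _]/(_ *m _) mul_delta_mx_cond; case: (b == k); rewrite ?scale1r ?scale0r.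
have ji : (j == i) = false by rewrite eq_sym; exact: negbTE.
set P : 'M[R]_n.+1 := delta_mx i i + delta_mx j j; set J : 'M[R]_n.+1 := delta_mx i j - delta_mx j i.
have PP : P * P = P.
  by rewrite /P !(mulrDl, mulrDr) !d !eqxx (negbTE ij) ji !scale1r !scale0r !addr0 add0r.
have PJ : P * J = J.
  by rewrite /P /J !(mulrDl, mulrDr, mulrN) !d !eqxx (negbTE ij) ji !scale1r !scale0r oppr0 addr0 add0r.
have JP : J * P = J.
  by rewrite /P /J !(mulrDl, mulrDr, mulNr) !d !eqxx (negbTE ij) ji !scale1r !scale0r oppr0 addr0 add0r.
have JJ : J * J = - P.
  rewrite /P /J !(mulrDl, mulrDr, mulNr, mulrN) !d !eqxx (negbTE ij) ji !scale1r !scale0r.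
  by rewrite !oppr0 !addr0 !add0r opprD.
rewrite /rotmx -/P -/J !(mulrDl, mulrDr) !mul1r !mulr1 -!scalerAl -!scalerAr !scalerA PP PJ JP JJ.
by apply/matrixP => k l; rewrite !mxE; ring.
Qed.

Lemma rotmxT c s : (rotmx c s)^T = rotmx c (- s).
Proof. by apply/matrixP => k l; rewrite !mxE ![(l == _) && _]andbC [l == k]eq_sym; ring. Qed.

Lemma rotmx1 : rotmx 1 0 = 1.
Proof. by rewrite /rotmx subrr !scale0r !addr0. Qed.

Lemma rotmx_orth c s : c ^+ 2 + s ^+ 2 = 1 -> rotmx c s *m (rotmx c s)^T = 1%:M.
Proof.
move=> cs; rewrite rotmxT -[_ *m _]/(_ * _) rotmxM -[1%:M]rotmx1 -cs; congr rotmx; ring.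
Qed.

Lemma half_angle (c s : R) : c ^+ 2 + s ^+ 2 = 1 -> exists c' s' : R,
  [/\ c' ^+ 2 + s' ^+ 2 = 1, c' * c' - s' * s' = c & c' * s' + s' * c' = s].
Proof.
move=> cs; have [c1|c1] := eqVneq c (-1).
  have s0 : s = 0.
    by apply/eqP; rewrite -sqrf_eq0; move: cs; rewrite c1 sqrrN expr1n => h; apply/eqP; move: h; lra.
  by exists 0, 1; rewrite c1 s0; split; ring.
have c0 : 0 < 1 + c.
  have : -1 <= c by have := sqr_ge0 s; rewrite expr2 => h; move: cs; rewrite !expr2; nra.
  by rewrite le_eqVlt eq_sym (negbTE c1) /= => h; lra.
pose c' := Num.sqrt ((1 + c) / 2).
have cc : c' ^+ 2 = (1 + c) / 2 by rewrite sqr_sqrtr// divr_ge0// ltW.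
have c'0 : c' != 0 by rewrite gt_eqF// sqrtr_gt0 divr_gt0.
exists c', (s / (2 * c')).
have ss : (s / (2 * c')) ^+ 2 = (1 - c) / 2.
  rewrite expr_div_n exprMn cc.
  have -> : s ^+ 2 = (1 - c) * (1 + c) by move: cs; rewrite !expr2 => h; lra.
  by field; rewrite gt_eqF.
by split; rewrite -?expr2 ?cc ?ss; field.
Qed.

(** A rotation is the square of the rotation by half the angle, and the determinant of an orthogonal
    matrix squares to 1; nothing has to be expanded. *)
Lemma rotmx_det c s : c ^+ 2 + s ^+ 2 = 1 -> \det (rotmx c s) = 1.
Proof.
move=> /half_angle[c' [s' [cs' <- <-]]]; rewrite -rotmxM -[_ * _]/(_ *m _) det_mulmx.
have := congr1 determinant (rotmx_orth cs'); by rewrite det_mulmx det_tr det1.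
Qed.

Lemma sum_eq_delta (k : 'I_n.+1) (F : 'I_n.+1 -> R) : \sum_l (l == k)%:R * F l = F k.
Proof.
rewrite (bigD1 k)//= eqxx mul1r big1 ?addr0// => l /negbTE ->; by rewrite mul0r.
Qed.

Lemma rotmxE c s k (F : 'I_n.+1 -> R) : \sum_l rotmx c s k l * F l =
  F k + (k == i)%:R * ((c - 1) * F i + s * F j) + (k == j)%:R * ((c - 1) * F j - s * F i).
Proof.
transitivity (\sum_l ((l == k)%:R * F l + ((k == i)%:R * (c - 1)) * ((l == i)%:R * F l) +
  ((k == j)%:R * (c - 1)) * ((l == j)%:R * F l) + ((k == i)%:R * s) * ((l == j)%:R * F l) -
  ((k == j)%:R * s) * ((l == i)%:R * F l))).
  apply: eq_bigr => l _; rewrite !mxE [k == l]eq_sym -!mulnb !natrM; ring.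
rewrite !sumrB !big_split/= -!mulr_sumr !sum_eq_delta; ring.
Qed.

End PlaneRotation.

(** * Spheres *)

Section Sphere.
Context {R : realType}.
Variable n : nat.
Hypothesis n0 : (0 < n)%N.
Let T := (n.+1).-tuple R.
Let coord (i : 'I_n.+1) (x : T) : R := tnth x i.
Let X : set T := sph_pts n.
Let M : 'I_n.+1 := ord_max.
Let m : 'I_n.+1 := ord0.

Let mM : m != M. Proof. by rewrite -val_eqE /= neq_ltn n0. Qed.

Lemma sph_coord_meas i : measurable_fun setT (coord i).
Proof. exact: measurable_tnth. Qed.

Lemma sph_meas_coord (g : T -> T) : (forall i, measurable_fun setT (fun x => coord i (g x))) ->
  measurable_fun setT g.
Proof. by move=> h; apply/measurable_fun_tnthP => i; exact: h. Qed.

Lemma sph_tk1 x : X x -> tk coord x x = 1.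
Proof. by move=> /= <-; apply: eq_bigr => i _; rewrite expr2. Qed.

Lemma sph_meas : measurable X.
Proof.
have mf : measurable_fun setT (fun x : T => \sum_i coord i x ^+ 2).
  by apply: measurable_sum => i; apply: measurable_funX; exact: sph_coord_meas.
rewrite -[X]setTI (_ : X = (fun x : T => \sum_i coord i x ^+ 2) @^-1` [set 1])//.
exact: mf.
Qed.

Lemma sph_dist_tk (L : R) : 0 < L -> L < pi / 2 -> forall x y, X x -> X y ->
  (@sph_dist R n x y <= L) = (cos L <= tk coord x y).
Proof.
move=> L0 L2 x y Xx Xy; have pi0 := pi_gt0 R.
have t1 : -1 <= tk coord x y <= 1 by exact: (tk_itv sph_tk1 Xx Xy).
have h1 : @sph_dist R n x y = acos (tk coord x y) by [].
rewrite h1 -{2}[tk coord x y]acosK; last by rewrite in_itv.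
have a0 := acos_ge0 t1; have a1 := acos_lepi t1.
by rewrite (leNgt (cos L)) ltr_cos ?in_itv/= ?a0 ?a1// ?leNgt//; apply/andP; split; lra.
Qed.

Definition rotS i j (c s : R) (x : T) : T :=
  [tuple \sum_(l < n.+1) rotmx i j c s k l * tnth x l | k < n.+1].

Lemma rotSE i j c s x k : i != j -> coord k (rotS i j c s x) =
  coord k x + (k == i)%:R * ((c - 1) * coord i x + s * coord j x) +
  (k == j)%:R * ((c - 1) * coord j x - s * coord i x).
Proof. by move=> ij; rewrite /coord /rotS tnth_mktuple rotmxE. Qed.

Lemma rotS_SO i j c s : i != j -> c ^+ 2 + s ^+ 2 = 1 -> SO_sph n (rotS i j c s).
Proof. by move=> ij cs; exists (rotmx i j c s); split; [exact: rotmx_orth|exact: rotmx_det|]. Qed.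

Lemma rotS_tk i j c s x y : i != j -> c ^+ 2 + s ^+ 2 = 1 ->
  tk coord (rotS i j c s x) (rotS i j c s y) = tk coord x y.
Proof.
move=> ij cs; rewrite /tk (bigD1 i)//= (bigD1 j)/=; last by rewrite eq_sym.
rewrite [in RHS](bigD1 i)//= [in RHS](bigD1 j)/=; last by rewrite eq_sym.
rewrite !addrA; congr (_ + _); last first.
  by apply: eq_bigr => k /andP[/negbTE k1 /negbTE k2]; rewrite !rotSE// k1 k2 !mul0r !addr0.
rewrite !rotSE// !eqxx (negbTE ij) eq_sym (negbTE ij) /=.
move: (coord i x) (coord i y) (coord j x) (coord j y) => a b a' b'.
have -> : a * b + a' * b' = (c ^+ 2 + s ^+ 2) * (a * b + a' * b') by rewrite cs mul1r.
by rewrite /=; ring.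
Qed.

Let rho : {poly R} := 1 - 'X^2.

Section Mean.
Variable mu : probability T R.
Hypothesis muX : mu X = 1%E.
Hypothesis mu_inv : invariant_under (SO_sph n) mu.
Let E := mean mu X.
Let HE : mean_on coord X E := mean_mean_on sph_coord_meas sph_meas sph_tk1 muX.
Notation sym := (symm coord X E).

Lemma rotS_symm i j c s : i != j -> c ^+ 2 + s ^+ 2 = 1 -> sym (rotS i j c s).
Proof.
move=> ij cs; apply: (symm_of_group sph_coord_meas sph_meas sph_tk1 sph_meas_coord muX mu_inv).
- exact: rotS_SO.
- move=> k; have h : polyfun coord (fun x => \sum_l rotmx i j c s k l * coord l x).
    by apply: polyfun_sum => l; apply: polyfunZ; exact: polyfun_coord.
  by apply: polyfun_ext h => x; rewrite /coord tnth_mktuple.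
- move=> x Xx; have h := rotS_tk x x ij cs; rewrite (sph_tk1 Xx) in h.
  by rewrite /X /sph_pts /= -h; apply: eq_bigr => k _; rewrite expr2.
- by move=> x y _ _; exact: rotS_tk.
Qed.

(* rotate plane by plane until the coordinates listed in r vanish *)
Lemma kill_coords (p : 'I_n.+1) (r : seq 'I_n.+1) x : p \notin r -> X x -> exists g,
  [/\ sym g, forall k, k \in r -> coord k (g x) = 0 &
      forall y k, k != p -> k \notin r -> coord k (g y) = coord k y] /\
      (forall y, coord p y = 0 -> (forall k, k \in r -> coord k y = 0) -> g y = y).
Proof.
elim: r x => [|i r IH] x; first by move=> _ Xx; exists id; split=> //; split=> //; exact: symm_id.
rewrite inE negb_or => /andP[pi pr] Xx; have [g [[sg g0 g1] g2]] := IH x pr Xx.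
have Xg : X (g x) by case: sg => h _ _ _; exact: h.
set a := coord p (g x); set b := coord i (g x).
have [ab|ab] := eqVneq (a ^+ 2 + b ^+ 2) 0.
  exists g; split; first split=> //.
  - move=> k; rewrite inE => /orP[/eqP ->|]; last exact: g0.
    apply/eqP; rewrite -sqrf_eq0 eq_le sqr_ge0 andbT -ab lerDr sqr_ge0//.
  - by move=> y k kp; rewrite inE negb_or => /andP[_]; exact: g1.
  - by move=> y yp yk; apply: g2 => // k kr; apply: yk; rewrite inE kr orbT.
have ab0 : 0 < a ^+ 2 + b ^+ 2 by rewrite lt_neqAle eq_sym ab addr_ge0 ?sqr_ge0.
set l := Num.sqrt (a ^+ 2 + b ^+ 2).
have l0 : l != 0 by rewrite gt_eqF// sqrtr_gt0.
have ll : l ^+ 2 = a ^+ 2 + b ^+ 2 by rewrite sqr_sqrtr// ltW.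
have cs : (a / l) ^+ 2 + (b / l) ^+ 2 = 1 by rewrite !expr_div_n -mulrDl ll divff.
exists (rotS p i (a / l) (b / l) \o g); split; first split.
- by apply: symm_comp => //; exact: rotS_symm.
- move=> k; rewrite inE => /orP[/eqP ->|kr] /=.
    rewrite rotSE// eqxx eq_sym (negbTE pi) mul0r addr0 mul1r -/a -/b; field.
    by [].
  have kp : (k == p) = false by apply: contraNF pr => /eqP <-.
  rewrite rotSE// kp mul0r addr0 g0// add0r; case: eqP => [ki|_]; last by rewrite mul0r.
  have b0 : b = 0 by rewrite /b -ki g0.
  have aa : (a / l) ^+ 2 = 1 by rewrite -cs b0 mul0r expr0n addr0.
  by rewrite -/b b0; ring.
- move=> y k kp; rewrite inE negb_or => /andP[ki kr] /=.
  by rewrite rotSE// (negbTE kp) (negbTE ki) !mul0r !addr0 g1.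
- move=> y yp yk /=; rewrite g2//; last by move=> k kr; apply: yk; rewrite inE kr orbT.
  have yi : coord i y = 0 by apply: yk; rewrite inE eqxx.
  apply: eq_from_tnth => k; have := rotSE (a / l) (b / l) y k pi; rewrite yp yi !mulr0 subr0 !addr0 !mulr0 !addr0.
  by [].
Qed.

Definition sph_base : T := [tuple (k == M)%:R | k < n.+1].

Lemma tk_base y : tk coord sph_base y = coord M y.
Proof.
rewrite -[RHS](sum_eq_delta M (fun k => coord k y)); apply: eq_bigr => k _.
by rewrite {1}/coord tnth_mktuple.
Qed.

Lemma X_base : X sph_base.
Proof.
have h := tk_base sph_base; rewrite {2}/coord tnth_mktuple eqxx in h.
by rewrite /X /sph_pts /= -[RHS]h; apply: eq_bigr => k _; rewrite expr2.
Qed.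

Lemma to_base x : X x -> exists2 g, sym g & g x = sph_base.
Proof.
move=> Xx; pose r := [seq k <- enum 'I_n.+1 | k != M].
have rP k : (k \in r) = (k != M) by rewrite mem_filter mem_enum andbT.
have Mr : M \notin r by rewrite rP eqxx.
have [g [[sg g0 _] _]] := kill_coords Mr Xx.
have Xg : X (g x) by case: sg => h _ _ _; exact: h.
have gM : coord M (g x) ^+ 2 = 1.
  rewrite -(sph_tk1 Xg) /tk (bigD1 M)//= big1 ?addr0 ?expr2// => k kM.
  by rewrite g0 ?rP// mul0r.
have gE (c : R) : coord M (g x) = c -> forall k, coord k (g x) = (k == M)%:R * c.
  move=> h k; have [->|kM] := eqVneq k M; first by rewrite h mul1r.
  by rewrite g0 ?rP// mul0r.
move/eqP: gM; rewrite -[X in _ == X](expr1n _ 2) eqf_sqr => /orP[/eqP/gE h|/eqP/gE h].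
  by exists g => //; apply: eq_from_tnth => k; rewrite tnth_mktuple -[LHS]/(coord k _) h mulr1.
have Mm : M != m by rewrite eq_sym.
(* When the last coordinate ends up at -1, a half turn in the plane of M and m corrects the sign
   with determinant 1. *)
exists (rotS M m (-1) 0 \o g).
  by apply: symm_comp => //; apply: rotS_symm => //; rewrite sqrrN expr1n expr0n addr0.
apply: eq_from_tnth => k; rewrite -[LHS]/(coord k (rotS M m (-1) 0 (g x))) rotSE// !h tnth_mktuple eqxx (negbTE mM).
by have [->|kM] := eqVneq k M; [rewrite (negbTE Mm)|]; rewrite /=; ring.
Qed.

(** x goes to the base point and z to the plane of e_M and e_m by rotations that fix the base point;
    r is then the m-th coordinate of the image of z, so r^2 = 1 - s^2. *)
Lemma sph_normal_form x z : X x -> X z -> exists2 r : R, r ^+ 2 = rho.[tk coord x z] &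
  forall f h : {poly R}, E (fun y => f.[tk coord x y] * h.[tk coord y z]) =
    E (fun y => f.[coord M y] * h.[0 + tk coord x z * coord M y + r * coord m y]).
Proof.
move=> Xx Xz; have [g sg gx] := to_base Xx.
have Xg y : X y -> X (g y) by case: sg => h _ _ _; exact: h.
pose r := [seq k <- enum 'I_n.+1 | (k != M) && (k != m)].
have rP k : (k \in r) = (k != M) && (k != m) by rewrite mem_filter mem_enum andbT.
have mr : m \notin r by rewrite rP eqxx andbF.
have [g' [[sg' g0 g1] g2]] := kill_coords mr (Xg _ Xz).
have gb : g' sph_base = sph_base.
  have base0 k : k != M -> coord k sph_base = 0 by rewrite /coord tnth_mktuple => /negbTE ->.
  by apply: g2; [exact: base0|move=> k; rewrite rP => /andP[kM _]; exact: base0].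
set w := g' (g z) in g0 *.
have Xw : X w by case: sg' => h _ _ _; apply: h; exact: Xg.
have stk : tk coord x z = coord M w.
  rewrite -(tk_base w) -gb /w; case: sg' => _ h _ _; rewrite h//; [|exact: X_base|exact: Xg].
  by rewrite -gx; case: sg => _ h' _ _; rewrite h'.
have wE y : tk coord y w = coord M w * coord M y + coord m w * coord m y.
  rewrite /tk (bigD1 M)//= (bigD1 m)//= big1 ?addr0; first by ring.
  by move=> k /andP[kM km]; rewrite g0 ?rP ?kM// mulr0.
exists (coord m w).
  rewrite stk !hornerE; have := sph_tk1 Xw; rewrite wE => <-; ring.
move=> f h; rewrite stk -(conv_symm HE f h sg Xx Xz) gx.
rewrite -(conv_symm HE f h sg' X_base (Xg _ Xz)) gb -/w.
by apply: (mean_on_ext HE) => y _; rewrite tk_base wE add0r.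
Qed.

(* the derivative of a monomial in two coordinates along the rotations of their plane has mean zero *)
Lemma sph_infinitesimal (k : 'I_n.+1) a b : k != M ->
  E (fun y => a%:R * (coord M y ^+ a.-1 * coord k y ^+ b.+1) - b%:R * (coord M y ^+ a.+1 * coord k y ^+ b.-1)) = 0.
Proof.
move=> kM; have Mk : M != k by rewrite eq_sym.
pose u y : {poly R} := (coord M y)%:P + (coord k y)%:P * 'X.
pose v y : {poly R} := (coord k y)%:P - (coord M y)%:P * 'X.
pose F y := u y ^+ a * v y ^+ b.
have pu : polycoef coord u.
  apply: polycoefD; first by apply: polycoefC; exact: polyfun_coord.
  by apply: polycoefM; [apply: polycoefC; exact: polyfun_coord|exact: polycoef_cst].
have pv : polycoef coord v.
  have h : polycoef coord (fun y => (coord k y)%:P + (coord M y)%:P * (- 'X)).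
    apply: polycoefD; first by apply: polycoefC; exact: polyfun_coord.
    by apply: polycoefM; [apply: polycoefC; exact: polyfun_coord|exact: polycoef_cst].
  by move=> i; apply: polyfun_ext (h i) => y; rewrite /v mulrN.
have pF : polycoef coord F by apply: polycoefM; exact: polycoefX.
have su (c d : R) : (size (c%:P + d%:P * 'X)%R <= 2)%N.
  rewrite (leq_trans (size_polyD _ _))// geq_max (leq_trans (size_polyC_leq1 _))//=.
  by rewrite mul_polyC (leq_trans (size_scale_leq _ _))// size_polyX.
have sX (p : {poly R}) e : (size p <= 2)%N -> (size (p ^+ e)%R <= e.+1)%N.
  move=> h; rewrite (leq_trans (size_poly_exp_leq _ _))// ltnS.
  by rewrite -[leqRHS]mul1n leq_mul2r; case: (size p) h => [|[|[|]]]//= _; rewrite orbT.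
have sF y : (size (F y) <= a + b.+1)%N.
  apply: size_mul_le; apply: sX; first exact: su.
  by rewrite /v -mulNr -polyCN; exact: su.
have ev (t : R) : E (fun y => (F y).[t]) = E (fun y => (F y).[- t]).
  (* F(e) is the monomial after the rotation of slope e, without the factor 1 / sqrt(1 + e^2) on
     each coordinate. By invariance its mean depends only on e^2, and its linear coefficient is the
     claimed combination. *)
  have aux (e : R) : e ^+ 2 = t ^+ 2 ->
      E (fun y => (F y).[e]) = Num.sqrt (1 + t ^+ 2) ^+ (a + b) * E (fun y => coord M y ^+ a * coord k y ^+ b).
    move=> et; have t0 : 0 < 1 + t ^+ 2 by rewrite ltr_pwDl// sqr_ge0.
    set l := Num.sqrt _; have l0 : l != 0 by rewrite gt_eqF// sqrtr_gt0.
    have ll : l ^+ 2 = 1 + e ^+ 2 by rewrite et sqr_sqrtr// ltW.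
    have cs : l^-1 ^+ 2 + (e / l) ^+ 2 = 1 by rewrite expr_div_n exprVn ll; field; rewrite -ll expf_neq0.
    have pm : polyfun coord (fun y => coord M y ^+ a * coord k y ^+ b).
      by apply: polyfunM; apply: polyfunX; exact: polyfun_coord.
    have [_ _ h1 h2] := rotS_symm Mk cs.
    rewrite -(h2 _ pm) -(monZ HE); last exact: (h1 _ pm).
    apply: (mean_on_ext HE) => y _; rewrite !rotSE// !eqxx (negbTE kM) (negbTE Mk) !mul1r !mul0r !addr0.
    have -> : coord M y + ((l^-1 - 1) * coord M y + e / l * coord k y) = l^-1 * (coord M y + e * coord k y) by ring.
    have -> : coord k y + ((l^-1 - 1) * coord k y - e / l * coord M y) = l^-1 * (coord k y - e * coord M y) by ring.
    rewrite /F /u /v !hornerE /= !exprMn exprD !exprVn [e * coord k y]mulrC [e * coord M y]mulrC.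
    by field; rewrite !expf_neq0.
  by rewrite aux// aux// sqrrN.
rewrite -[RHS](E_even HE pF sF ev); apply: (mean_on_ext HE) => y _.
have -> : (F y)`_1 = (F y)^`().[0] by rewrite horner_coef0 coef_deriv mulr1n.
rewrite /F derivM !deriv_exp /u /v derivD derivB !derivM !derivC derivX !mul0r !add0r !mulr1.
by rewrite !(hornerD, hornerM, hornerMn, horner_exp, hornerN, hornerC, hornerX) !(mulr0, addr0, subr0) !exprS; ring.
Qed.

(** Changing the sign of one coordinate has determinant -1, and for n = 1 no rotation does it while
    fixing the other coordinate. Odd moments therefore vanish by induction on b through the
    infinitesimal identity. *)
Lemma sph_odd (k : 'I_n.+1) a b : k != M -> E (fun y => coord M y ^+ a * coord k y ^+ b.*2.+1) = 0.
Proof.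
have pm (c d : nat) (k' : 'I_n.+1) : polyfun coord (fun y => coord M y ^+ c * coord k' y ^+ d).
  by apply: polyfunM; apply: polyfunX; exact: polyfun_coord.
move=> kM; elim: b a => [|b IH] a.
  have h := sph_infinitesimal a.+1 0 kM; apply: (@mulfI _ a.+1%:R) => //.
  rewrite mulr0 -(monZ HE) // -[RHS]h; apply: (mean_on_ext HE) => y _ /=; ring.
have h := sph_infinitesimal a.+1 b.*2.+2 kM; apply: (@mulfI _ a.+1%:R) => //.
rewrite mulr0 -(monZ HE) // -[RHS]h doubleS /=.
transitivity (E (fun y => a.+1%:R * (coord M y ^+ a * coord k y ^+ b.*2.+3)) +
   E (fun y => - b.*2.+2%:R * (coord M y ^+ a.+2 * coord k y ^+ b.*2.+1))).
  by rewrite (monZ HE (- _))// IH mulr0 addr0.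
rewrite -(monD HE); [|exact: polyfunZ..].
by apply: (mean_on_ext HE) => y _; rewrite mulNr.
Qed.

Lemma sph_reflect (f h : {poly R}) (s r : R) : r ^+ 2 = rho.[s] ->
  E (fun y => f.[coord M y] * h.[0 + s * coord M y + r * coord m y]) =
  E (fun y => f.[coord M y] * h.[0 + s * coord M y - r * coord m y]).
Proof.
move=> _.
have odd_mean (g : {poly R}) a b : E (fun y => g.[coord M y] * (coord M y ^+ a * coord m y ^+ b.*2.+1)) = 0.
  transitivity (E (fun y => \sum_(i < size g) g`_i * (coord M y ^+ (i + a) * coord m y ^+ b.*2.+1))).
    apply: (mean_on_ext HE) => y _; rewrite horner_coef mulr_suml; apply: eq_bigr => i _.
    by rewrite exprD; ring.
  rewrite (mean_on_lin HE (index_enum 'I_(size g)) (fun i : 'I_(size g) => g`_i)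
    (F := fun (i : 'I_(size g)) y => coord M y ^+ (i + a) * coord m y ^+ b.*2.+1)).
    by rewrite big1// => i _; rewrite sph_odd// mulr0.
  by move=> i; apply: polyfunM; apply: polyfunX; exact: polyfun_coord.
have pf (g : {poly R}) a b : polyfun coord (fun y => g.[coord M y] * (coord M y ^+ a * coord m y ^+ b)).
  apply: polyfunM; first by apply: polyfun_horner; exact: polyfun_coord.
  by apply: polyfunM; apply: polyfunX; exact: polyfun_coord.
have expand (e : R) : E (fun y => f.[coord M y] * h.[0 + s * coord M y + e * coord m y]) =
    \sum_(i < size h) \sum_(j < i.+1) (h`_i * ('C(i, j)%:R * (s ^+ (i - j) * e ^+ j))) *
      E (fun y => f.[coord M y] * (coord M y ^+ (i - j) * coord m y ^+ j)).
  transitivity (E (fun y => \sum_(i < size h) \sum_(j < i.+1) (h`_i * ('C(i, j)%:R * (s ^+ (i - j) * e ^+ j))) *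
      (f.[coord M y] * (coord M y ^+ (i - j) * coord m y ^+ j)))).
    apply: (mean_on_ext HE) => y _; rewrite add0r (horner_coef h) mulr_sumr; apply: eq_bigr => i _.
    rewrite exprDn !mulr_sumr; apply: eq_bigr => j _; rewrite !exprMn -mulr_natl; ring.
  rewrite (mon_sum HE); last by move=> i; apply: polyfun_sum => j; exact: polyfunZ.
  apply: eq_bigr => i _; rewrite (mon_sum HE); last by move=> j; exact: polyfunZ.
  by apply: eq_bigr => j _; rewrite (monZ HE).
have -> : E (fun y => f.[coord M y] * h.[0 + s * coord M y - r * coord m y]) =
          E (fun y => f.[coord M y] * h.[0 + s * coord M y + (- r) * coord m y]).
  by apply: (mean_on_ext HE) => y _; rewrite mulNr.
rewrite !expand; apply: eq_bigr => i _; apply: eq_bigr => j _.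
have [jo|je] := boolP (odd j); last by rewrite exprNn -signr_odd (negbTE je) expr0 mul1r.
by rewrite -[nat_of_ord j]odd_double_half jo add1n odd_mean !mulr0.
Qed.

(** For q = X^a, add the infinitesimal identities of the n planes containing e_M, with exponent 1 in
    the other coordinate, and use that the squares of the coordinates sum to 1. *)
Lemma sph_pearson x (q : {poly R}) : X x -> E (fun y => (Dop sigS (t0S n%:R) 0 q).[tk coord x y]) = 0.
Proof.
move=> Xx; have [g sg gx] := to_base Xx.
have e1 := conv_symm HE (Dop sigS (t0S n%:R) 0 q) 1 sg Xx Xx.
transitivity (E (fun y => (Dop sigS (t0S n%:R) 0 q).[coord M y])).
  transitivity (E (fun y => (Dop sigS (t0S n%:R) 0 q).[tk coord x y] * (1 : {poly R}).[tk coord y x])).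
    by apply: (mean_on_ext HE) => y _; rewrite hornerC mulr1.
  rewrite -e1 gx; apply: (mean_on_ext HE) => y _; by rewrite hornerC mulr1 tk_base.
apply: (E_Dop HE); first exact: polyfun_coord.
move=> a.
pose F (k : 'I_n.+1) y := a%:R * (coord M y ^+ a.-1 * coord k y ^+ 2) - 1%:R * (coord M y ^+ a.+1 * coord k y ^+ 0).
have pF k : polyfun coord (F k).
  have h : polyfun coord (fun y => a%:R * (coord M y ^+ a.-1 * coord k y ^+ 2) + (-1) * (coord M y ^+ a.+1 * coord k y ^+ 0)).
    by apply: polyfunD; apply: polyfunZ; apply: polyfunM; apply: polyfunX; exact: polyfun_coord.
  by apply: polyfun_ext h => y; rewrite /F; ring.
have h : E (fun y => \sum_(k <- [seq k <- index_enum 'I_n.+1 | k != M]) F k y) = 0.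
  rewrite (mon_sum HE)// big_filter big1// => k kM; exact: (sph_infinitesimal a 1 kM).
rewrite -[RHS]h; apply: (mean_on_ext HE) => y Xy.
rewrite big_filter /F sumrB -!mulr_sumr.
have s1 : \sum_(k | k != M) coord k y ^+ 2 = 1 - coord M y ^+ 2.
  have e := sph_tk1 Xy; rewrite /tk (bigD1 M)//= in e; rewrite -e expr2 addrAC subrr add0r.
  by apply: eq_bigr => k _; rewrite expr2.
have s2 : \sum_(k < n.+1 | k != M) coord k y ^+ 0 = n%:R.
  rewrite sumr_const; congr (_%:R); have h1 := cardC1 M; rewrite card_ord in h1; rewrite -[RHS]h1.
  by apply: eq_card => k; rewrite !inE.
rewrite s1 s2 DopS mulr0n derivXn hornerMn !hornerXn /= !exprS; ring.
Qed.

End Mean.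

Theorem GK_sphere_space (L : R) : 0 < L -> L < pi / 2 ->
  GK_spectral_limit (sph_pts n) (@sph_dist R n) (SO_sph n) L (eig_RS L n) (mult_RS n).
Proof.
move=> L0 L2; apply: (GK_RS (coord := coord) L0 L2 sph_coord_meas sph_meas sph_tk1 n0 (sph_dist_tk L0 L2)).
move=> mu muX mu_inv; split; first by move=> x Xx q; exact: sph_pearson.
move=> f h; have srho : (size rho <= 3)%N.
  by rewrite (leq_trans (size_polyD _ _))// size_polyN size_poly1 size_polyXn.
have HE := mean_mean_on sph_coord_meas sph_meas sph_tk1 muX.
apply: (conv_poly HE (polyfun_coord coord M) (polyfun_cst coord 0) (polyfun_coord coord M)
  (polyfun_coord coord m) srho).
- by move=> x z; exact: sph_normal_form.
- by move=> f' h' s r; exact: sph_reflect.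
Qed.

End Sphere.

(** * Projective spaces *)

Section KMatrices.
Context {R : realType} {j n : nat}.
Hypothesis j3 : (j <= 3)%N.
Notation D := (2 ^ j)%N.
Notation K := (K R j).
Definition KM := 'I_n.+1 -> 'I_n.+1 -> K.
Implicit Types (M N : KM) (g h : 'M[R]_n.+1).

Definition km M N : KM := fun i l => \sum_k kmul (M i k) (N k l).
(** Real matrices commute and associate with everything in [K], so their left action and right
    action (by the transpose, [rop]) are kept apart from the product [km]. Conjugation by a real
    orthogonal matrix then works for octonions too. *)
Definition lop g M : KM := fun k l => \sum_a g k a *: M a l.
Definition rop g M : KM := fun k l => \sum_b g l b *: M k b.
Definition fr M N : R := \sum_k \sum_l dot (M k l) (N k l).
Definition kid : KM := fun k l => (k == l)%:R *: ke 0.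
Definition kst M : KM := fun i l => kconj (M l i).

Lemma kmul_suml J (r : seq J) (F : J -> K) y : kmul (\sum_(i <- r) F i) y = \sum_(i <- r) kmul (F i) y.
Proof. exact: (lin_sum _ _ (lin_mull y)). Qed.
Lemma kmul_sumr J (r : seq J) (F : J -> K) y : kmul y (\sum_(i <- r) F i) = \sum_(i <- r) kmul y (F i).
Proof. exact: (lin_sum _ _ (lin_mulr y)). Qed.
Lemma kconj_sum J (r : seq J) (F : J -> K) : kconj (\sum_(i <- r) F i) = \sum_(i <- r) kconj (F i).
Proof. exact: (lin_sum _ _ (lin_conj (R := R) (j := j))). Qed.
Lemma dot_suml J (r : seq J) (F : J -> K) y : dot (\sum_(i <- r) F i) y = \sum_(i <- r) dot (F i) y.
Proof. exact: (lin_sum _ _ (lin_dotl y)). Qed.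
Lemma dot_sumr J (r : seq J) (F : J -> K) y : dot y (\sum_(i <- r) F i) = \sum_(i <- r) dot y (F i).
Proof. exact: (lin_sum _ _ (lin_dotr y)). Qed.
Lemma kconjZ a (x : K) : kconj (a *: x) = a *: kconj x.
Proof. exact: (lin_scale (lin_conj (R := R) (j := j))). Qed.
Lemma kconjD (x y : K) : kconj (x + y) = kconj x + kconj y.
Proof. exact: (lin_add (lin_conj (R := R) (j := j))). Qed.

Lemma KM_ext M N : (forall k l, M k l = N k l) -> M = N.
Proof. by move=> h; apply/funext => k; apply/funext => l. Qed.

Lemma km_lop g M N : km (lop g M) N = lop g (km M N).
Proof.
apply: KM_ext => i l; rewrite /km /lop; under eq_bigr do rewrite kmul_suml.
rewrite exchange_big/=; apply: eq_bigr => a _; rewrite scaler_sumr; apply: eq_bigr => k _.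
by rewrite kmulZl.
Qed.

Lemma km_rop g M N : km M (rop g N) = rop g (km M N).
Proof.
apply: KM_ext => i l; rewrite /km /rop; under eq_bigr do rewrite kmul_sumr.
rewrite exchange_big/=; apply: eq_bigr => a _; rewrite scaler_sumr; apply: eq_bigr => k _.
by rewrite kmulZr.
Qed.

Lemma km_rop_lop g M N : km (rop g M) N = km M (lop g^T N).
Proof.
apply: KM_ext => i l; rewrite /km /rop /lop.
under eq_bigr do rewrite kmul_suml; under [RHS]eq_bigr do rewrite kmul_sumr.
rewrite exchange_big/=; apply: eq_bigr => a _; apply: eq_bigr => k _.
by rewrite kmulZl kmulZr mxE.
Qed.

Lemma lopM g h M : lop g (lop h M) = lop (g *m h) M.
Proof.
apply: KM_ext => i l; rewrite /lop; under eq_bigr do rewrite scaler_sumr.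
rewrite exchange_big/=; apply: eq_bigr => a _; rewrite mxE scaler_suml; apply: eq_bigr => k _.
by rewrite scalerA.
Qed.

Lemma sum_delta_scale (i : 'I_n.+1) (F : 'I_n.+1 -> K) : \sum_a (i == a)%:R *: F a = F i.
Proof.
rewrite (bigD1 i)//= eqxx scale1r big1 ?addr0// => a; rewrite eq_sym => /negbTE ->.
by rewrite scale0r.
Qed.

Lemma lop1 M : lop 1%:M M = M.
Proof.
apply: KM_ext => i l; rewrite /lop -[RHS](sum_delta_scale i (M^~ l)); apply: eq_bigr => a _.
by rewrite mxE.
Qed.

Lemma lop_rop g h M : lop g (rop h M) = rop h (lop g M).
Proof.
apply: KM_ext => k l; rewrite /lop /rop.
under eq_bigr do rewrite scaler_sumr; under [RHS]eq_bigr do rewrite scaler_sumr.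
rewrite exchange_big/=; apply: eq_bigr => a _; apply: eq_bigr => b _.
by rewrite !scalerA mulrC.
Qed.

Lemma kst_lop g M : kst (lop g M) = rop g (kst M).
Proof.
apply: KM_ext => k l; rewrite /kst /lop /rop kconj_sum; apply: eq_bigr => a _; exact: kconjZ.
Qed.

Lemma kst_rop g M : kst (rop g M) = lop g (kst M).
Proof.
apply: KM_ext => k l; rewrite /kst /lop /rop kconj_sum; apply: eq_bigr => a _; exact: kconjZ.
Qed.

Lemma fr_lop g M N : fr (lop g M) N = fr M (lop g^T N).
Proof.
rewrite /fr exchange_big [RHS]exchange_big/=; apply: eq_bigr => l _; rewrite /lop.
under eq_bigr do rewrite dot_suml; under [RHS]eq_bigr do rewrite dot_sumr.
rewrite exchange_big/=; apply: eq_bigr => a _; apply: eq_bigr => b _.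
by rewrite dotZl dotZr mxE.
Qed.

Lemma fr_rop g M N : fr (rop g M) N = fr M (rop g^T N).
Proof.
apply: eq_bigr => l _; rewrite /rop.
under eq_bigr do rewrite dot_suml; under [RHS]eq_bigr do rewrite dot_sumr.
rewrite exchange_big/=; apply: eq_bigr => a _; apply: eq_bigr => b _.
by rewrite dotZl dotZr mxE.
Qed.

Section Conjugation.
Variable g : 'M[R]_n.+1.
Hypothesis gg : g *m g^T = 1%:M.

Let gg' : g^T *m g = 1%:M. Proof. exact: mulmx1C. Qed.

Definition rconj M : KM := lop g (rop g M).

Lemma rop1 M : rop 1%:M M = M.
Proof.
apply: KM_ext => i l; rewrite /rop -[RHS](sum_delta_scale l (M i)); apply: eq_bigr => a _.
by rewrite mxE.
Qed.

Lemma ropM h k M : rop h (rop k M) = rop (h *m k) M.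
Proof.
apply: KM_ext => i l; rewrite /rop; under eq_bigr do rewrite scaler_sumr.
rewrite exchange_big/=; apply: eq_bigr => a _; rewrite mxE scaler_suml; apply: eq_bigr => b _.
by rewrite scalerA.
Qed.

Lemma km_rconj M N : km (rconj M) (rconj N) = rconj (km M N).
Proof. by rewrite /rconj km_lop km_rop_lop lopM gg' lop1 km_rop. Qed.

Lemma kst_rconj M : kst (rconj M) = rconj (kst M).
Proof. by rewrite /rconj kst_lop kst_rop lop_rop. Qed.

Lemma fr_rconj M N : fr (rconj M) (rconj N) = fr M N.
Proof. by rewrite /rconj fr_lop lopM gg' lop1 fr_rop ropM gg' rop1. Qed.

Lemma rconj_id : rconj kid = kid.
Proof.
apply: KM_ext => k l; rewrite /rconj /lop /rop /kid.
have -> : \sum_a g k a *: (\sum_b g l b *: ((a == b)%:R *: ke 0)) = (g *m g^T) k l *: (ke 0 : K).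
  rewrite mxE scaler_suml; apply: eq_bigr => a _; rewrite mxE -scalerA; congr (_ *: _).
  rewrite (bigD1 a)//= eqxx scale1r big1 ?addr0// => b /negbTE; rewrite eq_sym => ->.
  by rewrite scale0r scaler0.
by rewrite gg mxE.
Qed.

End Conjugation.

Definition herm M := kst M = M.

Record is_proj M : Prop := IsProj { proj_herm : herm M; proj_idem : km M M = M; proj_tr : fr M kid = 1 }.

Lemma is_proj_rconj g M : g *m g^T = 1%:M -> is_proj M -> is_proj (rconj g M).
Proof.
move=> gg [h i t]; split.
- by rewrite /herm kst_rconj h.
- by rewrite km_rconj// i.
- by rewrite -(rconj_id gg) fr_rconj.
Qed.

Definition xi M k := dot (M k k) (ke 0).

Lemma fr_kid M : fr M kid = \sum_k xi M k.
Proof.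
apply: eq_bigr => k _; rewrite (bigD1 k)//= /kid eqxx scale1r big1 ?addr0// => l /negbTE.
by rewrite eq_sym => ->; rewrite scale0r; exact: (lin0 (lin_dotr _)).
Qed.

Lemma dot_kec (x : K) (c : 'I_D) : dot x (ke c) = x 0 c.
Proof.
rewrite /dot (bigD1 c)//= !mxE eqxx mulr1 big1 ?addr0// => d dc; rewrite !mxE.
by rewrite (_ : (d == c :> nat) = false) ?mulr0//; exact: negbTE.
Qed.

Lemma herm_diag M k : herm M -> M k k = xi M k *: ke 0.
Proof.
move=> h; apply/rowP => c; have := congr1 (fun N : KM => N k k 0 c) h; rewrite /kst !mxE /csg.
case: eqP => [c0|_]; first by rewrite mulr1 -dot_kec c0.
by rewrite mulr0 mulN1r => e; move: e; move: (M k k 0 c) => t; lra.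
Qed.

Section ProjFacts.
Variable M : KM.
Hypothesis pM : is_proj M.

Lemma ent_conj k l : M l k = kconj (M k l).
Proof. by rewrite -{1}(proj_herm pM). Qed.

Lemma dot_swap k l : dot (M l k) (M l k) = dot (M k l) (M k l).
Proof. by rewrite ent_conj dot_conj. Qed.

Lemma row_norm k : \sum_m dot (M k m) (M k m) = xi M k.
Proof.
rewrite /xi -{3}(proj_idem pM) /km dot_suml; apply: eq_bigr => m _.
by rewrite kre_mul// -ent_conj.
Qed.

Lemma xi_ge0 k : 0 <= xi M k.
Proof. by rewrite -row_norm; apply: sumr_ge0 => m _; exact: dot_ge0. Qed.

Lemma xi_sum : \sum_k xi M k = 1.
Proof. by rewrite -fr_kid proj_tr. Qed.

Lemma norm_le k l : dot (M k l) (M k l) <= xi M k * xi M l.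
Proof.
set u := M k l; have [->|u0] := eqVneq (dot u u) 0; first by rewrite mulr_ge0// xi_ge0.
have up : 0 < dot u u by rewrite lt_neqAle eq_sym u0 dot_ge0.
rewrite -(ler_pM2l up) -expr2.
pose a (i : 'I_n.+1 * 'I_D) := kmul (kconj (M k i.1)) u 0 i.2.
pose b (i : 'I_n.+1 * 'I_D) := M i.1 l 0 i.2.
have e1 : dot u u = \sum_i a i * b i.
  rewrite {2}/u -(proj_idem pM) /km dot_sumr -(pair_bigA _ (fun m c => a (m, c) * b (m, c)))/=.
  by apply: eq_bigr => m _; rewrite dotC dot_adjl// dotC.
have e2 : \sum_i a i ^+ 2 = xi M k * dot u u.
  rewrite -(pair_bigA _ (fun m c => a (m, c) ^+ 2))/= -row_norm mulr_suml; apply: eq_bigr => m _.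
  have := dot_mull j3 (kconj (M k m)) u u; rewrite dot_conj => <-.
  by apply: eq_bigr => c _; rewrite expr2.
have e3 : \sum_i b i ^+ 2 = xi M l.
  rewrite -(pair_bigA _ (fun m c => b (m, c) ^+ 2))/= -row_norm; apply: eq_bigr => m _.
  by rewrite -dot_swap; apply: eq_bigr => c _; rewrite expr2.
rewrite {1}e1 (le_trans (cauchy_schwarz _ _ _))// e2 e3; lra.
Qed.

(* Equality in [norm_le]: both sides have the same sum over l. *)
Lemma norm_ent k l : dot (M k l) (M k l) = xi M k * xi M l.
Proof.
have h : \sum_m (xi M k * xi M m - dot (M k m) (M k m)) = 0.
  by rewrite sumrB -mulr_sumr xi_sum row_norm mulr1 subrr.
apply/eqP; rewrite eq_sym -subr_eq0; apply/eqP/(psumr_eq0P _ h) => // m _.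
by rewrite subr_ge0 norm_le.
Qed.

Lemma ent_eq0 k l : xi M k = 0 -> M k l = 0.
Proof. by move=> k0; apply: dot_eq0; rewrite norm_ent k0 mul0r. Qed.

Lemma ent_eq0r k l : xi M k = 0 -> M l k = 0.
Proof. by move=> k0; apply: dot_eq0; rewrite norm_ent k0 mulr0. Qed.

End ProjFacts.

End KMatrices.

Arguments KM : clear implicits.

Section ProjSpace.
Context {R : realType} {j n : nat}.
Hypothesis j3 : (j <= 3)%N.
Notation D := (2 ^ j)%N.
Notation K := (K R j).
Notation T := (@proj_amb R j n).
Notation X := (@proj_pts R j n).

Definition pcoord (i : 'I_n.+1 * ('I_n.+1 * 'I_D)) (x : T) : R := tnth (tnth (tnth x i.1) i.2.1) i.2.2.
Definition ent (x : T) : KM R j n := fun k l => \row_c tnth (tnth (tnth x k) l) c.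
Definition encK (M : KM R j n) : T := kenc (fun k l => sq (M k l)).

Lemma ent_kenc (P : KMat n) k l : ent (kenc P) k l = unsq j (P k l).
Proof. by apply/rowP => c; rewrite !mxE !tnth_mktuple. Qed.

Lemma entK M : ent (encK M) = M.
Proof. by apply: KM_ext => k l; rewrite ent_kenc sqK. Qed.

Lemma kdecE x k l : kdec x k l = sq (ent x k l).
Proof.
apply: (@eq_from_nth _ 0); first by rewrite size_sq size_tuple.
rewrite size_tuple => i hi; rewrite (nth_sq _ (Ordinal hi)) mxE (tnth_nth 0)//.
Qed.

Lemma kdec_sq x : kdec x = fun k l => sq (ent x k l).
Proof. by apply/funext => k; apply/funext => l; exact: kdecE. Qed.

Lemma sq_inj' : injective (@sq R j).
Proof. exact: can_inj (@sqK R j). Qed.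

Lemma foldr_sq J (s : seq J) (F : J -> K) :
  foldr cdadd (cdzero j) [seq sq (F k) | k <- s] = sq (\sum_(k <- s) F k).
Proof.
elim: s => [|k s IH] /=; first by rewrite big_nil sq_zero.
by rewrite IH sq_add big_cons.
Qed.

Lemma kmxmul_sq (A B : KM R j n) : kmxmul j (fun k l => sq (A k l)) (fun k l => sq (B k l)) =
  fun k l => sq (km A B k l).
Proof.
apply/funext => i; apply/funext => l; rewrite /kmxmul.
under eq_map do rewrite sq_mul.
by rewrite foldr_sq big_enum.
Qed.

Lemma head_sq (x : K) : head 0 (sq x) = dot x (ke 0).
Proof.
have D0 : (0 < D)%N by rewrite expn_gt0.
by rewrite -nth0 (nth_sq x (Ordinal D0)) -dot_kec.
Qed.

Lemma kretr_sq (A : KM R j n) : kretr (fun k l => sq (A k l)) = \sum_k xi A k.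
Proof. by apply: eq_bigr => k _; rewrite head_sq. Qed.

Lemma proj_ptsE x : X x <-> is_proj (ent x).
Proof.
rewrite /proj_pts /= kdec_sq; split=> [[[_ h] i t]|[h i t]].
- split.
  + apply: KM_ext => k l; apply: sq_inj'; by rewrite -sq_conj -h.
  + apply: KM_ext => k l; apply: sq_inj'; by rewrite -[RHS]/((fun k l => sq (ent x k l)) k l) -i kmxmul_sq.
  + by rewrite fr_kid -kretr_sq.
- split.
  + by split=> [k l|k l]; [exact: size_sq|rewrite sq_conj -{1}h].
  + by rewrite kmxmul_sq i.
  + by rewrite kretr_sq -fr_kid.
Qed.

Lemma tk_fr x y : tk pcoord x y = fr (ent x) (ent y).
Proof.
rewrite /tk -(pair_bigA _ (fun k i => pcoord (k, i) x * pcoord (k, i) y))/=; apply: eq_bigr => k _.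
rewrite -(pair_bigA _ (fun l c => pcoord (k, (l, c)) x * pcoord (k, (l, c)) y))/=; apply: eq_bigr => l _.
by apply: eq_bigr => c _; rewrite !mxE.
Qed.

Lemma proj_tk1 x : X x -> tk pcoord x x = 1.
Proof.
move=> /proj_ptsE px; rewrite tk_fr -(xi_sum px); apply: eq_bigr => k _; exact: row_norm.
Qed.

Lemma proj_distE x y : X x -> X y ->
  @proj_dist R j n x y = acos (Num.sqrt (tk pcoord x y)).
Proof.
move=> _ /proj_ptsE py; rewrite /proj_dist !kdec_sq kmxmul_sq kretr_sq tk_fr; congr (acos (Num.sqrt _)).
apply: eq_bigr => k _; rewrite /xi /km dot_suml; apply: eq_bigr => l _.
by rewrite kre_mul// -(ent_conj py).
Qed.

Lemma proj_dist_tk (L : R) : 0 < L -> L < pi / 2 -> forall x y, X x -> X y ->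
  (@proj_dist R j n x y <= L) = (cos L ^+ 2 <= tk pcoord x y).
Proof.
move=> L0 L2 x y Xx Xy; have pi0 := pi_gt0 R; rewrite (proj_distE Xx Xy).
have /andP[_ t1] : -1 <= tk pcoord x y <= 1 by exact: (tk_itv proj_tk1 Xx Xy).
set t := tk pcoord x y in t1 *.
have s1 : -1 <= Num.sqrt t <= 1.
  by rewrite (le_trans _ (sqrtr_ge0 t)) ?lerN10//= -[leRHS]sqrtr1 ler_wsqrtr.
have cL : 0 < cos L by apply: cos_gt0_pihalf; apply/andP; split; lra.
have a0 := acos_ge0 s1; have a1 := acos_lepi s1.
transitivity (cos L <= Num.sqrt t).
  rewrite -{2}[Num.sqrt t]acosK; last by rewrite in_itv.
  by rewrite (leNgt (cos L)) ltr_cos ?in_itv/= ?a0 ?a1// ?leNgt//; apply/andP; split; lra.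
apply/idP/idP => h.
- have t0 : 0 < t by rewrite -sqrtr_gt0 (lt_le_trans cL).
  by rewrite -(sqr_sqrtr (ltW t0)) ler_sqr ?nnegrE ?sqrtr_ge0// ltW.
- by rewrite -[cos L]gtr0_norm// -sqrtr_sqr ler_wsqrtr.
Qed.

Lemma pcoord_meas i : measurable_fun setT (pcoord i).
Proof.
case: i => k [l c]; apply: (measurableT_comp (measurable_tnth c)).
by apply: (measurableT_comp (measurable_tnth l)); exact: measurable_tnth.
Qed.

Lemma meas_pcoord (g : T -> T) : (forall i, measurable_fun setT (fun x => pcoord i (g x))) ->
  measurable_fun setT g.
Proof.
move=> h; apply/measurable_fun_tnthP => k; apply/measurable_fun_tnthP => l.
apply/measurable_fun_tnthP => c; exact: (h (k, (l, c))).
Qed.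

Definition polyK (F : T -> K) := forall c, polyfun pcoord (fun x => F x 0 c).

Lemma polyK_ent k l : polyK (fun x => ent x k l).
Proof.
move=> c; apply: polyfun_ext (polyfun_coord pcoord (k, (l, c))) => x; by rewrite mxE.
Qed.

Lemma polyK_cst v : polyK (fun=> v).
Proof. by move=> c; exact: polyfun_cst. Qed.

Lemma polyK_sum (J : finType) (F : J -> T -> K) : (forall i, polyK (F i)) -> polyK (fun x => \sum_i F i x).
Proof.
move=> h c; have hs : polyfun pcoord (fun x => \sum_i F i x 0 c) by apply: polyfun_sum => i; exact: h.
by apply: polyfun_ext hs => x; rewrite summxE.
Qed.

Lemma polyKZ a F : polyK F -> polyK (fun x => a *: F x).
Proof. by move=> h c; apply: polyfun_ext (polyfunZ a (h c)) => x; rewrite mxE. Qed.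

Lemma polyK_conj F : polyK F -> polyK (fun x => kconj (F x)).
Proof. by move=> h c; apply: polyfun_ext (polyfunZ (csg c) (h c)) => x; rewrite mxE. Qed.

Lemma polyK_mul F G : polyK F -> polyK G -> polyK (fun x => kmul (F x) (G x)).
Proof.
move=> hF hG c.
have hs : polyfun pcoord (fun x => \sum_(a < D) \sum_(b < D) tc j a b c * (F x 0 a * G x 0 b)).
  by apply: polyfun_sum => a; apply: polyfun_sum => b; apply: polyfunZ; apply: polyfunM.
apply: polyfun_ext hs => x; rewrite mxE; apply: eq_bigr => a _; apply: eq_bigr => b _; ring.
Qed.

Lemma polyfun_dot F G : polyK F -> polyK G -> polyfun pcoord (fun x => dot (F x) (G x)).
Proof. by move=> hF hG; apply: polyfun_sum => c; apply: polyfunM. Qed.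

Lemma polyfun_xi k : polyfun pcoord (fun x => xi (ent x) k).
Proof. by apply: polyfun_dot; [exact: polyK_ent|exact: polyK_cst]. Qed.

Lemma meas_level (f : T -> R) (a : R) : polyfun pcoord f -> measurable [set x | f x = a].
Proof.
move=> pf; have mf := polyfun_meas pcoord_meas pf.
rewrite -[X in measurable X]setTI (_ : [set x | f x = a] = f @^-1` [set a])//; exact: mf.
Qed.

Lemma meas_eqK (F G : T -> KM R j n) : (forall k l, polyK (fun x => F x k l)) ->
  (forall k l, polyK (fun x => G x k l)) -> measurable [set x | F x = G x].
Proof.
move=> hF hG.
have -> : [set x | F x = G x] = \bigcap_(i in [set: 'I_n.+1 * ('I_n.+1 * 'I_D)])
    [set x | F x i.1 i.2.1 0 i.2.2 - G x i.1 i.2.1 0 i.2.2 = 0].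
  apply/seteqP; split=> x /=; first by move=> e i _; rewrite /= e subrr.
  move=> h; apply: KM_ext => k l; apply/rowP => c; apply/eqP; rewrite -subr_eq0.
  by apply/eqP/(h (k, (l, c))).
apply: fin_bigcap_measurable; first exact: finite_finset.
move=> i _; apply: meas_level.
have h := polyfunD (hF i.1 i.2.1 i.2.2) (polyfunZ (-1) (hG i.1 i.2.1 i.2.2)).
by apply: polyfun_ext h => x; rewrite mulN1r.
Qed.

Lemma proj_meas : measurable X.
Proof.
have -> : X = [set x | kst (ent x) = ent x] `&` [set x | km (ent x) (ent x) = ent x] `&`
    [set x | \sum_k xi (ent x) k = 1].
  apply/seteqP; split=> x; first by move=> /proj_ptsE[h i t]; split=> //; rewrite /= -fr_kid.
  by move=> [[h i] t]; apply/proj_ptsE; split=> //; rewrite fr_kid.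
apply: measurableI; first apply: measurableI.
- apply: meas_eqK => k l; last exact: polyK_ent.
  by apply: polyK_conj; exact: polyK_ent.
- apply: meas_eqK => k l; last exact: polyK_ent.
  by apply: polyK_sum => m; apply: polyK_mul; exact: polyK_ent.
- by apply: meas_level; apply: polyfun_sum => k; exact: polyfun_xi.
Qed.

End ProjSpace.

(** * Actions of real orthogonal matrices and of diagonal phases *)

Section Actions.
Context {R : realType} {j n : nat}.
Hypothesis j3 : (j <= 3)%N.
Notation K := (K R j).
Notation KM := (KM R j n).
Notation T := (@proj_amb R j n).
Implicit Types (M N : KM).

Definition kmact (Phi : KM -> KM) (x : T) : T := encK (Phi (ent x)).

Lemma ent_kmact Phi x : ent (kmact Phi x) = Phi (ent x).
Proof. exact: entK. Qed.

Lemma kmul0l (y : K) : kmul 0 y = 0.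
Proof. exact: (lin0 (lin_mull y)). Qed.
Lemma kmul0r (y : K) : kmul y 0 = 0.
Proof. exact: (lin0 (lin_mulr y)). Qed.

Lemma km1l M : km kid M = M.
Proof.
apply: KM_ext => k l; rewrite /km /kid -[RHS](sum_delta_scale k (M^~ l)); apply: eq_bigr => a _.
by rewrite kmulZl k1mul.
Qed.

Lemma km1r M : km M kid = M.
Proof.
apply: KM_ext => k l; rewrite /km /kid -[RHS](sum_delta_scale l (M k)); apply: eq_bigr => a _.
by rewrite kmulZr kmul1// eq_sym.
Qed.

Lemma kst_kid : kst kid = kid :> KM.
Proof.
apply: KM_ext => k l; rewrite /kst /kid kconjZ ke_conj /csg eqxx scale1r eq_sym//.
Qed.

Lemma kmxstar_sq M : kmxstar j (fun k l => sq (M k l)) = fun k l => sq (kst M k l).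
Proof. by apply/funext => k; apply/funext => l; rewrite /kmxstar sq_conj. Qed.

Lemma kmxid_sq : kmxid j n = fun k l => sq ((kid : KM) k l).
Proof.
apply/funext => k; apply/funext => l; rewrite /kmxid /kid.
by case: eqP => _; rewrite ?scale1r ?scale0r ?sq_one ?sq_zero.
Qed.

Lemma kact_sq (A : KM) : @kact R j n (fun k l => sq (A k l)) = kmact (fun M => km (km A M) (kst A)).
Proof.
by apply/funext => x; rewrite /kact kdec_sq kmxmul_sq kmxstar_sq kmxmul_sq.
Qed.

Lemma kact_real (g : 'M[R]_n.+1) : @kact R j n (fun k l => sq (lop g (kid : KM) k l)) = kmact (rconj g).
Proof.
rewrite kact_sq; congr kmact; apply/funext => M.
by rewrite km_lop km1l kst_lop kst_kid km_rop km1r -lop_rop.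
Qed.

Lemma kunitary_sq (A : KM) : km A (kst A) = kid -> km (kst A) A = kid ->
  kunitary j (fun k l => sq (A k l)).
Proof.
move=> h1 h2; split; first by move=> i l; exact: size_sq.
- by rewrite kmxstar_sq kmxmul_sq h1 kmxid_sq.
- by rewrite kmxstar_sq kmxmul_sq h2 kmxid_sq.
Qed.

Lemma kunitary_real (g : 'M[R]_n.+1) : g *m g^T = 1%:M -> kunitary j (fun k l => sq (lop g (kid : KM) k l)).
Proof.
move=> gg; apply: kunitary_sq; rewrite kst_lop kst_kid.
- by rewrite km_lop km1l; exact: rconj_id.
- by rewrite km_rop_lop km1l lopM (mulmx1C gg) lop1.
Qed.

Definition kdiag (d : 'I_n.+1 -> K) : KM := fun k l => (k == l)%:R *: d k.

Lemma km_kdiag d M : km (kdiag d) M = fun k l => kmul (d k) (M k l).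
Proof.
apply: KM_ext => k l; rewrite /km -[RHS](sum_delta_scale k (fun a => kmul (d k) (M a l))).
by apply: eq_bigr => a _; rewrite kmulZl.
Qed.

Lemma kst_kdiag d : kst (kdiag d) = kdiag (fun k => kconj (d k)).
Proof.
apply: KM_ext => k l; rewrite /kst /kdiag kconjZ eq_sym; case: eqP => [->|]//.
by rewrite !scale0r.
Qed.

Lemma km_kdiagr d M : km M (kdiag d) = fun k l => kmul (M k l) (d l).
Proof.
apply: KM_ext => k l; rewrite /km -[RHS](sum_delta_scale l (fun a => kmul (M k a) (d a))).
by apply: eq_bigr => a _; rewrite kmulZr eq_sym.
Qed.

Definition dact d M : KM := fun k l => kmul (kmul (d k) (M k l)) (kconj (d l)).

Lemma kact_diag d : @kact R j n (fun k l => sq (kdiag d k l)) = kmact (dact d).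
Proof.
rewrite kact_sq; congr kmact; apply/funext => M.
by rewrite kst_kdiag km_kdiag km_kdiagr.
Qed.

Lemma kunitary_diag d : (forall k, dot (d k) (d k) = 1) -> kunitary j (fun k l => sq (kdiag d k l)).
Proof.
move=> d1.
have h d' : (forall k, dot (d' k) (d' k) = 1) -> km (kdiag d') (kst (kdiag d')) = kid.
  move=> d'1; apply: KM_ext => k l; rewrite kst_kdiag km_kdiagr /kdiag /kid.
  case: eqP => [->|]; last by rewrite !scale0r kmul0l.
  by rewrite scale1r -{1}[d' l]k1mul// kaltr// d'1.
apply: kunitary_sq; first exact: h.
have e : kdiag d = kst (kdiag (fun k => kconj (d k))).
  by rewrite kst_kdiag; congr kdiag; apply/funext => k; rewrite kconjK.
by rewrite {2}e kst_kdiag; apply: h => k; rewrite dot_conj.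
Qed.

(* [j <= 2] because associativity is used *)
Lemma is_proj_dact d M : (j <= 2)%N -> (forall k, dot (d k) (d k) = 1) -> is_proj M -> is_proj (dact d M).
Proof.
move=> j2 d1 pM.
have A := @kmulA R j j2; have dd k : kmul (kconj (d k)) (d k) = ke 0.
  by have := kaltl j3 (d k) (ke 0); rewrite kmul1// d1 scale1r.
split.
- apply: KM_ext => k l; rewrite /kst /dact !kconjM// kconjK -(ent_conj pM) A//.
- apply: KM_ext => k l; rewrite -[in RHS](proj_idem pM) /km /dact kmul_sumr kmul_suml.
  apply: eq_bigr => m _; rewrite !A -[kmul (kconj (d m)) (kmul (d m) _)]A dd k1mul// !A//.
- rewrite fr_kid -(xi_sum pM); apply: eq_bigr => k _.
  rewrite /xi /dact kre_mul// kconjK (herm_diag k (proj_herm pM)) kmulZr kmul1// dotZl d1 dotZl.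
  by congr (_ * _); rewrite dot_ke ?expn_gt0.
Qed.

Lemma xi_dact d M k : (forall k, dot (d k) (d k) = 1) -> is_proj M -> xi (dact d M) k = xi M k.
Proof.
move=> d1 pM; rewrite /xi /dact kre_mul// kconjK (herm_diag k (proj_herm pM)) kmulZr kmul1// dotZl d1 dotZl.
by congr (_ * _); rewrite dot_ke ?expn_gt0.
Qed.

Lemma fr_dact d M N : (forall k, dot (d k) (d k) = 1) -> fr (dact d M) (dact d N) = fr M N.
Proof.
move=> d1; apply: eq_bigr => k _; apply: eq_bigr => l _.
by rewrite /dact dot_mulr// dot_conj d1 mul1r dot_mull// d1 mul1r.
Qed.

Lemma polyK_rconj g k l : polyK (fun x : T => rconj g (ent x) k l).
Proof.
apply: polyK_sum => a; apply: polyKZ; apply: polyK_sum => b; apply: polyKZ; exact: polyK_ent.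
Qed.

Lemma polyK_dact d k l : polyK (fun x : T => dact d (ent x) k l).
Proof.
apply: polyK_mul; last exact: polyK_cst.
by apply: polyK_mul; [exact: polyK_cst|exact: polyK_ent].
Qed.

Section Group.
Variable G : set (T -> T).
Variable mu : probability T R.
Hypothesis muX : mu (@proj_pts R j n) = 1%E.
Hypothesis mu_inv : invariant_under G mu.
Notation X := (@proj_pts R j n).
Notation sym := (symm pcoord X (mean mu X)).

Lemma symm_kmact Phi : G (kmact Phi) -> (forall k l, polyK (fun x : T => Phi (ent x) k l)) ->
  (forall M, is_proj M -> is_proj (Phi M)) ->
  (forall M N, is_proj M -> is_proj N -> fr (Phi M) (Phi N) = fr M N) -> sym (kmact Phi).
Proof.
move=> hG hp hX ht.
refine (symm_of_group (@pcoord_meas R j n) (@proj_meas R j n) (proj_tk1 j3) (@meas_pcoord R j n) muX mu_inv hG _ _ _).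
- move=> [k [l c]]; apply: polyfun_ext (hp k l c) => x.
  by rewrite -(ent_kmact Phi) mxE.
- by move=> x /proj_ptsE px; apply/proj_ptsE; rewrite ent_kmact; exact: hX.
- by move=> x y /proj_ptsE px /proj_ptsE py; rewrite !tk_fr !ent_kmact; exact: ht.
Qed.

Lemma symm_rconj (g : 'M[R]_n.+1) : g *m g^T = 1%:M -> G (kmact (rconj g)) -> sym (kmact (rconj g)).
Proof.
move=> gg hG; apply: symm_kmact => //.
- exact: polyK_rconj.
- by move=> M; exact: is_proj_rconj.
- by move=> M N _ _; exact: fr_rconj.
Qed.

Lemma symm_dact d : (j <= 2)%N -> (forall k, dot (d k) (d k) = 1) -> G (kmact (dact d)) -> sym (kmact (dact d)).
Proof.
move=> j2 d1 hG; apply: symm_kmact => //.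
- exact: polyK_dact.
- by move=> M; exact: is_proj_dact.
- by move=> M N _ _; exact: fr_dact.
Qed.

(* The real part of the (i,l) entry can be traded for any unit direction v without moving the diagonal entries. *)
Definition has_phase (i l : 'I_n.+1) (v : K) := exists g, [/\ sym g,
  forall y, X y -> forall k, xi (ent (g y)) k = xi (ent y) k &
  forall y, X y -> dot (ent (g y) i l) (ke 0) = dot v (ent y i l)].

Lemma phase_dact d i l v : (j <= 2)%N -> (forall k, dot (d k) (d k) = 1) -> G (kmact (dact d)) ->
  d i = kconj v -> d l = ke 0 -> has_phase i l v.
Proof.
move=> j2 d1 hG di dl; exists (kmact (dact d)); split; first exact: symm_dact.
- by move=> y /proj_ptsE py k; rewrite ent_kmact xi_dact.
- move=> y _; rewrite ent_kmact /dact di dl kre_mul// kconjK dot_adjl// kconjK kmul1// dotC//.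
Qed.

(** The entries (i,l) and (l,i) are conjugate, so their real parts agree and the direction v becomes
    its conjugate. *)
Lemma phase_swap i l v : has_phase l i (kconj v) -> has_phase i l v.
Proof.
move=> [g [sg g1 g2]]; exists g; split=> // y Xy.
have Xg : X (g y) by case: sg => h _ _ _; exact: h.
have e0 : kconj (ke 0 : K) = ke 0 by rewrite ke_conj /csg eqxx scale1r.
move: (Xg) (Xy) => /proj_ptsE/ent_conj h1 /proj_ptsE/ent_conj h2.
by rewrite (h1 l i) -e0 dot_conj g2// -dot_conj kconjK -h2.
Qed.

End Group.
End Actions.

Section RealComplexQuaternion.
Context {R : realType} {n : nat}.

Lemma SO_rconj (g : 'M[R]_n.+1) : g *m g^T = 1%:M -> \det g = 1 -> SO_proj n (kmact (rconj g)).
Proof.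
move=> gg dg; exists g; split=> //; rewrite -kact_real//; congr kact.
apply/funext => i; apply/funext => l; rewrite /lop.
have -> : \sum_a g i a *: (kid (R := R) (j := 0) a l) = g i l *: ke 0.
  rewrite (bigD1 l)//= /kid eqxx scale1r big1 ?addr0// => a /negbTE ->.
  by rewrite scale0r scaler0.
by apply/esym/sq_inj => // c; rewrite mxE mxE (ord1 c) mulr1.
Qed.

Lemma USp_rconj (g : 'M[R]_n.+1) : g *m g^T = 1%:M -> USp_proj n (kmact (rconj g)).
Proof. by move=> gg; eexists; split; [exact: (kunitary_real (j := 2) _ gg)|rewrite kact_real]. Qed.

Lemma USp_dact (d : 'I_n.+1 -> K R 2) : (forall k, dot (d k) (d k) = 1) -> USp_proj n (kmact (dact d)).
Proof. by move=> d1; eexists; split; [exact: (kunitary_diag (j := 2) _ d1)|rewrite kact_diag]. Qed.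

Lemma kdet_sq j (A : KM R j n) : kdet j (fun k l => sq (A k l)) =
  sq (\sum_(s : {perm 'I_n.+1}) (-1) ^+ odd_perm s *: foldr (@kmul R j) (ke 0) [seq A i (s i) | i <- enum 'I_n.+1]).
Proof.
rewrite /kdet.
have h (s : {perm 'I_n.+1}) (r : seq 'I_n.+1) :
    foldr (cdmul j) (cdone j) [seq sq (A i (s i)) | i <- r] = sq (foldr (@kmul R j) (ke 0) [seq A i (s i) | i <- r]).
  by elim: r => [|i r IH] /=; [exact: sq_one|rewrite IH sq_mul].
under eq_map do rewrite h sq_scale.
by rewrite foldr_sq big_enum.
Qed.

Lemma kdet_real (g : 'M[R]_n.+1) : \det g = 1 -> kdet 1 (fun k l => sq (lop g (kid (j := 1)) k l)) = cdone 1.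
Proof.
move=> dg; rewrite kdet_sq sq_one; congr sq; transitivity (\det g *: (ke 0 : K R 1)); last by rewrite dg scale1r.
rewrite /determinant scaler_suml.
apply: eq_bigr => s _; rewrite -scalerA; congr (_ *: _).
have gE i l : lop g (kid (R := R) (j := 1)) i l = g i l *: ke 0.
  rewrite /lop (bigD1 l)//= /kid eqxx scale1r big1 ?addr0// => a /negbTE ->.
  by rewrite scale0r scaler0.
rewrite -big_enum; elim: (enum _) => [|i r IH] /=; first by rewrite big_nil scale1r.
by rewrite IH gE big_cons kmulZl kmulZr k1mul// scalerA.
Qed.

Lemma SU_rconj (g : 'M[R]_n.+1) : g *m g^T = 1%:M -> \det g = 1 -> SU_proj n (kmact (rconj g)).
Proof.
move=> gg dg; eexists; split; [exact: (kunitary_real (j := 1) _ gg)|exact: kdet_real|].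
by rewrite kact_real.
Qed.

(** The conjugate phase at the further index m restores determinant 1, so the matrix lies in the
    special unitary group. *)
Definition phase_diag (i m : 'I_n.+1) (u : K R 1) k : K R 1 :=
  if k == i then u else if k == m then kconj u else ke 0.

(** A nontrivial permutation picks an off-diagonal zero. The identity contributes u times its
    conjugate, whatever the order of the factors, by commutativity at level 1. *)
Lemma kdet_phase i m u : i != m -> dot u u = 1 ->
  kdet 1 (fun k l => sq (kdiag (phase_diag i m u) k l)) = cdone 1.
Proof.
move=> im u1; rewrite kdet_sq sq_one; congr sq.
have mi : (m == i) = false by rewrite eq_sym; exact: negbTE.
set d := phase_diag i m u.
have uu : kmul u (kconj u) = ke 0 by have := kaltr (isT : (1 <= 3)%N) u (ke 0); rewrite k1mul// u1 scale1r.
have C := @kmulC R 1 isT; have A := @kmulA R 1 isT.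
rewrite (bigD1 1%g)//= big1 ?addr0; last first.
  move=> s s1; have [k sk] : exists k, s k != k.
    apply/existsP; rewrite -negb_forall; apply: contraNN s1 => /forallP h.
    by apply/eqP/permP => k; rewrite perm1; apply/eqP.
  rewrite (_ : foldr _ _ _ = 0) ?scaler0//.
  have : k \in enum 'I_n.+1 by rewrite mem_enum.
  elim: (enum _) => [//|a r IH]; rewrite inE => /orP[/eqP <-|kr] /=.
    by rewrite {1}/kdiag eq_sym (negbTE sk) scale0r kmul0l.
  by rewrite IH// kmul0r.
rewrite odd_perm1 scale1r.
have P (r : seq 'I_n.+1) : uniq r ->
    foldr (@kmul R 1) (ke 0) [seq kdiag d a ((1%g : {perm 'I_n.+1}) a) | a <- r] =
    kmul (if i \in r then u else ke 0) (if m \in r then kconj u else ke 0).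
  elim: r => [_|a r IH] /=; first by rewrite kmul1.
  move=> /andP[ar /IH ->]; rewrite {1}/kdiag perm1 eqxx scale1r /d /phase_diag !inE ![_ == a]eq_sym.
  have [ai|ai] := eqVneq a i.
    by rewrite -ai (negbTE ar) /= ai eq_sym mi k1mul.
  have [am|am] /= := eqVneq a m.
    by rewrite -am (negbTE ar) C A k1mul.
  by rewrite k1mul.
rewrite P ?enum_uniq// !mem_enum//.
Qed.

Lemma phase_diag1 i m u k : dot u u = 1 -> dot (phase_diag i m u k) (phase_diag i m u k) = 1.
Proof.
by move=> u1; rewrite /phase_diag; case: eqP => // _; case: eqP => // _; rewrite ?dot_conj ?dot_ke.
Qed.

Lemma SU_phase i m u : i != m -> dot u u = 1 -> SU_proj n (kmact (dact (phase_diag i m u))).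
Proof.
move=> im u1; eexists; split.
- by apply: (kunitary_diag (j := 1) _ (d := phase_diag i m u)) => // k; exact: phase_diag1.
- exact: kdet_phase.
- by rewrite kact_diag.
Qed.

End RealComplexQuaternion.

Section RealParts.
Context {R : realType} {j n : nat}.
Hypothesis j3 : (j <= 3)%N.
Notation K := (K R j).
Notation KM := (KM R j n).

Definition re (M : KM) k l := dot (M k l) (ke 0).

Lemma re_xi M k : re M k k = xi M k. Proof. by []. Qed.

Lemma re_sym M k l : is_proj M -> re M l k = re M k l.
Proof.
move=> pM; have e0 : kconj (ke 0 : K) = ke 0 by rewrite ke_conj /csg eqxx scale1r.
by rewrite /re (ent_conj pM k l) -{1}e0 dot_conj.
Qed.

(** By [norm_ent] the hypothesis says that the real part carries the whole norm of the entry. *)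
Lemma real_ent M k l : is_proj M -> re M k l ^+ 2 = xi M k * xi M l -> M k l = re M k l *: ke 0.
Proof.
move=> pM h; apply/eqP; rewrite -subr_eq0; apply/eqP/dot_eq0.
set r := re M k l in h *; have e : M k l - r *: ke 0 = (- r) *: ke 0 + M k l by rewrite scaleNr addrC.
have rE : dot (M k l) (ke 0) = r by [].
have k00 : dot (ke 0 : K) (ke 0) = 1 by rewrite dot_ke ?expn_gt0.
by rewrite e !(dot_linl, dot_linr) k00 [dot (ke 0) (M k l)]dotC rE (norm_ent j3 pM) -h; ring.
Qed.

Lemma re_rconj (g : 'M[R]_n.+1) M k l : re (rconj g M) k l = \sum_a g k a * \sum_b g l b * re M a b.
Proof.
rewrite /re /rconj /lop /rop dot_suml; apply: eq_bigr => a _; rewrite dotZl dot_suml; congr (_ * _).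
by apply: eq_bigr => b _; rewrite dotZl.
Qed.

Section Rotation.
Variables (p q : 'I_n.+1) (c s : R).
Hypothesis pq : p != q.
Let qp : q != p. Proof. by rewrite eq_sym. Qed.
Notation rot := (rconj (rotmx p q c s)).

Let H (M : KM) l a := re M a l + (l == p)%:R * ((c - 1) * re M a p + s * re M a q)
  + (l == q)%:R * ((c - 1) * re M a q - s * re M a p).

Lemma re_rot M k l : re (rot M) k l = H M l k + (k == p)%:R * ((c - 1) * H M l p + s * H M l q)
  + (k == q)%:R * ((c - 1) * H M l q - s * H M l p).
Proof.
rewrite re_rconj; have e a : \sum_b rotmx p q c s l b * re M a b = H M l a by rewrite rotmxE.
by under eq_bigr do rewrite e; rewrite rotmxE.
Qed.

Lemma xi_rot_other (M : KM) k : k != p -> k != q -> xi (rot M) k = xi M k.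
Proof. by move=> /negbTE kp /negbTE kq; rewrite -!re_xi re_rot /H kp kq /=; ring. Qed.

Lemma xi_rot_p M : is_proj M -> xi (rot M) p = c ^+ 2 * xi M p + s ^+ 2 * xi M q + 2 * c * s * re M q p.
Proof.
move=> pM; rewrite -!re_xi re_rot /H !eqxx (negbTE pq) [re M p q]re_sym//=; ring.
Qed.

Lemma xi_rot_q M : is_proj M -> xi (rot M) q = c ^+ 2 * xi M q + s ^+ 2 * xi M p - 2 * c * s * re M q p.
Proof.
move=> pM; rewrite -!re_xi re_rot /H !eqxx (negbTE qp) [re M p q]re_sym//=; ring.
Qed.

Lemma re_rot_qp M : is_proj M ->
  re (rot M) q p = (c ^+ 2 - s ^+ 2) * re M q p + c * s * (xi M q - xi M p).
Proof.
move=> pM; rewrite -!re_xi re_rot /H !eqxx (negbTE pq) (negbTE qp) [re M p q]re_sym//=; ring.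
Qed.

Lemma re_rot_pl (M : KM) l : l != p -> l != q -> re (rot M) p l = c * re M p l + s * re M q l.
Proof.
by move=> /negbTE lp /negbTE lq; rewrite re_rot /H !eqxx (negbTE pq) lp lq /=; ring.
Qed.

End Rotation.
End RealParts.

(** * Normal forms and the Pearson identity on projective spaces *)

Section Geometry.
Context {R : realType} {j n : nat}.
Hypothesis j3 : (j <= 3)%N.
Hypothesis n2 : (1 < n)%N.
Notation D := (2 ^ j)%N.
Notation K := (K R j).
Notation T := (@proj_amb R j n).
Notation X := (@proj_pts R j n).
Variable mu : probability T R.
Hypothesis muX : mu X = 1%E.
Notation E := (mean mu X).
Notation sym := (symm (@pcoord R j n) X E).
Notation tk := (tk (@pcoord R j n)).
Notation rot p q c s := (kmact (rconj (rotmx p q c s)) : T -> T).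
Notation xi' k y := (xi (ent y) k).
Notation re' k l y := (re (ent y) k l).
Hypothesis Hrot : forall (p q : 'I_n.+1) (c s : R), p != q -> c ^+ 2 + s ^+ 2 = 1 -> sym (rot p q c s).
Hypothesis Hph : forall (i l : 'I_n.+1) (v : K), i != l -> dot v v = 1 -> has_phase mu i l v.
Let HE : mean_on (@pcoord R j n) X E := mean_mean_on (@pcoord_meas R j n) (@proj_meas R j n) (proj_tk1 j3) muX.
Let B : 'I_n.+1 := ord_max.
Let m : 'I_n.+1 := ord0.

Let mB : m != B. Proof. by rewrite -val_eqE /= neq_ltn (ltnW n2). Qed.

Let symX g x : sym g -> X x -> X (g x). Proof. by case=> h _ _ _; exact: h. Qed.

(** Take the phase in the direction of the entry itself, divided by its norm; a zero entry is real
    already. *)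
Lemma phase_real i l x : i != l -> X x -> exists g, [/\ sym g,
  forall y, X y -> forall k, xi' k (g y) = xi' k y &
  re' i l (g x) ^+ 2 = xi' i (g x) * xi' l (g x)].
Proof.
move=> il Xx; have /proj_ptsE px := Xx; set w := ent x i l.
have ww : dot w w = xi' i x * xi' l x by exact: norm_ent.
have [w0|w0] := eqVneq (dot w w) 0.
  exists id; split; [exact: symm_id|by []|].
  by rewrite -ww w0 /re -/w (dot_eq0 w0) (lin0 (lin_dotl _)) expr0n.
have wp : 0 < dot w w by rewrite lt_neqAle eq_sym w0 dot_ge0.
set la := Num.sqrt (dot w w).
have l0 : la != 0 by rewrite gt_eqF// sqrtr_gt0.
have ll : la ^+ 2 = dot w w by rewrite sqr_sqrtr// ltW.
have v1 : dot (la^-1 *: w) (la^-1 *: w) = 1 by rewrite dotZl dotZr -ll; field.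
have [g [sg g1 g2]] := Hph il v1; exists g; split=> //.
by rewrite /re g2// !g1// dotZl -/w -ww -ll; field.
Qed.

(** For each index of r, a phase makes its off-diagonal entry with p real, after which a real plane
    rotation suffices. The last clause is what later keeps the base point fixed. *)
Lemma kill_diag (p : 'I_n.+1) (r : seq 'I_n.+1) x : p \notin r -> X x -> exists g,
  [/\ sym g, forall k, k \in r -> xi' k (g x) = 0 &
      forall y, X y -> forall k, k != p -> k \notin r -> xi' k (g y) = xi' k y].
Proof.
elim: r => [|i r IH]; first by move=> _ Xx; exists id; split=> //; exact: symm_id.
rewrite inE negb_or => /andP[pi pr] Xx; have [g [sg g0 g1]] := IH pr Xx.
have ip : i != p by rewrite eq_sym.
have Xg := symX sg Xx.
have [h [sh h1 h2]] := phase_real ip Xg.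
have Xh := symX sh Xg; have /proj_ptsE ph := Xh.
set a := xi' p (h (g x)) in h2; set b := xi' i (h (g x)) in h2; set o := re' i p _ in h2.
(* The real block with rows (a, o) and (o, b) has determinant 0 by [h2]; the rotation turns its
   kernel direction, proportional to (o, -a), into the i-th axis. *)
have [c [s [cs ci]]] : exists c s : R, c ^+ 2 + s ^+ 2 = 1 /\ c ^+ 2 * b + s ^+ 2 * a - 2 * c * s * o = 0.
  have [a0|a0] := eqVneq a 0.
    by exists 0, 1; rewrite a0; split; ring.
  have ap : 0 < a ^+ 2 + o ^+ 2 by rewrite ltr_wpDr ?sqr_ge0// exprn_even_gt0.
  set l := Num.sqrt (a ^+ 2 + o ^+ 2).
  have l0 : l != 0 by rewrite gt_eqF// sqrtr_gt0.
  have ll : l ^+ 2 = a ^+ 2 + o ^+ 2 by rewrite sqr_sqrtr// ltW.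
  exists (a / l), (o / l); split; first by rewrite !expr_div_n -mulrDl ll divff// gt_eqF.
  have -> : (a / l) ^+ 2 * b + (o / l) ^+ 2 * a - 2 * (a / l) * (o / l) * o = (a * (b * a) - a * o ^+ 2) / l ^+ 2.
    by field.
  by rewrite h2 subrr mul0r.
exists (rot p i c s \o (h \o g)); split.
- by apply: symm_comp; [exact: Hrot|exact: symm_comp].
- move=> k kr /=; rewrite ent_kmact; have [->|ki] := eqVneq k i; first by rewrite xi_rot_q.
  have kr' : k \in r by move: kr; rewrite inE (negbTE ki).
  have kp : k != p by apply: contraNneq pr => <-.
  by rewrite xi_rot_other// h1// g0.
- move=> y Xy k kp; rewrite inE negb_or => /andP[ki kr] /=.
  have Xgy := symX sg Xy; have Xhy := symX sh Xgy.
  by rewrite ent_kmact xi_rot_other// h1// g1.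
Qed.

(** Rows and columns of a projector with zero diagonal entry vanish, so the inner product sees only
    the block on B and m; since that block of w is real, only the real part of the entry of y
    matters. *)
Lemma tk_two y w : X y -> X w -> (forall k, k != B -> k != m -> xi' k w = 0) ->
  re' m B w ^+ 2 = xi' m w * xi' B w ->
  tk y w = xi' B w * xi' B y + xi' m w * xi' m y + 2 * re' m B w * re' m B y.
Proof.
move=> /proj_ptsE py /proj_ptsE pw w0 wr; rewrite tk_fr /fr.
have dg k : dot (ent y k k) (ent w k k) = xi' k w * xi' k y.
  rewrite (herm_diag k (proj_herm py)) (herm_diag k (proj_herm pw)) dotZl dotZr.
  by rewrite dot_ke ?expn_gt0// eqxx mulr1 mulrC.
have mBe := real_ent j3 pw wr.
have mr : re' B m w ^+ 2 = xi' B w * xi' m w by rewrite re_sym// wr mulrC.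
have Bme := real_ent j3 pw mr.
have rowE (F : 'I_n.+1 -> R) : (forall l, l != B -> l != m -> F l = 0) -> \sum_l F l = F B + F m.
  move=> F0; rewrite (bigD1 B)//= (bigD1 m)//= big1 ?addr0// => l /andP[lB lm]; exact: F0.
have z0 k l : xi' l w = 0 -> dot (ent y k l) (ent w k l) = 0.
  by move=> h; rewrite (ent_eq0r j3 pw k h); exact: (lin0 (lin_dotr _)).
have z0' k l : xi' k w = 0 -> dot (ent y k l) (ent w k l) = 0.
  by move=> h; rewrite (ent_eq0 j3 pw l h); exact: (lin0 (lin_dotr _)).
rewrite rowE; last first.
  by move=> k kB km; rewrite big1// => l _; rewrite z0'// w0.
rewrite (rowE (fun l => dot (ent y B l) _)); last by move=> l lB lm; rewrite z0// w0.
rewrite (rowE (fun l => dot (ent y m l) _)); last by move=> l lB lm; rewrite z0// w0.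
rewrite !dg mBe Bme !dotZr -!/(re' _ _ _) [re' B m y]re_sym// [re' B m w]re_sym//; ring.
Qed.

Lemma proj_to_base x : X x -> exists2 g, sym g & forall y, X y -> tk (g x) y = xi' B y.
Proof.
move=> Xx; pose r := [seq k <- enum 'I_n.+1 | k != B].
have rP k : (k \in r) = (k != B) by rewrite mem_filter mem_enum andbT.
have Br : B \notin r by rewrite rP eqxx.
have [g [sg g0 _]] := kill_diag Br Xx; exists g => // y Xy.
have Xg := symX sg Xx; have /proj_ptsE pg := Xg.
have z k : k != B -> xi' k (g x) = 0 by move=> kB; rewrite g0 ?rP.
have g1 : xi' B (g x) = 1.
  by rewrite -(xi_sum pg) [RHS](bigD1 B)//= [X in _ + X]big1 ?addr0.
have rm : re' m B (g x) = 0 by rewrite /re (ent_eq0 j3 pg _ (z _ mB)); exact: (lin0 (lin_dotl _)).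
rewrite tkC tk_two//; first by rewrite g1 z// rm; ring.
- by move=> k kB _; exact: z.
- by rewrite z// rm; ring.
Qed.

Let rho : {poly R} := 'X - 'X^2.

(** x goes to the base projector, and z to a projector supported on B and m with real off-diagonal
    entry r. Being of rank one with diagonal s and 1 - s, this block has r^2 = s (1 - s). *)
Lemma proj_normal_form x z : X x -> X z -> exists2 r : R, r ^+ 2 = rho.[tk x z] &
  forall f h : {poly R}, E (fun y => f.[tk x y] * h.[tk y z]) =
    E (fun y => f.[xi' B y] * h.[xi' m y + tk x z * (xi' B y - xi' m y) + r * (2 * re' m B y)]).
Proof.
move=> Xx Xz; have [g sg gx] := proj_to_base Xx.
pose r := [seq k <- enum 'I_n.+1 | (k != B) && (k != m)].
have rP k : (k \in r) = (k != B) && (k != m) by rewrite mem_filter mem_enum andbT.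
have mr : m \notin r by rewrite rP eqxx andbF.
have Br : B \notin r by rewrite rP eqxx.
have Bm : B != m by rewrite eq_sym.
have Xgx := symX sg Xx; have Xgz := symX sg Xz.
have [g1 [sg1 g10 g1B]] := kill_diag mr Xgz.
have [g2 [sg2 g2d g2r]] := phase_real mB (symX sg1 Xgz).
have sk : sym (g2 \o g1) by exact: symm_comp.
set w := g2 (g1 (g z)) in g2r.
have Xw : X w := symX sk Xgz; have /proj_ptsE pw := Xw.
have w0 k : k != B -> k != m -> xi' k w = 0.
  by move=> kB km; rewrite /w g2d ?g10 ?rP ?kB//; exact: symX.
have kB y : X y -> xi' B (g2 (g1 y)) = xi' B y.
  by move=> Xy; rewrite g2d ?g1B//; exact: symX.
have Xb := symX sk Xgx.
(* a projector whose B-th diagonal entry is 1 is the base point *)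
have base y : X y -> tk (g2 (g1 (g x))) y = xi' B y.
  move=> Xy; have /proj_ptsE pb := Xb.
  have b1 : xi' B (g2 (g1 (g x))) = 1.
    rewrite kB// -(gx _ Xgx); exact: (proj_tk1 j3).
  have bz k : k != B -> xi' k (g2 (g1 (g x))) = 0.
    move=> kb; have := xi_sum pb; rewrite (bigD1 B)//= b1 -[RHS]addr0 => /addrI h.
    by apply: (psumr_eq0P _ h) => // i _; exact: xi_ge0.
  have rm : re' m B (g2 (g1 (g x))) = 0.
    by rewrite /re (ent_eq0 j3 pb _ (bz _ mB)); exact: (lin0 (lin_dotl _)).
  rewrite tkC tk_two//; first by rewrite b1 bz// rm; ring.
  - by move=> k kb _; exact: bz.
  - by rewrite bz// rm; ring.
have stk : tk x z = xi' B w.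
  rewrite -(base _ Xw) /w; case: (sk) => _ h _ _; rewrite (h _ _ Xgx Xgz).
  by case: (sg) => _ h' _ _; rewrite h'.
have sm : xi' m w = 1 - xi' B w.
  have := xi_sum pw; rewrite (bigD1 B)//= (bigD1 m)//= big1 ?addr0; first by lra.
  by move=> k /andP[k1 k2]; exact: w0.
exists (re' m B w).
  by rewrite stk g2r sm !hornerE; ring.
move=> f h; rewrite stk -(conv_symm HE f h sg Xx Xz) -(conv_symm HE f h sk Xgx Xgz).
apply: (mean_on_ext HE) => y Xy; rewrite /= base// -/w tk_two// sm.
by congr (_ * h.[_]); ring.
Qed.

Lemma polyfun_re k l : polyfun (@pcoord R j n) (fun y => re' k l y).
Proof. by apply: polyfun_dot; [exact: polyK_ent|exact: polyK_cst]. Qed.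

(** A half turn in the plane of m and a third index k changes the sign of the (m,B) entry and fixes
    both diagonal entries; the third index exists because n >= 2. *)
Lemma proj_reflect (f h : {poly R}) (s r : R) : r ^+ 2 = rho.[s] ->
  E (fun y => f.[xi' B y] * h.[xi' m y + s * (xi' B y - xi' m y) + r * (2 * re' m B y)]) =
  E (fun y => f.[xi' B y] * h.[xi' m y + s * (xi' B y - xi' m y) - r * (2 * re' m B y)]).
Proof.
move=> _; pose k : 'I_n.+1 := inord 1.
have vk : nat_of_ord k = 1%N by rewrite inordK// ltnS ltnW.
have mk : m != k by rewrite -val_eqE /= vk.
have Bk : B != k by rewrite -val_eqE /= vk gtn_eqF.
have Bm : B != m by rewrite eq_sym.
have cs : (-1) ^+ 2 + 0 ^+ 2 = 1 :> R by rewrite sqrrN expr1n expr0n addr0.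
have [_ _ _ hE] := Hrot mk cs.
have pf : polyfun (@pcoord R j n)
    (fun y => f.[xi' B y] * h.[xi' m y + s * (xi' B y - xi' m y) + r * (2 * re' m B y)]).
  apply: polyfunM; apply: polyfun_horner; first exact: polyfun_xi.
  apply: polyfunD; last by do 2 apply: polyfunZ; exact: polyfun_re.
  apply: polyfunD; first exact: polyfun_xi.
  apply: polyfunZ; apply: polyfun_ext (polyfunD (polyfun_xi B) (polyfunZ (-1) (polyfun_xi m))) => y.
  by rewrite mulN1r.
rewrite -(hE _ pf); apply: (mean_on_ext HE) => y /proj_ptsE py.
rewrite ent_kmact xi_rot_other// xi_rot_p// re_rot_pl//.
by congr (_ * h.[_]); ring.
Qed.

(* The rotation by arctan tau, cleared of the denominators (1 + tau^2)^(a+1), gives an even polynomial in tau. *)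
Lemma proj_infinitesimal (i : 'I_n.+1) a : i != B ->
  E (fun y => (xi' i y - xi' B y) * xi' B y ^+ a + (2 * a%:R) * (re' i B y ^+ 2 * xi' B y ^+ a.-1)) = 0.
Proof.
move=> iB; have Bi : B != i by rewrite eq_sym.
pose Y (y : T) : {poly R} := (xi' B y)%:P + (2 * re' i B y)%:P * 'X + (xi' i y)%:P * 'X^2.
pose V (y : T) : {poly R} := (re' i B y)%:P + (xi' i y + (-1) * xi' B y)%:P * 'X + ((-1) * re' i B y)%:P * 'X^2.
pose F (y : T) := V y * Y y ^+ a.
have pX := polyfun_xi; have pR := polyfun_re.
have P2 (f g h : T -> R) : polyfun (@pcoord R j n) f -> polyfun (@pcoord R j n) g -> polyfun (@pcoord R j n) h ->
    polycoef (@pcoord R j n) (fun y => (f y)%:P + (g y)%:P * 'X + (h y)%:P * 'X^2).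
  move=> pf pg ph; apply: polycoefD; first apply: polycoefD.
  - exact: polycoefC.
  - by apply: polycoefM; [exact: polycoefC|exact: polycoef_cst].
  - by apply: polycoefM; [exact: polycoefC|exact: polycoef_cst].
have pF : polycoef (@pcoord R j n) F.
  apply: polycoefM; last apply: polycoefX; apply: P2 => //; try exact: polyfunZ.
  by apply: polyfunD => //; exact: polyfunZ.
have S2 (b c d : R) : (size (b%:P + c%:P * 'X + d%:P * 'X^2)%R <= 3)%N.
  rewrite (leq_trans (size_polyD _ _))// geq_max (leq_trans (size_polyD _ _)) ?geq_max/=.
    by rewrite mul_polyC (leq_trans (size_scale_leq _ _))// size_polyXn.
  rewrite (leq_trans (size_polyC_leq1 _))//= mul_polyC (leq_trans (size_scale_leq _ _))// size_polyX//.
have sF y : (size (F y) <= 2 + (2 * a).+1)%N.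
  apply: size_mul_le; first exact: S2.
  rewrite (leq_trans (size_poly_exp_leq _ _))// ltnS leq_mul2r; apply/orP; right.
  by have := S2 (xi' B y) (2 * re' i B y) (xi' i y); rewrite -/(Y y); case: (size _) => [|k].
have ev (t : R) : E (fun y => (F y).[t]) = E (fun y => (F y).[- t]).
  have aux (e : R) : e ^+ 2 = t ^+ 2 ->
      E (fun y => (F y).[e]) = (1 + t ^+ 2) ^+ a.+1 * E (fun y => re' i B y * xi' B y ^+ a).
    move=> et; have t0 : 0 < 1 + t ^+ 2 by rewrite ltr_pwDl// sqr_ge0.
    set l := Num.sqrt (1 + t ^+ 2); have l0 : l != 0 by rewrite gt_eqF// sqrtr_gt0.
    have ll : l ^+ 2 = 1 + e ^+ 2 by rewrite et sqr_sqrtr// ltW.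
    have cs : l^-1 ^+ 2 + (e / l) ^+ 2 = 1 by rewrite expr_div_n exprVn ll; field; rewrite -ll expf_neq0.
    have pm : polyfun (@pcoord R j n) (fun y => re' i B y * xi' B y ^+ a).
      by apply: polyfunM => //; exact: polyfunX.
    have [_ _ h1 h2] := Hrot Bi cs.
    rewrite -(h2 _ pm) -(monZ HE); last exact: (h1 _ pm).
    apply: (mean_on_ext HE) => y /proj_ptsE py; rewrite ent_kmact xi_rot_p// re_rot_qp//.
    have -> : (l^-1 ^+ 2 - (e / l) ^+ 2) * re' i B y + l^-1 * (e / l) * (xi' i y - xi' B y) = (l ^+ 2)^-1 * (V y).[e].
      by rewrite /V !hornerE /=; field.
    have -> : l^-1 ^+ 2 * xi' B y + (e / l) ^+ 2 * xi' i y + 2 * l^-1 * (e / l) * re' i B y = (l ^+ 2)^-1 * (Y y).[e].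
      by rewrite /Y !hornerE /=; field.
    rewrite /F hornerM horner_exp exprMn -et -ll; move: ((V y).[e]) ((Y y).[e]) => v u.
    rewrite exprS exprVn; field; by rewrite !expf_neq0.
  by rewrite aux// aux// sqrrN.
rewrite -[RHS](E_even HE pF sF ev); apply: (mean_on_ext HE) => y _.
have -> : (F y)`_1 = (F y)^`().[0] by rewrite horner_coef0 coef_deriv mulr1n.
rewrite /F derivM deriv_exp /V /Y !(derivD, derivM, derivC, derivX, derivXn).
rewrite !(hornerD, hornerM, hornerMn, horner_exp, hornerC, hornerX) !(expr0n, mulr0, mul0r, addr0, add0r, mulr1) /=.
by ring.
Qed.

(** The phase in direction [ke c] exchanges the real part of the entry for its c-th coordinate and
    leaves the diagonal alone. *)
Lemma proj_entry (i : 'I_n.+1) (c : 'I_D) a : i != B ->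
  E (fun y => (xi' i y - xi' B y) * xi' B y ^+ a + (2 * a%:R) * (ent y i B 0 c ^+ 2 * xi' B y ^+ a.-1)) = 0.
Proof.
move=> iB; have e1 : dot (ke c : K) (ke c) = 1 by rewrite dot_ke// eqxx.
have [g [[_ _ _ gE] g1 g2]] := Hph iB e1.
rewrite -[RHS](proj_infinitesimal a iB) -[RHS]gE.
  apply: (mean_on_ext HE) => y Xy; by rewrite /re !g1// g2// dotC dot_kec.
apply: polyfunD.
  apply: polyfunM; last by apply: polyfunX; exact: polyfun_xi.
  apply: polyfun_ext (polyfunD (polyfun_xi i) (polyfunZ (-1) (polyfun_xi B))) => y.
  by rewrite mulN1r.
by apply: polyfunZ; apply: polyfunM; apply: polyfunX; [exact: polyfun_re|exact: polyfun_xi].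
Qed.

(** For q = X^a, add the identities of [proj_entry] over all rows other than B and all D
    coordinates. The squares add up to the norm of the entry, which is the product of the diagonal
    entries by [norm_ent]; half of the total is the Beta(D/2, nD/2) identity. *)
Lemma proj_pearson x (q : {poly R}) : X x ->
  E (fun y => (Dop sigJ (t0J (D%:R / 2) ((n * D)%N%:R / 2)) 0 q).[tk x y]) = 0.
Proof.
move=> Xx; pose P (q : {poly R}) := Dop sigJ (t0J (D%:R / 2) ((n * D)%N%:R / 2)) 0 q.
have [g sg gx] := proj_to_base Xx; have Xgx := symX sg Xx.
transitivity (E (fun y => (P q).[xi' B y])).
  have [_ gt _ gE] := sg.
  rewrite -(gE (fun y => (P q).[xi' B y])); last by apply: polyfun_horner; exact: polyfun_xi.
  by apply: (mean_on_ext HE) => y Xy; rewrite -gx ?gt//; exact: symX.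
apply: (E_Dop HE); first exact: polyfun_xi.
move=> a.
pose F (k : 'I_n.+1) (c : 'I_D) (y : T) := (xi' k y - xi' B y) * xi' B y ^+ a +
  (2 * a%:R) * (ent y k B 0 c ^+ 2 * xi' B y ^+ a.-1).
have pF k c : polyfun (@pcoord R j n) (F k c).
  apply: polyfunD.
    apply: polyfunM; last by apply: polyfunX; exact: polyfun_xi.
    apply: polyfun_ext (polyfunD (polyfun_xi k) (polyfunZ (-1) (polyfun_xi B))) => y.
    by rewrite mulN1r.
  by apply: polyfunZ; apply: polyfunM; apply: polyfunX; [exact: polyK_ent|exact: polyfun_xi].
have h : E (fun y => 2^-1 * \sum_(k <- [seq k <- index_enum 'I_n.+1 | k != B]) \sum_c F k c y) = 0.
  rewrite (monZ HE); last by apply: polyfun_sum => k; apply: polyfun_sum => c.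
  rewrite (mon_sum HE); last by move=> k; apply: polyfun_sum => c.
  rewrite big_filter big1 ?mulr0// => k kB.
  by rewrite (mon_sum HE)// big1// => c _; exact: proj_entry.
rewrite -[RHS]h; apply: (mean_on_ext HE) => y Xy; have /proj_ptsE py := Xy.
rewrite big_filter DopJ derivXn hornerMn !hornerXn addr0 addr0.
set u := xi' B y.
have rowF k : \sum_c F k c y = D%:R * ((xi' k y - u) * u ^+ a) + (2 * a%:R) * (xi' k y * (u * u ^+ a.-1)).
  rewrite /F big_split/= sumr_const card_ord -mulr_sumr -mulr_suml; congr (_ + _ * _); first by rewrite mulr_natl.
  by rewrite mulrA -(norm_ent j3 py k B); congr (_ * _).
under eq_bigr do rewrite rowF.
rewrite big_split/= -!mulr_sumr -!mulr_suml sumrB.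
have s1 : \sum_(k | k != B) xi' k y = 1 - u.
  have e := xi_sum py; rewrite (bigD1 B)//= -/u in e; rewrite -e; ring.
have s2 : \sum_(k < n.+1 | k != B) u = n%:R * u.
  rewrite sumr_const mulr_natl; congr (_ *+ _); have h1 := cardC1 B; rewrite card_ord in h1; rewrite -[RHS]h1.
  by apply: eq_card => k; rewrite !inE.
rewrite s1 s2 natrM -mulr_natl; move: (D%:R : R) => d.
case: a {F pF h rowF} => [|a]; first by rewrite expr0 /=; field.
by rewrite /= exprS; field.
Qed.

Lemma proj_mean_invariant_aux :
  (forall x, X x -> forall q : {poly R},
     E (fun y => (Dop sigJ (t0J (D%:R / 2) ((n * D)%N%:R / 2)) 0 q).[tk x y]) = 0) /\
  (forall f g : {poly R}, exists2 h : {poly R}, (size h <= size g)%N &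
    forall x z, X x -> X z -> E (fun y => f.[tk x y] * g.[tk y z]) = h.[tk x z]).
Proof.
split; first by move=> x Xx q; exact: proj_pearson.
move=> f h; have srho : (size rho <= 3)%N := size_sigJ.
apply: (conv_poly HE (A := fun y => xi' B y) (A0 := fun y => xi' m y)
  (A1 := fun y => xi' B y - xi' m y) (B := fun y => 2 * re' m B y) _ _ _ _ srho).
- exact: polyfun_xi.
- exact: polyfun_xi.
- apply: polyfun_ext (polyfunD (polyfun_xi B) (polyfunZ (-1) (polyfun_xi m))) => y.
  by rewrite mulN1r.
- by apply: polyfunZ; exact: polyfun_re.
- by move=> x z; exact: proj_normal_form.
- by move=> f' h' s r; exact: proj_reflect.
Qed.

End Geometry.

(** * The exceptional Jordan algebra and its automorphisms *)

Section Albert.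
Context {R : realType}.
Notation K := (K R 3).
Notation KM := (KM R 3 2).
Implicit Types (M N : KM) (a : R).

Definition jor M N : KM := fun k l => (1 / 2) *: (km M N k l + km N M k l).

(** [Psi] is carried along because surjectivity on hermitian matrices is part of [albert_aut]. *)
Record kaut (Phi Psi : KM -> KM) : Prop := KAut {
  ka_herm : forall M, herm M -> herm (Phi M);
  ka_lin : forall a b M N, Phi (fun k l => a *: M k l + b *: N k l) = fun k l => a *: Phi M k l + b *: Phi N k l;
  ka_jor : forall M N, herm M -> herm N -> Phi (jor M N) = jor (Phi M) (Phi N);
  ka_inv : forall N, herm N -> herm (Psi N) /\ Phi (Psi N) = N }.

Lemma kherm_sq M : kherm 3 (fun k l => sq (M k l)) <-> herm M.
Proof.
split=> [[_ h]|h].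
- by apply: KM_ext => k l; apply: sq_inj'; rewrite -sq_conj -h.
- by split=> [k l|k l]; [exact: size_sq|rewrite sq_conj -{1}h].
Qed.

(** Automorphisms in [F4_proj] act on matrices of lists. Encoding and decoding are mutually inverse
    only on entries of the right length, which [kherm] guarantees. *)
Lemma F4_kmact Phi Psi : kaut Phi Psi -> F4_proj (kmact Phi).
Proof.
move=> [kh kl kj ki].
pose dec (P : KMat 2) : KM := fun k l => unsq 3 (P k l).
pose enc (M : KM) : KMat 2 := fun k l => sq (M k l).
have encK' M : dec (enc M) = M by apply: KM_ext => k l; exact: sqK.
have decK P : kherm 3 P -> enc (dec P) = P.
  by move=> [sP _]; apply/funext => k; apply/funext => l; rewrite /enc /dec unsqK.
have hdec P : kherm 3 P -> herm (dec P) by move=> hP; apply/kherm_sq; rewrite -[X in kherm _ X]/(enc (dec P)) decK.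
exists (fun P => enc (Phi (dec P))); split; last first.
  apply/funext => x; rewrite /kmact /encK; congr (kenc (enc (Phi _))).
  by apply: KM_ext => k l; rewrite /dec kdecE sqK.
have lin_enc a M N : kmxlin a (enc M) (enc N) = enc (fun k l => a *: M k l + 1 *: N k l).
  by apply/funext => k; apply/funext => l; rewrite /kmxlin /enc sq_scale sq_add scale1r.
have jor_enc M N : kjordan 3 (enc M) (enc N) = enc (jor M N).
  by apply/funext => k; apply/funext => l; rewrite /kjordan /enc !kmxmul_sq sq_add sq_scale.
split.
- by move=> P /hdec /kh h; apply/kherm_sq.
- by move=> a P Q hP hQ; rewrite -{1}(decK _ hP) -{1}(decK _ hQ) !lin_enc encK' kl.
- move=> P Q hP hQ; rewrite -{1}(decK _ hP) -{1}(decK _ hQ) !jor_enc encK' kj//; exact: hdec.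
- move=> Q hQ; have [h1 h2] := ki _ (hdec _ hQ); exists (enc (Psi (dec Q))); split; first exact/kherm_sq.
  by rewrite encK' h2 decK.
Qed.

Lemma rconjE (g : 'M[R]_3) M k l : rconj g M k l = \sum_a \sum_b (g k a * g l b) *: M a b.
Proof.
rewrite /rconj /lop /rop; apply: eq_bigr => a _; rewrite scaler_sumr; apply: eq_bigr => b _.
by rewrite scalerA.
Qed.

Lemma rconj_comb (g : 'M[R]_3) a b M N : rconj g (fun k l => a *: M k l + b *: N k l) =
  fun k l => a *: rconj g M k l + b *: rconj g N k l.
Proof.
apply: KM_ext => k l; rewrite !rconjE !scaler_sumr -big_split/=; apply: eq_bigr => c _.
rewrite !scaler_sumr -big_split/=; apply: eq_bigr => d _.
by rewrite scalerDr !scalerA ![_ * (g _ _ * g _ _)]mulrC.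
Qed.

Lemma jorE M N : jor M N = fun k l => (1 / 2) *: km M N k l + (1 / 2) *: km N M k l.
Proof. by apply: KM_ext => k l; rewrite /jor scalerDr. Qed.

Lemma kaut_rconj (g : 'M[R]_3) : g *m g^T = 1%:M -> kaut (rconj g) (rconj g^T).
Proof.
move=> gg; split.
- by move=> M h; rewrite /herm kst_rconj h.
- exact: rconj_comb.
- by move=> M N _ _; rewrite !jorE rconj_comb !km_rconj.
- move=> N h; split; first by rewrite /herm kst_rconj h.
  by rewrite /rconj -[rop g (lop _ _)]lop_rop lopM gg lop1 ropM gg rop1.
Qed.

Lemma F4_rconj (g : 'M[R]_3) : g *m g^T = 1%:M -> F4_proj (kmact (rconj g)).
Proof. by move=> /kaut_rconj/F4_kmact. Qed.

Definition o0 : 'I_3 := Ordinal (isT : (0 < 3)%N).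
Definition o1 : 'I_3 := Ordinal (isT : (1 < 3)%N).
Definition o2 : 'I_3 := Ordinal (isT : (2 < 3)%N).

Lemma ord3P (P : 'I_3 -> Prop) : P o0 -> P o1 -> P o2 -> forall k, P k.
Proof.
move=> p0 p1 p2 [[|[|[|k]]] hk] //.
- by rewrite (_ : Ordinal hk = o0)//; exact: val_inj.
- by rewrite (_ : Ordinal hk = o1)//; exact: val_inj.
- by rewrite (_ : Ordinal hk = o2)//; exact: val_inj.
Qed.

Lemma sum3 (V : nmodType) (F : 'I_3 -> V) : \sum_k F k = F o0 + (F o1 + F o2).
Proof.
rewrite !big_ord_recl big_ord0 addr0; congr (F _ + (F _ + F _)); exact: val_inj.
Qed.

(* triality applied to left multiplication by u, acting on the three off-diagonal octonions *)
Definition spin (u : K) M : KM := fun k l =>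
  match nat_of_ord k, nat_of_ord l with
  | 0, 1 => kmul u (M k l)
  | 1, 0 => kmul (M k l) (kconj u)
  | 1, 2 => kmul (M k l) u
  | 2, 1 => kmul (kconj u) (M k l)
  | 2, 0 => kmul (kmul (kconj u) (M k l)) (kconj u)
  | 0, 2 => kmul u (kmul (M k l) u)
  | _, _ => M k l
  end%N.

Section Spin.
Variable u : K.
Hypothesis u1 : dot u u = 1.
Let t3 : (3 <= 3)%N := isT.

Let ul x : kmul (kconj u) (kmul u x) = x. Proof. by rewrite kaltl// u1 scale1r. Qed.
Let ul' x : kmul u (kmul (kconj u) x) = x. Proof. by rewrite kaltl'// u1 scale1r. Qed.
Let ur x : kmul (kmul x u) (kconj u) = x. Proof. by rewrite kaltr// u1 scale1r. Qed.
Let ur' x : kmul (kmul x (kconj u)) u = x. Proof. by rewrite kaltr'// u1 scale1r. Qed.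

Lemma spin_herm M : herm M -> herm (spin u M).
Proof.
move=> h; have e k l : kconj (M k l) = M l k by rewrite -[in RHS]h.
apply: KM_ext; apply: ord3P; apply: ord3P; rewrite /kst /spin /= ?kconjM// ?kconjM// ?kconjK ?e//.
Qed.

Lemma spin_dot M N k l : dot (spin u M k l) (spin u N k l) = dot (M k l) (N k l).
Proof.
have h x y : dot (kmul u x) (kmul u y) = dot x y by rewrite dot_mull// u1 mul1r.
have h' x y : dot (kmul (kconj u) x) (kmul (kconj u) y) = dot x y by rewrite dot_mull// dot_conj u1 mul1r.
have r x y : dot (kmul x u) (kmul y u) = dot x y by rewrite dot_mulr// u1 mul1r.
have r' x y : dot (kmul x (kconj u)) (kmul y (kconj u)) = dot x y by rewrite dot_mulr// dot_conj u1 mul1r.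
by move: k l; apply: ord3P; apply: ord3P; rewrite /spin /= ?(h, h', r, r').
Qed.

Lemma spin_comb a b M N : spin u (fun k l => a *: M k l + b *: N k l) =
  fun k l => a *: spin u M k l + b *: spin u N k l.
Proof.
have D1 (x y z : K) : kmul (x + y) z = kmul x z + kmul y z := lin_add (lin_mull z) x y.
have D2 (x y z : K) : kmul z (x + y) = kmul z x + kmul z y := lin_add (lin_mulr z) x y.
apply: KM_ext; apply: ord3P; apply: ord3P; rewrite /spin //= ?(D1, D2, kmulZl, kmulZr)//.
Qed.

Lemma kscal_l M k x : herm M -> kmul (M k k) x = xi M k *: x.
Proof. by move=> h; rewrite (herm_diag k h) kmulZl k1mul. Qed.

Lemma kscal_r M k x : herm M -> kmul x (M k k) = xi M k *: x.
Proof. by move=> h; rewrite (herm_diag k h) kmulZr kmul1. Qed.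

Lemma spin_diag M k : spin u M k k = M k k.
Proof. by move: k; apply: ord3P. Qed.

(** Diagonal entries of hermitian matrices are real scalars, so each position involves one genuinely
    octonionic product: (0,1), (1,2) and (2,0) need the left, right and middle Moufang identity
    respectively. *)
Lemma spin_km M N k l : herm M -> herm N -> k != l -> (k, l) \in [:: (o0, o1); (o1, o2); (o2, o0)] ->
  km (spin u M) (spin u N) k l = spin u (km M N) k l.
Proof.
move=> hM hN _; rewrite !inE => /or3P[] /eqP[-> ->]; rewrite /km sum3 /spin /= sum3.
- rewrite !(lin_add (lin_mulr u)) !kscal_l// !kscal_r// !kmulZr; congr (_ + (_ + _)).
  by rewrite flexible -moufangl ul'.
- rewrite !(lin_add (lin_mull u)) !kscal_l// !kscal_r// !kmulZl; congr (_ + (_ + _)).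
  by rewrite -moufangr ur'.
- rewrite !(lin_add (lin_mulr (kconj u))) !(lin_add (lin_mull (kconj u))) !kscal_l// !kscal_r// !kmulZr !kmulZl.
  by congr (_ + (_ + _)); rewrite moufang.
Qed.

Lemma jor_herm M N : herm M -> herm N -> herm (jor M N).
Proof.
move=> hM hN; apply: KM_ext => k l; rewrite /kst /jor kconjZ; congr (_ *: _).
have e (P : KM) (hP : herm P) i m : kconj (P i m) = P m i by rewrite -[in RHS]hP.
rewrite kconjD addrC /km !kconj_sum; congr (_ + _); apply: eq_bigr => m _.
  by rewrite kconjM// !e.
by rewrite kconjM// !e.
Qed.

(** By polarised alternativity, x conj(y) + y conj(x) is the real scalar 2 <x,y>. *)
Lemma jor_diag M N k : herm M -> herm N -> jor M N k k = (\sum_m dot (M k m) (N k m)) *: ke 0.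
Proof.
move=> hM hN; have e (P : KM) (hP : herm P) i m : P m i = kconj (P i m) by rewrite -{1}hP.
rewrite /jor /km -big_split scaler_sumr scaler_suml; apply: eq_bigr => m _ /=.
rewrite (e _ hM k m) (e _ hN k m).
have := kalt_polar t3 (kconj (M k m)) (kconj (N k m)) (ke 0).
rewrite !kmul1// !kconjK dot_conj => ->; rewrite scalerA; congr (_ *: _).
by rewrite mulrA mul1r mulVf ?mul1r// pnatr_eq0.
Qed.

Lemma herm3_ext M N : herm M -> herm N -> (forall k, M k k = N k k) ->
  M o0 o1 = N o0 o1 -> M o1 o2 = N o1 o2 -> M o2 o0 = N o2 o0 -> M = N.
Proof.
move=> hM hN d h1 h2 h3; have e (P : KM) (hP : herm P) i m : P m i = kconj (P i m) by rewrite -{1}hP.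
apply: KM_ext; apply: ord3P; apply: ord3P => //.
- by rewrite (e _ hM o2 o0) (e _ hN o2 o0) h3.
- by rewrite (e _ hM o0 o1) (e _ hN o0 o1) h1.
- by rewrite (e _ hM o1 o2) (e _ hN o1 o2) h2.
Qed.

(** Three off-diagonal positions come from [spin_km], and the opposite ones by conjugation. On the
    diagonal the symmetrised product reduces to inner products of entries, which [spin]
    preserves. *)
Lemma spin_jor M N : herm M -> herm N -> spin u (jor M N) = jor (spin u M) (spin u N).
Proof.
move=> hM hN; have hM' := spin_herm hM; have hN' := spin_herm hN.
have off k l : k != l -> (k, l) \in [:: (o0, o1); (o1, o2); (o2, o0)] ->
    spin u (jor M N) k l = jor (spin u M) (spin u N) k l.
  by move=> kl hkl; rewrite jorE spin_comb /jor !spin_km// scalerDr.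
apply: herm3_ext; rewrite ?off//.
- by apply: spin_herm; exact: jor_herm.
- exact: jor_herm.
- move=> k; rewrite spin_diag !jor_diag//; congr (_ *: _); apply: eq_bigr => m _.
  by rewrite spin_dot.
Qed.

(** A square is the same for the matrix product and the Jordan product, so idempotence passes
    through [spin_jor]. *)
Lemma is_proj_spin M : is_proj M -> is_proj (spin u M).
Proof.
move=> [h i t]; have jj P : jor P P = km P P.
  apply: KM_ext => k l; rewrite /jor; move: (km P P k l) => A; apply/rowP => c.
  by rewrite !mxE; move: (A 0 c) => a; lra.
split; first exact: spin_herm.
- by rewrite -jj -spin_jor// jj i.
- by rewrite fr_kid -t fr_kid; apply: eq_bigr => k _; rewrite /xi spin_diag.
Qed.

End Spin.

Lemma spinK u M : dot u u = 1 -> spin u (spin (kconj u) M) = M.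
Proof.
move=> u1; have t3 : (3 <= 3)%N := isT.
have ul x : kmul (kconj u) (kmul u x) = x by rewrite kaltl// u1 scale1r.
have ul' x : kmul u (kmul (kconj u) x) = x by rewrite kaltl'// u1 scale1r.
have ur x : kmul (kmul x u) (kconj u) = x by rewrite kaltr// u1 scale1r.
have ur' x : kmul (kmul x (kconj u)) u = x by rewrite kaltr'// u1 scale1r.
apply: KM_ext; apply: ord3P; apply: ord3P; rewrite /spin //= ?kconjK ?(ul, ul', ur, ur')//.
- by rewrite (flexible (kconj u)) ur' ul'.
- by rewrite -(flexible u) ul ur.
Qed.

Lemma F4_spin u : dot u u = 1 -> F4_proj (kmact (spin u)).
Proof.
move=> u1; have u1' : dot (kconj u) (kconj u) = 1 by rewrite dot_conj.
apply: (@F4_kmact _ (spin (kconj u))); split.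
- by move=> M; exact: spin_herm.
- exact: spin_comb.
- by move=> M N; exact: spin_jor.
- by move=> N h; split; [exact: spin_herm|exact: spinK].
Qed.

Lemma polyK_spin u k l : polyK (fun x : @proj_amb R 3 2 => spin u (ent x) k l).
Proof.
have P k' l' := @polyK_ent R 3 2 k' l'.
have C (v : K) := @polyK_cst R 3 2 v.
move: k l; apply: ord3P; apply: ord3P; rewrite /spin /=; try exact: P.
- by apply: polyK_mul.
- by apply: polyK_mul => //; apply: polyK_mul.
- by apply: polyK_mul.
- by apply: polyK_mul.
- by apply: polyK_mul => //; apply: polyK_mul.
- by apply: polyK_mul.
Qed.

End Albert.

Lemma third_index n (i l : 'I_n.+1) : (1 < n)%N -> exists m, (m != i) && (m != l).
Proof.
move=> n2; apply/existsP; apply: contraTT n2 => /existsPn h.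
have : (#|[set: 'I_n.+1]%SET| <= #|[set i; l]%SET|)%N.
  apply/subset_leq_card/fintype.subsetP => k _; have := h k; by rewrite !inE negb_and !negbK.
rewrite cardsT card_ord cards2 -leqNgt => h2; rewrite -ltnS (leq_trans h2)//.
by case: (_ != _).
Qed.

Section MeanInvariance.
Context {R : realType} {j n : nat}.
Hypothesis j3 : (j <= 3)%N.
Hypothesis n2 : (1 < n)%N.
Notation T := (@proj_amb R j n).
Notation X := (@proj_pts R j n).
Variable G : set (T -> T).
Hypothesis Grot : forall (g : 'M[R]_n.+1), g *m g^T = 1%:M -> \det g = 1 -> G (kmact (rconj g)).

Lemma proj_mean_invariant :
  (forall mu : probability T R, mu X = 1%E -> invariant_under G mu ->
    forall (i l : 'I_n.+1) (v : K R j), i != l -> dot v v = 1 -> has_phase mu i l v) ->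
  mean_invariant (@pcoord R j n) X G sigJ (t0J ((2 ^ j)%N%:R / 2) ((n * 2 ^ j)%N%:R / 2)).
Proof.
move=> Hph mu muX mu_inv; apply: (proj_mean_invariant_aux j3 n2 muX); last exact: Hph.
move=> p q c s pq cs; have o := rotmx_orth pq cs.
by apply: (symm_rconj j3 muX mu_inv o); apply: Grot => //; exact: rotmx_det.
Qed.

End MeanInvariance.

(** * Phases for each division algebra, and the five families *)

Section Spaces.
Context {R : realType}.
Variable L : R.
Hypotheses (L0 : 0 < L) (L2 : L < pi / 2).

(** Over the reals the only units are 1 and -1. The second is realised by a half turn in the plane
    of i and an index different from l, which has determinant 1. *)
Lemma phase_real_line n (mu : probability (@proj_amb R 0 n) R) (i l : 'I_n.+1) (v : K R 0) : (1 < n)%N ->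
  mu (@proj_pts R 0 n) = 1%E -> invariant_under (SO_proj n) mu -> i != l -> dot v v = 1 -> has_phase mu i l v.
Proof.
move=> n2 muX mu_inv il v1; pose r : R := dot v (ke 0).
have ve : v = r *: ke 0.
  by apply/rowP => c; rewrite /r !mxE (ord1 c) mulr1 -(dot_kec v).
have rr : r ^+ 2 = 1 by have := v1; rewrite ve dotZl dotZr dot_ke// mulr1 -expr2.
move/eqP: rr; rewrite -[X in _ == X](expr1n _ 2) eqf_sqr => /orP[/eqP r1|/eqP r1].
  exists id; split; [exact: symm_id|by []|].
  by move=> y _; rewrite ve r1 scale1r dotC.
have [m /andP[mi ml]] := third_index i l n2.
have im : i != m by rewrite eq_sym.
have cs : (-1) ^+ 2 + 0 ^+ 2 = 1 :> R by rewrite sqrrN expr1n expr0n addr0.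
exists (kmact (rconj (rotmx i m (-1) 0))); split.
- have o := rotmx_orth im cs.
  by apply: (symm_rconj (isT : (0 <= 3)%N) muX mu_inv o); apply: SO_rconj => //; exact: rotmx_det.
- move=> y /proj_ptsE py k; rewrite ent_kmact.
  have [->|ki] := eqVneq k i; first by rewrite xi_rot_p//; ring.
  have [->|km] := eqVneq k m; first by rewrite xi_rot_q//; ring.
  by rewrite xi_rot_other.
- move=> y _; rewrite ent_kmact -/(re _ _ _) re_rot_pl ?[l == _]eq_sym// 1?eq_sym//.
  by rewrite ve r1 scaleN1r mul0r addr0 /re -scaleN1r dotZl dotC.
Qed.

Theorem GK_real_projective n : (1 < n)%N ->
  GK_spectral_limit (proj_pts 0 n) (@proj_dist R 0 n) (SO_proj n) L (eig_RP L n) (mult_RP n).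
Proof.
move=> n2; have j3 : (0 <= 3)%N by [].
apply: (GK_RP (coord := @pcoord R 0 n) L0 L2 (@pcoord_meas R 0 n) (@proj_meas R 0 n) (proj_tk1 j3) n2 (proj_dist_tk j3 L0 L2)).
apply: (proj_mean_invariant j3 n2); first exact: SO_rconj.
by move=> mu muX mu_inv i l v; exact: phase_real_line.
Qed.

Theorem GK_complex_projective n : (1 < n)%N ->
  GK_spectral_limit (proj_pts 1 n) (@proj_dist R 1 n) (SU_proj n) L (eig_CP L n) (mult_CP n).
Proof.
move=> n2; have j3 : (1 <= 3)%N by [].
apply: (GK_CP (coord := @pcoord R 1 n) L0 L2 (@pcoord_meas R 1 n) (@proj_meas R 1 n) (proj_tk1 j3) n2 (proj_dist_tk j3 L0 L2)).
apply: (proj_mean_invariant j3 n2); first exact: SU_rconj.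
move=> mu muX mu_inv i l v il v1; have [m /andP[mi ml]] := third_index i l n2.
have v1' : dot (kconj v) (kconj v) = 1 by rewrite dot_conj.
apply: (phase_dact j3 muX mu_inv (d := phase_diag i m (kconj v))) => //.
- by move=> k; exact: phase_diag1.
- by apply: SU_phase => //; rewrite eq_sym.
- by rewrite /phase_diag eqxx.
- by rewrite /phase_diag ![l == _]eq_sym (negbTE il) (negbTE ml).
Qed.

Theorem GK_quaternionic_projective n : (1 < n)%N ->
  GK_spectral_limit (proj_pts 2 n) (@proj_dist R 2 n) (USp_proj n) L (eig_HP L n) (mult_HP n).
Proof.
move=> n2; have j3 : (2 <= 3)%N by [].
apply: (GK_HP (coord := @pcoord R 2 n) L0 L2 (@pcoord_meas R 2 n) (@proj_meas R 2 n) (proj_tk1 j3) n2 (proj_dist_tk j3 L0 L2)).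
apply: (proj_mean_invariant j3 n2); first by move=> g gg _; exact: USp_rconj.
move=> mu muX mu_inv i l v il v1.
pose d k : K R 2 := if k == i then kconj v else ke 0.
have d1 k : dot (d k) (d k) = 1 by rewrite /d; case: eqP => _; rewrite ?dot_conj ?dot_ke.
apply: (phase_dact j3 muX mu_inv (d := d)) => //.
- exact: USp_dact.
- by rewrite /d eqxx.
- by rewrite /d eq_sym (negbTE il).
Qed.

Section Octonionic.
Variable mu : probability (@proj_amb R 3 2) R.
Hypothesis muX : mu (@proj_pts R 3 2) = 1%E.
Hypothesis mu_inv : invariant_under F4_proj mu.
Notation sym := (symm (@pcoord R 3 2) (@proj_pts R 3 2) (mean mu (@proj_pts R 3 2))).
Notation quarter s := (rconj (rotmx o0 o1 0 s) : KM R 3 2 -> KM R 3 2).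

Lemma symm_spin u : dot u u = 1 -> sym (kmact (spin u)).
Proof.
move=> u1; apply: (symm_kmact (isT : (3 <= 3)%N) muX mu_inv (F4_spin u1)).
- exact: polyK_spin.
- by move=> M; exact: is_proj_spin.
- by move=> M N _ _; apply: eq_bigr => k _; apply: eq_bigr => l _; exact: spin_dot.
Qed.

Lemma xi_spin u (M : KM R 3 2) k : xi (spin u M) k = xi M k.
Proof. by rewrite /xi spin_diag. Qed.

Lemma phase01 v : dot v v = 1 -> has_phase mu o0 o1 v.
Proof.
move=> v1; have v1' : dot (kconj v) (kconj v) = 1 by rewrite dot_conj.
exists (kmact (spin (kconj v))); split; first exact: symm_spin.
- by move=> y _ k; rewrite ent_kmact xi_spin.
- by move=> y _; rewrite ent_kmact /spin /= dot_adjl// kconjK kmul1// dotC.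
Qed.

Lemma phase12 v : dot v v = 1 -> has_phase mu o1 o2 v.
Proof.
move=> v1; have v1' : dot (kconj v) (kconj v) = 1 by rewrite dot_conj.
exists (kmact (spin (kconj v))); split; first exact: symm_spin.
- by move=> y _ k; rewrite ent_kmact xi_spin.
- by move=> y _; rewrite ent_kmact /spin /= kre_mul// kconjK dotC.
Qed.

Lemma quarter12 (M : KM R 3 2) : quarter 1 M o1 o2 = - M o0 o2.
Proof.
rewrite rconjE !sum3.
have e10 : rotmx o0 o1 0 1 o1 o0 = -1 :> R by rewrite !mxE /=; ring.
have e11 : rotmx o0 o1 0 1 o1 o1 = 0 :> R by rewrite !mxE /=; ring.
have e12 : rotmx o0 o1 0 1 o1 o2 = 0 :> R by rewrite !mxE /=; ring.
have e20 : rotmx o0 o1 0 1 o2 o0 = 0 :> R by rewrite !mxE /=; ring.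
have e21 : rotmx o0 o1 0 1 o2 o1 = 0 :> R by rewrite !mxE /=; ring.
have e22 : rotmx o0 o1 0 1 o2 o2 = 1 :> R by rewrite !mxE /=; ring.
by rewrite e10 e11 e12 e20 e21 e22 !(mulr0, mul0r, scale0r, addr0, add0r) mulr1 scaleN1r.
Qed.

(** At position (0,2) [spin] multiplies on both sides, so reaching a given unit would require a
    square root. A quarter turn in the plane (0,1) moves the entry to position (1,2), where [spin]
    acts by a single right multiplication, and the inverse turn brings it back. *)
Lemma phase02 v : dot v v = 1 -> has_phase mu o0 o2 v.
Proof.
move=> v1; have v1' : dot (kconj v) (kconj v) = 1 by rewrite dot_conj.
have o01 : o0 != o1 by [].
have cs (s : R) : s ^+ 2 = 1 -> 0 ^+ 2 + s ^+ 2 = 1 by move=> ->; rewrite expr0n add0r.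
have s1 : (1 : R) ^+ 2 = 1 by rewrite expr1n.
have s1' : (-1 : R) ^+ 2 = 1 by rewrite sqrrN expr1n.
have symq s : s ^+ 2 = 1 -> sym (kmact (quarter s)).
  move=> /cs/(rotmx_orth o01) o; apply: (symm_rconj (isT : (3 <= 3)%N) muX mu_inv o); exact: F4_rconj.
exists (kmact (quarter (-1)) \o (kmact (spin (kconj v)) \o kmact (quarter 1))); split.
- by apply: symm_comp; [exact: symq|apply: symm_comp; [exact: symm_spin|exact: symq]].
- move=> y /proj_ptsE py k; rewrite /= !ent_kmact.
  have p1 : is_proj (quarter 1 (ent y)) by apply: is_proj_rconj => //; exact/rotmx_orth/cs.
  have p2 := is_proj_spin v1' p1.
  move: k; apply: ord3P.
  + rewrite xi_rot_p// !xi_spin xi_rot_q//; ring.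
  + rewrite xi_rot_q// !xi_spin xi_rot_p//; ring.
  + by rewrite xi_rot_other// xi_spin xi_rot_other.
- move=> y _; rewrite /= !ent_kmact -/(re _ _ _) re_rot_pl// mul0r add0r mulN1r /re.
  have -> M : spin (kconj v) M o1 o2 = kmul (M o1 o2) (kconj v) by [].
  by rewrite kre_mul// kconjK quarter12 -[- ent y o0 o2]scaleN1r dotZl mulN1r opprK dotC.
Qed.

Lemma phase_octonion i l v : i != l -> dot v v = 1 -> has_phase mu i l v.
Proof.
move=> il v1; have v1' : dot (kconj v) (kconj v) = 1 by rewrite dot_conj.
have t3 : (3 <= 3)%N by [].
move: i l il; apply: ord3P; apply: ord3P => // _.
- exact: phase01.
- exact: phase02.
- by apply: phase_swap; exact: phase01.
- exact: phase12.
- by apply: phase_swap; exact: phase02.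
- by apply: phase_swap; exact: phase12.
Qed.

End Octonionic.

Theorem GK_octonionic_projective :
  GK_spectral_limit (proj_pts 3 2) (@proj_dist R 3 2) F4_proj L (eig_OP L) mult_OP.
Proof.
have j3 : (3 <= 3)%N by [].
apply: (GK_OP (coord := @pcoord R 3 2) L0 L2 (@pcoord_meas R 3 2) (@proj_meas R 3 2) (proj_tk1 j3) (proj_dist_tk j3 L0 L2)).
apply: (proj_mean_invariant j3 (isT : (1 < 2)%N)); first by move=> g gg _; exact: F4_rconj.
by move=> mu muX mu_inv i l v; exact: phase_octonion.
Qed.

End Spaces.

Theorem theorem3p9 (R : realType) (L : R) (hL0 : 0 < L) (hL1 : L < pi / 2) :
  [/\ (forall n : nat, (1 <= n)%N ->
         GK_spectral_limit (sph_pts n) (@sph_dist R n) (SO_sph n) L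
           (eig_RS L n) (mult_RS n)),
      (forall n : nat, (2 <= n)%N ->
         GK_spectral_limit (proj_pts 0 n) (@proj_dist R 0 n) (SO_proj n) L
           (eig_RP L n) (mult_RP n)),
      (forall n : nat, (2 <= n)%N ->
         GK_spectral_limit (proj_pts 1 n) (@proj_dist R 1 n) (SU_proj n) L
           (eig_CP L n) (mult_CP n)),
      (forall n : nat, (2 <= n)%N ->
         GK_spectral_limit (proj_pts 2 n) (@proj_dist R 2 n) (USp_proj n) L
           (eig_HP L n) (mult_HP n)) &
      GK_spectral_limit (proj_pts 3 2) (@proj_dist R 3 2) F4_proj L
        (eig_OP L) mult_OP].
Proof.
split.
- by move=> n n0; exact: GK_sphere_space.
- by move=> n n2; exact: GK_real_projective.
- by move=> n n2; exact: GK_complex_projective.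
- by move=> n n2; exact: GK_quaternionic_projective.
- exact: GK_octonionic_projective.
Qed.
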